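(* Let $g\colon S^2\to S^2$ be an orientation-preserving homeomorphism, and let $\Lambda$ be a simple homoclinic loop at a direct saddle fixed point $p$ of $g$. Then the fixed point index of $g$ in one of the two connected components of $S^2\setminus\Lambda$ is $1$, and the fixed point index of $g$ in the other component is $2$.
   Context: A fixed point $p$ of $g$ is a direct saddle if there is a coordinate chart around $p$ sending $p$ to $0\in\mathbb{R}^2$ in which $g$ is locally represented by $(x,y)\mapsto(\mu x,\lambda y)$ with $\mu>1>\lambda>0$. The stable curve $W_s(p)$ is the connected component containing $p$ of the set of $x$ for which there is a sequence $(x_k)_{k\ge0}$ with $x_0=x$, $g(x_k)=x_{k+1}$, $x_k\to p$; the unstable curve $W_u(p)$ is the stable curve of $p$ for $g^{-1}$. A homoclinic point is $p'\in(W_s(p)\cap W_u(p))\setminus\{p\}$; the homoclinic loop it determines is $J_s\cup J_u$ where $J_s\subset W_s(p)$, $J_u\subset W_u(p)$ are the arcs with endpoints $p,p'$; it is simple if $J_s\cap J_u=\{p,p'\}$. The fixed point index of $g$ in an open set $U$ (with $U\cap\mathrm{Fix}(g)$ compact) is the Dold fixed point index $I(g,U)$. *)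

(* Defs.v *)
From HB Require Import structures.
From mathcomp Require Import all_boot all_order all_algebra.
From mathcomp Require Import all_classical all_reals all_analysis.
Set Implicit Arguments. Unset Strict Implicit. Unset Printing Implicit Defensive.
Import Order.TTheory GRing.Theory Num.Theory.
Import numFieldNormedType.Exports.
Local Open Scope classical_set_scope.
Local Open Scope ring_scope.

Section Defs.
Variable R : realType.

Local Notation R3 := (R * R * R)%type.
Local Notation R2 := (R * R)%type.

Definition S2 : set R3 := [set x | x.1.1 ^+ 2 + x.1.2 ^+ 2 + x.2 ^+ 2 = 1].

Definition S2open (U : set R3) := exists2 V : set R3, open V & U = S2 `&` V.

Definition S2homeo (g ginv : R3 -> R3) :=
  [/\ (forall x, S2 x -> S2 (g x)), (forall x, S2 x -> S2 (ginv x)),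
      (forall x, S2 x -> ginv (g x) = x /\ g (ginv x) = x),
      {within S2, continuous g} & {within S2, continuous ginv}].

Definition S2chart (q : R3) (phi : R3 -> R2) (psi : R2 -> R3) :=
  [/\ S2 q,
      (forall x, S2 x -> x <> q -> psi (phi x) = x),
      (forall y, [/\ S2 (psi y), psi y <> q & phi (psi y) = y]),
      {within S2 `\ q, continuous phi} & continuous psi].

Definition rad (y : R2) : R := Num.sqrt (y.1 ^+ 2 + y.2 ^+ 2).

Definition AngleVar (f : R -> R2) (a : R) :=
  exists theta : R -> R,
    [/\ {within `[0, 1], continuous theta},
        (forall t, t \in `[0, 1] ->
           f t = (rad (f t) * cos (theta t), rad (f t) * sin (theta t)))
      & a = theta 1 - theta 0].

(* orientation preserving: local degree +1 at some point, read in a chart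
   of S2 (the same chart on source and target) *)
Definition orientation_preserving (g : R3 -> R3) :=
  exists q phi psi, S2chart q phi psi /\
  exists x, [/\ S2 x, x <> q, g x <> q &
  (exists2 r : R, 0 < r &
    (forall y : R2, rad (y - phi x) <= r -> g (psi y) <> q) /\
    AngleVar (fun t => phi (g (psi (phi x + (r * cos (2 * pi * t),
                                               r * sin (2 * pi * t)))))
                       - phi (g x)) (2 * pi))].

Definition direct_saddle (g : R3 -> R3) (p : R3) :=
  S2 p /\ g p = p /\
  exists (W : set R3) (V : set R2) (h : R3 -> R2) (k : R2 -> R3) (mu lam : R),
  [/\ [/\ S2open W, W p, open V & h p = 0],
      (forall x, W x -> V (h x) /\ k (h x) = x),
      (forall y, V y -> W (k y) /\ h (k y) = y),
      {within W, continuous h} /\ {within V, continuous k} &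
      [/\ 1 < mu, 0 < lam, lam < 1 &
       (exists2 W' : set R3, S2open W' /\ W' p /\ W' `<=` W &
         forall x, W' x -> W (g x) /\
           h (g x) = (mu * (h x).1, lam * (h x).2))]].

Definition stable_set (g : R3 -> R3) (p : R3) : set R3 :=
  [set x | S2 x /\ (fun n : nat => iter n g x) @ \oo --> p].
Definition Ws (g : R3 -> R3) (p : R3) : set R3 :=
  connected_component (stable_set g p) p.

Definition is_arc (J : set R3) (a b : R3) :=
  exists gam : R -> R3,
    [/\ {within `[0, 1], continuous gam},
        {in `[0, 1] &, injective gam},
        gam 0 = a, gam 1 = b & J = gam @` `[0, 1]].

Definition Fix (g : R3 -> R3) : set R3 := [set x | S2 x /\ g x = x].

Definition dy (k : nat) (i : int) : R := i%:~R / 2 ^+ k.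
Definition square (k : nat) (ij : int * int) : set R2 :=
  [set y | dy k ij.1 <= y.1 <= dy k (ij.1 + 1) /\ dy k ij.2 <= y.2 <= dy k (ij.2 + 1)].

(* the four counterclockwise edges of a square: start corner, end corner
   and neighbouring square across the edge *)
Definition edge_data (ij : int * int) (d : 'I_4) : (int * int) * (int * int) * (int * int) :=
  let: (i, j) := ij in
  match val d with
  | 0%N => ((i, j), (i + 1, j), (i, j - 1))
  | 1%N => ((i + 1, j), (i + 1, j + 1), (i + 1, j))
  | 2%N => ((i + 1, j + 1), (i, j + 1), (i, j + 1))
  | _ => ((i, j + 1), (i, j), (i - 1, j))
  end.

Definition edge_path (k : nat) (ij : int * int) (d : 'I_4) (t : R) : R2 :=
  let: (a, b, _) := edge_data ij d in
  ((1 - t) * dy k a.1 + t * dy k b.1, (1 - t) * dy k a.2 + t * dy k b.2).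

Definition bd_edge (s : seq (int * int)) (ij : int * int) (d : 'I_4) : bool :=
  (edge_data ij d).2 \notin s.

Definition grid_union (k : nat) (s : seq (int * int)) : set R2 :=
  [set y | exists2 ij, ij \in s & square k ij y].

Definition admissible (g : R3 -> R3) (U : set R3) (q : R3) (phi : R3 -> R2)
    (psi : R2 -> R3) (k : nat) (s : seq (int * int)) :=
  uniq s /\
  (forall y, grid_union k s y -> U (psi y) /\ g (psi y) <> q) /\
  phi @` (Fix g `&` U) `<=` interior (grid_union k s).

Definition boundary_angle (g : R3 -> R3) (phi : R3 -> R2) (psi : R2 -> R3)
    (k : nat) (s : seq (int * int)) (a : R) :=
  exists av : int * int -> 'I_4 -> R,
    (forall ij d, ij \in s -> bd_edge s ij d ->
       AngleVar (fun t => edge_path k ij d t - phi (g (psi (edge_path k ij d t))))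
                (av ij d)) /\
    a = \sum_(ij <- s) \sum_(d < 4 | bd_edge s ij d) av ij d.

Definition fp_index (g : R3 -> R3) (U : set R3) (n : int) :=
  [/\ S2open U, compact (Fix g `&` U),
      (exists q phi psi k s, ~ U q /\ S2chart q phi psi /\ admissible g U q phi psi k s) &
      (forall q phi psi k s, ~ U q -> S2chart q phi psi -> admissible g U q phi psi k s ->
         boundary_angle g phi psi k s (2 * pi * n%:~R))].

End Defs.

(* Main.v *)
(* In a chart sending the saddle p to infinity, g becomes a homeomorphism f of the
   plane and the loop a closed curve through infinity. Near p, the loop leaves one
   quadrant of the saddle on one side and three quadrants on the other, so that it
   can be rerouted off p in two ways, giving closed chains c1 and c2. Their winding
   numbers about a point are locally constant off the loop, each c_i winds zero
   times about the side it is not rerouted through, and the two numbers differ by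
   one turn around infinity: this separates the two sides. A third component of the
   complement would be bounded with boundary in an arc, against the extension of
   angles from an arc (Tietze).

   Along c_i the vector f x - x is deformed, sliding its end points along the stable
   and unstable branches on which f acts as s |-> lam s and s |-> mu s, into a
   vector depending on the saddle coordinates alone; it turns once, resp. twice, as
   often as c_i winds around its own side. Winding numbers around points detect the
   homology of the complement of a compact set F of the plane (an argument of Artin:
   on a fine grid a nonvanishing field off F extends square by square after division
   by powers of x - z, z in F). With F the fixed point set, the turning of x - f x
   along the boundary of a grid region is therefore that along c_i, which is the
   index; a change of chart is an inversion and adds only terms of total variation
   zero. *)

From HB Require Import structures.
From mathcomp Require Import all_boot all_order all_algebra.
From mathcomp Require Import all_classical all_reals all_analysis.
From mathcomp Require Import ring lra zify.
Require Import Defs.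
Set Implicit Arguments. Unset Strict Implicit. Unset Printing Implicit Defensive.
Import Order.TTheory GRing.Theory Num.Theory.
Import numFieldNormedType.Exports.
Local Open Scope classical_set_scope.
Local Open Scope ring_scope.

(** * Continuity on a set and complex arithmetic *)

(** The stable and unstable sets are only injective images of a line, so an arc inside one of them
    need not be a segment of the parameter: the parameter could jump, since an end of the line may
    come back to the arc. A Baire argument shows that a jump can happen only at [p], because an end
    of an invariant line can converge to no other point of that line. In the remaining case the arc
    is the far end of the line, and the loop is still made of the two standard segments. The two
    indices come from one identity. Since 1/T is a local homeomorphism of degree [del] at the
    saddle, the turning of [T x - T y] is [del] times the turning of [x - y] less those of [x] and
    of [y]. On each rerouting the three terms are sums of quarter turns of straight segments. They
    give one turn when the loop is closed through one quadrant and two when it is closed through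
    three, whereas the winding about the own side is one turn up to sign in both cases. The sign
    [del] depends on the chart and cancels in the quotient. *)

Definition con (T U : topologicalType) (A : set T) (f : T -> U) :=
  forall x, A x -> f @ within A (nbhs x) --> f x.

Lemma within_cvgP (T U : topologicalType) (A : set T) (f : T -> U) (x : T) (l : U) :
  f @ within A (nbhs x) --> l <->
  forall V, nbhs l V -> nbhs x [set y | A y -> V (f y)].
Proof. by []. Qed.

Section Con.
Variables (T U : topologicalType).
Implicit Types (A B : set T) (f : T -> U).

(** [con] states continuity as limits at the points of the domain, so that limit lemmas apply to it
    directly; this equivalence connects it with the subspace formulation used in the definitions. *)
Lemma conP A f : {within A, continuous f} <-> con A f.
Proof. exact: subspace_continuousP. Qed.

Lemma con_continuous A f : continuous f -> con A f.
Proof. by move=> cf x _; apply: cvg_within_filter; exact: cf. Qed.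

Lemma con_setT f : con setT f -> continuous f.
Proof.
move=> cf x V /= nV; have /within_cvgP/(_ _ nV) := cf x I.
by apply: filterS => y; apply.
Qed.

Lemma con_subset A B f : A `<=` B -> con B f -> con A f.
Proof.
move=> AB cf x Ax; apply/within_cvgP => V nV.
have /within_cvgP/(_ _ nV) := cf x (AB _ Ax).
by apply: filterS => y /= H /AB.
Qed.

Lemma con_eq A f g : (forall x, A x -> f x = g x) -> con A f -> con A g.
Proof.
move=> fg cf x Ax; apply/within_cvgP => V nV; rewrite -fg// in nV.
have /within_cvgP/(_ _ nV) := cf x Ax.
by apply: filterS => y /= Hy Ay; rewrite -fg//; exact: Hy.
Qed.

Lemma con_cst A (c : U) : con A (fun=> c).
Proof. by move=> x _; apply: cvg_cst. Qed.

Lemma con_setU A B f : closed A -> closed B -> con A f -> con B f ->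
  con (A `|` B) f.
Proof. by move=> cA cB /conP ? /conP ?; apply/conP; exact: withinU_continuous. Qed.

Lemma con_image_compact A f : con A f -> compact A -> compact (f @` A).
Proof. by move=> /conP; exact: continuous_compact. Qed.

Lemma con_image_connected A f : con A f -> connected A -> connected (f @` A).
Proof. by move=> /conP ? ?; exact: connected_continuous_connected. Qed.

Lemma con_nbhs A f x : con A f -> nbhs x A -> {for x, continuous f}.
Proof.
move=> cf nA; have Ax := nbhs_singleton nA.
move=> V /= nV; have /within_cvgP/(_ _ nV) H := cf x Ax.
by apply: filterS2 H nA => y /[apply].
Qed.
End Con.

Lemma con_id (T : topologicalType) (A : set T) : con A id.
Proof. by apply: con_continuous => x. Qed.

Lemma con_comp (T U V : topologicalType) (A : set T) (B : set U)
  (f : T -> U) (g : U -> V) :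
  con A f -> (forall x, A x -> B (f x)) -> con B g -> con A (g \o f).
Proof.
move=> cf AB cg x Ax; apply/within_cvgP => W nW.
have /within_cvgP/(_ _ nW) H := cg _ (AB _ Ax).
have /within_cvgP/(_ _ H) := cf x Ax.
by apply: filterS => y /= Hy Ay; apply: Hy => //; exact: AB.
Qed.

Lemma con_comp1 (T U V : topologicalType) (A : set T) (f : T -> U) (g : U -> V) :
  con A f -> continuous g -> con A (fun x => g (f x)).
Proof. by move=> cf cg; apply: (con_comp (B := setT)) cf _ (con_continuous cg). Qed.

Lemma con_pair (T U V : topologicalType) (A : set T) (f : T -> U) (g : T -> V) :
  con A f -> con A g -> con A (fun x => (f x, g x)).
Proof. by move=> cf cg x Ax; apply: cvg_pair; [exact: cf|exact: cg]. Qed.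

Lemma con_fst (T U V : topologicalType) (A : set T) (f : T -> U * V) :
  con A f -> con A (fun x => (f x).1).
Proof. by move=> cf; apply: con_comp1 cf _ => x; exact: cvg_fst. Qed.

Lemma con_snd (T U V : topologicalType) (A : set T) (f : T -> U * V) :
  con A f -> con A (fun x => (f x).2).
Proof. by move=> cf; apply: con_comp1 cf _ => x; exact: cvg_snd. Qed.

Section ConNormed.
Variables (R : realType) (T : topologicalType).
Implicit Types (A : set T).

Lemma conD (V : normedModType R) A (f g : T -> V) :
  con A f -> con A g -> con A (fun x => f x + g x).
Proof. by move=> cf cg x Ax; apply: cvgD; [exact: cf|exact: cg]. Qed.

Lemma conN (V : normedModType R) A (f : T -> V) : con A f -> con A (fun x => - f x).
Proof. by move=> cf x Ax; apply: cvgN; exact: cf. Qed.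

Lemma conB (V : normedModType R) A (f g : T -> V) :
  con A f -> con A g -> con A (fun x => f x - g x).
Proof. by move=> cf cg; apply: conD => //; exact: conN. Qed.

Lemma conM A (f g : T -> R) :
  con A f -> con A g -> con A (fun x => f x * g x).
Proof. by move=> cf cg x Ax; apply: cvgM; [exact: cf|exact: cg]. Qed.

Lemma conV A (f : T -> R) :
  (forall x, A x -> f x != 0) -> con A f -> con A (fun x => (f x)^-1).
Proof. by move=> f0 cf x Ax; apply: cvgV; [exact: f0|exact: cf]. Qed.

Lemma conX A (f : T -> R) n : con A f -> con A (fun x => f x ^+ n).
Proof.
move=> cf; elim: n => [|n IH].
  by apply: (con_eq (f := fun=> (1 : R))); [move=> x _; rewrite expr0|exact: con_cst].
apply: (con_eq (f := fun x => f x * f x ^+ n)); last exact: conM.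
by move=> x _; rewrite exprS.
Qed.

Lemma conZ (V : normedModType R) A (f : T -> R) (g : T -> V) :
  con A f -> con A g -> con A (fun x => f x *: g x).
Proof. by move=> cf cg x Ax; apply: cvgZ; [exact: cf|exact: cg]. Qed.
End ConNormed.

Lemma con_eps (R : realType) (V W : normedModType R) (A : set V) (f : V -> W) :
  con A f <-> (forall x, A x -> forall e, 0 < e -> exists2 d, 0 < d &
    forall y, A y -> `|x - y| < d -> `|f x - f y| < e).
Proof.
split=> [cf x Ax e e0|H x Ax].
  have /cvgrPdist_lt/(_ _ e0) := cf x Ax.
  rewrite /= near_withinE => /nbhs_ballP[d /= d0 H]; exists d => // y Ay xy.
  by apply: (H y) => //; rewrite -ball_normE.
apply/cvgrPdist_lt => e e0; have [d d0 Hd] := H x Ax e e0.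
rewrite near_withinE; apply/nbhs_ballP; exists d => // y; rewrite -ball_normE /= => xy Ay.
exact: Hd.
Qed.

Lemma itv01P (R : realType) (t : R) : `[0, 1]%classic t <-> 0 <= t <= 1.
Proof. by rewrite /= in_itv. Qed.

Definition I01 {R : realType} : set R := `[0, 1]%classic.
Lemma I01P {R : realType} (t : R) : I01 t <-> 0 <= t <= 1.
Proof. exact: itv01P. Qed.
Lemma I010 {R : realType} : I01 (0 : R). Proof. by apply/I01P; rewrite lexx ler01. Qed.
Lemma I011 {R : realType} : I01 (1 : R). Proof. by apply/I01P; rewrite lexx ler01. Qed.
Lemma I01C {R : realType} (t : R) : I01 t -> I01 (1 - t).
Proof. by move=> /I01P ?; apply/I01P; lra. Qed.
Global Hint Resolve I010 I011 : core.

Lemma con_fst_id (T U : topologicalType) (A : set (T * U)) : con A fst.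
Proof. by apply: con_continuous => x; exact: cvg_fst. Qed.

Lemma con_snd_id (T U : topologicalType) (A : set (T * U)) : con A snd.
Proof. by apply: con_continuous => x; exact: cvg_snd. Qed.

Lemma con_opp_id (R : realType) (V : normedModType R) (A : set V) : con A (-%R : V -> V).
Proof. exact: (conN (con_id (A := A))). Qed.

Ltac ctac := repeat first
  [ match goal with
    | H : con ?A ?f |- con ?A ?f => exact: H
    | |- con _ (fun x => x) => apply: con_id
    | |- con _ (@fst _ _) => apply: con_fst_id
    | |- con _ (@snd _ _) => apply: con_snd_id
    | |- con _ (fun x => (_, _)) => apply: con_pair
    | |- con _ (fun x => _ + _) => apply: conD
    | |- con _ (fun x => - _) => apply: conN
    | |- con _ (fun x => _ * _) => apply: conM
    | |- con _ (fun x => _ ^+ _) => apply: conX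
    | |- con _ (fun x => _ *: _) => apply: conZ
    | |- con _ (fun x => fst _) => apply: con_fst
    | |- con _ (fun x => snd _) => apply: con_snd
    | |- con _ (fun x => ?c) => apply: con_cst
    end
  | assumption
  | apply: con_opp_id
  | apply: con_id ].

(** * Complex arithmetic on pairs of reals *)

Section Complex.
Variable R : realType.
Local Notation R2 := (R * R)%type.
Implicit Types (z w : R2) (t : R).

Definition cmul z w : R2 := (z.1 * w.1 - z.2 * w.2, z.1 * w.2 + z.2 * w.1).
Definition cconj z : R2 := (z.1, - z.2).
Definition n2 z : R := z.1 ^+ 2 + z.2 ^+ 2.
Definition cinv z : R2 := (z.1 / n2 z, - z.2 / n2 z).
Definition expi t : R2 := (cos t, sin t).

Lemma pair_eq0 z : (z == 0) = (z.1 == 0) && (z.2 == 0).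
Proof. by case: z => a b. Qed.

Lemma n2_ge0 z : 0 <= n2 z. Proof. by rewrite addr_ge0// sqr_ge0. Qed.
Lemma n2_eq0 z : (n2 z == 0) = (z == 0).
Proof. by rewrite paddr_eq0 ?sqr_ge0// !sqrf_eq0 pair_eq0. Qed.
Lemma n2_gt0 z : z != 0 -> 0 < n2 z.
Proof. by move=> z0; rewrite lt_neqAle n2_ge0 eq_sym n2_eq0 z0. Qed.
Lemma n2M z w : n2 (cmul z w) = n2 z * n2 w.
Proof. rewrite /n2 /=; ring. Qed.
Lemma rad2 z : rad z ^+ 2 = n2 z. Proof. by rewrite sqr_sqrtr// n2_ge0. Qed.
Lemma rad_ge0 z : 0 <= rad z. Proof. exact: sqrtr_ge0. Qed.
Lemma rad_eq0 z : (rad z == 0) = (z == 0).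
Proof. by rewrite -(sqrf_eq0 (rad z)) rad2 n2_eq0. Qed.
Lemma rad_gt0 z : z != 0 -> 0 < rad z.
Proof. by move=> z0; rewrite lt_neqAle rad_ge0 eq_sym rad_eq0 z0. Qed.
Lemma radM z w : rad (cmul z w) = rad z * rad w.
Proof. by rewrite /rad -!/(n2 _) n2M sqrtrM// n2_ge0. Qed.

Lemma cmulC z w : cmul z w = cmul w z.
Proof. congr pair; ring. Qed.
Lemma cmul1 z : cmul (1, 0) z = z.
Proof. by case: z => a b; congr pair => /=; ring. Qed.
Lemma cmul_eq0 z w : (cmul z w == 0) = (z == 0) || (w == 0).
Proof. by rewrite -!n2_eq0 n2M mulf_eq0. Qed.
Lemma cmul_neq0 z w : z != 0 -> w != 0 -> cmul z w != 0.
Proof. by move=> z0 w0; rewrite cmul_eq0 negb_or z0. Qed.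
Lemma cmulV z : z != 0 -> cmul z (cinv z) = (1, 0).
Proof.
move=> z0; have := n2_gt0 z0; rewrite /n2 => h.
by congr pair => /=; rewrite /n2; field; lra.
Qed.
Lemma n2V z : n2 (cinv z) = (n2 z)^-1.
Proof.
have [->|z0] := eqVneq z 0; first by rewrite /n2 /cinv /= /n2 /= !(expr0n, mul0r, oppr0, addr0, invr0).
have := n2_gt0 z0; rewrite /n2 => h; rewrite /cinv /n2 /=; field; lra.
Qed.
Lemma cinv_eq0 z : (cinv z == 0) = (z == 0).
Proof. by rewrite -!n2_eq0 n2V invr_eq0. Qed.
Lemma cinvK z : cinv (cinv z) = z.
Proof.
have [->|z0] := eqVneq z 0; first by rewrite /cinv /= oppr0 !mul0r oppr0 mul0r.
rewrite {1}/cinv n2V invrK /=; have := n2_gt0 z0 => h; case: z z0 h => a b /= _ h.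
by congr pair; field; lra.
Qed.
Lemma cinv_diff z w : z != 0 -> w != 0 ->
  cinv z - cinv w = cmul (w - z) (cmul (cinv z) (cinv w)).
Proof.
move=> z0 w0; have := n2_gt0 z0; have := n2_gt0 w0; rewrite /n2 => h1 h2.
case: z w z0 w0 h1 h2 => [a b] [c d] /= _ _ h1 h2.
by congr pair => /=; rewrite /n2 /=; field; rewrite !gt_eqF.
Qed.
Lemma expiD t t' : expi (t + t') = cmul (expi t) (expi t').
Proof. by rewrite /expi /cmul /= cosD sinD; congr pair; ring. Qed.
Lemma n2_expi t : n2 (expi t) = 1. Proof. exact: cos2Dsin2. Qed.
Lemma expi_neq0 t : expi t != 0. Proof. by rewrite -n2_eq0 n2_expi oner_eq0. Qed.
Lemma rad_expi t : rad (expi t) = 1.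
Proof. by rewrite /rad -/(n2 _) n2_expi sqrtr1. Qed.

Lemma con_cmul (T : topologicalType) (A : set T) (f g : T -> R2) :
  con A f -> con A g -> con A (fun x => cmul (f x) (g x)).
Proof. by move=> cf cg; rewrite /cmul; ctac. Qed.

Lemma con_n2 (T : topologicalType) (A : set T) (f : T -> R2) :
  con A f -> con A (fun x => n2 (f x)).
Proof. by move=> cf; rewrite /n2; ctac. Qed.

Lemma con_rad (T : topologicalType) (A : set T) (f : T -> R2) :
  con A f -> con A (fun x => rad (f x)).
Proof. by move=> cf; apply: con_comp1 (con_n2 cf) _; exact: sqrt_continuous. Qed.

Lemma con_cinv (T : topologicalType) (A : set T) (f : T -> R2) :
  (forall x, A x -> f x != 0) -> con A f -> con A (fun x => cinv (f x)).
Proof.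
move=> f0 cf; rewrite /cinv; have H : con A (fun x => (n2 (f x))^-1).
  by apply: conV (con_n2 cf) => x /f0; rewrite n2_eq0.
by ctac.
Qed.

Lemma con_expi (T : topologicalType) (A : set T) (f : T -> R) :
  con A f -> con A (fun x => expi (f x)).
Proof.
move=> cf; apply: con_pair; apply: con_comp1 cf _; [exact: continuous_cos|exact: continuous_sin].
Qed.

Definition scal t z : R2 := (t * z.1, t * z.2).
Lemma scalE t z : t *: z = scal t z. Proof. by []. Qed.

(** A continuous branch of the argument of [f] along [A]; a zero of [f] leaves [th] unconstrained
    there. *)
Definition isang (T : topologicalType) (A : set T) (f : T -> R2) (th : T -> R) :=
  con A th /\ forall x, A x -> f x = scal (rad (f x)) (expi (th x)).

(* an argument of z only if 0 < z.1 *)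
Definition arg z : R := atan (z.2 / z.1).

Lemma arg_polar z : 0 < z.1 -> z = scal (rad z) (expi (arg z)).
Proof.
move=> z1; rewrite /scal /expi /arg /= cos_atan.
have ct : cos (atan (z.2 / z.1)) = (Num.sqrt (1 + (z.2 / z.1) ^+ 2))^-1 by rewrite cos_atan.
have rE : rad z = z.1 * Num.sqrt (1 + (z.2 / z.1) ^+ 2).
  have e : z.1 = Num.sqrt (z.1 ^+ 2) by rewrite sqrtr_sqr gtr0_norm.
  rewrite [X in X * _]e -sqrtrM ?sqr_ge0// /rad; congr Num.sqrt.
  by case: z z1 {ct e} => a b /= a0; field; rewrite gt_eqF.
have s0 : 0 < Num.sqrt (1 + (z.2 / z.1) ^+ 2).
  by rewrite sqrtr_gt0 ltr_pwDl// sqr_ge0.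
have st : sin (atan (z.2 / z.1)) = z.2 / z.1 * (Num.sqrt (1 + (z.2 / z.1) ^+ 2))^-1.
  rewrite -ct -{2}(atanK (z.2 / z.1)) /tan; rewrite divfK// ct.
  by rewrite invr_eq0 gt_eqF.
rewrite st rE; case: z z1 s0 {ct st rE} => a b /= a0; set s := Num.sqrt _ => s0.
by congr pair; field; rewrite ?gt_eqF.
Qed.

Lemma con_arg (T : topologicalType) (A : set T) (f : T -> R2) :
  (forall x, A x -> 0 < (f x).1) -> con A f -> con A (fun x => arg (f x)).
Proof.
move=> f0 cf; apply: (con_comp1 (f := fun x => (f x).2 / (f x).1)); last first.
  by move=> x; exact: continuous_atan.
have H : con A (fun x => (f x).1^-1).
  by apply: conV; [move=> x /f0 /gt_eqF -> | ctac].
by ctac.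
Qed.

Lemma cmul_scal t t' z w : cmul (scal t z) (scal t' w) = scal (t * t') (cmul z w).
Proof. by congr pair => /=; ring. Qed.

Lemma isangM (T : topologicalType) (A : set T) (f g : T -> R2) th th' :
  isang A f th -> isang A g th' ->
  isang A (fun x => cmul (f x) (g x)) (fun x => th x + th' x).
Proof.
move=> [cth hf] [cth' hg]; split; first exact: conD.
by move=> x Ax; rewrite radM expiD -cmul_scal -hf// -hg.
Qed.

End Complex.

(** * Angle variation of paths *)

Lemma con_preimage_closed (T U : topologicalType) (A : set T) (f : T -> U) (D : set U) :
  con A f -> closed D -> exists2 V, closed V & A `&` f @^-1` D = A `&` V.
Proof.
move=> /conP cf cD; have /closed_subspaceP[V cV VE] := (continuous_closedP _).1 cf D cD.
by exists V => //; rewrite setIC -VE setIC.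
Qed.

Lemma compact_preimage (T U : topologicalType) (A : set T) (f : T -> U) (D : set U) :
  con A f -> compact A -> closed D -> compact (A `&` f @^-1` D).
Proof.
by move=> cf cA cD; have [V cV ->] := con_preimage_closed cf cD; exact: compact_closedI.
Qed.

Lemma compact_lower_bound (R : realType) (T : topologicalType) (K : set T) (h : T -> R) :
  compact K -> con K h -> (forall x, K x -> 0 < h x) ->
  exists2 d, 0 < d & forall x, K x -> d <= h x.
Proof.
move=> cK ch h0; have [[x Kx]|K0] := pselect (K !=set0); last first.
  by exists 1 => // x Kx; case: K0; exists x.
have [c cK' hc] := compact_EVT_min (ex_intro _ x Kx) cK ((conP _ _).2 ch).
exists (h c); first by apply: h0; exact: set_mem.
by move=> y Ky; apply: hc; rewrite inE.
Qed.

Lemma compact_upper_bound (R : realType) (T : topologicalType) (K : set T) (h : T -> R) :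
  compact K -> con K h -> exists2 d, 0 < d & forall x, K x -> h x < d.
Proof.
move=> cK ch; have [[x Kx]|K0] := pselect (K !=set0); last first.
  by exists 1 => // x Kx; case: K0; exists x.
have [c cK' hc] := compact_EVT_max (ex_intro _ x Kx) cK ((conP _ _).2 ch).
exists (`|h c| + 1); first by rewrite ltr_pwDr.
move=> y Ky; have := hc y; rewrite inE => /(_ Ky) H.
by rewrite (le_lt_trans H)// (le_lt_trans (ler_norm _))// ltrDl.
Qed.

Lemma I01_compact (R : realType) : compact (@I01 R).
Proof. exact: segment_compact. Qed.

Section Lift.
Variable R : realType.
Local Notation R2 := (R * R)%type.

Lemma polar_ex (z : R2) : exists t, z = scal (rad z) (expi t).
Proof.
have [->|z0] := eqVneq z 0.
  by exists 0; rewrite (eqP (_ : rad (0 : R2) == 0)) ?rad_eq0// /scal !mul0r.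
have r0 := rad_gt0 z0; have r2 := rad2 z.
have e : (z.1 / rad z) ^+ 2 + (z.2 / rad z) ^+ 2 = 1.
  by rewrite !expr_div_n -mulrDl r2 divff// n2_eq0.
have a1 : -1 <= z.1 / rad z <= 1.
  by have := sqr_ge0 (z.2 / rad z) => ?; nra.
have sE : sin (acos (z.1 / rad z)) = `|z.2 / rad z|.
  rewrite sin_acos// -sqrtr_sqr; congr Num.sqrt; lra.
have cE : cos (acos (z.1 / rad z)) = z.1 / rad z by rewrite acosK.
have [z2|z2] := leP 0 (z.2 / rad z).
  exists (acos (z.1 / rad z)); rewrite /scal /expi /= cE sE ger0_norm//.
  by rewrite !mulrA ![rad z * _]mulrC !mulfK ?gt_eqF//; case: (z).
exists (- acos (z.1 / rad z)); rewrite /scal /expi /= cosN sinN cE sE ltr0_norm// opprK.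
by rewrite !mulrA ![rad z * _]mulrC !mulfK ?gt_eqF//; case: (z).
Qed.

Lemma rad_scal (c : R) (z : R2) : 0 <= c -> rad (scal c z) = c * rad z.
Proof.
move=> c0; rewrite /rad /= !exprMn -mulrDr sqrtrM ?sqr_ge0//.
by rewrite sqrtr_sqr ger0_norm.
Qed.

Lemma isang_scal (T : topologicalType) (A : set T) (f : T -> R2) (c : T -> R) th :
  (forall x, A x -> 0 <= c x) -> isang A f th -> isang A (fun x => scal (c x) (f x)) th.
Proof.
move=> c0 [cth H]; split=> // x Ax; rewrite rad_scal ?c0// {1}H//.
by congr pair => /=; rewrite mulrA.
Qed.

Lemma isang_eq (T : topologicalType) (A : set T) (f g : T -> R2) th :
  (forall x, A x -> f x = g x) -> isang A f th -> isang A g th.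
Proof. by move=> fg [cth H]; split=> // x Ax; rewrite -fg// -H. Qed.

(* The homotopy x |-> f (s x) contracts f to a constant; the angle is carried
   along in steps so small that the successive quotients have positive real part. *)
Lemma lift_angle (T : normedModType R) (K : set T) (f : T -> R2) :
  compact K -> (forall x s, K x -> I01 s -> K (s *: x)) ->
  con K f -> (forall x, K x -> f x != 0) -> exists th, isang K f th.
Proof.
move=> cK stK cf f0.
(* Up to a positive factor, [q] is the quotient of the values of [f] at two scales; conjugation
   replaces inversion. *)
pose q (p : R * R * T) := cmul (f (p.1.2 *: p.2)) (cconj (f (p.1.1 *: p.2))).
pose S : set (R * R * T) := (I01 `*` I01) `*` K.
have cS : compact S.
  by apply: compact_setX => //; apply: compact_setX; exact: I01_compact.
have cq : con S q.
  apply: con_cmul.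
    apply: (con_comp (f := fun p : R * R * T => p.1.2 *: p.2) (B := K)) => //; first by ctac.
    by move=> -[[s t] x] [[/= ? ?] ?] /=; exact: stK.
  have H : con S (fun p => f (p.1.1 *: p.2)).
    apply: (con_comp (f := fun p : R * R * T => p.1.1 *: p.2) (B := K)) => //; first by ctac.
    by move=> -[[s t] x] [[/= ? ?] ?] /=; exact: stK.
  by rewrite /cconj; ctac.
(* The triples where the quotient has real part at most 0 form a compact set that misses the
   diagonal of equal scales, so the distance of the scales is bounded below on it. *)
have [e e0 He] : exists2 e, 0 < e & forall s t x, I01 s -> I01 t -> K x ->
    `|s - t| < e -> 0 < (q (s, t, x)).1.
  have cZ := compact_preimage (con_fst cq) cS (@closed_le R 0).
  have cd : con (S `&` (fun p => (q p).1) @^-1` [set x | x <= 0])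
      (fun p => `|p.1.1 - p.1.2|).
    apply: (con_comp1 (f := fun p : R * R * T => p.1.1 - p.1.2)); first by ctac.
    exact: norm_continuous.
  have [|e e0 He] := compact_lower_bound cZ cd.
    move=> [[s t] x] [[[/= Is It] Kx] /= qle0]; rewrite normr_gt0 subr_eq0; apply/eqP => st.
    move: qle0; apply/negP; rewrite -ltNge st /q /=.
    have := n2_gt0 (f0 _ (stK x t Kx It)); rewrite /n2; lra.
  exists e => // s t x Is It Kx st; rewrite ltNge; apply/negP => qle0.
  by have := He (s, t, x) (conj (conj (conj Is It) Kx) qle0); rewrite /= leNgt st.
have [N HN] : exists N : nat, N.+1%:R^-1 < e.
  have [N _ HN] := near_infty_natSinv_lt (PosNum e0); exists N.
  by have := HN N (leqnn N).
pose s i : R := i%:R / N.+1%:R.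
have N0 : 0 < N.+1%:R :> R by rewrite ltr0n.
have Is i : (i <= N.+1)%N -> I01 (s i).
  move=> iN; apply/I01P; rewrite /s divr_ge0 ?ler0n//=.
  by rewrite ler_pdivrMr// mul1r ler_nat.
have : forall i, (i <= N.+1)%N -> exists th, isang K (fun x => f (s i *: x)) th.
  elim=> [|i IH] iN.
    have [t tE] := polar_ex (f 0); exists (fun=> t); split; first exact: con_cst.
    by move=> x Kx; rewrite /s mul0r scale0r.
  have [th hth] := IH (ltnW iN).
  have qp x : K x -> 0 < (q (s i, s i.+1, x)).1.
    move=> Kx; apply: He => //; [exact/Is/ltnW|exact: Is|].
    rewrite /s -mulrBl -natr1 opprD addrA subrr add0r mulN1r normrN ger0_norm ?invr_ge0 ?(ltW N0)//.
  have qa : isang K (fun x => q (s i, s i.+1, x)) (fun x => arg (q (s i, s i.+1, x))).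
    split; last by move=> x Kx; exact: arg_polar (qp _ Kx).
    apply: con_arg => //.
    apply: (con_comp (f := fun x : T => (s i, s i.+1, x)) (B := S)) => //; first by ctac.
    by move=> x Kx; split=> //; split; [exact/Is/ltnW|exact: Is].
  exists (fun x => th x + arg (q (s i, s i.+1, x))).
  have := isangM hth qa.
  have c0 x : K x -> 0 <= (n2 (f (s i *: x)))^-1 by move=> _; rewrite invr_ge0 n2_ge0.
  move=> /(isang_scal c0); apply: isang_eq => x Kx; rewrite /q /=.
  have /n2_gt0 : f (s i *: x) != 0 by apply: f0; apply: stK => //; exact/Is/ltnW.
  rewrite /cmul /n2 /cconj /scal /=.
  case: (f (s i *: x)) (f (s i.+1 *: x)) => a b [c d] /= h.
  by congr pair; field; rewrite gt_eqF.
move=> /(_ N.+1 (leqnn _))[th Hth]; exists th; apply: isang_eq Hth => x _.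
by rewrite /s divff ?scale1r// gt_eqF.
Qed.

Lemma expi_eq1 (t : R) : expi t = (1, 0) -> 0 <= t <= pi -> t = 0.
Proof.
move=> [ct _] /andP[t0 tpi]; apply/eqP; rewrite eq_le t0 andbT leNgt; apply/negP => t1.
have : cos t < cos 0.
  by rewrite ltr_cos// in_itv /= ?lexx ?pi_ge0 ?t0 ?tpi.
by rewrite cos0 ct ltxx.
Qed.

Lemma expiN (t : R) : expi (- t) = cconj (expi t).
Proof. by rewrite /expi cosN sinN. Qed.

Lemma expiB1 (s t : R) : expi s = expi t <-> expi (s - t) = (1, 0).
Proof.
split=> [st|st].
  rewrite expiD expiN st; have := n2_expi t; rewrite /n2 /cmul /cconj /= => h.
  congr pair; lra.
have -> : s = (s - t) + t by ring.
by rewrite expiD st cmul1.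
Qed.

(** Otherwise, by the intermediate value theorem, [d] takes a value [v] that exceeds [d 0] by a
    positive amount of at most [pi], and such an angle is not a whole number of turns. *)
Lemma angle_const_le (d : R -> R) : con I01 d -> (forall t, I01 t -> expi (d t) = expi (d 0)) ->
  d 1 <= d 0.
Proof.
move=> cd ed; rewrite leNgt; apply/negP => d01.
pose v := Num.min (d 1) (d 0 + pi).
have v0 : d 0 < v by rewrite lt_min d01/= ltrDl pi_gt0.
have v1 : v <= d 1 by rewrite ge_min lexx.
have vp : v <= d 0 + pi by rewrite ge_min lexx orbT.
have [|c] := @IVT R d 0 1 v ler01 ((conP _ _).2 cd).
  by rewrite (min_idPl (ltW d01)) (max_idPr (ltW d01)) v1 ltW.
rewrite in_itv => /I01P Ic dc; have := (expiB1 _ _).1 (ed c Ic); rewrite dc => /expi_eq1.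
by rewrite subr_ge0 ltW// lerBlDl vp => /(_ isT) ?; lra.
Qed.

Lemma angle_const (d : R -> R) : con I01 d -> (forall t, I01 t -> expi (d t) = expi (d 0)) ->
  d 1 = d 0.
Proof.
move=> cd ed; apply/eqP; rewrite eq_le angle_const_le//=.
have := @angle_const_le (fun t => - d t); rewrite lerN2; apply; first by ctac.
by move=> t It; rewrite !expiN ed.
Qed.

Lemma isang_AngleVar (f : R -> R2) th : isang I01 f th -> AngleVar f (th 1 - th 0).
Proof.
by move=> [/conP cth H]; exists th.
Qed.

Definition npath (f : R -> R2) := con I01 f /\ forall t, I01 t -> f t != 0.

Lemma AngleVar_uniq (f : R -> R2) a b : (forall t, I01 t -> f t != 0) ->
  AngleVar f a -> AngleVar f b -> a = b.
Proof.
move=> f0 [th [cth hth ->]] [th' [cth' hth' ->]].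
have e t : I01 t -> expi (th t) = expi (th' t).
  move=> It; have it : t \in `[0, 1] by rewrite in_itv; apply/I01P.
  have := hth' _ it; rewrite {1}hth// => -[h1 h2].
  have r0 : rad (f t) != 0 by rewrite rad_eq0 f0.
  by rewrite /expi; congr pair; [exact: (mulfI r0)|exact: (mulfI r0)].
have cd : con I01 (fun t => th t - th' t) by move: cth cth' => /conP ? /conP ?; ctac.
have /= := angle_const cd; have He t : I01 t -> expi (th t - th' t) = expi (th 0 - th' 0).
  by move=> It; have /expiB1 -> := e t It; have /expiB1 -> := e 0 I010.
by move=> /(_ He) h; lra.
Qed.

(* 0 if f has no continuous angle function *)
Definition av (f : R -> R2) : R := xget 0 [set a | AngleVar f a].

Lemma npath_isang f : npath f -> exists th, isang I01 f th.
Proof.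
move=> [cf f0]; apply: lift_angle => //; first exact: I01_compact.
move=> x s /I01P ? /I01P ?; apply/I01P; rewrite /GRing.scale /=; nra.
Qed.

Lemma avP f : npath f -> AngleVar f (av f).
Proof.
move=> /npath_isang[th /isang_AngleVar hth].
apply: (@xgetPex _ 0 [set a | AngleVar f a]). by exists (th 1 - th 0).
Qed.

Lemma av_isang f th : (forall t, I01 t -> f t != 0) -> isang I01 f th -> av f = th 1 - th 0.
Proof.
move=> f0 /isang_AngleVar H; apply: (AngleVar_uniq f0) (H).
apply: (@xgetPex _ 0 [set a | AngleVar f a]). by exists (th 1 - th 0).
Qed.

Lemma npath_eq f g : (forall t, I01 t -> f t = g t) -> npath f -> npath g.
Proof. by move=> fg [cf f0]; split; [exact: con_eq cf|move=> t It; rewrite -fg ?f0]. Qed.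

Lemma AngleVar_eq (f g : R -> R2) a : (forall t, I01 t -> f t = g t) ->
  AngleVar f a -> AngleVar g a.
Proof.
move=> fg [th [c h e]]; exists th; split; [exact: c| |exact: e] => t it.
by rewrite -fg; [exact: h|move: it; rewrite in_itv => /I01P].
Qed.

Lemma av_eq f g : (forall t, I01 t -> f t = g t) -> av f = av g.
Proof.
move=> fg; rewrite /av; congr xget; apply/seteqP; split=> a; apply: AngleVar_eq => // t It.
by rewrite fg.
Qed.

Lemma npathM f g : npath f -> npath g -> npath (fun t => cmul (f t) (g t)).
Proof. by move=> [cf f0] [cg g0]; split; [exact: con_cmul|move=> t It; rewrite cmul_neq0 ?f0 ?g0]. Qed.

Lemma npathV f : npath f -> npath (fun t => cinv (f t)).
Proof. by move=> [cf f0]; split; [exact: con_cinv|move=> t It; rewrite cinv_eq0 f0]. Qed.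

Lemma npath_cst c : c != 0 -> npath (fun=> c).
Proof. by move=> c0; split; [exact: con_cst|]. Qed.

Lemma avM f g : npath f -> npath g -> av (fun t => cmul (f t) (g t)) = av f + av g.
Proof.
move=> pf pg; have [th hth] := npath_isang pf; have [th' hth'] := npath_isang pg.
rewrite (av_isang (npathM pf pg).2 (isangM hth hth')).
by rewrite (av_isang pf.2 hth) (av_isang pg.2 hth') /= opprD addrACA.
Qed.

Lemma av_cst c : c != 0 -> av (fun=> c) = 0.
Proof.
move=> c0; have [t tE] := polar_ex c.
rewrite (@av_isang _ (fun=> t)) ?subrr//; split=> //; exact: con_cst.
Qed.

Lemma avV f : npath f -> av (fun t => cinv (f t)) = - av f.
Proof.
move=> pf; apply/eqP; rewrite -addr_eq0 addrC -avM//; last exact: npathV.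
have e : ((1 : R), (0 : R)) != 0 by rewrite pair_eq0 /= oner_eq0.
by rewrite -(av_cst e); apply/eqP/av_eq => t It; rewrite cmulV// pf.2.
Qed.

Lemma cmulN1 (z : R2) : cmul (-1, 0) z = - z.
Proof. by case: z => a b; rewrite /cmul /= !mulN1r !mul0r subr0 addr0. Qed.

Lemma npathN f : npath f -> npath (fun t => - f t).
Proof. by move=> [cf f0]; split; [exact: conN|move=> t It; rewrite oppr_eq0 f0]. Qed.

Lemma avN f : npath f -> av (fun t => - f t) = av f.
Proof.
move=> pf; have e : ((- 1 : R), (0 : R)) != 0 by rewrite pair_eq0 /= oppr_eq0 oner_eq0.
rewrite -[RHS]add0r -(av_cst e) -avM//; last exact: npath_cst.
by apply: av_eq => t _; rewrite cmulN1.
Qed.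

Lemma av_scal f (c : R -> R) : npath f -> (forall t, I01 t -> 0 < c t) ->
  av (fun t => scal (c t) (f t)) = av f.
Proof.
move=> pf c0; have [th hth] := npath_isang pf; rewrite (av_isang pf.2 hth).
rewrite (@av_isang _ th)//; last by apply: isang_scal hth => t /c0/ltW.
move=> t It; rewrite pair_eq0 /= !mulf_eq0 gt_eqF ?c0//= -pair_eq0; exact: pf.2.
Qed.

Lemma con_rev (T : topologicalType) (c : R -> T) : con I01 c -> con I01 (fun t => c (1 - t)).
Proof.
move=> cc; apply: (con_comp (f := fun t : R => 1 - t) (g := c) (B := I01)) => //; first by ctac.
by move=> t /= It; exact: I01C.
Qed.

Lemma av_rev f : npath f -> av (fun t => f (1 - t)) = - av f.
Proof.
move=> pf; have [th [cth hth]] := npath_isang pf; rewrite (av_isang pf.2 (conj cth hth)).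
rewrite (@av_isang _ (fun t => th (1 - t))) ?subrr ?subr0 ?opprB//.
  by move=> t /I01C; exact: pf.2.
split; first exact: con_rev.
by move=> t /I01C; exact: hth.
Qed.

Lemma sq_isang (H : R * R -> R2) : con (I01 `*` I01) H ->
  (forall p, (I01 `*` I01) p -> H p != 0) -> exists th, isang (I01 `*` I01) H th.
Proof.
move=> cH H0; apply: lift_angle => //; first by apply: compact_setX; exact: I01_compact.
by move=> [x y] s [/I01P /= ? /I01P ?] /I01P ?; split; apply/I01P; rewrite /= /GRing.scale /=; nra.
Qed.

Lemma isang_comp (T U : topologicalType) (A : set T) (B : set U) (c : T -> U) (f : U -> R2) th :
  con A c -> (forall x, A x -> B (c x)) -> isang B f th -> isang A (f \o c) (th \o c).
Proof.
move=> cc AB [cth hth]; split; first exact: con_comp cth.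
by move=> x Ax /=; exact/hth/AB.
Qed.

(** A single angle function on the whole square turns each variation into a difference of its values
    at two corners. *)
Lemma av_square (H : R * R -> R2) : con (I01 `*` I01) H ->
  (forall p, (I01 `*` I01) p -> H p != 0) ->
  av (fun t => H (0, t)) + av (fun t => H (t, 1)) =
  av (fun t => H (t, 0)) + av (fun t => H (1, t)) /\
  av (fun t => H (t, t)) = av (fun t => H (0, t)) + av (fun t => H (t, 1)).
Proof.
move=> cH H0; have [th hth] := sq_isang cH H0.
have avE (c : R -> R * R) : con I01 c -> (forall x, I01 x -> (I01 `*` I01) (c x)) ->
    av (fun t => H (c t)) = th (c 1) - th (c 0).
  move=> cc Ac; rewrite (@av_isang _ (th \o c)) //; first by move=> t /Ac; exact: H0.
  exact: isang_comp hth.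
have E1 := avE (fun t => (0, t)); have E2 := avE (fun t => (t, 1)).
have E3 := avE (fun t => (t, 0)); have E4 := avE (fun t => (1, t)).
have E5 := avE (fun t => (t, t)).
rewrite E1 ?E2 ?E3 ?E4 ?E5 //; by [split; ring|ctac].
Qed.

End Lift.

(** * Winding numbers of chains *)

(** A propositional [all]: the conditions put on the paths of a chain are not boolean, and stating
    them along the list avoids membership of functions. *)
Fixpoint alls (T : Type) (P : T -> Prop) (r : seq T) : Prop :=
  if r is c :: r' then P c /\ alls P r' else True.

Lemma alls_impl (T : Type) (P Q : T -> Prop) r :
  (forall c, P c -> Q c) -> alls P r -> alls Q r.
Proof. by move=> PQ; elim: r => //= c r IH [/PQ ? /IH]. Qed.

Lemma alls_and (T : Type) (P Q : T -> Prop) r :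
  alls P r -> alls Q r -> alls (fun c => P c /\ Q c) r.
Proof. by elim: r => //= c r IH [? /IH H] [? /H]. Qed.

Lemma alls_all (T : Type) (P : T -> Prop) r : (forall c, P c) -> alls P r.
Proof. by move=> H; elim: r => //=. Qed.

Lemma alls_cat (T : Type) (P : T -> Prop) r s : alls P r -> alls P s -> alls P (r ++ s).
Proof. by elim: r => //= c r IH [? /IH H] /H. Qed.

Lemma alls_map (S : eqType) (T : Type) (P : T -> Prop) (f : S -> T) (r : seq S) :
  (forall i, i \in r -> P (f i)) -> alls P [seq f i | i <- r].
Proof.
elim: r => //= c r IH H; split; first by apply: H; rewrite mem_head.
by apply: IH => i ir; apply: H; rewrite in_cons ir orbT.
Qed.

Section Chains.
Variable R : realType.
Local Notation R2 := (R * R)%type.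

(* the formal sum of the paths has zero boundary, tested against all functions F *)
Definition closed_chain (T : Type) (r : seq (R -> T)) :=
  forall F : T -> R, \sum_(c <- r) (F (c 1) - F (c 0)) = 0.

Definition wsum (T : Type) (r : seq (R -> T)) (f : T -> R2) : R :=
  \sum_(c <- r) av (fun t => f (c t)).

Definition nchain (T : Type) (r : seq (R -> T)) (f : T -> R2) :=
  alls (fun c => npath (fun t => f (c t))) r.

Definition chain_in (T : topologicalType) (X : set T) (r : seq (R -> T)) :=
  alls (fun c => con I01 c /\ forall t, I01 t -> X (c t)) r.

Lemma sum_alls (T : Type) (r : seq T) (f g : T -> R) :
  alls (fun c => f c = g c) r -> \sum_(c <- r) f c = \sum_(c <- r) g c.
Proof. by elim: r => [|c r IH] /=; rewrite ?big_nil// !big_cons => -[-> /IH ->]. Qed.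

Lemma closed_map (T U : Type) (r : seq (R -> T)) (f : T -> U) :
  closed_chain r -> closed_chain [seq (fun t => f (c t)) | c <- r].
Proof. by move=> cr F; rewrite big_map; exact: (cr (fun x => F (f x))). Qed.

Lemma wsum_map (T U : Type) (r : seq (R -> T)) (f : T -> U) (g : U -> R2) :
  wsum [seq (fun t => f (c t)) | c <- r] g = wsum r (fun x => g (f x)).
Proof. by rewrite /wsum big_map. Qed.

Lemma alls_mapE (S T : Type) (P : T -> Prop) (f : S -> T) (r : seq S) :
  alls P [seq f i | i <- r] <-> alls (fun i => P (f i)) r.
Proof. by elim: r => //= c r IH; split=> -[? /IH]. Qed.

Lemma chain_map (T U : topologicalType) (X : set T) (Y : set U) (r : seq (R -> T)) (f : T -> U) :
  chain_in X r -> con X f -> (forall x, X x -> Y (f x)) ->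
  chain_in Y [seq (fun t => f (c t)) | c <- r].
Proof.
move=> cr cf XY; apply/alls_mapE; apply: alls_impl cr => c [cc cX]; split.
  exact: (con_comp cc cX cf).
by move=> t It; apply/XY/cX.
Qed.

Lemma chain_sub (T : topologicalType) (X Y : set T) (r : seq (R -> T)) :
  X `<=` Y -> chain_in X r -> chain_in Y r.
Proof. by move=> XY; apply: alls_impl => c [cc cX]; split=> // t It; exact/XY/cX. Qed.

Lemma chain_in_npath (T : topologicalType) (X : set T) (r : seq (R -> T)) (f : T -> R2) :
  chain_in X r -> con X f -> (forall x, X x -> f x != 0) -> nchain r f.
Proof.
move=> H cf f0; apply: alls_impl H => c [cc cX]; split; first exact: (con_comp cc cX cf).
by move=> t It; apply/f0/cX.
Qed.

Lemma wsum_eq (T : Type) (r : seq (R -> T)) (f g : T -> R2) :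
  alls (fun c => forall t, I01 t -> f (c t) = g (c t)) r -> wsum r f = wsum r g.
Proof. by move=> H; apply: sum_alls; apply: alls_impl H => c H; exact: av_eq. Qed.

Lemma wsum_eq_in (T : topologicalType) (X : set T) (r : seq (R -> T)) (f g : T -> R2) :
  chain_in X r -> (forall x, X x -> f x = g x) -> wsum r f = wsum r g.
Proof.
move=> H fg; apply: wsum_eq; apply: alls_impl H => c [_ cX] t It; exact/fg/cX.
Qed.

Lemma wsumM (T : Type) (r : seq (R -> T)) (f g : T -> R2) :
  nchain r f -> nchain r g -> wsum r (fun x => cmul (f x) (g x)) = wsum r f + wsum r g.
Proof.
move=> nf ng; rewrite /wsum -big_split /=; apply: sum_alls.
by apply: alls_impl (alls_and nf ng) => c [pf pg]; exact: avM.
Qed.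

Lemma wsumV (T : Type) (r : seq (R -> T)) (f : T -> R2) :
  nchain r f -> wsum r (fun x => cinv (f x)) = - wsum r f.
Proof.
move=> nf; rewrite /wsum -sumrN; apply: sum_alls.
by apply: alls_impl nf => c pf; exact: avV.
Qed.

Lemma wsumN (T : Type) (r : seq (R -> T)) (f : T -> R2) :
  nchain r f -> wsum r (fun x => - f x) = wsum r f.
Proof. by move=> nf; apply: sum_alls; apply: alls_impl nf => c pf; exact: avN. Qed.

Lemma nchainV (T : Type) (r : seq (R -> T)) (f : T -> R2) : nchain r f -> nchain r (fun x => cinv (f x)).
Proof. by apply: alls_impl => c; exact: npathV. Qed.

Lemma nchainN (T : Type) (r : seq (R -> T)) (f : T -> R2) : nchain r f -> nchain r (fun x => - f x).
Proof. by apply: alls_impl => c; exact: npathN. Qed.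

Lemma nchainM (T : Type) (r : seq (R -> T)) (f g : T -> R2) : nchain r f -> nchain r g ->
  nchain r (fun x => cmul (f x) (g x)).
Proof. by move=> nf ng; apply: alls_impl (alls_and nf ng) => c [? ?]; exact: npathM. Qed.

Lemma wsum_scal (T : Type) (r : seq (R -> T)) (f : T -> R2) (a : R) :
  0 < a -> nchain r f -> wsum r (fun x => scal a (f x)) = wsum r f.
Proof.
by move=> a0 nf; apply: sum_alls; apply: alls_impl nf => c pf; exact: (av_scal (c := fun=> a)).
Qed.

Lemma wsum_cst (T : Type) (r : seq (R -> T)) (a : R2) : a != 0 -> wsum r (fun=> a) = 0.
Proof. by move=> a0; rewrite /wsum big1// => c _; exact: av_cst. Qed.

(** [th] is a potential for the angle, and a closed chain annihilates differences of a potential. *)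
Lemma wsum_isang (T : topologicalType) (X : set T) (r : seq (R -> T)) (f : T -> R2) th :
  closed_chain r -> chain_in X r -> isang X f th -> (forall x, X x -> f x != 0) ->
  wsum r f = 0.
Proof.
move=> cr rX hth f0; rewrite -(cr th); apply: sum_alls; apply: alls_impl rX => c [cc cX].
rewrite (@av_isang _ _ (fun t => th (c t)))//; first by move=> t It; exact/f0/cX.
exact: (isang_comp cc cX hth).
Qed.

(** Each path sweeps a square under [H]. The variation along the two remaining sides depends on the
    end points alone, and closedness, tested against this function of the end points, cancels it. *)
Lemma wsum_homotopy (T : topologicalType) (X : set T) (r : seq (R -> T)) (H : R * T -> R2) :
  closed_chain r -> chain_in X r -> con (I01 `*` X) H ->
  (forall p, (I01 `*` X) p -> H p != 0) ->
  wsum r (fun x => H (0, x)) = wsum r (fun x => H (1, x)).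
Proof.
move=> cr rX cH H0; apply/eqP; rewrite -subr_eq0; apply/eqP.
rewrite -[RHS](cr (fun x => - av (fun s => H (s, x)))) /wsum -sumrB.
apply: sum_alls; apply: alls_impl rX => c [cc cX].
pose G (p : R * R) := H (p.1, c p.2).
have cG : con (I01 `*` I01) G.
  apply: (con_comp (f := fun p : R * R => (p.1, c p.2)) (B := I01 `*` X)) => //.
    apply: con_pair; first by ctac.
    apply: (con_comp (f := fun p : R * R => p.2) (g := c) (B := I01)) cc; first by ctac.
    by move=> p [].
  by move=> [s t] [/= Is /cX].
have G0 p : (I01 `*` I01) p -> G p != 0 by move=> [Is It]; apply: H0; split=> //=; exact: cX.
have [] := av_square cG G0; rewrite /G /=; lra.
Qed.

Lemma wsum_move (r : seq (R -> R2)) (z : R -> R2) :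
  closed_chain r -> con I01 z ->
  chain_in [set x | forall s, I01 s -> x != z s] r ->
  wsum r (fun x => x - z 0) = wsum r (fun x => x - z 1).
Proof.
move=> cr cz rX; apply: (wsum_homotopy (H := fun p : R * R2 => p.2 - z p.1) cr rX).
  apply: conB; first by ctac.
  apply: (con_comp (f := fun p : R * R2 => p.1) (g := z) (B := I01)) cz; first by ctac.
  by move=> p [].
by move=> [s x] [/= Is]; rewrite subr_eq0; exact.
Qed.

Lemma expi_periodic (t : R) (n : int) : expi (t + 2 * pi * n%:~R) = expi t.
Proof.
have P m (s : R) : expi (s + 2 * pi * m%:R) = expi s.
  elim: m => [|m IH]; first by rewrite mulr0 addr0.
  rewrite -[RHS]IH (_ : 2 * pi * m.+1%:R = 2 * pi * m%:R + pi *+ 2); last first.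
    by rewrite -(natr1 m) -(mulr_natr pi); ring.
  by rewrite addrA /expi cosD2pi sinD2pi.
case: (intP n) => [|m|m]; [by rewrite mulr0 addr0|by rewrite -pmulrn P|].
by rewrite rmorphN /= mulrN -pmulrn -(P m.+1 (t - _)) subrK.
Qed.

Lemma expi_int (t : R) : expi t = (1, 0) -> exists n : int, t = 2 * pi * n%:~R.
Proof.
move=> et; have p0 := pi_gt0 R; pose n := Num.floor (t / (2 * pi)).
pose s := t - 2 * pi * n%:~R.
have p20 : 0 < 2 * pi :> R by rewrite mulr_gt0.
have s0 : 0 <= s.
  by rewrite subr_ge0 mulrC -ler_pdivlMr// floor_le_tmp.
have s1 : s < 2 * pi.
  have := floorD1_gt (t / (2 * pi)); rewrite ltr_pdivrMr// -/n intrD mulrDl mul1r /s.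
  by rewrite ltrBlDl mulrC.
have es : expi s = (1, 0) by rewrite -(expi_periodic s n) /s subrK.
exists n; apply/eqP; rewrite -subr_eq0 -/s; apply/eqP.
have [sp|sp] := leP s pi; first by apply: expi_eq1 => //; rewrite s0.
have : 2 * pi - s = 0; last by lra.
apply: expi_eq1; last by apply/andP; split; lra.
have := expi_periodic (- s) 1; rewrite mulr1 addrC => ->.
by rewrite expiN es /cconj /= oppr0.
Qed.

Definition polar_angle (z : R2) : R := xget 0 [set t | z = scal (rad z) (expi t)].
Lemma polar_angleE z : z = scal (rad z) (expi (polar_angle z)).
Proof. by apply: (@xgetPex _ 0 [set t | z = scal (rad z) (expi t)]); exact: polar_ex. Qed.

Lemma scalI (a : R) (z w : R2) : a != 0 -> scal a z = scal a w -> z = w.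
Proof.
by case: z w => [z1 z2] [w1 w2] a0 [/= /(mulfI a0) -> /(mulfI a0) ->].
Qed.

Lemma av_endpoints (f : R -> R2) : npath f ->
  expi (av f) = expi (polar_angle (f 1) - polar_angle (f 0)).
Proof.
move=> pf; have [th [cth hth]] := npath_isang pf; rewrite (av_isang pf.2 (conj cth hth)).
have e t : I01 t -> expi (th t) = expi (polar_angle (f t)).
  move=> It; have r0 : rad (f t) != 0 by rewrite rad_eq0 pf.2.
  by apply: (scalI r0); rewrite -polar_angleE -hth.
by rewrite !expiD !expiN !e.
Qed.

(** Along each path the variation differs from the increment of [polar_angle] by whole turns.
    [polar_angle] is discontinuous, but closed chains are tested against arbitrary functions, so its
    increments add up to 0. *)
Lemma wsum_int (T : Type) (r : seq (R -> T)) (f : T -> R2) : closed_chain r -> nchain r f ->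
  exists n : int, wsum r f = 2 * pi * n%:~R.
Proof.
move=> cr nf; have e0 := cr (fun x => polar_angle (f x)).
suff [n nE] : exists n : int, \sum_(c <- r) (av (fun t => f (c t)) -
    (polar_angle (f (c 1)) - polar_angle (f (c 0)))) = 2 * pi * n%:~R.
  by exists n; rewrite -nE sumrB e0 subr0.
elim: r nf {cr e0} => [|c r IH] /=; first by exists 0; rewrite big_nil mulr0.
move=> [pc /IH[n nE]]; rewrite big_cons nE.
have := av_endpoints pc => /expiB1/expi_int[m ->]; exists (m + n).
by rewrite intrD (mulrDr (2 * pi)).
Qed.

Definition dot (u v : R2) := u.1 * v.1 + u.2 * v.2.
Definition cross (u v : R2) := u.1 * v.2 - u.2 * v.1.

(** After rotation by the conjugate of [w] the path lies in the right half plane, where [arg] is a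
    continuous angle that depends on the point only. *)
Lemma av_half (w : R2) (f : R -> R2) : con I01 f -> (forall t, I01 t -> 0 < dot w (f t)) ->
  npath f /\ av f = arg (cmul (f 1) (cconj w)) - arg (cmul (f 0) (cconj w)).
Proof.
move=> cf fw; have f0 t : I01 t -> f t != 0.
  by move=> /fw; apply: contraTneq => ->; rewrite /dot /= !mulr0 addr0 ltxx.
have pf : npath f by [].
have w0 : cconj w != 0.
  have := fw 0 I010; apply: contraTneq => -[e1 /eqP]; rewrite oppr_eq0 => /eqP e2.
  by rewrite /dot e1 e2 !mul0r addr0 ltxx.
have g0 t : I01 t -> 0 < (cmul (f t) (cconj w)).1.
  by move=> /fw; rewrite /dot /=; lra.
split=> //; have -> : av f = av f + av (fun=> cconj w) by rewrite av_cst// addr0.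
rewrite -avM//; last exact: npath_cst.
have cg : con I01 (fun t => cmul (f t) (cconj w)) by apply: con_cmul => //; exact: con_cst.
rewrite (@av_isang _ _ (fun t => arg (cmul (f t) (cconj w))))//.
  by move=> t It; rewrite cmul_neq0 ?f0.
by split; [exact: con_arg|move=> t It; exact: arg_polar (g0 t It)].
Qed.

Lemma wsum_half (T : Type) (w : R2) (r : seq (R -> T)) (f : T -> R2) : closed_chain r ->
  alls (fun c => con I01 (fun t => f (c t)) /\ forall t, I01 t -> 0 < dot w (f (c t))) r ->
  wsum r f = 0.
Proof.
move=> cr H; rewrite -(cr (fun x => arg (cmul (f x) (cconj w)))); apply: sum_alls.
by apply: alls_impl H => c [cc /(av_half cc)[]].
Qed.

Lemma dot_bound (x z : R2) : n2 x < n2 z -> 0 < dot (- z) (x - z).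
Proof.
case: x z => [a b] [c d]; rewrite /dot /n2 /= => h.
have := sqr_ge0 (a - c); have := sqr_ge0 (b - d); nra.
Qed.

(** Seen from [z], an open disc about the origin with [z] on or outside its boundary circle lies in
    the half plane of direction [- z]. *)
Lemma wsum_far (r : seq (R -> R2)) (z : R2) : closed_chain r ->
  chain_in [set x | n2 x < n2 z] r -> wsum r (fun x => x - z) = 0.
Proof.
move=> cr H; apply: (wsum_half (w := - z) cr); apply: alls_impl H => c [cc cX]; split.
  by ctac.
by move=> t /cX; exact: dot_bound.
Qed.

Definition seg (u v : R2) (t : R) : R2 := ((1 - t) * u.1 + t * v.1, (1 - t) * u.2 + t * v.2).

Lemma con_seg u v (A : set R) : con A (seg u v).
Proof. by rewrite /seg; ctac. Qed.

Lemma seg0 u v : seg u v 0 = u.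
Proof. by case: u v => [a b] [c d]; rewrite /seg /= subr0 !mul1r !mul0r !addr0. Qed.
Lemma seg1 u v : seg u v 1 = v.
Proof. by case: u v => [a b] [c d]; rewrite /seg /= subrr !mul1r !mul0r !add0r. Qed.

Lemma dot_seg w u v t : dot w (seg u v t) = (1 - t) * dot w u + t * dot w v.
Proof. rewrite /dot /=; ring. Qed.

Lemma cross_neq0 u v : cross u v != 0 -> u != 0 /\ v != 0.
Proof.
by move=> h; split; apply: contraNneq h => ->; rewrite /cross /= ?(mul0r, mulr0) subrr.
Qed.

(** The segment stays in the half plane around the bisector of [u] and [v], so its turn is a
    difference of two arctangents, positive by the sign of the cross product. For orthogonal [u] and
    [v] the cosine of the turn vanishes, which singles out [pi / 2]. *)
Lemma av_seg u v : 0 < cross u v -> [/\ npath (seg u v), 0 < av (seg u v) < pi &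
  dot u v = 0 -> av (seg u v) = pi / 2].
Proof.
move=> uv; have [u0 v0] := cross_neq0 (lt0r_neq0 uv).
have ru := rad_gt0 u0; have rv := rad_gt0 v0.
(* The direction of the bisector. Its products with [u] and [v] are positive because [u] and [v] are
   not opposite, which is [duv]. *)
pose w : R2 := (rad v * u.1 + rad u * v.1, rad v * u.2 + rad u * v.2).
have duv : - (rad u * rad v) < dot u v.
  have : dot u v ^+ 2 < (rad u * rad v) ^+ 2.
    by rewrite exprMn !rad2 /dot /n2; rewrite /cross in uv; nra.
  have : 0 < rad u * rad v by rewrite mulr_gt0.
  by move: (rad u * rad v) (dot u v) => y x *; nra.
have dwu : 0 < dot w u.
  have -> : dot w u = rad v * n2 u + rad u * dot u v by rewrite /dot /n2 /=; ring.
  rewrite -rad2; nra.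
have dwv : 0 < dot w v.
  have -> : dot w v = rad u * n2 v + rad v * dot u v by rewrite /dot /n2 /=; ring.
  rewrite -rad2; nra.
clearbody w.
have [pf avE] : npath (seg u v) /\ av (seg u v) =
    arg (cmul v (cconj w)) - arg (cmul u (cconj w)).
  have := @av_half w (seg u v) (@con_seg u v I01); rewrite seg0 seg1; apply=> t /I01P t01.
  by rewrite dot_seg; nra.
have a0 : 0 < av (seg u v) < pi.
  apply/andP; split.
    rewrite avE subr_gt0; apply: lt_atan; rewrite /= ltr_pdivrMr; last first.
      by rewrite /dot in dwu; lra.
    rewrite mulrAC ltr_pdivlMr; last by rewrite /dot in dwv; lra.
    have w0 : 0 < n2 w.
      apply: n2_gt0; apply: contraTneq dwu => ->.
      by rewrite /dot /= !mul0r addr0 ltxx.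
    have : 0 < n2 w * cross u v by rewrite mulr_gt0.
    by rewrite /n2 /cross /=; move: (w) => [c d] /=; lra.
  have := atan_ltpi2 ((cmul v (cconj w)).2 / (cmul v (cconj w)).1).
  have := atan_gtNpi2 ((cmul u (cconj w)).2 / (cmul u (cconj w)).1).
  by rewrite avE /arg; lra.
split=> // duv0; have [a1 a2] := andP a0.
have := av_endpoints pf; rewrite seg0 seg1 expiD expiN => -[ca _].
have uE := polar_angleE u; have vE := polar_angleE v.
have ca0 : cos (av (seg u v)) = 0.
  have : rad u * rad v * cos (av (seg u v)) = 0.
    by rewrite ca -duv0 [in RHS]uE [in RHS]vE /dot /=; ring.
  by move/eqP; rewrite !mulf_eq0 (gt_eqF ru) (gt_eqF rv) /= => /eqP.
apply: (@cos_inj R); rewrite ?ca0 ?cos_pihalf// in_itv /=; have := pi_gt0 R; lra.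
Qed.

Lemma seg_rev u v t : seg u v (1 - t) = seg v u t.
Proof. rewrite /seg; congr pair; ring. Qed.

Lemma av_seg_neg u v : cross u v < 0 -> [/\ npath (seg u v), - pi < av (seg u v) < 0 &
  dot u v = 0 -> av (seg u v) = - (pi / 2)].
Proof.
move=> uv; have vu : 0 < cross v u by move: uv; rewrite /cross; lra.
have [pf /andP[h1 h2] h3] := av_seg vu.
have E : av (seg u v) = - av (seg v u).
  by rewrite -(av_rev pf); apply: av_eq => t _; rewrite seg_rev.
have pf' : npath (seg u v).
  split; first exact: con_seg.
  by move=> t It; rewrite -seg_rev; apply: pf.2; exact: I01C.
split=> //; rewrite E; first by apply/andP; split; lra.
by move=> d0; rewrite h3//; move: d0; rewrite /dot => <-; ring.
Qed.

End Chains.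

(** * Turning along the boundary of a rectangle *)

Section Rect.
Variable R : realType.
Local Notation R2 := (R * R)%type.

Lemma lift_angle_at (c : R2) (K : set R2) (f : R2 -> R2) :
  compact K -> (forall x s, K x -> I01 s -> K (c + s *: (x - c))) ->
  con K f -> (forall x, K x -> f x != 0) -> exists th, isang K f th.
Proof.
move=> cK stK cf f0; pose K' := (fun x => x - c) @` K.
have cK' : compact K' by apply: con_image_compact => //; ctac.
have KK' x : K' x -> K (x + c) by move=> [y Ky <-]; rewrite subrK.
have [|||th hth] := @lift_angle R _ K' (fun x => f (x + c)) cK'.
- by move=> x s [y Ky <-] Is; exists (c + s *: (y - c)); [exact: stK|rewrite addrAC subrr add0r].
- by apply: (con_comp (f := fun x : R2 => x + c) (B := K)) => //; ctac.
- by move=> x /KK'; exact: f0.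
exists (fun x => th (x - c)).
have := isang_comp (c := fun x : R2 => x - c) (A := K) _ _ hth.
case=> [||c1 c2]; first by ctac.
  by move=> x Kx; exists x.
by split=> // x Kx; have := c2 x Kx; rewrite /= subrK.
Qed.

Definition rect (x0 x1 y0 y1 : R) : set R2 :=
  [set z | x0 <= z.1 <= x1 /\ y0 <= z.2 <= y1].

Lemma rectE x0 x1 y0 y1 : rect x0 x1 y0 y1 = `[x0, x1]%classic `*` `[y0, y1]%classic.
Proof. by apply/seteqP; split=> -[a b]; rewrite /rect /= !in_itv. Qed.

Lemma rect_compact x0 x1 y0 y1 : compact (rect x0 x1 y0 y1).
Proof. by rewrite rectE; apply: compact_setX; exact: segment_compact. Qed.

Lemma R2_hausdorff : hausdorff_space R2.
Proof. exact: norm_hausdorff. Qed.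

Lemma rect_closed x0 x1 y0 y1 : closed (rect x0 x1 y0 y1).
Proof. by apply: compact_closed; [exact: R2_hausdorff|exact: rect_compact]. Qed.

Lemma rect_star x0 x1 y0 y1 c : rect x0 x1 y0 y1 c ->
  forall x s, rect x0 x1 y0 y1 x -> I01 s -> rect x0 x1 y0 y1 (c + s *: (x - c)).
Proof.
move=> [/andP[? ?] /andP[? ?]] x s [/andP[? ?] /andP[? ?]] /I01P /andP[? ?].
by rewrite /rect /= /GRing.scale /=; split; apply/andP; split; nra.
Qed.

Lemma rect_isang x0 x1 y0 y1 (f : R2 -> R2) : con (rect x0 x1 y0 y1) f ->
  (forall x, rect x0 x1 y0 y1 x -> f x != 0) -> exists th, isang (rect x0 x1 y0 y1) f th.
Proof.
have [[c Kc]|K0] := pselect (rect x0 x1 y0 y1 !=set0); last first.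
  move=> _ _; exists (fun=> 0); split; first exact: con_cst.
  by move=> x Kx; case: K0; exists x.
exact: lift_angle_at (@rect_compact _ _ _ _) (rect_star Kc).
Qed.

Definition rect_chain (x0 x1 y0 y1 : R) : seq (R -> R2) :=
  [:: seg (x0, y0) (x1, y0); seg (x1, y0) (x1, y1);
      seg (x1, y1) (x0, y1); seg (x0, y1) (x0, y0)].

Lemma rect_chain_closed x0 x1 y0 y1 : closed_chain (rect_chain x0 x1 y0 y1).
Proof.
by move=> F; rewrite /rect_chain !big_cons big_nil !seg0 !seg1; ring.
Qed.

Definition rect_bd (x0 x1 y0 y1 : R) : set R2 :=
  [set z | rect x0 x1 y0 y1 z /\ (z.1 = x0 \/ z.1 = x1 \/ z.2 = y0 \/ z.2 = y1)].

Lemma rect_chain_bd x0 x1 y0 y1 : x0 <= x1 -> y0 <= y1 ->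
  chain_in (rect_bd x0 x1 y0 y1) (rect_chain x0 x1 y0 y1).
Proof.
move=> x01 y01; rewrite /rect_bd /rect.
do 4?[split; first by split; [exact: con_seg|move=> t /I01P/andP[? ?];
  rewrite /seg /=; split;
    [by split; apply/andP; split; nra
    |first [by right; right; left; ring|by left; ring|by right; left; ring|by do 3 right; ring]]]].
by [].
Qed.

Lemma rect_chain_in x0 x1 y0 y1 : x0 <= x1 -> y0 <= y1 ->
  chain_in (rect x0 x1 y0 y1) (rect_chain x0 x1 y0 y1).
Proof. by move=> h1 h2; apply: chain_sub (rect_chain_bd h1 h2) => x []. Qed.

Lemma wsum_rect0 x0 x1 y0 y1 (f : R2 -> R2) (r : seq (R -> R2)) :
  closed_chain r -> chain_in (rect x0 x1 y0 y1) r ->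
  con (rect x0 x1 y0 y1) f -> (forall x, rect x0 x1 y0 y1 x -> f x != 0) ->
  wsum r f = 0.
Proof.
by move=> cr rX cf f0; have [th hth] := rect_isang cf f0; exact: wsum_isang hth f0.
Qed.

Lemma seg_sub (u v c : R2) t : seg u v t - c = seg (u - c) (v - c) t.
Proof. rewrite /seg; congr pair => /=; ring. Qed.

(** Each side turns by an angle strictly between 0 and [pi], so the total lies strictly between 0
    and [4 * pi]; being a multiple of [2 * pi], it is [2 * pi]. *)
Lemma wsum_rect_center x0 x1 y0 y1 (c : R2) : x0 < c.1 < x1 -> y0 < c.2 < y1 ->
  wsum (rect_chain x0 x1 y0 y1) (fun x => x - c) = 2 * pi.
Proof.
move=> /andP[? ?] /andP[? ?].
have H (u v : R2) : 0 < cross (u - c) (v - c) ->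
    npath (fun t => seg u v t - c) /\ 0 < av (fun t => seg u v t - c) < pi.
  move=> /av_seg[p1 p2 _]; split.
    by apply: npath_eq p1 => t _; rewrite seg_sub.
  rewrite (@av_eq _ _ (seg (u - c) (v - c)))// => t _; exact: seg_sub.
have [|n1 /andP[a1 b1]] := H (x0, y0) (x1, y0); first by rewrite /cross /=; nra.
have [|n2 /andP[a2 b2]] := H (x1, y0) (x1, y1); first by rewrite /cross /=; nra.
have [|n3 /andP[a3 b3]] := H (x1, y1) (x0, y1); first by rewrite /cross /=; nra.
have [|n4 /andP[a4 b4]] := H (x0, y1) (x0, y0); first by rewrite /cross /=; nra.
have [|m] := wsum_int (f := fun x => x - c) (@rect_chain_closed x0 x1 y0 y1); first by [].
rewrite /wsum /rect_chain !big_cons big_nil => E; rewrite E.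
have p0 := pi_gt0 R.
have m0 : 0 < m%:~R :> R by nra.
have m2 : m%:~R < 2 :> R by nra.
have -> : m = 1.
  by move: m0 m2; rewrite ltr0z (_ : 2 = 2%:~R)// ltr_int; case: (m) => [[|[|j]]|j].
by rewrite mulr1.
Qed.

End Rect.

(** * Extending nonvanishing fields over the plane *)

Lemma con_glue (T U : topologicalType) (A B : set T) (f g : T -> U) :
  closed A -> closed B -> con A f -> con B g ->
  (forall x, A x -> B x -> f x = g x) ->
  con (A `|` B) (fun x => if `[< A x >] then f x else g x).
Proof.
move=> cA cB cf cg fg; apply: con_setU => //.
  by apply: con_eq cf => x Ax; case: asboolP.
by apply: con_eq cg => x Bx; case: asboolP => // Ax; rewrite fg.
Qed.

Section Extend.
Variable R : realType.
Local Notation R2 := (R * R)%type.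

Lemma tietze_compact (K : set R2) (f : R2 -> R) : compact K -> con K f ->
  exists2 g : R2 -> R, continuous g & forall x, K x -> g x = f x.
Proof.
move=> cK cf.
have cn : con K (fun x => `|f x|) by apply: con_comp1 cf _; exact: norm_continuous.
have [M M0 HM] := compact_upper_bound cK cn.
have clK : closed K by apply: compact_closed => //; exact: R2_hausdorff.
have [||||g [gf cg _]] := @continuous_bounded_extension R2 R _ K clK f M _ _ _.
- exact: pseudometric_normal.
- exact: M0.
- exact/conP.
- by move=> x /HM/ltW.
by exists g => // x Kx; rewrite gf ?inE.
Qed.

Definition ext_of (A B : set R2) (v v' : R2 -> R2) :=
  [/\ con (A `|` B) v', (forall x, (A `|` B) x -> v' x != 0) & forall x, A x -> v' x = v x].

(** [tau] parametrizes the edge. Modulus and angle are interpolated separately between the values at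
    its ends, because a linear interpolation of the vectors could pass through 0. *)
Lemma add_edge (A E : set R2) (v : R2 -> R2) (tau : R2 -> R) (u w : R2) :
  closed A -> closed E -> con A v -> (forall x, A x -> v x != 0) ->
  con E tau -> (forall x, E x -> 0 <= tau x <= 1) ->
  (forall x, A x -> E x -> (x = u /\ tau x = 0) \/ (x = w /\ tau x = 1)) ->
  exists v', ext_of A E v v'.
Proof.
move=> cA cE cv v0 ct t01 AE.
(* An end point not yet in [A] receives the default value 1. *)
pose val x : R2 := if `[< A x >] then v x else (1, 0).
have val0 x : val x != 0.
  by rewrite /val; case: asboolP => [/v0//|_]; rewrite pair_eq0 /= oner_eq0.
pose rho t := scal ((1 - t) * rad (val u) + t * rad (val w))
  (expi ((1 - t) * polar_angle (val u) + t * polar_angle (val w))).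
have rho0 t : 0 <= t <= 1 -> rho t != 0.
  move=> /andP[? ?]; rewrite -rad_eq0 rad_scal ?rad_expi ?mulr1.
    by have := rad_gt0 (val0 u); have := rad_gt0 (val0 w) => ? ?; rewrite gt_eqF//; nra.
  by have := rad_gt0 (val0 u); have := rad_gt0 (val0 w) => ? ?; nra.
have crho (B : set R) : con B rho.
  rewrite /rho /scal; have H : con B (fun t : R =>
     expi ((1 - t) * polar_angle (val u) + t * polar_angle (val w))).
    by apply: con_expi; ctac.
  by ctac.
exists (fun x => if `[< A x >] then v x else rho (tau x)); split.
- apply: con_glue => //; first exact: (con_comp ct t01 (@crho [set t | 0 <= t <= 1])).
  move=> x Ax Ex; have vE : val x = v x by rewrite /val; case: asboolP.
  case: (AE x Ax Ex) => [[xu ->]|[xw ->]].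
    by rewrite /rho subr0 !mul1r !mul0r !addr0 -polar_angleE -xu vE.
  by rewrite /rho subrr !mul1r !mul0r !add0r -polar_angleE -xw vE.
- move=> x; case: asboolP => [Ax _|nA [//|Ex]]; first exact: v0.
  exact/rho0/t01.
- by move=> x Ax; case: asboolP.
Qed.

(** Angle and modulus are extended separately by Tietze. Any extension of the angle will do, but
    that of the modulus has to be kept positive. *)
Lemma add_fill (A Q : set R2) (v : R2 -> R2) th :
  closed A -> compact Q -> con A v -> (forall x, A x -> v x != 0) ->
  isang (A `&` Q) v th -> exists v', ext_of A Q v v'.
Proof.
move=> cA cQ cv v0 [cth hth].
have clQ : closed Q by apply: compact_closed => //; exact: R2_hausdorff.
have cK : compact (A `&` Q) by rewrite setIC; exact: compact_closedI.
have cvK : con (A `&` Q) v by apply: con_subset cv => x [].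
have [g cg gth] := tietze_compact cK cth.
have [h ch hr] := tietze_compact cK (con_rad cvK).
have [m m0 Hm] := compact_lower_bound cK (con_rad cvK) (fun x Kx => rad_gt0 (v0 x (proj1 Kx))).
(* Positive everywhere, and equal to [h x] wherever [h x] is at least the lower bound [m], in
   particular on the part of [A] in [Q]. *)
pose rho x := m + `|h x - m|.
have rho_gt0 x : 0 < rho x by rewrite ltr_pwDl.
exists (fun x => if `[< A x >] then v x else scal (rho x) (expi (g x))); split.
- apply: con_glue => //.
    have c1 : con Q h by exact: con_continuous.
    have c2 : con Q (fun x => `|h x - m|).
      apply: (con_comp1 (f := fun x => h x - m)); first by ctac.
      exact: norm_continuous.
    have c3 : con Q (fun x => expi (g x)) by apply: con_expi; exact: con_continuous.
    by rewrite /scal /rho; ctac.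
  move=> x Ax Qx; have Kx : (A `&` Q) x by [].
  by rewrite (gth x Kx) hth// /rho hr// ger0_norm ?subr_ge0 ?Hm// addrC subrK.
- move=> x; case: asboolP => [Ax _|_ _]; first exact: v0.
  by rewrite -rad_eq0 rad_scal ?rad_expi ?mulr1 ?gt_eqF// ltW.
- by move=> x Ax; case: asboolP.
Qed.

(** The boundary is cut at two opposite corners into L-shaped halves, star-shaped about the other
    two corners, so each half has an angle function. The vanishing of the total turning says that
    the two functions differ by the same amount [k] at both cuts; after a shift they glue, and
    [add_fill] applies. *)
Lemma fill_rect x0 x1 y0 y1 (A : set R2) (v : R2 -> R2) : x0 < x1 -> y0 < y1 ->
  closed A -> con A v -> (forall x, A x -> v x != 0) ->
  A `&` rect x0 x1 y0 y1 = rect_bd x0 x1 y0 y1 ->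
  wsum (rect_chain x0 x1 y0 y1) v = 0 ->
  exists v', ext_of A (rect x0 x1 y0 y1) v v'.
Proof.
move=> x01 y01 cA cv v0 AQ w0.
have bdA x : rect_bd x0 x1 y0 y1 x -> A x by rewrite -AQ => -[].
pose L1 := rect x0 x1 y0 y0 `|` rect x0 x0 y0 y1.
pose L2 := rect x0 x1 y1 y1 `|` rect x1 x1 y0 y1.
have cptL1 : compact L1 by apply: compactU; exact: rect_compact.
have cptL2 : compact L2 by apply: compactU; exact: rect_compact.
have L1b x : L1 x -> rect_bd x0 x1 y0 y1 x.
  by case: x => a b; rewrite /L1 /rect_bd /rect /= => -[] [/andP[? ?] /andP[? ?]]; split;
    [split; apply/andP; split; lra|right;right;left;lra|split; apply/andP; split; lra|left;lra].
have L2b x : L2 x -> rect_bd x0 x1 y0 y1 x.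
  by case: x => a b; rewrite /L2 /rect_bd /rect /= => -[] [/andP[? ?] /andP[? ?]]; split;
    [split; apply/andP; split; lra|right;right;right;lra
    |split; apply/andP; split; lra|right;left;lra].
have bdE : rect_bd x0 x1 y0 y1 = L1 `|` L2.
  apply/seteqP; split=> [[a b]|x [/L1b|/L2b]]//.
  rewrite /rect_bd /L1 /L2 /rect /= => -[[/andP[? ?] /andP[? ?]]] [|[|[|]]] e;
    [left; right|right; right|left; left|right; left]; split; apply/andP; split; lra.
have [||th1 [cth1 hth1]] := @lift_angle_at R (x0, y0) L1 v cptL1 _ (con_subset (fun x Lx => bdA x (L1b x Lx)) cv).
- move=> [a b] s; rewrite /L1 /rect /= /GRing.scale /= => H /I01P/andP[? ?].
  by case: H => -[/andP[? ?] /andP[? ?]]; [left|right]; split; apply/andP; split; nra.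
- by move=> x /L1b/bdA/v0.
have [||th2 [cth2 hth2]] := @lift_angle_at R (x1, y1) L2 v cptL2 _ (con_subset (fun x Lx => bdA x (L2b x Lx)) cv).
- move=> [a b] s; rewrite /L2 /rect /= /GRing.scale /= => H /I01P/andP[? ?].
  by case: H => -[/andP[? ?] /andP[? ?]]; [left|right]; split; apply/andP; split; nra.
- by move=> x /L2b/bdA/v0.
have segL (L : set R2) th u w : isang L v th -> (forall x, L x -> v x != 0) ->
    (forall t, I01 t -> L (seg u w t)) -> av (fun t => v (seg u w t)) = th w - th u.
  move=> hth L0 Lt; rewrite (@av_isang _ _ (th \o seg u w)); first by rewrite /= seg0 seg1.
    by move=> t /Lt/L0.
  exact: isang_comp (@con_seg R u w I01) Lt hth.
have L10 x : L1 x -> v x != 0 by move=> /L1b/bdA/v0.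
have L20 x : L2 x -> v x != 0 by move=> /L2b/bdA/v0.
have e1 := segL L1 th1 (x0, y0) (x1, y0) (conj cth1 hth1) L10.
have e2 := segL L2 th2 (x1, y0) (x1, y1) (conj cth2 hth2) L20.
have e3 := segL L2 th2 (x1, y1) (x0, y1) (conj cth2 hth2) L20.
have e4 := segL L1 th1 (x0, y1) (x0, y0) (conj cth1 hth1) L10.
have {e1 e2 e3 e4} E : th1 (x1, y0) - th2 (x1, y0) = th1 (x0, y1) - th2 (x0, y1).
  move: w0; rewrite /wsum /rect_chain !big_cons big_nil e1 ?e2 ?e3 ?e4; first by lra.
  - by move=> t /I01P/andP[? ?]; right; rewrite /rect /=; split; apply/andP; split; nra.
  - by move=> t /I01P/andP[? ?]; left; rewrite /rect /=; split; apply/andP; split; nra.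
  - by move=> t /I01P/andP[? ?]; right; rewrite /rect /=; split; apply/andP; split; nra.
  - by move=> t /I01P/andP[? ?]; left; rewrite /rect /=; split; apply/andP; split; nra.
pose k := th1 (x1, y0) - th2 (x1, y0).
have P1 : L1 (x1, y0) by left; rewrite /rect /=; split; apply/andP; split; lra.
have P2 : L2 (x1, y0) by right; rewrite /rect /=; split; apply/andP; split; lra.
have ek : expi k = (1, 0).
  apply/expiB1; have r0 : rad (v (x1, y0)) != 0 by rewrite rad_eq0 L10.
  by apply: (scalI r0); rewrite -hth1// -hth2.
pose th x := if `[< L1 x >] then th1 x else th2 x + k.
apply: (@add_fill A (rect x0 x1 y0 y1) v th) => //; first exact: rect_compact.
rewrite AQ bdE; split.
- apply: con_glue => //; [apply: compact_closed => //; exact: R2_hausdorff| |by ctac|].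
    by apply: compact_closed => //; exact: R2_hausdorff.
  move=> [a b]; rewrite /L1 /L2 /rect /= => -[] [/andP[? ?] /andP[? ?]] [] [/andP[? ?] /andP[? ?]].
  - by exfalso; lra.
  - have -> : a = x1 by lra. have -> : b = y0 by lra. rewrite /k; lra.
  - have -> : a = x0 by lra. have -> : b = y1 by lra. rewrite /k E; lra.
  - by exfalso; lra.
- move=> x; rewrite /th; case: asboolP => [L _|_ [//|L]]; first exact: hth1.
  by rewrite expiD ek cmulC cmul1; exact: hth2.
Qed.

(** The edges are added one after another. The hypothesis survives each addition because distinct
    edges of the rectangle meet at corners only. *)
Lemma rect_edges x0 x1 y0 y1 (A : set R2) (v : R2 -> R2) : x0 < x1 -> y0 < y1 ->
  closed A -> con A v -> (forall x, A x -> v x != 0) ->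
  (forall E, E = rect x0 x1 y0 y0 \/ E = rect x1 x1 y0 y1 \/ E = rect x0 x1 y1 y1 \/
     E = rect x0 x0 y0 y1 -> E `<=` A \/
     forall z, E z -> A z -> (z.1 = x0 \/ z.1 = x1) /\ (z.2 = y0 \/ z.2 = y1)) ->
  exists v', ext_of A (rect_bd x0 x1 y0 y1) v v'.
Proof.
move=> x01 y01 cA cv v0 HE.
have dx : 0 < (x1 - x0)^-1 by rewrite invr_gt0 subr_gt0.
have dy : 0 < (y1 - y0)^-1 by rewrite invr_gt0 subr_gt0.
have mx : (x1 - x0) * (x1 - x0)^-1 = 1 by rewrite divff// gt_eqF ?subr_gt0.
have my : (y1 - y0) * (y1 - y0)^-1 = 1 by rewrite divff// gt_eqF ?subr_gt0.
pose corner (z : R2) := (z.1 = x0 \/ z.1 = x1) /\ (z.2 = y0 \/ z.2 = y1).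
have stepx (B : set R2) (f : R2 -> R2) y : y = y0 \/ y = y1 -> closed B -> con B f ->
    (forall x, B x -> f x != 0) ->
    rect x0 x1 y y `<=` B \/ (forall z, rect x0 x1 y y z -> B z -> corner z) ->
    exists f', ext_of B (rect x0 x1 y y) f f'.
  move=> yE cB cf f0 [EB|EB]; first by exists f; rewrite /ext_of (setUidl EB).
  apply: (@add_edge B _ f (fun z => (z.1 - x0) * (x1 - x0)^-1) (x0, y) (x1, y)) => //.
  - exact: rect_closed.
  - by ctac.
  - by move=> z [/andP[? ?] _]; apply/andP; split; nra.
  - move=> [a b] Bz Ez; have := EB _ Ez Bz; move: Ez => [_ /= /andP[? ?]].
    have -> : b = y by lra. by move=> [[/= ->|/= ->] _]; [left|right]; split=> //; lra.
have stepy (B : set R2) (f : R2 -> R2) x : x = x0 \/ x = x1 -> closed B -> con B f ->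
    (forall z, B z -> f z != 0) ->
    rect x x y0 y1 `<=` B \/ (forall z, rect x x y0 y1 z -> B z -> corner z) ->
    exists f', ext_of B (rect x x y0 y1) f f'.
  move=> xE cB cf f0 [EB|EB]; first by exists f; rewrite /ext_of (setUidl EB).
  apply: (@add_edge B _ f (fun z => (z.2 - y0) * (y1 - y0)^-1) (x, y0) (x, y1)) => //.
  - exact: rect_closed.
  - by ctac.
  - by move=> z [_ /andP[? ?]]; apply/andP; split; nra.
  - move=> [a b] Bz Ez; have := EB _ Ez Bz; move: Ez => [/= /andP[? ?] _].
    have -> : a = x by lra. by move=> [_ [/= ->|/= ->]]; [left|right]; split=> //; lra.
pose E1 := rect x0 x1 y0 y0; pose E2 := rect x1 x1 y0 y1.
pose E3 := rect x0 x1 y1 y1; pose E4 := rect x0 x0 y0 y1.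
have cE1 : closed E1 by exact: rect_closed.
have cE2 : closed E2 by exact: rect_closed.
have cE3 : closed E3 by exact: rect_closed.
have C12 z : E1 z -> E2 z -> corner z.
  by case: z => a b [/= /andP[? ?] /andP[? ?]] [/= /andP[? ?] /andP[? ?]]; split; [right|left] => /=; lra.
have C14 z : E1 z -> E4 z -> corner z.
  by case: z => a b [/= /andP[? ?] /andP[? ?]] [/= /andP[? ?] /andP[? ?]]; split; [left|left] => /=; lra.
have C32 z : E3 z -> E2 z -> corner z.
  by case: z => a b [/= /andP[? ?] /andP[? ?]] [/= /andP[? ?] /andP[? ?]]; split; [right|right] => /=; lra.
have C34 z : E3 z -> E4 z -> corner z.
  by case: z => a b [/= /andP[? ?] /andP[? ?]] [/= /andP[? ?] /andP[? ?]]; split; [left|right] => /=; lra.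
have C13 z : E1 z -> E3 z -> corner z.
  by case: z => a b [/= /andP[? ?] /andP[? ?]] [/= /andP[? ?] /andP[? ?]]; exfalso; lra.
have C24 z : E2 z -> E4 z -> corner z.
  by case: z => a b [/= /andP[? ?] /andP[? ?]] [/= /andP[? ?] /andP[? ?]]; exfalso; lra.
have [v1 [c1 n1 a1]] := stepx A v y0 (or_introl erefl) cA cv v0 (HE E1 (or_introl erefl)).
have [||v2 [c2 n2 a2]] := stepy (A `|` E1) v1 x1 (or_intror erefl) _ c1 n1.
- exact: closedU.
- case: (HE E2 (or_intror (or_introl erefl))) => H; first by left=> x /H; left.
  by right=> z Ez [Az|Ez1]; [exact: H|exact: C12].
have [||v3 [c3 n3 a3]] := stepx (A `|` E1 `|` E2) v2 y1 (or_intror erefl) _ c2 n2.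
- by apply: closedU => //; exact: closedU.
- case: (HE E3 (or_intror (or_intror (or_introl erefl)))) => H; first by left=> x /H; left; left.
  by right=> z Ez [[Az|Ez1]|Ez2]; [exact: H|exact: C13|exact: C32].
have [||v4 [c4 n4 a4]] := stepy (A `|` E1 `|` E2 `|` E3) v3 x0 (or_introl erefl) _ c3 n3.
- by apply: closedU => //; apply: closedU => //; exact: closedU.
- case: (HE E4 (or_intror (or_intror (or_intror erefl)))) => H; first by left=> x /H; left; left; left.
  by right=> z Ez [[[Az|?]|?]|?]; [exact: H|exact: C14|exact: C24|exact: C34].
have bdE x : rect_bd x0 x1 y0 y1 x -> (E1 `|` E2 `|` E3 `|` E4) x.
  case: x => a b; rewrite /rect_bd /rect /= => -[[/andP[? ?] /andP[? ?]]] [|[|[|]]] e;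
    [right|left; left; right|left; left; left|left; right];
    by split; apply/andP; split=> /=; lra.
have sub : A `|` rect_bd x0 x1 y0 y1 `<=` A `|` E1 `|` E2 `|` E3 `|` rect x0 x0 y0 y1.
  move=> x [Ax|/bdE [[[?|?]|?]|?]]; [by left; left; left; left|by left; left; left; right|
    by left; left; right|by left; right|by right].
exists v4; split.
- exact: con_subset c4.
- by move=> x /sub; exact: n4.
- by move=> x Ax; rewrite a4 ?a3 ?a2 ?a1//; [left|left; left|left; left; left].
Qed.

End Extend.

Lemma int_between (i j : int) : j < i + 1 -> i < j + 1 -> i = j.
Proof. lia. Qed.

(** * Dyadic grids of squares *)

Section Grid.
Variable R : realType.
Local Notation R2 := (R * R)%type.
Local Notation dy := (@dy R).
Local Notation square := (@square R).

Lemma dy_lt k i j : (dy k i < dy k j) = (i < j).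
Proof. by rewrite /Defs.dy ltr_pM2r ?ltr_int// invr_gt0 exprn_gt0. Qed.

Lemma dy_le k i j : (dy k i <= dy k j) = (i <= j).
Proof. by rewrite /Defs.dy ler_pM2r ?ler_int// invr_gt0 exprn_gt0. Qed.

Lemma dyS k i : dy k i < dy k (i + 1).
Proof. by rewrite dy_lt ltrDl. Qed.

Lemma dyB k i : dy k (i + 1) - dy k i = (2 ^+ k)^-1.
Proof. by rewrite /Defs.dy -mulrBl intrD addrAC subrr add0r mul1r. Qed.

Lemma dyM k (M : nat) : dy k (M * 2 ^ k)%N%:Z = M%:R.
Proof. by rewrite /Defs.dy -pmulrn natrM natrX mulfK// expf_neq0. Qed.

Lemma dyN k i : dy k (- i) = - dy k i.
Proof. by rewrite /Defs.dy intrN mulNr. Qed.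

Lemma grid_union_cons k ij s : grid_union k (ij :: s) = (grid_union k s `|` square k ij : set R2).
Proof.
apply/seteqP; split=> x.
  by move=> [l]; rewrite in_cons => /orP[/eqP->|ls] H; [right|left; exists l].
by move=> [[l ls]|] H; [exists l; rewrite ?in_cons ?ls ?orbT|exists ij; rewrite ?mem_head].
Qed.

Lemma grid_union_compact k s : compact (grid_union k s : set R2).
Proof.
elim: s => [|ij s IH].
  rewrite (_ : grid_union k [::] = set0); first exact: compact0.
  by apply/seteqP; split=> x // [].
by rewrite grid_union_cons; apply: compactU => //; exact: rect_compact.
Qed.

Lemma grid_union_closed k s : closed (grid_union k s : set R2).
Proof. by apply: compact_closed; [exact: R2_hausdorff|exact: grid_union_compact]. Qed.

Definition box (k M : nat) : seq (int * int) :=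
  let rng := [seq n%:Z - (M * 2 ^ k)%N%:Z | n <- iota 0 (2 * (M * 2 ^ k))] in
  [seq (i, j) | i <- rng, j <- rng].

Lemma mem_rng (m : nat) (i : int) :
  (i \in [seq n%:Z - m%:Z | n <- iota 0 (2 * m)]) = (- m%:Z <= i < m%:Z).
Proof.
apply/mapP/idP => [[n]|h]; first by rewrite mem_iota => h ->; lia.
by exists (absz (i + m%:Z)); rewrite ?mem_iota; lia.
Qed.

Lemma mem_box k M ij : (ij \in box k M) =
  (- (M * 2 ^ k)%N%:Z <= ij.1 < (M * 2 ^ k)%N%:Z) && (- (M * 2 ^ k)%N%:Z <= ij.2 < (M * 2 ^ k)%N%:Z).
Proof.
case: ij => i j; rewrite /box -!mem_rng.
apply/allpairsP/andP => [[[a b] /= [ha hb [-> ->]]]//|[h1 h2]].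
by exists (i, j).
Qed.

Lemma box_uniq k M : uniq (box k M).
Proof.
have u : uniq [seq n%:Z - (M * 2 ^ k)%N%:Z | n <- iota 0 (2 * (M * 2 ^ k))].
  by rewrite map_inj_uniq ?iota_uniq// => a b; lia.
by rewrite allpairs_uniq// => -[a b] [c d].
Qed.

Definition dom (M : nat) : set R2 := rect (- M%:R) M%:R (- M%:R) M%:R.

Lemma dy_floor k (M : nat) (x : R) : (0 < M)%N -> - M%:R <= x <= M%:R ->
  exists i, (- (M * 2 ^ k)%N%:Z <= i < (M * 2 ^ k)%N%:Z) && (dy k i <= x <= dy k (i + 1)).
Proof.
move=> M0 /andP[x0 x1]; have p2 : 0 < 2 ^+ k :> R by rewrite exprn_gt0.
have [xM|xM] := ltP x M%:R; last first.
  (* The right end point [M] is put into the last cell; its floor would give an index outside the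
     range. *)
  exists ((M * 2 ^ k)%N%:Z - 1); rewrite subrK dyM x1 andbT.
  rewrite (le_trans _ xM) ?andbT; last by rewrite -(dyM k) dy_le; lia.
  have : (0 < M * 2 ^ k)%N by rewrite muln_gt0 M0 expn_gt0.
  by lia.
exists (Num.floor (x * 2 ^+ k)).
have f1 : (Num.floor (x * 2 ^+ k))%:~R <= x * 2 ^+ k by exact: floor_le_tmp.
have f2 : x * 2 ^+ k < (Num.floor (x * 2 ^+ k) + 1)%:~R by exact: floorD1_gt.
have g1 : dy k (Num.floor (x * 2 ^+ k)) <= x by rewrite /Defs.dy ler_pdivrMr.
have g2 : x < dy k (Num.floor (x * 2 ^+ k) + 1) by rewrite /Defs.dy ltr_pdivlMr.
rewrite g1 (ltW g2) !andbT -(dy_lt k) dyM (le_lt_trans g1 xM) andbT.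
have : - (M * 2 ^ k)%N%:Z < Num.floor (x * 2 ^+ k) + 1; last by lia.
by rewrite -(dy_lt k) dyN dyM (le_lt_trans x0 g2).
Qed.

Lemma grid_union_box k M : (0 < M)%N -> grid_union k (box k M) = dom M.
Proof.
move=> M0; apply/seteqP; split=> [x [[i j]]|x [hx hy]].
  rewrite mem_box /= => /andP[/andP[? ?] /andP[? ?]] [/= /andP[? ?] /andP[? ?]].
  have ? : - M%:R <= dy k i by rewrite -(dyM k) -dyN dy_le.
  have ? : - M%:R <= dy k j by rewrite -(dyM k) -dyN dy_le.
  have ? : dy k (i + 1) <= M%:R by rewrite -(dyM k) dy_le; lia.
  have ? : dy k (j + 1) <= M%:R by rewrite -(dyM k) dy_le; lia.
  by split; apply/andP; split; lra.
have [i /andP[i1 i2]] := dy_floor k M0 hx; have [j /andP[j1 j2]] := dy_floor k M0 hy.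
by exists (i, j); rewrite ?mem_box /= ?i1.
Qed.

Definition center k (ij : int * int) : R2 :=
  ((dy k ij.1 + dy k (ij.1 + 1)) / 2, (dy k ij.2 + dy k (ij.2 + 1)) / 2).

Lemma center_unique k ij ij' : square k ij' (center k ij) -> ij' = ij.
Proof.
case: ij ij' => [i j] [i' j'] [/= /andP[a1 a2] /andP[b1 b2]].
have := dyS k i; have := dyS k j => ? ?.
have : dy k i' < dy k (i + 1) by lra.
have : dy k i < dy k (i' + 1) by lra.
have : dy k j' < dy k (j + 1) by lra.
have : dy k j < dy k (j' + 1) by lra.
by rewrite !dy_lt => /int_between q1 /q1-> /int_between q2 /q2->.
Qed.

Lemma square_bd k ij ij' x : ij' != ij -> square k ij x -> square k ij' x ->
  rect_bd (dy k ij.1) (dy k (ij.1 + 1)) (dy k ij.2) (dy k (ij.2 + 1)) x.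
Proof.
case: ij ij' x => [i j] [i' j'] [a b] ne Q [/= /andP[a1 a2] /andP[b1 b2]].
split=> //=; apply: contrapT => H; case: Q => [/= /andP[c1 c2] /andP[d1 d2]].
have e1 : a != dy k i by apply/eqP => e; apply: H; left.
have e2 : a != dy k (i + 1) by apply/eqP => e; apply: H; right; left.
have e3 : b != dy k j by apply/eqP => e; apply: H; right; right; left.
have e4 : b != dy k (j + 1) by apply/eqP => e; apply: H; right; right; right.
move/negP: ne; apply; apply/eqP.
have : dy k i' < dy k (i + 1) by rewrite (le_lt_trans a1)// lt_neqAle e2.
have : dy k i < dy k (i' + 1) by rewrite (lt_le_trans _ a2)// lt_neqAle eq_sym e1.
have : dy k j' < dy k (j + 1) by rewrite (le_lt_trans b1)// lt_neqAle e4.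
have : dy k j < dy k (j' + 1) by rewrite (lt_le_trans _ b2)// lt_neqAle eq_sym e3.
by rewrite !dy_lt => /int_between q1 /q1-> /int_between q2 /q2->.
Qed.

(* An edge of the square ij shared with a square of the union lies in the union;
   otherwise the union meets it at most in its end points. *)
Lemma square_edges k t ij : ij \notin t ->
  let x0 := dy k ij.1 in let x1 := dy k (ij.1 + 1) in
  let y0 := dy k ij.2 in let y1 := dy k (ij.2 + 1) in
  forall E, E = rect x0 x1 y0 y0 \/ E = rect x1 x1 y0 y1 \/ E = rect x0 x1 y1 y1 \/
     E = rect x0 x0 y0 y1 -> E `<=` grid_union k t \/
     forall z, E z -> grid_union k t z -> (z.1 = x0 \/ z.1 = x1) /\ (z.2 = y0 \/ z.2 = y1).
Proof.
case: ij => i j nt x0 x1 y0 y1.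
have H (nb : int * int) (E : set R2) : E `<=` square k nb ->
   (forall z ij', E z -> ij' != (i, j) -> ij' != nb -> square k ij' z ->
     (z.1 = x0 \/ z.1 = x1) /\ (z.2 = y0 \/ z.2 = y1)) ->
   E `<=` grid_union k t \/
   forall z, E z -> grid_union k t z -> (z.1 = x0 \/ z.1 = x1) /\ (z.2 = y0 \/ z.2 = y1).
  move=> En Hz; have [nbt|nbt] := boolP (nb \in t); first by left=> z /En Q; exists nb.
  right=> z Ez [ij' ij't Q]; apply: (Hz z ij' Ez) => //.
    by apply: contraNneq nt => <-.
  by apply: contraNneq nbt => <-.
have sq z ij' : square k ij' z -> [/\ (x0 < z.1 -> i < ij'.1 + 1), (z.1 < x1 -> ij'.1 < i + 1),
    (y0 < z.2 -> j < ij'.2 + 1) & (z.2 < y1 -> ij'.2 < j + 1)] /\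
    [/\ (x0 <= z.1 -> i <= ij'.1 + 1), (z.1 <= x1 -> ij'.1 <= i + 1),
    (y0 <= z.2 -> j <= ij'.2 + 1) & (z.2 <= y1 -> ij'.2 <= j + 1)].
  move=> [/andP[? ?] /andP[? ?]]; split; split; rewrite -?(dy_lt k) -?(dy_le k) -?/x0 -?/y0 -?/x1 -?/y1; lra.
have lx := dyS k i; have ly := dyS k j; rewrite -/x0 -/x1 -/y0 -/y1 in lx ly.
have strict (a b c : R) : a <= c <= b -> ~ (c = a \/ c = b) -> a < c < b.
  move=> /andP[? ?] n; rewrite !lt_neqAle; apply/andP; split; apply/andP; split=> //; apply/eqP => e.
    by apply: n; left.
  by apply: n; right.
move=> E [->|[->|[->|->]]].
- apply: (H (i, j - 1)).
    by move=> z [h1 /andP[? ?]]; split; rewrite //= subrK -/y0; have := dyS k (j - 1); rewrite subrK -/y0; lra.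
  move=> z [i' j'] [h1 /andP[? ?]] n1 n2 /sq[[/= s1 s2 s3 s4] [/= w1 w2 w3 w4]].
  split; last by left; lra.
  apply: contrapT => nx; have /andP[h2 h3] := strict _ _ _ h1 nx.
  move: n1 n2; rewrite -!pair_eqE /= /pair_eq /= => n1 n2.
  have e1 := s1 h2; have e2 := s2 h3; have e3 : j <= j' + 1 by apply: w3; lra.
  have e4 : j' < j + 1 by apply: s4; lra.
  by move: n1 n2 e1 e2 e3 e4; clear; lia.
- apply: (H (i + 1, j)).
    by move=> z [/andP[? ?] h1]; split; rewrite //= -/x1; have := dyS k (i + 1); rewrite -/x1; lra.
  move=> z [i' j'] [/andP[? ?] h1] n1 n2 /sq[[/= s1 s2 s3 s4] [/= w1 w2 w3 w4]].
  split; first by right; lra.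
  apply: contrapT => nx; have /andP[h2 h3] := strict _ _ _ h1 nx.
  move: n1 n2; rewrite -!pair_eqE /= /pair_eq /= => n1 n2.
  have e1 := s3 h2; have e2 := s4 h3; have e3 : i' <= i + 1 by apply: w2; lra.
  have e4 : i < i' + 1 by apply: s1; lra.
  by move: n1 n2 e1 e2 e3 e4; clear; lia.
- apply: (H (i, j + 1)).
    by move=> z [h1 /andP[? ?]]; split; rewrite //= -/y1; have := dyS k (j + 1); rewrite -/y1; lra.
  move=> z [i' j'] [h1 /andP[? ?]] n1 n2 /sq[[/= s1 s2 s3 s4] [/= w1 w2 w3 w4]].
  split; last by right; lra.
  apply: contrapT => nx; have /andP[h2 h3] := strict _ _ _ h1 nx.
  move: n1 n2; rewrite -!pair_eqE /= /pair_eq /= => n1 n2.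
  have e1 := s1 h2; have e2 := s2 h3; have e3 : j' <= j + 1 by apply: w4; lra.
  have e4 : j < j' + 1 by apply: s3; lra.
  by move: n1 n2 e1 e2 e3 e4; clear; lia.
- apply: (H (i - 1, j)).
    by move=> z [/andP[? ?] h1]; split; rewrite //= subrK -/x0; have := dyS k (i - 1); rewrite subrK -/x0; lra.
  move=> z [i' j'] [/andP[? ?] h1] n1 n2 /sq[[/= s1 s2 s3 s4] [/= w1 w2 w3 w4]].
  split; first by left; lra.
  apply: contrapT => nx; have /andP[h2 h3] := strict _ _ _ h1 nx.
  move: n1 n2; rewrite -!pair_eqE /= /pair_eq /= => n1 n2.
  have e1 := s3 h2; have e2 := s4 h3; have e3 : i <= i' + 1 by apply: w1; lra.
  have e4 : i' < i + 1 by apply: s2; lra.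
  by move: n1 n2 e1 e2 e3 e4; clear; lia.
Qed.

End Grid.

(** * Turning numbers as combinations of winding numbers *)

Section Artin.
Variable R : realType.
Local Notation R2 := (R * R)%type.
Local Notation dy := (@dy R).

Definition cpow (z : R2) (n : nat) : R2 := iter n (cmul z) (1, 0).
Definition cpowz (z : R2) (n : int) : R2 :=
  match n with Posz m => cpow z m | Negz m => cinv (cpow z m.+1) end.

Lemma c1_neq0 : ((1, 0) : R2) != 0.
Proof. by rewrite pair_eq0 /= oner_eq0. Qed.

Lemma cpow_neq0 z n : z != 0 -> cpow z n != 0.
Proof. by move=> z0; elim: n => [|n IH] /=; [exact: c1_neq0|exact: cmul_neq0]. Qed.

Lemma cpowz_neq0 z n : z != 0 -> cpowz z n != 0.
Proof. by move=> z0; case: n => n; rewrite /cpowz ?cinv_eq0; exact: cpow_neq0. Qed.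

Lemma con_cpow (T : topologicalType) (A : set T) (f : T -> R2) n :
  con A f -> con A (fun x => cpow (f x) n).
Proof. by move=> cf; elim: n => [|n IH] /=; [exact: con_cst|exact: con_cmul]. Qed.

Lemma con_cpowz (T : topologicalType) (A : set T) (f : T -> R2) n :
  (forall x, A x -> f x != 0) -> con A f -> con A (fun x => cpowz (f x) n).
Proof.
move=> f0 cf; case: n => n; rewrite /cpowz; first exact: con_cpow.
by apply: con_cinv; [move=> x /f0/cpow_neq0|exact: con_cpow].
Qed.

Lemma wsum_cpow (T : Type) (r : seq (R -> T)) (f : T -> R2) n : nchain r f ->
  nchain r (fun x => cpow (f x) n) /\ wsum r (fun x => cpow (f x) n) = n%:R * wsum r f.
Proof.
move=> nf; elim: n => [|n [IH1 IH2]] /=.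
  split; last by rewrite mul0r wsum_cst// c1_neq0.
  by apply: alls_all => c; apply: npath_cst; exact: c1_neq0.
split; first exact: nchainM.
by rewrite wsumM// IH2 -(natr1 n); ring.
Qed.

Lemma wsum_cpowz (T : Type) (r : seq (R -> T)) (f : T -> R2) n : nchain r f ->
  nchain r (fun x => cpowz (f x) n) /\ wsum r (fun x => cpowz (f x) n) = n%:~R * wsum r f.
Proof.
move=> nf; case: n => n; rewrite /cpowz; first by rewrite -pmulrn; exact: wsum_cpow.
have [h1 h2] := wsum_cpow n.+1 nf; split; first exact: nchainV.
by rewrite wsumV// h2 NegzE intrN -pmulrn mulNr.
Qed.

Lemma rect_bd_closed x0 x1 y0 y1 : x0 <= x1 -> y0 <= y1 -> closed (@rect_bd R x0 x1 y0 y1).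
Proof.
move=> hx hy; rewrite (_ : rect_bd x0 x1 y0 y1 = rect x0 x1 y0 y0 `|` rect x0 x1 y1 y1 `|`
  (rect x0 x0 y0 y1 `|` rect x1 x1 y0 y1)).
  by apply: closedU; apply: closedU; exact: rect_closed.
apply/seteqP; split=> -[a b]; rewrite /rect_bd /rect /=.
  by move=> [[/andP[? ?] /andP[? ?]]] [|[|[|]]] e;
    [right; left|right; right|left; left|left; right]; split; apply/andP; split; lra.
move=> [[|]|[|]] [/andP[? ?] /andP[? ?]]; (split; first by split; apply/andP; split; lra).
- by right; right; left; lra.
- by right; right; right; lra.
- by left; lra.
- by right; left; lra.
Qed.

Lemma center_in k ij : let c := @center R k ij in
  (dy k ij.1 < c.1 < dy k (ij.1 + 1)) /\ (dy k ij.2 < c.2 < dy k (ij.2 + 1)).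
Proof.
have := dyS R k ij.1; have := dyS R k ij.2 => ? ?.
by split; apply/andP; split; rewrite /center /=; lra.
Qed.

Lemma grid_union_mem k s t : s =i t -> grid_union k s = grid_union k t :> set R2.
Proof. by move=> st; apply/seteqP; split=> x [ij]; rewrite ?st => H Q; exists ij; rewrite ?st. Qed.

(** Induction on the squares still missing from the domain. The turning [n] of the field around [Q]
    is removed by a power of the difference to the centre of [Q], a point outside the domain reached
    so far, and the corrected field fills [Q]. When no square is missing, the domain is a full
    square and every turning vanishes. *)
Lemma artin_ind k M : forall s t : seq (int * int), uniq s ->
  (forall ij, ij \in s -> ij \notin t) -> grid_union k (s ++ t) = @dom R M ->
  forall v : R2 -> R2, con (grid_union k t) v -> (forall x, grid_union k t x -> v x != 0) ->
  exists n : int * int -> int, forall r, closed_chain r -> chain_in (grid_union k t) r ->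
    wsum r v = \sum_(ij <- s) (n ij)%:~R * wsum r (fun x => x - center R k ij).
Proof.
elim=> [|Q s IH] t us st gE v cv v0.
  exists (fun=> 0) => r cr rX; rewrite big_nil; rewrite /= in gE; rewrite gE in cv v0 rX.
  exact: wsum_rect0 rX cv v0.
have Qt : Q \notin t by apply: st; rewrite mem_head.
have [hx hy] := (dyS R k Q.1, dyS R k Q.2); have [cx cy] := center_in k Q.
set c := center R k Q in cx cy *.
set G := grid_union k t in cv v0 *.
pose bd := rect_bd (dy k Q.1) (dy k (Q.1 + 1)) (dy k Q.2) (dy k (Q.2 + 1)).
have cG : closed G by exact: grid_union_closed.
have [v1 [c1 n1 a1]] := rect_edges hx hy cG cv v0 (@square_edges R k t Q Qt).
rewrite -/bd in c1 n1.
have cbd : closed bd by apply: rect_bd_closed; exact: ltW.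
have rbd := rect_chain_bd (ltW hx) (ltW hy); rewrite -/bd in rbd.
have rA := chain_sub (@subsetUr _ G bd) rbd.
have rcc := @rect_chain_closed R (dy k Q.1) (dy k (Q.1 + 1)) (dy k Q.2) (dy k (Q.2 + 1)).
have nr1 := chain_in_npath rA c1 n1.
have [n nE] := wsum_int rcc nr1.
have Ac x : (G `|` bd) x -> x - c != 0.
  move=> Ax; rewrite subr_eq0; apply/eqP => xc; move: Ax; rewrite xc => -[[ij ijt /center_unique e]|].
    by move: ijt; rewrite e (negbTE Qt).
  by move: cx cy => /andP[? ?] /andP[? ?] [_]; lra.
have cc : con (G `|` bd) (fun x => x - c) by ctac.
pose v2 x := cmul (v1 x) (cpowz (x - c) (- n)).
have c2 : con (G `|` bd) v2 by apply: con_cmul => //; exact: con_cpowz.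
have n2 x : (G `|` bd) x -> v2 x != 0.
  by move=> Ax; rewrite cmul_neq0 ?n1// cpowz_neq0// Ac.
have wE r : chain_in (G `|` bd) r -> wsum r v2 = wsum r v1 - n%:~R * wsum r (fun x => x - c).
  move=> rG; have nc := chain_in_npath rG cc Ac.
  have [h1 h2] := wsum_cpowz (- n) nc.
  by rewrite /v2 wsumM//; [rewrite h2 intrN mulNr|exact: chain_in_npath rG c1 n1].
have w0 : wsum (rect_chain (dy k Q.1) (dy k (Q.1 + 1)) (dy k Q.2) (dy k (Q.2 + 1))) v2 = 0.
  by rewrite wE// nE wsum_rect_center//; ring.
have AQ : (G `|` bd) `&` rect (dy k Q.1) (dy k (Q.1 + 1)) (dy k Q.2) (dy k (Q.2 + 1)) = bd.
  apply/seteqP; split=> [x [[[ij ijt S]|//] Sx]|x bx].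
    by apply: square_bd Sx S; apply: contraNneq Qt => <-.
  by split; [right|case: bx].
have [v3 [c3 n3 a3]] := fill_rect hx hy (closedU cG cbd) c2 n2 AQ w0.
have sub : grid_union k (Q :: t) `<=`
    G `|` bd `|` rect (dy k Q.1) (dy k (Q.1 + 1)) (dy k Q.2) (dy k (Q.2 + 1)).
  by rewrite grid_union_cons => x [Gx|Sx]; [left; left|right].
move: us => /= /andP[Qs us].
have [|||n' Hn'] := IH (Q :: t) us _ _ v3 (con_subset sub c3) _.
- move=> ij ijs; rewrite in_cons negb_or st ?in_cons ?ijs ?orbT// andbT.
  by apply: contraNneq Qs => <-.
- rewrite -gE; apply: grid_union_mem => ij; rewrite /= !(in_cons, mem_cat).
  by rewrite orbCA.
- by move=> x /sub; exact: n3.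
exists (fun ij => if ij == Q then n else n' ij) => r cr rG.
rewrite big_cons eqxx -/c.
have rG1 : chain_in (G `|` bd) r by apply: chain_sub rG => x; left.
have E3 : wsum r v3 = wsum r v2 by apply: wsum_eq_in rG1 _ => x Ax; exact: a3.
have E1 : wsum r v1 = wsum r v by apply: wsum_eq_in rG _ => x Ax; exact: a1.
have := Hn' r cr; rewrite E3 wE// E1 => H.
have -> : \sum_(j <- s) (if j == Q then n else n' j)%:~R * wsum r (fun x => x - center R k j) =
    \sum_(ij <- s) (n' ij)%:~R * wsum r (fun x => x - center R k ij).
  apply: eq_big_seq => j js; rewrite ifF//; apply/negP => /eqP e.
  by move: Qs; rewrite -e js.
rewrite -H; first by rewrite addrC subrK.
by apply: chain_sub rG => x Gx; rewrite grid_union_cons; left.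
Qed.

Lemma R2_norm_lt (x : R2) e : (`|x| < e) = (`|x.1| < e) && (`|x.2| < e).
Proof. by rewrite prod_normE gt_max. Qed.

Lemma R2_norm_le (x : R2) e : (`|x| <= e) = (`|x.1| <= e) && (`|x.2| <= e).
Proof. by rewrite prod_normE ge_max. Qed.

Lemma square_diam k ij (x y : R2) : square k ij x -> square k ij y -> `|x - y| <= (2 ^+ k)^-1.
Proof.
move=> [/andP[? ?] /andP[? ?]] [/andP[? ?] /andP[? ?]].
have := dyB R k ij.1; have := dyB R k ij.2 => e1 e2.
by rewrite R2_norm_le !ler_norml /=; apply/andP; split; apply/andP; split; lra.
Qed.

Lemma square_seg k ij (x y : R2) t : square k ij x -> square k ij y -> I01 t -> square k ij (seg x y t).
Proof.
move=> [/andP[? ?] /andP[? ?]] [/andP[? ?] /andP[? ?]] /I01P/andP[? ?].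
by split; apply/andP; split; rewrite /seg /=; nra.
Qed.

Lemma mesh_ex (e : R) : 0 < e -> exists k : nat, (2 ^+ k)^-1 < e.
Proof.
move=> e0; have [N _ HN] := near_infty_natSinv_lt (PosNum e0); exists N.+1.
have /= := HN N (leqnn N); apply: le_lt_trans.
rewrite lef_pV2 ?posrE ?exprn_gt0 ?ltr0n// -natrX ler_nat.
exact: ltnW (ltn_expl _ _).
Qed.

(* The cohomology of the complement of F is detected by winding numbers around points of F. *)
Theorem winding_detection (M : nat) (F : set R2) (v : R2 -> R2) (e : R) :
  (0 < M)%N -> 0 < e -> con (@dom R M) v -> (forall x, @dom R M x -> ~ F x -> v x != 0) ->
  exists L : seq (R2 * int), alls (fun p => F p.1) L /\ forall r, closed_chain r ->
    chain_in [set x | @dom R M x /\ forall z, F z -> e <= `|x - z|] r ->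
    wsum r v = \sum_(p <- L) p.2%:~R * wsum r (fun x => x - p.1).
Proof.
move=> M0 e0 cv v0; have [k ke] := mesh_ex e0.
(* The squares that meet [F] are the missing ones; on the others [v] has no zero. *)
pose meets ij := `[< exists2 z, F z & square k ij z >].
pose s := [seq ij <- box k M | meets ij]; pose t := [seq ij <- box k M | ~~ meets ij].
have gE : grid_union k (s ++ t) = @dom R M.
  rewrite -(grid_union_box R k M0); apply: grid_union_mem => ij.
  by rewrite mem_cat !mem_filter -andb_orl orbN.
have tD x : grid_union k t x -> @dom R M x.
  by rewrite -gE => -[ij ijt S]; exists ij; rewrite ?mem_cat ?ijt ?orbT.
have tF x : grid_union k t x -> ~ F x.
  move=> [ij]; rewrite mem_filter => /andP[/asboolPn H _] S Fx.
  by apply: H; exists x.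
have [||||n Hn] := @artin_ind k M s t _ _ gE v _ _.
- by rewrite filter_uniq// box_uniq.
- by move=> ij; rewrite !mem_filter => /andP[-> ->].
- exact: con_subset tD cv.
- by move=> x Gx; apply: v0; [exact: tD|exact: tF].
have [zf Hz] : {zf : int * int -> R2 & forall ij, ij \in s -> F (zf ij) /\ square k ij (zf ij)}.
  apply: (@choice _ _ (fun ij z => ij \in s -> F z /\ square k ij z)) => ij.
  have [|h] := boolP (ij \in s); last by exists 0.
  by rewrite mem_filter => /andP[/asboolP[z Fz S] _]; exists z.
exists [seq (zf ij, n ij) | ij <- s]; split; first by apply: alls_map => ij /Hz[].
move=> r cr rX; rewrite big_map /= Hn//.
  apply: eq_big_seq => ij ijs; congr (_ * _); have [Fz Sz] := Hz _ ijs.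
  have [cx cy] := center_in k ij.
  have Sc : square k ij (center R k ij).
    by move: cx cy => /andP[? ?] /andP[? ?]; split; apply/andP; split; exact: ltW.
  (* The centre is exchanged for a point of [F] in the same square. The segment between them stays
     within less than [e] of that point, and the chain keeps distance [e] from [F]. *)
  have := @wsum_move R r (seg (center R k ij) (zf ij)) cr (@con_seg _ _ _ _).
  rewrite seg0 seg1; apply; apply: chain_sub rX => x [_ xF] u Iu /=.
  apply/eqP => xE; have := xF _ Fz; rewrite leNgt => /negP; apply.
  by rewrite (le_lt_trans (square_diam _ Sz) ke)// xE; exact: square_seg.
apply: chain_sub rX => x [+ xF]; rewrite -gE => -[ij ijst S].
exists ij => //; move: ijst; rewrite mem_cat => /orP[|//].
rewrite mem_filter => /andP[/asboolP[z Fz Sz] _].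
by have := xF _ Fz; rewrite leNgt (le_lt_trans (square_diam S Sz) ke).
Qed.

End Artin.

(** * Boundaries of grid regions *)

Definition opp_edge (d : 'I_4) : 'I_4 :=
  match val d with
  | 0%N => @Ordinal 4 2 isT | 1%N => @Ordinal 4 3 isT
  | 2%N => @Ordinal 4 0 isT | _ => @Ordinal 4 1 isT
  end.

Lemma opp_edgeK : involutive opp_edge.
Proof. by move=> [[|[|[|[|d]]]] hd] //; apply: val_inj. Qed.

Lemma edge_data_opp ij d : let e := edge_data ij d in
  edge_data e.2 (opp_edge d) = (e.1.2, e.1.1, ij).
Proof.
by case: ij d => [i j] [[|[|[|[|d]]]] hd] //=; rewrite /edge_data /= ?subrK ?addrK.
Qed.

Lemma big_I4 (R : zmodType) (F : 'I_4 -> R) :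
  \sum_(d < 4) F d = F (@Ordinal 4 0 isT) + F (@Ordinal 4 1 isT) + F (@Ordinal 4 2 isT)
    + F (@Ordinal 4 3 isT).
Proof.
rewrite !big_ord_recr big_ord0 /= add0r.
by do ?congr (_ + _); congr F; apply: val_inj.
Qed.

Section Boundary.
Variable R : realType.
Local Notation R2 := (R * R)%type.
Local Notation dy := (@dy R).
Implicit Types (s : seq (int * int)).

(** An inner edge occurs in two squares with opposite orientations, so adding all the inner edges
    changes nothing. The involution [tau] exchanges the two occurrences. *)
Lemma sum_boundary (G : (int * int) -> (int * int) -> R) s : uniq s ->
  (forall ij d, ij \in s -> (edge_data ij d).2 \in s ->
    G (edge_data ij d).1.1 (edge_data ij d).1.2 = - G (edge_data ij d).1.2 (edge_data ij d).1.1) ->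
  \sum_(ij <- s) \sum_(d < 4 | bd_edge s ij d) G (edge_data ij d).1.1 (edge_data ij d).1.2 =
  \sum_(ij <- s) \sum_(d < 4) G (edge_data ij d).1.1 (edge_data ij d).1.2.
Proof.
move=> us anti; pose H (x : (int * int) * 'I_4) := G (edge_data x.1 x.2).1.1 (edge_data x.1 x.2).1.2.
pose L := [seq x <- [seq (ij, d) | ij <- s, d <- enum 'I_4] | (edge_data x.1 x.2).2 \in s].
have inner : \sum_(ij <- s) \sum_(d < 4 | ~~ bd_edge s ij d) H (ij, d) = \sum_(x <- L) H x.
  rewrite /L [RHS]big_filter [RHS]big_mkcond [RHS]big_allpairs_dep /=.
  apply: eq_bigr => ij _; rewrite -[RHS]big_mkcond [RHS]big_enum_cond /=.
  by apply: eq_bigl => d; rewrite negbK.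
pose tau (x : (int * int) * 'I_4) := ((edge_data x.1 x.2).2, opp_edge x.2).
have memL x : (x \in L) = (x.1 \in s) && ((edge_data x.1 x.2).2 \in s).
  rewrite mem_filter andbC; congr (_ && _); case: x => ij d /=.
  by apply/allpairsP/idP => [[[a b] /= [h _ [-> _]]]//|h]; exists (ij, d); rewrite /= mem_enum.
have tauK : cancel tau tau.
  by move=> [ij d]; rewrite /tau /= edge_data_opp /= opp_edgeK.
have tauL : perm_eq [seq tau x | x <- L] L.
  have uL : uniq L.
    by rewrite filter_uniq// allpairs_uniq ?enum_uniq// => -[a b] [c d].
  apply: uniq_perm => //; first by rewrite map_inj_uniq//; exact: can_inj tauK.
  have tL x : x \in L -> tau x \in L.
    by rewrite !memL => /andP[h1 h2]; rewrite /tau /= h2 edge_data_opp.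
  move=> x; apply/mapP/idP => [[y yL ->]|xL]; first exact: tL.
  by exists (tau x); rewrite ?tauK ?tL.
have S0 : \sum_(x <- L) H x = 0.
  have : \sum_(x <- L) H x = - \sum_(x <- L) H x; last by lra.
  rewrite -{1}(perm_big _ tauL) big_map -sumrN; apply: eq_big_seq => x.
  by rewrite memL /H /tau => /andP[h1 h2]; rewrite edge_data_opp /= anti ?opprK.
have -> : \sum_(ij <- s) \sum_(d < 4) G (edge_data ij d).1.1 (edge_data ij d).1.2 =
    \sum_(ij <- s) (\sum_(d < 4 | bd_edge s ij d) H (ij, d) +
      \sum_(d < 4 | ~~ bd_edge s ij d) H (ij, d)).
  by apply: eq_bigr => ij _; rewrite (bigID (fun d => bd_edge s ij d)).
by rewrite big_split /= inner S0 addr0.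
Qed.

Definition gpt k (a : int * int) : R2 := (dy k a.1, dy k a.2).

Lemma edge_pathE k ij d t :
  @edge_path R k ij d t = seg (gpt k (edge_data ij d).1.1) (gpt k (edge_data ij d).1.2) t.
Proof. by rewrite /edge_path; case: (edge_data ij d) => [[a b] c]. Qed.

Definition bchain k s : seq (R -> R2) :=
  [seq @edge_path R k x.1 x.2 | x <- [seq (ij, d) | ij <- s, d <- enum 'I_4] & bd_edge s x.1 x.2].

Lemma sum_bchain k s (A : (R -> R2) -> R) :
  \sum_(c <- bchain k s) A c =
  \sum_(ij <- s) \sum_(d < 4 | bd_edge s ij d) A (@edge_path R k ij d).
Proof.
rewrite /bchain big_map big_filter [LHS]big_mkcond [LHS]big_allpairs_dep /=.
by apply: eq_bigr => ij _; rewrite -big_mkcond big_enum_cond.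
Qed.

Lemma bchain_closed k s : uniq s -> closed_chain (bchain k s).
Proof.
move=> us F; rewrite (sum_bchain k s (fun c => F (c 1) - F (c 0))).
pose G a b := F (gpt k b) - F (gpt k a).
have E ij d : F (@edge_path R k ij d 1) - F (@edge_path R k ij d 0) =
    G (edge_data ij d).1.1 (edge_data ij d).1.2 by rewrite !edge_pathE seg1 seg0.
under eq_bigr do under eq_bigr do rewrite E.
rewrite sum_boundary//; last by move=> ij d _ _; rewrite /G; ring.
rewrite big1// => -[i j] _; rewrite big_I4 /edge_data /G /=; ring.
Qed.

Lemma edge_in_square k ij d t : I01 t -> square k ij (@edge_path R k ij d t) /\
  square k (edge_data ij d).2 (@edge_path R k ij d t).
Proof.
move=> /I01P/andP[? ?]; rewrite edge_pathE; case: ij => i j.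
have h1 := dyS R k i; have h2 := dyS R k j.
have h3 := dyS R k (i + 1); have h4 := dyS R k (j + 1).
have h5 := dyS R k (i - 1); have h6 := dyS R k (j - 1); rewrite !subrK in h5 h6.
case: d => [[|[|[|[|d]]]] hd] //; rewrite /edge_data /seg /square /gpt /= ?subrK;
  by split; split; apply/andP; split; nra.
Qed.

Lemma mix_lt (x0 x1 x c t : R) : x0 <= x <= x1 -> x0 < c < x1 -> 0 < t <= 1 ->
  x0 < (1 - t) * x + t * c < x1.
Proof. by move=> /andP[? ?] /andP[? ?] /andP[? ?]; apply/andP; split; nra. Qed.

Lemma seg_center_in k ij (x : R2) t : square k ij x -> 0 < t <= 1 ->
  let z := seg x (center R k ij) t in
  (dy k ij.1 < z.1 < dy k (ij.1 + 1)) /\ (dy k ij.2 < z.2 < dy k (ij.2 + 1)).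
Proof. by move=> [? ?] ?; have [? ?] := center_in R k ij; split; exact: mix_lt. Qed.

Lemma strict_not_bd k ij (z : R2) :
  (dy k ij.1 < z.1 < dy k (ij.1 + 1)) /\ (dy k ij.2 < z.2 < dy k (ij.2 + 1)) ->
  ~ rect_bd (dy k ij.1) (dy k (ij.1 + 1)) (dy k ij.2) (dy k (ij.2 + 1)) z.
Proof. by move=> [/andP[? ?] /andP[? ?]] [_] [|[|[|]]]; lra. Qed.

Lemma seg_center k ij ij' (x : R2) t : square k ij x -> 0 < t <= 1 ->
  square k ij' (seg x (center R k ij) t) -> ij' = ij.
Proof.
move=> Sx t01 S'; have [//|ne] := eqVneq ij' ij.
have zin := seg_center_in Sx t01; exfalso; apply: (strict_not_bd zin).
apply: square_bd ne _ S'; move: zin => [/andP[? ?] /andP[? ?]].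
by split; apply/andP; split; exact: ltW.
Qed.

(** Serves to push a point lying on grid lines into the inside of a chosen square without leaving
    [A]. *)
Lemma con_seg_nbhs (x y : R2) (A : set R2) : nbhs x A -> exists2 t, 0 < t <= 1 & A (seg x y t) /\
  forall u, I01 u -> A (seg x (seg x y t) u).
Proof.
move=> /nbhs_ballP[e /= e0 He].
pose M := `|y - x| + 1; have M0 : 0 < M by rewrite ltr_wpDl.
pose t := Num.min 1 (e / (2 * M)).
have t0 : 0 < t by rewrite lt_min ltr01 divr_gt0// mulr_gt0.
have t1 : t <= 1 by rewrite ge_min lexx.
have tM : t * M < e.
  have : t <= e / (2 * M) by rewrite ge_min lexx orbT.
  by rewrite ler_pdivlMr ?mulr_gt0//; lra.
have H u : 0 <= u <= t -> A (seg x y u).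
  move=> /andP[u0 ut]; apply: He; rewrite -ball_normE /ball_ /=.
  have -> : x - seg x y u = u *: (x - y).
    by rewrite /seg; congr pair; rewrite /= /GRing.scale /=; ring.
  rewrite normrZ ger0_norm// -normrN opprB (le_lt_trans _ tM)//.
  by apply: ler_pM => //; rewrite lerDl.
exists t; first by rewrite t0.
split; first by apply: H; rewrite (ltW t0) lexx.
move=> u /I01P/andP[u0 u1]; rewrite (_ : seg _ _ u = seg x y (u * t)).
  by apply: H; apply/andP; split; nra.
by rewrite /seg /=; congr pair; ring.
Qed.

(** Pushed towards the centre of the neighbour across the edge, the point enters the inside of that
    square, which no square of [s] meets. *)
Lemma bd_not_interior k s ij d t : ij \in s -> bd_edge s ij d -> I01 t ->
  ~ interior (grid_union k s : set R2) (@edge_path R k ij d t).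
Proof.
move=> ijs bd It int; have [_ Sn] := edge_in_square k ij d It.
have [u u01 [[ij' ijs' S'] _]] := con_seg_nbhs (center R k (edge_data ij d).2) int.
by move: bd; rewrite /bd_edge -(seg_center Sn u01 S') ijs'.
Qed.

Definition gbd k s : set R2 := grid_union k s `\` interior (grid_union k s).

Lemma bchain_in k s : chain_in (gbd k s) (bchain k s).
Proof.
apply: alls_map => -[ij d]; rewrite mem_filter /= => /andP[bd /allpairsP[[a b] /= [ijs _ [e1 e2]]]].
rewrite -{a}e1 in ijs; split.
  by apply: con_eq (@con_seg _ (gpt k (edge_data ij d).1.1) (gpt k (edge_data ij d).1.2) _) => t _; rewrite edge_pathE.
move=> t It; split; last exact: bd_not_interior.
by exists ij => //; have [] := edge_in_square k ij d It.
Qed.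

Lemma square_wsum k ij (f : R2 -> R2) :
  \sum_(d < 4) av (fun t => f (@edge_path R k ij d t)) =
  wsum (rect_chain (dy k ij.1) (dy k (ij.1 + 1)) (dy k ij.2) (dy k (ij.2 + 1))) f.
Proof.
rewrite big_I4 /wsum /rect_chain !big_cons big_nil addr0 !addrA; case: ij => i j.
by do ?congr (_ + _).
Qed.

Lemma wsum_bchain_squares k s (f : R2 -> R2) : uniq s ->
  (forall ij d, ij \in s -> npath (fun t => f (@edge_path R k ij d t))) ->
  wsum (bchain k s) f = \sum_(ij <- s) wsum (rect_chain (dy k ij.1) (dy k (ij.1 + 1))
     (dy k ij.2) (dy k (ij.2 + 1))) f.
Proof.
move=> us nf; rewrite /wsum (sum_bchain k s (fun c => av (fun t => f (c t)))).
pose G a b := av (fun t => f (seg (gpt k a) (gpt k b) t)).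
have E ij d : av (fun t => f (@edge_path R k ij d t)) =
    G (edge_data ij d).1.1 (edge_data ij d).1.2.
  by apply: av_eq => t _; rewrite edge_pathE.
under eq_bigr do under eq_bigr do rewrite E.
rewrite sum_boundary//.
  apply: eq_bigr => ij _; rewrite -/(wsum _ f) -square_wsum.
  by apply: eq_bigr => d _; rewrite E.
move=> ij d ijs nbs; rewrite /G -av_rev.
  by apply: av_eq => t _; rewrite seg_rev.
have := nf _ (opp_edge d) nbs; apply: npath_eq => t It.
by rewrite edge_pathE edge_data_opp.
Qed.

Lemma edge_npath k s (f : R2 -> R2) ij d : ij \in s -> con (grid_union k s) f ->
  (forall t, I01 t -> f (@edge_path R k ij d t) != 0) -> npath (fun t => f (@edge_path R k ij d t)).
Proof.
move=> ijs cf f0; split=> //; apply: con_comp cf.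
  by apply: con_eq (@con_seg _ (gpt k (edge_data ij d).1.1) (gpt k (edge_data ij d).1.2) _) => t _; rewrite edge_pathE.
by move=> t It; exists ij => //; have [] := edge_in_square k ij d It.
Qed.

Lemma square_sub k s ij : ij \in s -> square k ij `<=` (grid_union k s : set R2).
Proof. by move=> ijs x S; exists ij. Qed.

Lemma wsum_bchain0 k s (f : R2 -> R2) : uniq s -> con (grid_union k s) f ->
  (forall x, grid_union k s x -> f x != 0) -> wsum (bchain k s) f = 0.
Proof.
move=> us cf f0; rewrite wsum_bchain_squares//.
  rewrite big_seq big1// => ij ijs.
  apply: wsum_rect0; [exact: rect_chain_closed| |exact: con_subset (square_sub ijs) cf|].
    by apply: rect_chain_in; apply: ltW; exact: dyS.
  by move=> x Sx; apply: f0; exact: (square_sub ijs).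
move=> ij d ijs; apply: (edge_npath ijs cf) => t It; apply: f0.
by exists ij => //; have [] := edge_in_square k ij d It.
Qed.

(** [z] may lie on grid lines, so it is first moved inside a square [Q] without crossing the
    boundary of the region. Then the boundary sum is the sum over all squares, and only [Q]
    contributes. *)
Lemma wsum_bchain1 k s (z : R2) : uniq s -> interior (grid_union k s) z ->
  wsum (bchain k s) (fun x => x - z) = 2 * pi.
Proof.
move=> us zi; have [Q Qs Sz] := interior_subset zi.
have [t t01 [zt Hu]] := con_seg_nbhs (center R k Q) (open_nbhs_nbhs (conj (open_interior _) zi)).
pose z' := seg z (center R k Q) t; rewrite -/z' in zt Hu.
have zu ij : square k ij z' -> ij = Q by exact: seg_center Sz t01.
have -> : wsum (bchain k s) (fun x => x - z) = wsum (bchain k s) (fun x => x - z').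
  have := @wsum_move R (bchain k s) (seg z z') (bchain_closed k us) (@con_seg _ _ _ _).
  rewrite seg0 seg1; apply; apply: chain_sub (bchain_in k s) => x [_ nx] u Iu /=.
  by apply/eqP => xE; apply: nx; rewrite xE; exact: Hu.
have inQ := seg_center_in Sz t01; rewrite -/z' in inQ.
have bdedge ij d u : ij \in s -> I01 u -> @edge_path R k ij d u - z' != 0.
  move=> ijs Iu; rewrite subr_eq0; apply/eqP => e.
  have [S1 S2] := edge_in_square k ij d Iu; rewrite e in S1 S2.
  have e2 := zu _ S2; have e1 := zu _ S1.
  by move: e2; rewrite e1; case: (Q) d {S1 S2 e} => i j [[|[|[|[|d]]]] hd] //= []; lia.
rewrite wsum_bchain_squares//; last first.
  move=> ij d ijs; have cz : con (grid_union k s) (fun x : R2 => x - z') by ctac.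
  by apply: (edge_npath ijs cz) => u; exact: bdedge.
rewrite (big_rem Q) //= wsum_rect_center; [|by case: inQ|by case: inQ].
rewrite big_seq big1 ?addr0// => ij ijs; apply: wsum_rect0.
- exact: rect_chain_closed.
- by apply: rect_chain_in; apply: ltW; exact: dyS.
- by ctac.
- move=> x Sx; rewrite subr_eq0; apply/eqP => xz; rewrite xz in Sx.
  by move: ijs; rewrite (zu _ Sx) mem_rem_uniq// inE eqxx.
Qed.

End Boundary.

(** * The degree of a local homeomorphism *)

Section Degree.
Variable R : realType.
Local Notation R2 := (R * R)%type.

Lemma compact_dist (V : normedModType R) (K F : set V) : compact K -> closed F ->
  (forall x, K x -> ~ F x) -> exists2 e, 0 < e & forall x z, K x -> F z -> e <= `|x - z|.
Proof.
move=> cK cF KF.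
have /compact_near_coveringP H := cK.
have := H _ (0 : R)^'+ (fun e x => forall z, F z -> e <= `|x - z|) _.
case=> [x Kx|e /= e0 He].
  have oF : open (~` F) by exact: closed_openC.
  have /nbhs_ballP[d /= d0 Hd] : nbhs x (~` F) by apply: open_nbhs_nbhs; split=> //; exact: KF.
  near=> y e => z Fz /=; rewrite leNgt; apply/negP => yz.
  apply: (Hd z) => //; rewrite -ball_normE /ball_ /=.
  have xy : `|x - y| < d / 2.
    near: y; apply/nbhs_ballP; exists (d / 2); first by rewrite /= divr_gt0.
    by move=> w; rewrite -ball_normE.
  have ed : e < d / 2 by near: e; apply: nbhs_right_lt; rewrite divr_gt0.
  have := ler_distD y x z; lra.
exists (e / 2); first by rewrite divr_gt0.
move=> x z Kx Fz; apply: (He (e / 2)) => //=; last by rewrite divr_gt0.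
by rewrite sub0r normrN ger0_norm ?divr_ge0 ?ltW//; lra.
Unshelve. all: by end_near. Qed.

Lemma chain_dist (X F : set R2) (r : seq (R -> R2)) : closed F ->
  chain_in (X `\` F) r -> exists2 e, 0 < e &
  chain_in [set x | X x /\ forall z, F z -> e <= `|x - z|] r.
Proof.
move=> cF; elim: r => [_|c r IH] /=; first by exists 1.
move=> [[cc cX] /IH[e e0 He]].
have cK : compact (c @` I01) by apply: con_image_compact => //; exact: I01_compact.
have [|d d0 Hd] := compact_dist cK cF; first by move=> _ [t It <-]; case: (cX t It).
exists (Num.min e d); first by rewrite lt_min e0.
split.
  split=> // t It; split; first by case: (cX t It).
  by move=> z Fz; rewrite ge_min (Hd (c t) z) ?orbT//; exists t.
apply: chain_sub He => x [Xx xF]; split=> // z Fz.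
by rewrite ge_min xF.
Qed.

Definition Bx (h : R) : set R2 := rect (- h) h (- h) h.

Lemma Bx_scal h a x : 0 < a -> Bx h x -> Bx (a * h) (scal a x).
Proof.
by move=> a0 [/andP[? ?] /andP[? ?]]; split; apply/andP; split; rewrite /scal /=; nra.
Qed.

Lemma Bx_convex h x y s t : 0 <= s -> 0 <= t -> s + t = 1 -> Bx h x -> Bx h y ->
  Bx h (scal s x + scal t y).
Proof.
move=> ? ? ? [/andP[? ?] /andP[? ?]] [/andP[? ?] /andP[? ?]].
by split; apply/andP; split; rewrite /scal /=; nra.
Qed.

Lemma Bx_norm h x : Bx h x <-> `|x| <= h.
Proof.
by rewrite R2_norm_le !ler_norml; split=> [[h1 h2]|/andP[h1 h2]]; [exact/andP|by split].
Qed.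

Lemma scalA (a b : R) (x : R2) : scal a (scal b x) = scal (a * b) x.
Proof. by rewrite /scal /= !mulrA. Qed.
Lemma scal1 (x : R2) : scal 1 x = x.
Proof. by case: x => a b; rewrite /scal /= !mul1r. Qed.
Lemma scal0 (x : R2) : scal 0 x = 0.
Proof. by rewrite /scal !mul0r. Qed.
Lemma scal_eq0 (a : R) (x : R2) : a != 0 -> (scal a x == 0) = (x == 0).
Proof. by move=> a0; rewrite !pair_eq0 /= !mulf_eq0 (negbTE a0). Qed.

Lemma wsum_rect_far (h : R) (z : R2) : 0 < h -> rect_bd (-h) h (-h) h z -> h <= `|z|.
Proof.
case: z => a b h0 [[/= ? ?] E]; rewrite prod_normE /= le_max.
by case: E => [e|[e|[e|e]]] /=; rewrite e ?normrN (gtr0_norm h0) lexx ?orbT.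
Qed.

Lemma square_chain (h : R) : 0 < h -> chain_in (Bx h `\` [set 0]) (rect_chain (-h) h (-h) h).
Proof.
move=> h0; have hh : - h <= h by lra.
apply: chain_sub (rect_chain_bd hh hh) => x bx; split; first by case: bx.
by move=> /= x0; have := wsum_rect_far h0 bx; rewrite x0 normr0 leNgt h0.
Qed.

Lemma square_wsum0 (h : R) : 0 < h -> wsum (rect_chain (-h) h (-h) h) id = 2 * pi.
Proof.
move=> h0; rewrite -(@wsum_rect_center R (-h) h (-h) h 0) /=; [|apply/andP; split; lra..].
by apply: (wsum_eq_in (square_chain h0)) => x _; rewrite subr0.
Qed.

(** [winding_detection] with [F] reduced to 0 yields an integer for each distance [e] kept from 0.
    Evaluated on the boundary of the square, all these integers agree. *)
Lemma deg1 (v : R2 -> R2) : con (Bx 1) v -> (forall x, Bx 1 x -> x <> 0 -> v x != 0) ->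
  exists n : int, forall r, closed_chain r -> chain_in (Bx 1 `\` [set 0]) r ->
    wsum r v = n%:~R * wsum r id.
Proof.
move=> cv v0; pose sq : seq (R -> R2) := rect_chain (-1) 1 (-1) 1.
have H (e : R) : 0 < e -> e <= 1 -> exists n : int, wsum sq v = n%:~R * (2 * pi) /\
    forall r, closed_chain r -> chain_in [set x | Bx 1 x /\ e <= `|x|] r ->
    wsum r v = n%:~R * wsum r id.
  move=> e0 e1; have [|L [L0 HL]] := @winding_detection R 1 [set 0] v e isT e0 cv.
    by move=> x Dx /= x0; apply: v0.
  have {}HL r : closed_chain r -> chain_in [set x | Bx 1 x /\ e <= `|x|] r ->
      wsum r v = (\sum_(p <- L) p.2)%:~R * wsum r id.
    move=> cr rX; rewrite HL//; last first.
      by apply: chain_sub rX => x [? ?]; split=> // z ->; rewrite subr0.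
    rewrite rmorph_sum mulr_suml /=; apply: sum_alls; apply: alls_impl L0 => p /= ->.
    by congr (_ * _); apply: (wsum_eq_in rX) => x _; rewrite subr0.
  exists (\sum_(p <- L) p.2); split=> //.
  rewrite HL; first by rewrite square_wsum0.
    exact: rect_chain_closed.
  have h : (-1 : R) <= 1 by lra.
  apply: chain_sub (rect_chain_bd h h) => x bx; split; first by case: bx.
  by rewrite (le_trans e1)// wsum_rect_far.
have [n [nE Hn]] := H 1 ltr01 (lexx _); exists n => r cr rX.
have c0 : closed [set (0 : R2)] by apply: compact_closed; [exact: R2_hausdorff|exact: compact_set1].
have [e e0 rE] := chain_dist c0 rX.
have [||m [mE Hm]] := H (Num.min e 1); [by rewrite lt_min e0 ltr01|by rewrite ge_min lexx orbT|].
have <- : m%:~R = n%:~R :> R.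
  have p0 : 2 * pi != 0 :> R by rewrite mulf_neq0// gt_eqF ?pi_gt0.
  by apply: (mulIf p0); rewrite -nE -mE.
apply: Hm => //; apply: chain_sub rE => x [Bx1 /(_ 0 erefl)]; rewrite subr0 => xe.
by split=> //; rewrite ge_min xe.
Qed.

Lemma con_scal (T : topologicalType) (A : set T) (f : T -> R2) a :
  con A f -> con A (fun x => scal a (f x)).
Proof. by move=> cf; rewrite /scal; ctac. Qed.

Lemma deg_ex (h : R) (v : R2 -> R2) : 0 < h -> con (Bx h) v ->
  (forall x, Bx h x -> x <> 0 -> v x != 0) ->
  exists n : int, forall r, closed_chain r -> chain_in (Bx h `\` [set 0]) r ->
    wsum r v = n%:~R * wsum r id.
Proof.
move=> h0 cv v0; have hn : h != 0 by rewrite gt_eqF.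
have B1 x : Bx 1 x -> Bx h (scal h x) by move=> /(Bx_scal h0); rewrite mulr1.
have [||n Hn] := @deg1 (fun x => v (scal h x)).
- by apply: (con_comp (f := scal h)) cv => //; apply: con_scal; exact: con_id.
- by move=> x Bx1 /eqP x0; apply: v0; [exact: B1|apply/eqP; rewrite scal_eq0].
have hi : 0 < h^-1 by rewrite invr_gt0.
exists n => r cr rX.
have := Hn _ (closed_map (fun x => scal h^-1 x) cr); rewrite !wsum_map.
have E1 : wsum r (fun x => v (scal h (scal h^-1 x))) = wsum r v.
  by apply: (wsum_eq_in rX) => x _; rewrite scalA divff// scal1.
have E2 : wsum r (fun x => scal h^-1 x) = wsum r id.
  apply: wsum_scal => //; apply: (chain_in_npath rX (con_id (A := _))) => x [_ /eqP]//.
rewrite E1 E2; apply; apply: (chain_map rX); first by apply: con_scal; exact: con_id.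
move=> x [Bxh /= /eqP x0]; split; first by rewrite -(mulVf hn); exact: Bx_scal.
by apply/eqP; rewrite scal_eq0// gt_eqF.
Qed.

(** The local inverse [S] has a degree as well. On a small square the two degrees multiply to that
    of the identity, so both are units of the integers. *)
Lemma degree_unit (h rho : R) (P S : R2 -> R2) : 0 < h -> 0 < rho ->
  con (Bx h) P -> (forall x y, Bx h x -> Bx h y -> P x = P y -> x = y) -> P 0 = 0 ->
  con (Bx rho) S -> (forall y, Bx rho y -> Bx h (S y) /\ P (S y) = y) ->
  exists2 d : R, d = 1 \/ d = -1 & forall r, closed_chain r -> chain_in (Bx h `\` [set 0]) r ->
    wsum r P = d * wsum r id.
Proof.
move=> h0 rho0 cP iP P0 cS SP.
have B0 : Bx h 0 by apply/Bx_norm; rewrite normr0 ltW.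
have [|n Hn] := deg_ex h0 cP.
  by move=> x Bxx x0; apply/eqP => Px; apply: x0; apply: iP => //; rewrite Px P0.
have S0 x : Bx rho x -> x <> 0 -> S x != 0.
  by move=> Bxx x0; apply/eqP => Sx; apply: x0; have [_ <-] := SP x Bxx; rewrite Sx P0.
have [m Hm] := deg_ex rho0 cS S0.
pose sq : seq (R -> R2) := rect_chain (-rho) rho (-rho) rho.
have sqX := square_chain rho0; have csq := @rect_chain_closed R (-rho) rho (-rho) rho.
have e1 := Hm _ csq sqX; rewrite square_wsum0// in e1.
have : chain_in (Bx h `\` [set 0]) [seq (fun t => S (c t)) | c <- sq].
  apply: (chain_map sqX); first by apply: con_subset cS => x [].
  by move=> x [Bxx /= x0]; split; [case: (SP x Bxx)|apply/eqP/S0].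
move=> /(Hn _ (closed_map S csq)); rewrite !wsum_map e1.
rewrite (wsum_eq_in sqX (g := id)); last by move=> x [/SP[_ ->]].
rewrite square_wsum0// => E.
have nm : n * m = 1.
  apply: (@intr_inj R); rewrite intrM; have p0 : 2 * pi != 0 :> R by rewrite mulf_neq0// gt_eqF ?pi_gt0.
  by apply: (mulIf p0); rewrite -mulrA -E mul1r.
exists n%:~R; last by [].
have /orP[/eqP->|/eqP->] : (n == 1) || (n == -1).
  have := congr1 absz nm; rewrite abszM => /eqP; rewrite muln_eq1 => /andP[/eqP].
  by clear; lia.
- by left.
- by right.
Qed.

(* The difference of the pair (x, y) is halved while the pair is moved to the origin. *)
Lemma degree_pairs (h d : R) (P : R2 -> R2) : 0 < h -> con (Bx h) P ->
  (forall x y, Bx h x -> Bx h y -> P x = P y -> x = y) -> P 0 = 0 ->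
  (forall r, closed_chain r -> chain_in (Bx h `\` [set 0]) r -> wsum r P = d * wsum r id) ->
  forall r : seq (R -> R2 * R2), closed_chain r ->
    chain_in [set p | [/\ Bx h p.1, Bx h p.2 & p.1 <> p.2]] r ->
    wsum r (fun p => P p.1 - P p.2) = d * wsum r (fun p => p.1 - p.2).
Proof.
move=> h0 cP iP P0 Hd r cr rX; set X := (X in chain_in X r) in rX.
pose a (q : R * (R2 * R2)) : R2 := scal (1 - q.1) q.2.1.
pose b (q : R * (R2 * R2)) : R2 := scal (1 - q.1) q.2.2 + scal (q.1 / 2) (q.2.2 - q.2.1).
have half q : X q -> Bx h (scal (1 / 2) (q.2 - q.1)).
  case: q => x y [/= [/andP[? ?] /andP[? ?]] [/andP[? ?] /andP[? ?]] _].
  by split; apply/andP; split; rewrite /scal /=; lra.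
have B0 : Bx h 0 by apply/Bx_norm; rewrite normr0 ltW.
have aB q : (I01 `*` X) q -> Bx h (a q).
  case: q => s q [/= /I01P/andP[? ?] [Bx1 _ _]].
  have := @Bx_convex h q.1 0 (1 - s) s; rewrite {2}/scal /= !mulr0 addr0.
  by apply => //; lra.
have bB q : (I01 `*` X) q -> Bx h (b q).
  case: q => s q [/= /I01P/andP[? ?] Xq]; have [_ Bx2 _] := Xq.
  have -> : b (s, q) = scal (1 - s) q.2 + scal s (scal (1 / 2) (q.2 - q.1)).
    by rewrite /b /= scalA; congr (_ + scal _ _); ring.
  by apply: Bx_convex => //; [lra|ring|exact: half].
have ab q : (I01 `*` X) q -> a q <> b q.
  case: q => s [[x1 x2] [y1 y2]] [/= /I01P/andP[? ?] [_ _ /= xy]] [e1 e2]; apply: xy.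
  have k0 : 1 - s / 2 != 0 :> R by rewrite gt_eqF//; lra.
  have f1 : (1 - s / 2) * (y1 - x1) = 0 by move: e1 => /=; lra.
  have f2 : (1 - s / 2) * (y2 - x2) = 0 by move: e2 => /=; lra.
  move/eqP: f1; rewrite mulf_eq0 (negbTE k0) /= subr_eq0 => /eqP ->.
  by move/eqP: f2; rewrite mulf_eq0 (negbTE k0) /= subr_eq0 => /eqP ->.
have ca : con (I01 `*` X) a by rewrite /a /scal; ctac.
have cb : con (I01 `*` X) b by rewrite /b /scal /=; ctac.
have := @wsum_homotopy R _ X r (fun q => P (a q) - P (b q)) cr rX.
have -> : con (I01 `*` X) (fun q => P (a q) - P (b q)) = True.
  by apply/propT; apply: conB; [exact: con_comp ca aB cP|exact: con_comp cb bB cP].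
move=> /(_ I); have ne q : (I01 `*` X) q -> P (a q) - P (b q) != 0.
  by move=> Xq; rewrite subr_eq0; apply/eqP => /(iP _ _ (aB _ Xq) (bB _ Xq)); exact: ab.
move=> /(_ ne) E.
have E0 : wsum r (fun x => P (a (0, x)) - P (b (0, x))) = wsum r (fun p => P p.1 - P p.2).
  apply: wsum_eq_in rX _ => -[x y] _; rewrite /a /b /= subr0 !scal1 mul0r.
  by rewrite scal0 addr0.
have E1 : wsum r (fun x => P (a (1, x)) - P (b (1, x))) =
    wsum r (fun p => - P (scal (1 / 2) (p.2 - p.1))).
  apply: wsum_eq_in rX _ => -[x y] _; rewrite /a /b /= subrr.
  by rewrite !scal0 add0r P0 sub0r.
rewrite -E0 E E1.
pose w (p : R2 * R2) : R2 := scal (1 / 2) (p.2 - p.1).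
pose r' := [seq (fun t => w (c t)) | c <- r].
have cw : con X w by apply: con_scal; ctac.
have w0 p : X p -> scal (1 / 2) (p.2 - p.1) != 0.
  move=> [_ _ ne']; rewrite scal_eq0; last by rewrite gt_eqF//; lra.
  by rewrite subr_eq0; apply/eqP => e; apply: ne'.
have r'X : chain_in (Bx h `\` [set 0]) r'.
  apply: (chain_map rX cw) => p Xp; split; first exact: half.
  by apply/eqP; exact: w0.
have cPw : con X (fun p : R2 * R2 => P (scal (1 / 2) (p.2 - p.1))) by exact: con_comp cw half cP.
rewrite wsumN; last first.
  apply: chain_in_npath rX cPw _ => p Xp; apply/eqP => Pe.
  by have := w0 p Xp; rewrite (iP _ 0 (half _ Xp) B0) ?eqxx// Pe P0.
have := Hd r' (closed_map w cr) r'X; rewrite /r' !wsum_map => ->; congr (_ * _).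
have nd : nchain r (fun p : R2 * R2 => p.1 - p.2).
  apply: chain_in_npath rX _ _; first by ctac.
  by move=> p [_ _ ne']; rewrite subr_eq0; apply/eqP.
rewrite -(wsumN nd) -(@wsum_scal R _ r (fun p => - (p.1 - p.2)) (1 / 2)).
- by apply: (wsum_eq_in rX) => p _; rewrite opprB.
- lra.
- exact: nchainN.
Qed.

End Degree.

(** * The stable curve and the homoclinic loop *)

(** A continuous injection of a compact set maps relatively closed parts to closed sets, so a lift
    of a continuous map through it is continuous. *)
Lemma con_inverse (T U W : topologicalType) (K : set T) (a : T -> U) (A : set W)
    (g : W -> U) (l : W -> T) :
  hausdorff_space U -> compact K -> con K a ->
  (forall s t, K s -> K t -> a s = a t -> s = t) -> con A g ->
  (forall w, A w -> K (l w) /\ a (l w) = g w) -> con A l.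
Proof.
move=> hU cK ca ia cg H w Aw; apply/within_cvgP => Y nY.
have [Klw alw] := H w Aw.
have [D [oO Olw OY]] : exists D, [/\ open D, D (l w) & D `<=` Y].
  by exists (interior Y); split; [exact: open_interior|exact: nY|exact: interior_subset].
have cKO : compact (K `&` ~` D) by apply: compact_closedI => //; exact: open_closedC.
have cl : closed (a @` (K `&` ~` D)).
  apply: compact_closed => //; apply: con_image_compact => //.
  by apply: con_subset ca => x [].
have nw : nbhs (g w) (~` (a @` (K `&` ~` D))).
  apply: open_nbhs_nbhs; split; first exact: closed_openC.
  by move=> [t [Kt nOt] /=]; rewrite -alw => /(ia _ _ Kt Klw) tl; apply: nOt; rewrite tl.
have /within_cvgP/(_ _ nw) := cg w Aw; apply: filterS => v /= Hv Av.
have [Klv alv] := H v Av; apply: OY; apply: contrapT => nO; apply: (Hv Av).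
by exists (l v).
Qed.

(** * Arcs inside an injectively immersed line *)

Section Curve.
Variables (R : realType) (V : normedModType R).
Implicit Types (a g : R -> V) (l : R -> R).

(** Concerns the positive end only; the negative end is handled as the positive end of the reversed
    line. *)
Definition tends_at_infinity a (z : V) := forall e, 0 < e -> exists M, forall s, M <= s -> `|z - a s| < e.

Definition cc (x y : R) : set R := [set t | x <= t <= y].
Definition oc (x y : R) : set R := [set t | x < t <= y].

Lemma ccE x y : cc x y = `[x, y]%classic.
Proof. by apply/seteqP; split=> t; rewrite /cc /= in_itv. Qed.

Lemma cc_compact x y : compact (cc x y).
Proof. by rewrite ccE; exact: segment_compact. Qed.

Lemma ocE x y : oc x y = [set` `]x, y]].
Proof. by apply/seteqP; split=> t; rewrite /oc /= in_itv. Qed.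

Lemma IVT_cc l x y v : x <= y -> con (cc x y) l -> (l x <= v <= l y \/ l y <= v <= l x) ->
  exists2 t, cc x y t & l t = v.
Proof.
move=> xy cl H; rewrite ccE in cl.
have [|t] := @IVT R l x y v xy ((conP _ _).2 cl).
  by rewrite ge_min le_max; case: H => /andP[-> ->]; rewrite ?orbT.
by rewrite in_itv => ? ?; exists t.
Qed.

Definition bounded_in l x y := exists M, forall t, cc x y t -> `|l t| <= M.

Lemma bounded_in_join l x y z : bounded_in l x y -> bounded_in l y z -> bounded_in l x z.
Proof.
move=> [M HM] [N HN]; exists (Num.max M N) => t /andP[t1 t2]; rewrite le_max.
have [ty|ty] := leP t y; first by rewrite HM//; apply/andP.
by rewrite HN ?orbT//; apply/andP; split=> //; exact: ltW.
Qed.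

Section Line.
Variables (a : R -> V).
Hypotheses (ca : continuous a) (ia : injective a).

Lemma param_con g l (A : set R) M : con A g -> (forall t, A t -> a (l t) = g t) ->
  (forall t, A t -> `|l t| <= M) -> con A l.
Proof.
move=> cg al lM; apply: (@con_inverse R V R (cc (- M) M) a A g l) => //.
- exact: cc_compact.
- exact: con_continuous.
- by move=> s t _ _; exact: ia.
- by move=> w Aw; split; [rewrite /cc /= -ler_norml lM|exact: al].
Qed.

Lemma param_con_oc g l x y : con (cc x y) g -> (forall t, cc x y t -> a (l t) = g t) ->
  (forall v, oc x y v -> bounded_in l v y) -> con (oc x y) l.
Proof.
move=> cg al lb t /andP[xt ty]; pose v := (x + t) / 2.
have v1 : x < v by rewrite /v; lra.
have v2 : v < t by rewrite /v; lra.
have [|M HM] := lb v; first by apply/andP; split; lra.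
have sub : cc v y `<=` cc x y by move=> s /andP[? ?]; apply/andP; split; lra.
have cl := param_con (con_subset sub cg) (fun t ct => al t (sub t ct)) HM.
have ct : cc v y t by apply/andP; split; lra.
apply/within_cvgP => Y nY; have /within_cvgP/(_ _ nY) H := cl t ct.
have : nbhs t [set s | v < s] by apply: open_nbhs_nbhs; split=> //; exact: open_gt.
by apply: filterS2 H => s /= H vs /andP[xs sy]; apply: H; apply/andP; split=> //; exact: ltW.
Qed.

Lemma unbounded_above_end g l x y : x < y -> con (cc x y) g ->
  (forall t, cc x y t -> a (l t) = g t) ->
  (forall s t, oc x y s -> oc x y t -> l s = l t -> s = t) ->
  (forall v, oc x y v -> bounded_in l v y) ->
  (forall M, exists2 t, oc x y t & M < l t) ->
  [/\ tends_at_infinity a (g x), (forall s, l y <= s -> exists2 t, oc x y t & l t = s) &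
      forall t, oc x y t -> l y <= l t].
Proof.
move=> xy cg al il lb lu.
have yy : oc x y y by rewrite /oc /= xy lexx.
have cl := param_con_oc cg al lb.
have dec : forall s t, oc x y s -> oc x y t -> s < t -> l t < l s.
  have := @itv_continuous_inj_mono R l `]x, y].
  rewrite -ocE => /(_ ((conP _ _).2 cl)) [].
    by move=> s t; rewrite !in_itv; exact: il.
  - move=> inc; exfalso; have [t Ht] := lu (l y).
    have [/andP[t1]] := Ht; rewrite le_eqVlt => /orP[/eqP ->|ty]; first by rewrite ltxx.
    by rewrite ltNge => /negP; apply; apply: ltW; rewrite inc ?in_itv /= ?t1 ?xy ?lexx ?(ltW ty).
  - by move=> dc s t Hs Ht st; rewrite dc ?in_itv.
have le_ly t : oc x y t -> l y <= l t.
  move=> Ht; have [/andP[t1]] := Ht; rewrite le_eqVlt => /orP[/eqP ->//|ty].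
  by apply: ltW; exact: dec.
have surj s : l y <= s -> exists2 t, oc x y t & l t = s.
  move=> ys; have [t0 Ht0 lt0] := lu s; have /andP[t1 t2] := Ht0.
  have [|||t /andP[u1 u2] ts] := @IVT_cc l t0 y s.
  - exact: t2.
  - apply: con_subset cl => u /andP[? ?]; apply/andP; split; lra.
  - by right; rewrite ys ltW.
  - by exists t => //; apply/andP; split=> //; lra.
split=> // e e0.
have /con_eps/(_ x _ e e0) := cg; have xx : cc x y x by rewrite /cc /= lexx ltW.
move=> /(_ xx)[d d0 Hd]; pose t0 := Num.min y (x + d / 2).
have t01 : x < t0 by rewrite lt_min xy; lra.
have t02 : t0 <= y by rewrite ge_min lexx.
have t03 : t0 <= x + d / 2 by rewrite ge_min lexx orbT.
have H0 : oc x y t0 by rewrite /oc /= t01.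
exists (l t0) => s ls; have [|t Ht lts] := surj s; first by rewrite (le_trans (le_ly _ H0)).
have tt0 : t <= t0.
  rewrite leNgt; apply/negP => /(dec _ _ H0 Ht); lra.
have /andP[h1 h2] := Ht; rewrite -lts al; last by rewrite /cc /= h2 ltW.
apply: Hd; first by rewrite /cc /= h2 ltW.
by rewrite ltr0_norm; lra.
Qed.

End Line.
End Curve.

Lemma nbhs_dist (R : realType) (t e : R) : 0 < e -> nbhs t [set s | `|s - t| < e].
Proof.
move=> e0; apply/nbhs_ballP; exists e => // w; rewrite -ball_normE /ball_ /=.
by rewrite distrC.
Qed.

Section Dichotomy.
Variables (R : realType) (V : normedModType R).

Lemma con_opp (x y : R) (g : R -> V) : con (cc x y) g -> con (cc (- y) (- x)) (fun t => g (- t)).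
Proof.
move=> cg; apply: (con_comp (f := fun t : R => - t) (B := cc x y)) cg; first by ctac.
by move=> t /andP[? ?]; apply/andP; split; lra.
Qed.

Definition locally_bounded (l : R -> R) (A : set R) t :=
  exists e M, 0 < e /\ forall s, A s -> `|s - t| < e -> `|l s| <= M.

Lemma locally_bounded_compact (l : R -> R) x y :
  (forall t, cc x y t -> locally_bounded l (cc x y) t) -> bounded_in l x y.
Proof.
move=> H; have /compact_near_coveringP K := @cc_compact R x y.
have := K R (pinfty_nbhs R) (fun M t => cc x y t -> `|l t| <= M) _.
case=> [t /H [e [M [e0 HM]]]|M [Mr HM]].
  near=> s N; have MN : M <= N by near: N; apply: nbhs_pinfty_ge; exact: num_real.
  have st : `|s - t| < e by near: s; exact: nbhs_dist.
  by move=> cs; rewrite (le_trans (HM s cs _)).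
exists (M + 1) => t ct; apply: HM => //; lra.
Unshelve. all: by end_near. Qed.

Variables (a : R -> V).
Hypotheses (ca : continuous a) (ia : injective a).
Hypothesis ends : forall s, tends_at_infinity a (a s) \/ tends_at_infinity (fun t => a (- t)) (a s) -> s = 0.

Lemma not_bounded (l : R -> R) x y : x < y -> ~ bounded_in l x y ->
  (forall M, exists2 t, oc x y t & M < l t) \/ (forall M, exists2 t, oc x y t & M < - l t).
Proof.
move=> xy nb; apply: contrapT => /not_orP[/existsNP[M hM] /existsNP[N hN]].
apply: nb; exists (Num.max `|l x| (Num.max M N)) => t /andP[xt ty]; rewrite le_max.
move: xt; rewrite le_eqVlt => /orP[/eqP ->|xt]; first by rewrite lexx.
have Ht : oc x y t by rewrite /oc /= xt.
have h1 : l t <= M by rewrite leNgt; apply/negP => h; apply: hM; exists t.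
have h2 : - l t <= N by rewrite leNgt; apply/negP => h; apply: hN; exists t.
apply/orP; right; rewrite ler_norml; apply/andP; split.
  by rewrite lerNl (le_trans h2)// le_max lexx orbT.
by rewrite (le_trans h1)// le_max lexx.
Qed.

(** If [l] were unbounded, an end of the line would converge to [g x], which is the point [a (l x)]
    of the line; [ends] allows this only for [l x = 0]. *)
Lemma bounded_right_end (g : R -> V) l x y : x < y -> con (cc x y) g ->
  (forall t, cc x y t -> a (l t) = g t) ->
  (forall s t, cc x y s -> cc x y t -> l s = l t -> s = t) ->
  (forall v, oc x y v -> bounded_in l v y) -> l x <> 0 -> bounded_in l x y.
Proof.
move=> xy cg al il lb lx; apply: contrapT => nb; apply: lx.
have xx : cc x y x by rewrite /cc /= lexx ltW.
have sub t : oc x y t -> cc x y t by move=> /andP[? ?]; apply/andP; split=> //; exact: ltW.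
have [H|H] := not_bounded xy nb; apply: ends; rewrite al//.
  by left; have [] := unbounded_above_end ca ia xy cg al (fun s t hs ht => il s t (sub s hs) (sub t ht)) lb H.
right; have ca' : continuous (fun t => a (- t)).
  by move=> t; apply: continuous_comp; [exact: opp_continuous|exact: ca].
have ia' : injective (fun t => a (- t)) by move=> s t /ia/oppr_inj.
have := @unbounded_above_end R V (fun t => a (- t)) ca' ia' g (fun t => - l t) x y xy cg.
case=> //.
- by move=> t ct; rewrite opprK al.
- by move=> s t hs ht /oppr_inj; apply: il; exact: sub.
- by move=> v hv; have [M HM] := lb v hv; exists M => t ct; rewrite normrN HM.
Qed.

Lemma bounded_left_end (g : R -> V) l x y : x < y -> con (cc x y) g ->
  (forall t, cc x y t -> a (l t) = g t) ->
  (forall s t, cc x y s -> cc x y t -> l s = l t -> s = t) ->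
  (forall v, x <= v < y -> bounded_in l x v) -> l y <> 0 -> bounded_in l x y.
Proof.
move=> xy cg al il lb ly.
have N t : cc (- y) (- x) t -> cc x y (- t) by move=> /andP[? ?]; apply/andP; split; lra.
have [||||||M HM] := @bounded_right_end (fun t => g (- t)) (fun t => l (- t)) (- y) (- x).
- by rewrite ltrN2.
- exact: con_opp.
- by move=> t /N; exact: al.
- by move=> s t /N hs /N ht /(il _ _ hs ht)/oppr_inj.
- move=> v /andP[v1 v2]; have [|M HM] := lb (- v); first by apply/andP; split; lra.
  by exists M => t /andP[? ?]; apply: HM; apply/andP; split; lra.
- by rewrite opprK.
by exists M => t /andP[? ?]; rewrite -(opprK t); apply: HM; apply/andP; split; lra.
Qed.

Variables (g : R -> V) (l : R -> R).
Hypotheses (cg : con I01 g) (al : forall t, I01 t -> a (l t) = g t)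
  (ig : forall s t, I01 s -> I01 t -> g s = g t -> s = t) (g0 : g 0 = a 0).

Let il s t : I01 s -> I01 t -> l s = l t -> s = t.
Proof. by move=> Is It e; apply: ig => //; rewrite -!al// e. Qed.

Let l0 : l 0 = 0.
Proof. by apply: ia; rewrite al ?g0. Qed.

Let ln0 t : I01 t -> 0 < t -> l t <> 0.
Proof. by move=> It t0 lt; move: t0; rewrite (il It I010) ?ltxx// lt l0. Qed.

Let I01cc (x y : R) : 0 <= x -> y <= 1 -> cc x y `<=` I01.
Proof. by move=> ? ? t /andP[? ?]; apply/I01P; lra. Qed.

(** [a] maps a bounded interval onto a compact set, whose complement is open. So the absolute value
    of [l] is lower semicontinuous, although [l] is not yet known to be continuous. *)
Lemma large_open t n : I01 t -> n < `|l t| -> exists2 e, 0 < e &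
  forall s, I01 s -> `|s - t| < e -> n < `|l s|.
Proof.
move=> It nl.
have cK : compact (a @` cc (- n) n).
  by apply: con_image_compact; [exact: con_continuous|exact: cc_compact].
have clK : closed (a @` cc (- n) n) by apply: compact_closed => //; exact: norm_hausdorff.
have nK : nbhs (g t) (~` (a @` cc (- n) n)).
  apply: open_nbhs_nbhs; split; first exact: closed_openC.
  move=> [s cs /=]; rewrite -al// => /ia st; move: nl; rewrite -st ltNge ler_norml.
  by rewrite cs.
have /within_cvgP/(_ _ nK)/nbhs_ballP[e /= e0 He] := cg It.
exists e => // s Is st; rewrite ltNge; apply/negP => ln.
have := He s; rewrite -ball_normE /ball_ /= distrC => /(_ st Is); apply.
by exists (l s); [rewrite /cc /= -ler_norml|exact: al].
Qed.

(** The parameter 0 is left out: the arc starts there at [a 0], to which an end of the line may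
    indeed return. *)
Definition bad t := [/\ I01 t, 0 < t & ~ locally_bounded l I01 t].

(** Baire's argument on the set of bad points. If no bound [n] held on a relatively open part of it,
    [large_open] would produce nested intervals on which the absolute value of [l] exceeds every
    integer, which is absurd at a common point. *)
Lemma baire_bad : (exists t, bad t) -> exists (n : nat) x y, [/\ 0 < x,
  exists2 t, x < t < y & bad t & forall t, x < t < y -> bad t -> `|l t| <= n%:R].
Proof.
move=> [t0 bt0]; apply: contrapT => H.
pose Inv (q : R * R) := 0 < q.1 /\ exists2 t, q.1 < t < q.2 & bad t.
have step (n : nat) (q : R * R) : exists q' : R * R, Inv q -> [/\ Inv q', q.1 <= q'.1, q'.2 <= q.2 &
    forall t, I01 t -> q'.1 <= t <= q'.2 -> n%:R < `|l t|].
  have [[q0 [t ht bt]]|nI] := pselect (Inv q); last by exists q => /nI.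
  have [s hs [bs ls]] : exists2 s, q.1 < s < q.2 & bad s /\ n%:R < `|l s|.
    apply: contrapT => ns; apply: H; exists n, q.1, q.2; split=> //; first by exists t.
    by move=> s hs bs; rewrite leNgt; apply/negP => ln; apply: ns; exists s.
  have [Is s0 _] := bs; have [e e0 He] := large_open Is ls; have /andP[hs1 hs2] := hs.
  pose d := Num.min (e / 2) (Num.min (s - q.1) (q.2 - s)).
  have d0 : 0 < d by rewrite !lt_min divr_gt0//= !subr_gt0 hs1.
  have de : d < e by rewrite (le_lt_trans (y := e / 2)) ?ge_min ?lexx//; lra.
  have d1 : d <= s - q.1 by rewrite !ge_min lexx !orbT.
  have d2 : d <= q.2 - s by rewrite !ge_min lexx !orbT.
  exists (s - d, s + d) => _; split=> /=; [|lra|lra|].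
    by split=> /=; [lra|exists s => //; apply/andP; split; lra].
  move=> u Iu /andP[? ?]; apply: He => //; rewrite (le_lt_trans _ de)//.
  by rewrite ler_norml; apply/andP; split; lra.
have [F HF] := choice (fun nq : nat * (R * R) => step nq.1 nq.2).
have [_ t0p _] := bt0.
(* Starting at [t0 / 2] keeps all the intervals away from 0. *)
pose q0 := (t0 / 2, t0 + 1).
pose q := fix q n := if n is m.+1 then F (m, q m) else q0.
have Iq n : Inv (q n).
  elim: n => [|n IH] /=; last by have [] := HF (n, q n) IH.
  by split=> /=; [lra|exists t0 => //; apply/andP; split; lra].
have mono n m : (n <= m)%N -> (q n).1 <= (q m).1 /\ (q m).2 <= (q n).2.
  move=> /subnK <-; elim: (m - n)%N => [|j [IH1 IH2]] //; rewrite addSn /=.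
  have [_ h1 h2 _] := HF ((j + n)%N, q (j + n)%N) (Iq _); split; [exact: le_trans h1|exact: le_trans IH2].
have lt12 n m : (q n).1 <= (q m).2.
  have [_ [u /andP[u1 u2] _]] := Iq (maxn n m).
  have [h1 _] := mono n _ (leq_maxl n m); have [_ h2] := mono m _ (leq_maxr n m).
  by lra.
pose S := range (fun n => (q n).1).
have supS : has_sup S.
  by split; [exists (q 0%N).1; exists 0%N|exists (q 0%N).2 => _ [n _ <-]].
pose c := sup S.
have c1 n : (q n).1 <= c by apply: sup_upper_bound => //; exists n.
have c2 n : c <= (q n).2 by apply: ge_sup; [case: supS|move=> _ [m _ <-]].
have c01 : I01 c.
  apply/I01P; apply/andP; split; first by apply: le_trans (c1 0%N) => /=; lra.
  apply: ge_sup; [by case: supS|move=> _ [m _ <-]].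
  by have [_ [u /andP[u1 u2] [/I01P/andP[_ u3] _ _]]] := Iq m; lra.
have big (n : nat) : n%:R < `|l c|.
  by have [_ _ _ h] := HF (n, q n) (Iq n); apply: h => //; rewrite (c1 n.+1) (c2 n.+1).
have := big (Num.bound `|l c|); rewrite ltNge => /negP; apply.
by have := archi_boundP (normr_ge0 (l c)) => /ltW.
Qed.

Lemma locally_bounded_sub t x y : 0 <= x -> y <= 1 -> locally_bounded l I01 t ->
  locally_bounded l (cc x y) t.
Proof. by move=> x0 y1 [e [M [e0 H]]]; exists e, M; split=> // s /(I01cc x0 y1); exact: H. Qed.

Lemma good_bounded x y : 0 < x -> y <= 1 -> (forall t, cc x y t -> ~ bad t) -> bounded_in l x y.
Proof.
move=> x0 y1 H; apply: locally_bounded_compact => t ct.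
have It : I01 t by apply: I01cc ct => //; exact: ltW.
apply: locally_bounded_sub => //; first exact: ltW.
apply: contrapT => nb; apply: (H t ct); split=> //; case/andP: ct; lra.
Qed.

Lemma bounded_right t y : 0 < t -> t < y -> y <= 1 -> (forall s, oc t y s -> ~ bad s) -> bounded_in l t y.
Proof.
move=> t0 ty y1 H; have sub := I01cc (ltW t0) y1.
apply: (bounded_right_end (g := g)) => //.
- exact: con_subset cg.
- by move=> s /sub; exact: al.
- by move=> s u /sub hs /sub hu; exact: il.
- move=> v /andP[v1 v2]; apply: good_bounded => //; first lra.
  by move=> s /andP[? ?]; apply: H; apply/andP; split; lra.
- apply: ln0 => //; apply/I01P; lra.
Qed.

Lemma bounded_left t y : 0 < t -> t < y -> y <= 1 -> (forall s, t <= s < y -> ~ bad s) -> bounded_in l t y.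
Proof.
move=> t0 ty y1 H; have sub := I01cc (ltW t0) y1.
apply: (bounded_left_end (g := g)) => //.
- exact: con_subset cg.
- by move=> s /sub; exact: al.
- by move=> s u /sub hs /sub hu; exact: il.
- move=> v /andP[v1 v2]; apply: good_bounded => //; first lra.
  by move=> s /andP[? ?]; apply: H; apply/andP; split; lra.
- apply: ln0; [apply/I01P|]; lra.
Qed.

Lemma bad_closed t : I01 t -> 0 < t -> (forall e, 0 < e -> exists2 s, bad s & `|s - t| < e) -> bad t.
Proof.
move=> It t0 H; split=> // -[e [M [e0 HM]]].
have [|s [Is _ ns] st] := H (e / 2); first by rewrite divr_gt0.
apply: ns; exists (e / 2), M; split; first by rewrite divr_gt0.
move=> u Iu us; apply: HM => //; have := ler_distD s u t; lra.
Qed.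

(* a maximal interval without bad points ends at bad points, where l is bounded by n,
   and l is monotone in between *)
Lemma bounded_between (n : R) x y : 0 < x -> x < y -> bad x -> bad y ->
  (forall t, cc x y t -> bad t -> `|l t| <= n) -> forall t, cc x y t -> `|l t| <= n.
Proof.
move=> x0 xy bx by_ H t ct; have [bt|nt] := pselect (bad t); first exact: H.
have /andP[xt ty] := ct; have [/I01P/andP[_ y1] _ _] := by_.
pose S1 := [set s | bad s /\ x <= s <= t].
have sup1 : has_sup S1 by split; [exists x; rewrite /S1 /= lexx|exists t => s [_ /andP[]]].
pose S2 := [set s | bad s /\ t <= s <= y].
have inf2 : has_inf S2 by split; [exists y; rewrite /S2 /= lexx ty|exists t => s [_ /andP[]]].
pose u := sup S1; pose v := inf S2.
have ux : x <= u by apply: sup_upper_bound => //; rewrite /S1 /= lexx.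
have ut : u <= t by apply: ge_sup; [case: sup1|move=> s [_ /andP[]]].
have vy : v <= y by apply: (inf_lbound inf2.2); rewrite /S2 /= lexx ty.
have tv : t <= v by apply: lb_le_inf; [case: inf2|move=> s [_ /andP[]]].
have bu : bad u.
  apply: bad_closed; [apply/I01P; lra|lra|move=> e e0].
  have [s [bs /andP[s1 s2]] us] := sup_adherent e0 sup1; exists s => //.
  have : s <= u by apply: sup_upper_bound => //; rewrite /S1 /= s1 s2.
  by move=> su; rewrite ler0_norm; rewrite -/u in us; lra.
have bv : bad v.
  apply: bad_closed; [apply/I01P; lra|lra|move=> e e0].
  have [s [bs /andP[s1 s2]] vs] := inf_adherent e0 inf2; exists s => //.
  have : v <= s by apply: (inf_lbound inf2.2); rewrite /S2 /= s1 s2.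
  by move=> su; rewrite ger0_norm; rewrite -/v in vs; lra.
have ut' : u < t by rewrite lt_neqAle ut andbT; apply/eqP => e; apply: nt; rewrite -e.
have tv' : t < v by rewrite lt_neqAle tv andbT; apply/eqP => e; apply: nt; rewrite e.
have bd1 : bounded_in l u t.
  apply: bounded_right; [lra|lra|lra|move=> s /andP[s1 s2] bs].
  have : s <= u by apply: sup_upper_bound => //; split=> //; apply/andP; split; lra.
  by lra.
have bd2 : bounded_in l t v.
  apply: bounded_left; [lra|lra|lra|move=> s /andP[s1 s2] bs].
  have : v <= s by apply: (inf_lbound inf2.2); split=> //; apply/andP; split; lra.
  by lra.
have [M HM] := bounded_in_join bd1 bd2.
have sub : cc u v `<=` I01 by apply: I01cc; lra.
have cl : con (cc u v) l.
  by apply: (param_con ca ia (con_subset sub cg) _ HM) => s /sub; exact: al.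
have lu : `|l u| <= n by apply: H => //; apply/andP; split; lra.
have lv : `|l v| <= n by apply: H => //; apply/andP; split; lra.
move: lu lv; rewrite !ler_norml => /andP[u1 u2] /andP[v1 v2].
have inu : u \in `[u, v] by rewrite in_itv /= lexx; lra.
have inv : v \in `[u, v] by rewrite in_itv /= lexx andbT; lra.
have int : t \in `[u, v] by rewrite in_itv /= ut tv.
have := @itv_continuous_inj_mono R l `[u, v]; rewrite -ccE => /(_ ((conP _ _).2 cl)) [].
  by move=> s w; rewrite !in_itv => hs hw; apply: il; exact: sub.
- move=> inc; have h1 : l u < l t by rewrite inc.
  have h2 : l t < l v by rewrite inc.
  by apply/andP; split; lra.
- move=> dc; have h1 : l t < l u by rewrite dc.
  have h2 : l v < l t by rewrite dc.
  by apply/andP; split; lra.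
Qed.

(** Take the bad point [u] given by [baire_bad]. On each side there is either another bad point
    nearby, and [bounded_between] bounds [l] up to it, or no bad point nearby, and [bounded_right]
    or [bounded_left] applies. So [l] is bounded near [u] after all. *)
Lemma no_bad t : ~ bad t.
Proof.
move=> bt; have [|n [x [y [x0 [u /andP[xu uy] bu] H]]]] := baire_bad; first by exists t.
have [Iu u0 nu] := bu; apply: nu; have /I01P/andP[_ u1] := Iu.
(* The minimum with 1 covers the case [u = 1], where nothing of the interval lies to the right. *)
have right : exists e, 0 < e /\ bounded_in (fun s => l (Num.min s 1)) u (u + e).
  have [u1'|u1'] := ltP u 1; last first.
    exists 1; split=> //; exists `|l 1| => s /andP[s1 s2]; rewrite (min_idPr _)//; lra.
  have [[w bw /andP[w1 w2]]|nw] := pselect (exists2 w, bad w & u < w < y).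
    exists (w - u); split; first lra.
    have [/I01P/andP[_ w3] _ _] := bw.
    exists n%:R => s /andP[s1 s2]; rewrite (min_idPl _); last lra.
    apply: (@bounded_between n%:R u w) => //; last by apply/andP; split; lra.
    by move=> r /andP[? ?]; apply: H; apply/andP; split; lra.
  pose v := Num.min 1 ((u + y) / 2).
  have v1 : u < v by rewrite lt_min u1'; lra.
  have v2 : v <= 1 by rewrite ge_min lexx.
  have v3 : v <= (u + y) / 2 by rewrite ge_min lexx orbT.
  exists (v - u); split; first lra.
  have [|M HM] := bounded_right u0 v1 v2.
    by move=> s /andP[? ?] bs; apply: nw; exists s => //; apply/andP; split; lra.
  by exists M => s /andP[? ?]; rewrite (min_idPl _); [apply: HM; apply/andP; split|]; lra.
have left : exists e, 0 < e /\ bounded_in l (u - e) u.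
  have [[w bw /andP[w1 w2]]|nw] := pselect (exists2 w, bad w & x < w < u).
    exists (u - w); split; first lra.
    exists n%:R => s /andP[s1 s2].
    apply: (@bounded_between n%:R w u) => //; [lra| |by apply/andP; split; lra].
    by move=> r /andP[? ?]; apply: H; apply/andP; split; lra.
  exists (u - (x + u) / 2); split; first lra.
  rewrite subKr; apply: bounded_left; [lra|lra|lra|].
  by move=> s /andP[? ?] bs; apply: nw; exists s => //; apply/andP; split; lra.
have [e1 [e10 [M1 H1]]] := right; have [e2 [e20 [M2 H2]]] := left.
exists (Num.min e1 e2), (Num.max M1 M2); split; first by rewrite lt_min e10.
move=> s /I01P/andP[s0 s1]; rewrite lt_min !ltr_norml => /andP[/andP[? ?] /andP[? ?]].
rewrite le_max; have [us|us] := leP u s.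
  by have := H1 s; rewrite (min_idPl s1) => ->//; apply/andP; split; lra.
by rewrite H2 ?orbT//; apply/andP; split; lra.
Qed.

End Dichotomy.

Section Arcs.
Variables (R : realType) (V : normedModType R).
Implicit Types (a b : R -> V).

Definition proper_ends a :=
  forall s, tends_at_infinity a (a s) \/ tends_at_infinity (fun t => a (- t)) (a s) -> s = 0.

Lemma tends_scale a c z : 0 < c -> tends_at_infinity (fun t => a (c * t)) z -> tends_at_infinity a z.
Proof.
move=> c0 H e e0; have [M HM] := H e e0; exists (c * M) => s Ms.
have := HM (s / c); rewrite mulrCA divff ?gt_eqF// mulr1; apply.
by rewrite ler_pdivlMr// mulrC.
Qed.

Lemma proper_ends_scale a c : c != 0 -> proper_ends a -> proper_ends (fun t => a (c * t)).
Proof.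
move=> c0 pa s H; apply: (mulfI c0); rewrite mulr0; apply: pa.
have E : (fun t => a (c * - t)) = (fun t => a (- c * t)) by apply/funext => t; rewrite mulrN mulNr.
have E2 : (fun t => a (c * t)) = (fun t => a (- (- c * t))) by apply/funext => t; rewrite mulNr opprK.
have E3 : (fun t => a (c * - t)) = (fun t => a (- (c * t))) by apply/funext => t; rewrite mulrN.
have [cn|cp] := ltP c 0.
  have c0' : 0 < - c by rewrite oppr_gt0.
  case: H => H; first by right; rewrite E2 in H; exact: (tends_scale (a := fun t => a (- t)) c0' H).
  by left; rewrite E in H; exact: tends_scale c0' H.
have c0' : 0 < c by rewrite lt_neqAle eq_sym c0.
case: H => H; first by left; exact: tends_scale c0' H.
by right; rewrite E3 in H; exact: (tends_scale (a := fun t => a (- t)) c0' H).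
Qed.

(** Without bad points the parameter [l] is continuous off 0. If it is also bounded at 0, it is a
    monotone map onto the unit interval; otherwise it comes down from infinity to 1, and the arc is
    the far end of the line together with [a 0]. *)
Lemma arc_dichotomy1 a (g : R -> V) : continuous a -> injective a -> proper_ends a ->
  con I01 g -> (forall s t, I01 s -> I01 t -> g s = g t -> s = t) -> g 0 = a 0 -> g 1 = a 1 ->
  (forall t, I01 t -> exists s, a s = g t) ->
  g @` I01 = a @` I01 \/
  g @` I01 = [set a 0] `|` a @` [set t | 1 <= t] /\ tends_at_infinity a (a 0).
Proof.
move=> ca ia pa cg ig g0 g1 gr.
have [l al] : {l : R -> R & forall t, I01 t -> a (l t) = g t}.
  apply: (@choice _ _ (fun t s => I01 t -> a s = g t)) => t.
  have [It|nI] := pselect (I01 t); last by exists 0.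
  by have [s hs] := gr t It; exists s.
have l0 : l 0 = 0 by apply: ia; rewrite al.
have l1 : l 1 = 1 by apply: ia; rewrite al.
have il s t : I01 s -> I01 t -> l s = l t -> s = t.
  by move=> Is It e; apply: ig => //; rewrite -!al// e.
have ccI : cc 0 1 = @I01 R by rewrite ccE.
have sub (t : R) : oc 0 1 t -> I01 t by move=> /andP[? ?]; apply/I01P; rewrite ltW.
have lb v : oc 0 1 v -> bounded_in l v 1.
  move=> /andP[v0 v1]; apply: (good_bounded (l := l)) => // t _.
  exact: (no_bad ca ia pa cg al ig g0).
have [bl|nb] := pselect (bounded_in l 0 1).
  left; have cl : con I01 l.
    by have [M HM] := bl; rewrite -ccI; apply: (param_con (g := g) ca ia); [rewrite ccI|rewrite ccI|exact: HM].
  have l01 t : I01 t -> I01 (l t).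
    move=> It; have /I01P/andP[t0 t1] := It; apply/I01P.
    have in0 : (0 : R) \in `[0, 1] by rewrite in_itv /= lexx ler01.
    have in1 : (1 : R) \in `[0, 1] by rewrite in_itv /= lexx ler01.
    have int : t \in `[0, 1] by rewrite in_itv /= t0 t1.
    have := @itv_continuous_inj_mono R l `[0, 1]; move=> /(_ ((conP _ _).2 cl)) [].
      by move=> s w; rewrite !in_itv => /I01P hs /I01P hw; exact: il.
    - move=> inc; apply/andP; split.
        move: t0; rewrite le_eqVlt => /orP[/eqP <-|t0]; first by rewrite l0.
        by rewrite -l0 ltW// inc.
      move: t1; rewrite le_eqVlt => /orP[/eqP ->|t1]; first by rewrite l1.
      by rewrite -l1 ltW// inc.
    - by move=> dc; have : l 1 < l 0 by [rewrite dc|]; rewrite l0 l1 ltr10.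
  apply/seteqP; split=> [_ [t It <-]|_ [s Is <-]].
    by exists (l t); [exact: l01|exact: al].
  have [||t ct <-] := @IVT_cc R l 0 1 s ler01; first by rewrite ccI.
    by left; rewrite l0 l1; apply/I01P.
  by rewrite ccI in ct; exists t => //; rewrite al.
have cg' : con (cc 0 1) g by rewrite ccI.
have al' t : cc 0 1 t -> a (l t) = g t by rewrite ccI; exact: al.
have ilo s t : oc 0 1 s -> oc 0 1 t -> l s = l t -> s = t by move=> /sub hs /sub ht; exact: il.
right; have [H|H] := not_bounded ltr01 nb.
  have [h1 h2 h3] := unbounded_above_end ca ia ltr01 cg' al' ilo lb H.
  rewrite -g0; split=> //; apply/seteqP; split=> [_ [t It <-]|x].
    have /I01P/andP[t0 t1] := It; move: t0; rewrite le_eqVlt => /orP[/eqP <-|t0]; first by left.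
    have ot : oc 0 1 t by rewrite /oc /= t0.
    by right; exists (l t); [rewrite /= -l1; exact: h3|exact: al].
  move=> [->|[s /= s1 <-]]; first by exists 0.
  by have [|t ot <-] := h2 s; [rewrite l1|exists t; [exact: sub|rewrite al//; exact: sub]].
(* Coming from minus infinity up to 1, [l] would take the value 0 at a positive time, but it has
   this value already at time 0. *)
exfalso; have ca' : continuous (fun t => a (- t)).
  by move=> t; apply: continuous_comp; [exact: opp_continuous|exact: ca].
have ia' : injective (fun t => a (- t)) by move=> s t /ia/oppr_inj.
have := @unbounded_above_end R V (fun t => a (- t)) ca' ia' g (fun t => - l t) 0 1 ltr01 cg'.
case=> //.
- by move=> t ct; rewrite opprK al'.
- by move=> s t hs ht /oppr_inj; exact: ilo.
- by move=> v hv; have [M HM] := lb v hv; exists M => t ct; rewrite normrN HM.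
move=> _ h2 _; have [|t ot /eqP] := h2 0; first by rewrite l1; lra.
rewrite oppr_eq0 => /eqP lt0; have := il t 0 (sub _ ot) I010.
by rewrite lt0 l0 => /(_ erefl) t0; move: ot; rewrite t0 /oc /= ltxx.
Qed.

Definition half_arc a c : set V := (fun t => a (c * t)) @` I01.
Definition end_arc a c : set V := [set a 0] `|` (fun t => a (c * t)) @` [set t | 1 <= t].

Lemma arc_dichotomy a (g : R -> V) c : continuous a -> injective a -> proper_ends a ->
  con I01 g -> (forall s t, I01 s -> I01 t -> g s = g t -> s = t) -> g 0 = a 0 -> g 1 = a c ->
  c != 0 -> g @` I01 `<=` range a ->
  g @` I01 = half_arc a c \/
  g @` I01 = end_arc a c /\ tends_at_infinity (fun t => a (c * t)) (a 0).
Proof.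
move=> ca ia pa cg ig g0 g1 c0 gr.
have := @arc_dichotomy1 (fun t => a (c * t)) g.
rewrite mulr0 mulr1; apply=> //.
- move=> t; apply: continuous_comp; last exact: ca.
  by apply: continuousM; [exact: cst_continuous|].
- by move=> s t /ia/(mulfI c0).
- exact: proper_ends_scale.
- move=> t It; have [|s _ hs] := gr (g t); first by exists t.
  by exists (s / c); rewrite mulrCA divff// mulr1.
Qed.

Section Loop.
Variables (G : V -> V) (a b : R -> V) (lam mu c d : R) (p p' : V) (gs gu : R -> V).
Hypotheses (ca : continuous a) (ia : injective a) (pa : proper_ends a).
Hypotheses (cb : continuous b) (ib : injective b) (pb : proper_ends b).
Hypotheses (a0 : a 0 = p) (b0 : b 0 = p) (ac : a c = p') (bd : b d = p') (pp' : p' <> p).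
Hypotheses (lam0 : 0 < lam) (lam1 : lam < 1) (mu1 : 1 < mu).
Hypotheses (Ga : forall s, G (a s) = a (lam * s)) (Gb : forall s, G (b s) = b (mu * s)).
Hypothesis (aU : tends_at_infinity (fun t => a (c * t)) p -> end_arc a c `<=` range b).
Hypothesis (bS : tends_at_infinity (fun t => b (d * t)) p -> end_arc b d `<=` range a).
Hypotheses (cgs : con I01 gs) (igs : forall s t, I01 s -> I01 t -> gs s = gs t -> s = t)
  (gs0 : gs 0 = p) (gs1 : gs 1 = p') (gsa : gs @` I01 `<=` range a).
Hypotheses (cgu : con I01 gu) (igu : forall s t, I01 s -> I01 t -> gu s = gu t -> s = t)
  (gu0 : gu 0 = p) (gu1 : gu 1 = p') (gub : gu @` I01 `<=` range b).
Hypothesis meet : gs @` I01 `&` gu @` I01 = [set p] `|` [set p'].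

Let c0 : c != 0.
Proof. by apply/eqP => e; apply: pp'; rewrite -ac e a0. Qed.

Let d0 : d != 0.
Proof. by apply/eqP => e; apply: pp'; rewrite -bd e b0. Qed.

(** [G] sends the point of parameter [c / lam] on the stable end to [p'], whereas it sends every
    point of the unstable end to [p] or strictly beyond [p']. *)
Let ends_differ : end_arc a c <> end_arc b d.
Proof.
move=> E; have h : end_arc b d (a (c * lam^-1)).
  by rewrite -E; right; exists lam^-1 => //=; rewrite invf_ge1// ltW.
have Gh : G (a (c * lam^-1)) = p' by rewrite Ga mulrCA divff ?mulr1 ?gt_eqF.
case: h => [e|[t /= t1 e]].
  by apply: pp'; rewrite -Gh e Gb mulr0 b0.
move: Gh; rewrite -e Gb -bd => /ib e'.
have : mu * t = 1 by apply: (mulfI d0); rewrite mulr1 -[RHS]e'; ring.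
move=> e2; have : 0 < (mu - 1) * t.
  by apply: mulr_gt0; [rewrite subr_gt0|rewrite (lt_le_trans ltr01)].
by rewrite mulrBl mul1r e2; lra.
Qed.

Let half_a : exists2 x, half_arc a c x & x <> p /\ x <> p'.
Proof.
exists (a (c * 2^-1)); first by exists 2^-1 => //; apply/I01P; lra.
rewrite -a0 -ac; split=> /ia e.
  by move: c0; apply/negP/negPn/eqP; lra.
by move: c0; apply/negP/negPn/eqP; lra.
Qed.

Let half_b : exists2 x, half_arc b d x & x <> p /\ x <> p'.
Proof.
exists (b (d * 2^-1)); first by exists 2^-1 => //; apply/I01P; lra.
rewrite -b0 -bd; split=> /ib e.
  by move: d0; apply/negP/negPn/eqP; lra.
by move: d0; apply/negP/negPn/eqP; lra.
Qed.

Let meetP x : (gs @` I01) x -> (gu @` I01) x -> x <> p /\ x <> p' -> False.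
Proof.
move=> h1 h2 [n1 n2]; have : ([set p] `|` [set p']) x by rewrite -meet.
by case=> [/n1|/n2].
Qed.

(* If the stable end winds back to p, the two arcs exchange their roles. *)
Lemma loop_standard :
  gs @` I01 `|` gu @` I01 = half_arc a c `|` half_arc b d /\
  half_arc a c `&` half_arc b d = [set p] `|` [set p'].
Proof.
have Da (g : R -> V) : con I01 g -> (forall s t, I01 s -> I01 t -> g s = g t -> s = t) -> g 0 = p -> g 1 = p' ->
    g @` I01 `<=` range a -> g @` I01 = half_arc a c \/
  g @` I01 = end_arc a c /\ tends_at_infinity (fun t => a (c * t)) p.
  by move=> cg ig g0 g1 gr; have := @arc_dichotomy a g c ca ia pa cg ig; rewrite a0 ac; apply.
have Db (g : R -> V) : con I01 g -> (forall s t, I01 s -> I01 t -> g s = g t -> s = t) -> g 0 = p -> g 1 = p' ->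
    g @` I01 `<=` range b -> g @` I01 = half_arc b d \/
  g @` I01 = end_arc b d /\ tends_at_infinity (fun t => b (d * t)) p.
  by move=> cg ig g0 g1 gr; have := @arc_dichotomy b g d cb ib pb cg ig; rewrite b0 bd; apply.
have [sE|[sE st]] := Da gs cgs igs gs0 gs1 gsa; have [uE|[uE ut]] := Db gu cgu igu gu0 gu1 gub.
- by rewrite -sE -uE.
- have ur : gu @` I01 `<=` range a by rewrite uE; exact: bS ut.
  have [uE'|[uE' _]] := Da gu cgu igu gu0 gu1 ur.
    have [x hx nx] := half_a; exfalso; apply: (meetP _ _ nx); first by rewrite sE.
    by rewrite uE'.
  by exfalso; apply: ends_differ; rewrite -uE -uE'.
- have sr : gs @` I01 `<=` range b by rewrite sE; exact: aU st.
  have [sE'|[sE' _]] := Db gs cgs igs gs0 gs1 sr.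
    have [x hx nx] := half_b; exfalso; apply: (meetP _ _ nx); first by rewrite sE'.
    by rewrite uE.
  by exfalso; apply: ends_differ; rewrite -sE -sE'.
- have sr : gs @` I01 `<=` range b by rewrite sE; exact: aU st.
  have ur : gu @` I01 `<=` range a by rewrite uE; exact: bS ut.
  have [sE'|[sE' _]] := Db gs cgs igs gs0 gs1 sr; last first.
    by exfalso; apply: ends_differ; rewrite -sE -sE'.
  have [uE'|[uE' _]] := Da gu cgu igu gu0 gu1 ur; last first.
    by exfalso; apply: ends_differ; rewrite -uE -uE'.
  by rewrite -sE' -uE' setIC setUC.
Qed.

End Loop.
End Arcs.

(** * Parametrization of the stable and unstable sets *)

Section Saddle.
Variable R : realType.
Local Notation R3 := (R * R * R)%type.
Local Notation R2 := (R * R)%type.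
Local Notation S2 := (@S2 R).
Implicit Types (g : R3 -> R3).

(** The linear form is stated through [k] because the image of a point of the box may leave the box;
    it only has to stay in [V]. *)
Record lsaddle g (p : R3) (W : set R3) (V : set R2) (h : R3 -> R2) (k : R2 -> R3)
    (mu lam eta : R) : Prop := LSaddle {
  ls_mu : 1 < mu; ls_lam0 : 0 < lam; ls_lam1 : lam < 1; ls_eta : 0 < eta;
  ls_W : S2open W; ls_V : open V; ls_h : con W h; ls_k : con V k;
  ls_hk : forall y, V y -> W (k y) /\ h (k y) = y;
  ls_kh : forall x, W x -> V (h x) /\ k (h x) = x;
  ls_box : Bx eta `<=` V;
  ls_p : k 0 = p;
  ls_g : forall y, Bx eta y -> V (mu * y.1, lam * y.2) /\ g (k y) = k (mu * y.1, lam * y.2) }.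

Lemma Bx0 (r : R) : 0 <= r -> Bx r 0.
Proof. by move=> r0; apply/Bx_norm; rewrite normr0. Qed.

Lemma Bx_nbhs (r : R) : 0 < r -> nbhs (0 : R2) (Bx r).
Proof.
move=> r0; apply/nbhs_ballP; exists r => // x; rewrite -ball_normE /ball_ /= sub0r normrN.
by move=> h; apply/Bx_norm; exact: ltW.
Qed.

Lemma nbhs_Bx (A : set R2) : nbhs (0 : R2) A -> exists2 r, 0 < r & Bx r `<=` A.
Proof.
move=> /nbhs_ballP[e /= e0 He]; exists (e / 2); first by rewrite divr_gt0.
move=> x /Bx_norm xe; apply: He; rewrite -ball_normE /ball_ /= sub0r normrN.
by rewrite (le_lt_trans xe)//; lra.
Qed.

Lemma Bx_sub (r s : R) : r <= s -> Bx r `<=` Bx s.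
Proof. by move=> rs x /Bx_norm h; apply/Bx_norm; exact: le_trans rs. Qed.

Lemma S2open_sub (W : set R3) : S2open W -> W `<=` S2.
Proof. by move=> [D _ ->] x []. Qed.

Lemma direct_saddle_lsaddle g ginv p : S2homeo g ginv -> direct_saddle g p ->
  exists W V h k mu lam eta, lsaddle g p W V h k mu lam eta.
Proof.
move=> _ [Sp [gp [W [V [h [k [mu [lam]]]]]]]].
move=> [[oW Wp oV hp] Wh Vk [/conP ch /conP ck] [mu1 lam0 lam1 [W' [[D oD WD] [W'p W'W]] Hg]]].
have kp : k 0 = p by have [_] := Wh p Wp; rewrite hp.
have V0 : V 0 by have [] := Wh p Wp; rewrite hp.
have nV : nbhs (0 : R2) V by apply: open_nbhs_nbhs.
have nD : nbhs (k 0) D by rewrite kp; apply: open_nbhs_nbhs; split=> //; move: W'p; rewrite WD => -[].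
have /within_cvgP/(_ _ nD) nk := ck 0 V0.
have [eta eta0 He] := nbhs_Bx (filterI nV nk).
exists W, V, h, k, mu, lam, eta; split=> //.
- by move=> y /He[].
- move=> y By; have [Vy Dy] := He y By; have [Wky hky] := Vk y Vy.
  have W'y : W' (k y) by rewrite WD; split; [exact: S2open_sub oW _ Wky|exact: Dy].
  have [Wg hg] := Hg _ W'y; have [Vh kh] := Wh _ Wg.
  by rewrite hg hky in Vh kh; split=> //; rewrite kh.
Qed.

Definition swap (y : R2) : R2 := (y.2, y.1).

Lemma Bx_swap r y : Bx r y -> Bx r (swap y).
Proof. by move=> []. Qed.

Lemma con_swap (A : set R2) : con A swap.
Proof. by rewrite /swap; ctac. Qed.

Lemma open_preimage_cont (f : R2 -> R2) (V : set R2) : continuous f -> open V -> open (f @^-1` V).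
Proof. by move=> /continuousP; apply. Qed.

Lemma swapK y : swap (swap y) = y.
Proof. by case: y. Qed.

(** Swapping the coordinates puts the expanding direction of the inverse first, so that the unstable
    set can be treated as a stable one. The box shrinks by the factor [lam] because the inverse
    divides the old second coordinate by [lam]. *)
Lemma lsaddle_inv g ginv p W V h k mu lam eta : S2homeo g ginv ->
  lsaddle g p W V h k mu lam eta ->
  lsaddle ginv p W (swap @^-1` V) (fun x => swap (h x)) (fun y => k (swap y))
    lam^-1 mu^-1 (lam * eta).
Proof.
move=> [Sg Si gK _ _] [mu1 lam0 lam1 eta0 oW oV ch ck hk kh box kp Hg].
have mu0 : 0 < mu by rewrite (lt_trans ltr01).
have sub : Bx (lam * eta) `<=` Bx eta by apply: Bx_sub; nra.
split=> //.
- by rewrite invf_gt1.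
- by rewrite invr_gt0.
- by rewrite invf_lt1.
- by rewrite mulr_gt0.
- by apply: open_preimage_cont => //; apply: con_setT; exact: con_swap.
- by apply: (con_comp (g := swap)) ch _ (@con_swap setT).
- by apply: (con_comp (f := swap)) (@con_swap _) _ ck.
- by move=> y Vy; have [? ->] := hk _ Vy; rewrite swapK.
- by move=> x /kh[? ?]; rewrite /preimage /= swapK.
- by move=> y /sub/Bx_swap/box.
- move=> y By; pose z : R2 := (mu^-1 * y.2, lam^-1 * y.1).
  have Bz : Bx eta z.
    move: By => [/andP[? ?] /andP[? ?]].
    have m1 : mu^-1 < 1 by rewrite invf_lt1.
    have m0 : 0 < mu^-1 by rewrite invr_gt0.
    have l1 : lam^-1 * lam = 1 by rewrite mulVf// gt_eqF.
    have l0 : 0 < lam^-1 by rewrite invr_gt0.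
    split; apply/andP; split=> /=; [nra|nra| |].
      by rewrite -[eta]mul1r -l1 -mulrA -mulrN ler_pM2l.
    by rewrite -[leRHS]mul1r -l1 -mulrA ler_pM2l.
  have [_ gz] := Hg z Bz; split; first exact: box Bz.
  rewrite /= !mulrA !divff ?gt_eqF// !mul1r in gz.
  rewrite /swap /= -gz; have [Wz _] := hk _ (box _ Bz).
  by have [->] := gK _ (S2open_sub oW Wz).
Qed.

Section Param.
Variables (g ginv : R3 -> R3) (p : R3) (W : set R3) (V : set R2) (h : R3 -> R2) (k : R2 -> R3).
Variables (mu lam eta : R).
Hypotheses (hom : S2homeo g ginv) (ls : lsaddle g p W V h k mu lam eta).

Let mu1 := ls_mu ls. Let lam0 := ls_lam0 ls. Let lam1 := ls_lam1 ls. Let eta0 := ls_eta ls.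

Lemma ls_kS2 y : V y -> S2 (k y).
Proof. by move=> /(ls_hk ls)[Wk _]; exact: S2open_sub (ls_W ls) _ Wk. Qed.

Lemma ls_kinj y z : V y -> V z -> k y = k z -> y = z.
Proof. by move=> /(ls_hk ls)[_ hy] /(ls_hk ls)[_ hz] e; rewrite -hy e. Qed.

Lemma ls_S2p : S2 p.
Proof. by rewrite -(ls_p ls); apply: ls_kS2; apply: (ls_box ls); apply: Bx0; exact: ltW. Qed.

Lemma ls_near r : 0 < r -> exists2 e, 0 < e & forall x, S2 x -> `|p - x| < e -> exists y, [/\ Bx r y, V y & k y = x].
Proof.
move=> r0; have V0 : V 0 by apply: (ls_box ls); apply: Bx0; exact: ltW.
have [Wp hp] := ls_hk ls V0; rewrite (ls_p ls) in Wp hp.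
have [D oD WD] := ls_W ls.
have nD : nbhs p D by apply: open_nbhs_nbhs; split=> //; move: Wp; rewrite WD => -[].
have nB : nbhs (h p) (Bx r) by rewrite hp; exact: Bx_nbhs.
have /within_cvgP/(_ _ nB) nh := ls_h ls Wp.
have : nbhs p (D `&` [set x | W x -> Bx r (h x)]) by exact: filterI.
move=> /nbhs_ballP[e /= e0 He].
exists e => // x Sx px; have [Dx Hx] : D x /\ (W x -> Bx r (h x)) by apply: He; rewrite -ball_normE.
have Wx : W x by rewrite WD.
by exists (h x); have [? ?] := ls_kh ls Wx; split=> //; exact: Hx.
Qed.

Definition lam_index (s : R) : nat := xget 0%N [set n | `|lam ^+ n * s| <= eta].

Lemma expr_small (q r : R) : 0 < q < 1 -> forall s, exists n, `|q ^+ n * s| <= eta.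
Proof.
move=> /andP[q0 q1] s; have s0 : 0 < `|s| + 1 by rewrite ltr_wpDl.
have := @cvg_expr R q; rewrite ger0_norm ?ltW// => /(_ q1)/cvgrPdist_lt/(_ (eta / (`|s| + 1))).
rewrite divr_gt0// => /(_ isT)[n _ Hn]; exists n.
have := Hn n (leqnn n); rewrite /= sub0r normrN ltr_pdivlMr// => H.
rewrite normrM (le_trans _ (ltW H))// ler_wpM2l// lerDl ler01//.
Qed.

Lemma lam_exp s : exists n, `|lam ^+ n * s| <= eta.
Proof. by apply: expr_small => //; rewrite lam0. Qed.

Lemma lam_decr n s : `|lam ^+ n * s| <= eta -> `|lam ^+ n.+1 * s| <= eta.
Proof.
move=> H; apply: le_trans H; rewrite exprS -mulrA normrM gtr0_norm//.
by rewrite ler_piMl// ltW.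
Qed.

(** The local stable axis is spread over the whole line: [n] contractions bring [s] into the box,
    and [ginv] undoes them on the sphere. Once the box is reached, the result no longer depends on
    [n]. *)
Definition stable_piece n (s : R) := iter n ginv (k (0, lam ^+ n * s)).
Definition stable_param (s : R) := stable_piece (lam_index s) s.

Lemma axis_box r s : `|s| <= r -> Bx r ((0, s) : R2).
Proof.
move=> sr; apply/Bx_norm; rewrite prod_normE /= normr0 ge_max sr andbT.
exact: le_trans sr.
Qed.

Lemma stable_pieceS n s : `|lam ^+ n * s| <= eta -> stable_piece n.+1 s = stable_piece n s.
Proof.
move=> H; rewrite /stable_piece iterSr; congr iter.
have B := axis_box H; have [_ gk] := ls_g ls B.
rewrite /= mulr0 mulrA -exprS in gk; rewrite -gk.
by case: hom => _ _ gK _ _; have [->] := gK _ (ls_kS2 (ls_box ls B)).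
Qed.

Lemma stable_piece_le n m s : (n <= m)%N -> `|lam ^+ n * s| <= eta ->
  stable_piece m s = stable_piece n s /\ `|lam ^+ m * s| <= eta.
Proof.
move=> /subnK <- H; elim: (m - n)%N => [//|j [IH1 IH2]].
by rewrite addSn stable_pieceS// IH1; split=> //; exact: lam_decr.
Qed.

Lemma stable_paramE n s : `|lam ^+ n * s| <= eta -> stable_param s = stable_piece n s.
Proof.
move=> H; have H' : `|lam ^+ lam_index s * s| <= eta.
  exact: (@xgetPex _ 0%N [set n | `|lam ^+ n * s| <= eta] (lam_exp s)).
rewrite /stable_param; have [le|/ltnW le] := leqP n (lam_index s).
  by have [] := stable_piece_le le H.
by have [] := stable_piece_le le H'.
Qed.

Lemma stable_local s : `|s| <= eta -> stable_param s = k (0, s).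
Proof. by move=> H; rewrite (@stable_paramE 0) /stable_piece /= expr0 mul1r. Qed.

Lemma stable_param0 : stable_param 0 = p.
Proof. by rewrite stable_local ?normr0 ?ltW// (ls_p ls). Qed.

Let Sg x : S2 x -> S2 (g x). Proof. by case: hom => H _ _ _ _; exact: H. Qed.
Let Si x : S2 x -> S2 (ginv x). Proof. by case: hom => _ H _ _ _; exact: H. Qed.
Let gK x : S2 x -> ginv (g x) = x. Proof. by case: hom => _ _ H _ _ /H[]. Qed.
Let giK x : S2 x -> g (ginv x) = x. Proof. by case: hom => _ _ H _ _ /H[]. Qed.

Lemma iter_S2 n x : S2 x -> S2 (iter n ginv x).
Proof. by move=> Sx; elim: n => //= n; exact: Si. Qed.

Lemma iterg_S2 n x : S2 x -> S2 (iter n g x).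
Proof. by move=> Sx; elim: n => //= n; exact: Sg. Qed.

Lemma iter_inj n x y : S2 x -> S2 y -> iter n ginv x = iter n ginv y -> x = y.
Proof.
move=> Sx Sy; elim: n => //= n IH e; apply: IH.
by rewrite -(giK (iter_S2 n Sx)) e giK//; exact: iter_S2.
Qed.

Lemma iterg_inj n x y : S2 x -> S2 y -> iter n g x = iter n g y -> x = y.
Proof.
move=> Sx Sy; elim: n => //= n IH e; apply: IH.
by rewrite -(gK (iterg_S2 n Sx)) e gK//; exact: iterg_S2.
Qed.

Lemma stable_S2 s : S2 (stable_param s).
Proof.
have [n H] := lam_exp s; rewrite (stable_paramE H); apply: iter_S2; apply: ls_kS2.
exact/(ls_box ls)/axis_box.
Qed.

Lemma stable_g s : g (stable_param s) = stable_param (lam * s).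
Proof.
have [n H] := lam_exp s; have H1 := lam_decr H; rewrite (stable_paramE H1).
have H2 : `|lam ^+ n * (lam * s)| <= eta by rewrite mulrA -exprSr.
rewrite (stable_paramE H2) /stable_piece /= giK ?mulrA -?exprSr//.
by apply: iter_S2; apply: ls_kS2; apply/(ls_box ls)/axis_box.
Qed.

Lemma stable_iter n s : iter n g (stable_param s) = stable_param (lam ^+ n * s).
Proof. by elim: n => [|n IH]; rewrite ?expr0 ?mul1r//= IH stable_g mulrA -exprS. Qed.

Lemma stable_ginv s : ginv (stable_param s) = stable_param (lam^-1 * s).
Proof.
have e : s = lam * (lam^-1 * s) by rewrite mulrA divff ?mul1r// gt_eqF.
by rewrite {1}e -stable_g gK//; exact: stable_S2.
Qed.

Lemma stable_inj : injective stable_param.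
Proof.
move=> s t; have [n Hn] := lam_exp s; have [m Hm] := lam_exp t.
have [_ Hs] := stable_piece_le (leq_maxl n m) Hn; have [_ Ht] := stable_piece_le (leq_maxr n m) Hm.
rewrite (stable_paramE Hs) (stable_paramE Ht).
move=> /(iter_inj (ls_kS2 (ls_box ls (axis_box Hs))) (ls_kS2 (ls_box ls (axis_box Ht)))).
move=> /(ls_kinj (ls_box ls (axis_box Hs)) (ls_box ls (axis_box Ht)))[] /mulfI; apply.
by rewrite expf_neq0// gt_eqF.
Qed.

Lemma con_iter n : con S2 (iter n ginv).
Proof.
elim: n => [|n IH]; first exact: con_id.
have ci : con S2 ginv by case: hom => _ _ _ _ /conP.
by apply: (con_comp (f := iter n ginv)) IH _ ci => x; exact: iter_S2.
Qed.

Lemma stable_continuous : continuous stable_param.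
Proof.
move=> s; pose M := `|s| + 1; have M0 : 0 < M by rewrite ltr_wpDl.
have [n Hn] := lam_exp M.
have small t : cc (- M) M t -> `|lam ^+ n * t| <= eta.
  rewrite /cc /= -ler_norml => tM; apply: le_trans Hn; rewrite !normrM.
  by rewrite ler_wpM2l// [leRHS]ger0_norm// ltW.
apply: (@con_nbhs _ _ (cc (- M) M)).
  apply: (con_eq (f := stable_piece n)); first by move=> t /small/stable_paramE.
  apply: (con_comp (f := fun t => k (0, lam ^+ n * t)) (B := S2)); last exact: con_iter.
    apply: (con_comp (f := fun t : R => (0, lam ^+ n * t)) (B := V)); last exact: ls_k ls.
      by apply: con_pair; [exact: con_cst|apply: conM; [exact: con_cst|exact: con_id]].
    by move=> t /small/axis_box/(ls_box ls).
  by move=> t /small/axis_box/(ls_box ls)/ls_kS2.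
have : nbhs s [set t | `|t - s| < 1] by exact: nbhs_dist.
apply: filterS => t /= ts; rewrite /cc /= -ler_norml.
by rewrite /M -[t](subrK s) (le_trans (ler_normD _ _))// addrC lerD2l ltW.
Qed.

(** From some time on the orbit stays in the box, where it is linear; a nonzero first coordinate
    would grow like the powers of [mu]. *)
Lemma stable_range x : stable_set g p x -> exists s, stable_param s = x.
Proof.
move=> [Sx /cvgrPdist_lt xp]; have [e e0 He] := ls_near eta0.
have [N _ HN] := xp e e0.
have HY n : (N <= n)%N -> exists y, [/\ Bx eta y, V y & k y = iter n g x].
  by move=> Nn; apply: He; [exact: iterg_S2|exact: HN].
have [y [By Vy ky]] := HY N (leqnn _).
have pow m : Bx eta (mu ^+ m * y.1, lam ^+ m * y.2) /\ k (mu ^+ m * y.1, lam ^+ m * y.2) = iter (m + N) g x.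
  elim: m => [|m [IH1 IH2]]; first by rewrite !expr0 !mul1r -surjective_pairing.
  have [z [Bz Vz kz]] := HY (m.+1 + N)%N (leq_addl _ _).
  have [VL gL] := ls_g ls IH1; rewrite IH2 /= !mulrA -!exprS in VL gL.
  have zE : z = (mu ^+ m.+1 * y.1, lam ^+ m.+1 * y.2) by apply: ls_kinj => //; rewrite kz -gL.
  by rewrite -zE kz.
have y10 : y.1 = 0.
  apply/eqP; apply/negPn/negP => y1; have mui : 0 < mu^-1 < 1.
    by rewrite invr_gt0 invf_lt1 ?(lt_trans ltr01)//= mu1.
  have yn : 0 < `|y.1| by rewrite normr_gt0.
  (* The constant is chosen so that [mu ^+ m] times the first coordinate is at least [2 * eta] in
     absolute value, beyond the box. *)
  have [m Hm] := @expr_small mu^-1 0 mui (2 * eta * eta / `|y.1|).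
  have mum : 0 < mu ^+ m by rewrite exprn_gt0// (lt_trans ltr01).
  have [/Bx_norm Bm _] := pow m; move: Bm; rewrite prod_normE ge_max /= => /andP[+ _].
  rewrite normrM (gtr0_norm mum) => h1; move: Hm.
  rewrite -mulrA normrM exprVn gtr0_norm ?invr_gt0// gtr0_norm; last first.
    by rewrite !mulr_gt0 ?invr_gt0.
  rewrite ler_pdivrMl// !mulrA ler_pdivrMr// => H.
  by move: h1 H mum yn eta0; move: `|y.1| (mu ^+ m) => b m' *; nra.
have yN : `|y.2| <= eta by move: By => /Bx_norm; rewrite prod_normE ge_max => /andP[].
exists (lam^-1 ^+ N * y.2); apply: (@iterg_inj N) => //; first exact: stable_S2.
rewrite stable_iter exprVn mulrA divff ?mul1r; last by rewrite expf_neq0// gt_eqF.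
by rewrite stable_local// -ky -y10 -surjective_pairing.
Qed.

(** [g] multiplies the parameter by [lam], so it preserves each end of the line. A limit of an end
    is therefore a fixed point of [g], and on the line only the parameter 0 is fixed. *)
Lemma stable_ends : proper_ends stable_param.
Proof.
move=> s H; suff e : g (stable_param s) = stable_param s.
  move: e; rewrite stable_g => /stable_inj e; apply/eqP; apply: contraTT isT => s0.
  by have : lam = 1 by [apply: (mulIf s0); rewrite mul1r|]; move: lam1 => /[swap] ->; rewrite ltxx.
have [e [e2 He]] : exists e : R, e ^+ 2 = 1 /\ tends_at_infinity (fun t => stable_param (e * t)) (stable_param s).
  case: H => H; [exists 1|exists (-1)]; split; rewrite ?sqrrN ?expr1n//.
    by rewrite (_ : (fun t => _) = stable_param)//; apply/funext => t; rewrite mul1r.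
  by rewrite (_ : (fun t => _) = (fun t => stable_param (- t)))//; apply/funext => t; rewrite mulN1r.
apply/eqP; rewrite -subr_eq0 -normr_eq0; apply: contraT => n0.
have n0' : 0 < `|g (stable_param s) - stable_param s| by rewrite lt_neqAle eq_sym n0 normr_ge0.
pose d := `|g (stable_param s) - stable_param s| / 2; have d0 : 0 < d by rewrite divr_gt0.
have cg : con S2 g by case: hom => _ _ _ /conP.
have /con_eps/(_ _ (stable_S2 s) d d0)[r r0 Hr] := cg.
have [M HM] := He r r0; have [N HN] := He d d0.
pose t := `|M| + `|N| / lam.
have lamN : lam * (`|N| / lam) = `|N| by rewrite mulrCA divff ?mulr1// gt_eqF.
have nl : 0 <= `|N| / lam by rewrite divr_ge0// ltW.
have Mt : M <= t by rewrite (le_trans (ler_norm M))// lerDl.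
have Nt : N <= lam * t.
  by rewrite (le_trans (ler_norm N))// mulrDr lamN lerDr mulr_ge0// ltW.
have := Hr _ (stable_S2 (e * t)) (HM t Mt); rewrite (stable_g (e * t)) mulrCA => h1.
have h2 := HN _ Nt.
have := ler_distD (stable_param (e * (lam * t))) (g (stable_param s)) (stable_param s).
rewrite (distrC (stable_param (e * (lam * t)))) => h3.
have : `|g (stable_param s) - stable_param s| < d + d by rewrite (le_lt_trans h3)// ltrD.
by rewrite /d -splitr ltxx.
Qed.

(** [ginv] divides the parameter by [lam], hence moves the points of the end along it towards the
    limit [p]. This allows an arc of one curve to be studied again as an arc of the other. *)
Lemma stable_end_unstable c : c != 0 -> tends_at_infinity (fun t => stable_param (c * t)) p ->
  forall t, 1 <= t -> stable_set ginv p (stable_param (c * t)).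
Proof.
move=> c0 H t t1; split; first exact: stable_S2.
have itE n : iter n ginv (stable_param (c * t)) = stable_param (c * (lam^-1 ^+ n * t)).
  elim: n => [|n IH] /=; first by rewrite expr0 mul1r.
  by rewrite IH stable_ginv exprS; congr stable_param; ring.
apply/cvgrPdist_lt => e e0; have [M HM] := H e e0.
have [n Hn] := @lam_exp (`|M| * eta).
have ln m : 0 < lam ^+ m by rewrite exprn_gt0.
have big m : (n <= m)%N -> M <= lam^-1 ^+ m * t.
  move=> nm; rewrite exprVn; apply: (le_trans (ler_norm M)).
  have le1 : lam ^+ m <= lam ^+ n by rewrite ler_wiXn2l// ltW.
  have hM : lam ^+ n * `|M| <= 1.
    move: Hn; rewrite mulrA ger0_norm; last by rewrite !mulr_ge0// ltW.
    by rewrite -[leRHS]mul1r ler_pM2r.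
  rewrite ler_pdivlMl//; apply: (le_trans _ t1); apply: le_trans hM.
  by rewrite ler_wpM2r.
by exists n => // m /= nm; rewrite itE; apply: HM; exact: big.
Qed.

End Param.
End Saddle.

(** * Normalized coordinates for the loop *)

Section Setup.
Variable R : realType.
Local Notation R3 := (R * R * R)%type.
Local Notation R2 := (R * R)%type.
Local Notation S2 := (@S2 R).
Implicit Types (g : R3 -> R3).

Lemma S2homeo_sym g ginv : S2homeo g ginv -> S2homeo ginv g.
Proof. by move=> [a b c d e]; split=> // x /c[]. Qed.

Lemma lsaddle_shrink g p W V h k mu lam eta eta' : 0 < eta' -> eta' <= eta ->
  lsaddle g p W V h k mu lam eta -> lsaddle g p W V h k mu lam eta'.
Proof.
move=> e0 ee [mu1 lam0 lam1 eta0 oW oV ch ck hk kh box kp Hg]; split=> //.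
  by move=> y /(Bx_sub ee)/box.
by move=> y /(Bx_sub ee)/Hg.
Qed.

Definition flip (e1 e2 : R) (y : R2) : R2 := (e1 * y.1, e2 * y.2).

Lemma con_flip e1 e2 (A : set R2) : con A (flip e1 e2).
Proof. by rewrite /flip; ctac. Qed.

Lemma lsaddle_flip g p W V h k mu lam eta e1 e2 : (e1 = 1 \/ e1 = -1) -> (e2 = 1 \/ e2 = -1) ->
  lsaddle g p W V h k mu lam eta ->
  lsaddle g p W (flip e1 e2 @^-1` V) (fun x => flip e1 e2 (h x)) (fun y => k (flip e1 e2 y)) mu lam eta.
Proof.
move=> E1 E2 [mu1 lam0 lam1 eta0 oW oV ch ck hk kh box kp Hg].
have ee1 : e1 * e1 = 1 by case: E1 => ->; ring.
have ee2 : e2 * e2 = 1 by case: E2 => ->; ring.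
have fK y : flip e1 e2 (flip e1 e2 y) = y.
  by case: y => a b; rewrite /flip /= !mulrA ee1 ee2 !mul1r.
have fB y : Bx eta y -> Bx eta (flip e1 e2 y).
  move=> /Bx_norm h0; apply/Bx_norm; move: h0; rewrite !prod_normE /= !normrM.
  have -> : `|e1| = 1 by case: E1 => ->; rewrite ?normrN normr1.
  have -> : `|e2| = 1 by case: E2 => ->; rewrite ?normrN normr1.
  by rewrite !mul1r.
split=> //.
- by apply: open_preimage_cont => //; apply: con_setT; exact: con_flip.
- by apply: (con_comp (g := flip e1 e2)) ch _ (@con_flip e1 e2 setT).
- by apply: (con_comp (f := flip e1 e2)) (@con_flip e1 e2 _) _ ck.
- by move=> y Vy; have [? ->] := hk _ Vy; rewrite fK.
- by move=> x /kh[? ?]; rewrite /preimage /= fK.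
- by move=> y /fB/box.
- by rewrite /flip /= !mulr0.
- move=> y /fB/Hg [/= V1 gk].
  have E : flip e1 e2 (mu * y.1, lam * y.2) = (mu * (e1 * y.1), lam * (e2 * y.2)).
    by rewrite /flip /=; congr pair; ring.
  by rewrite /preimage /= E.
Qed.

(** Signs are normalized by reflecting the axes: both branches leave [p] along positive half axes,
    so that near [p] one side of the loop is the first quadrant. *)
Record hloop g (k : R2 -> R3) (mu lam eta : R) (a b : R -> R3) (c d : R) (L : set R3) : Prop := HLoop {
  hl_ca : continuous a; hl_ia : injective a; hl_aS : forall s, S2 (a s);
  hl_a : forall s, `|s| <= eta -> a s = k (0, s); hl_ga : forall s, g (a s) = a (lam * s);
  hl_cb : continuous b; hl_ib : injective b; hl_bS : forall s, S2 (b s);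
  hl_b : forall s, `|s| <= eta -> b s = k (s, 0); hl_gb : forall s, g (b s) = b (mu * s);
  hl_c : 0 < c; hl_d : 0 < d; hl_cd : a c = b d;
  hl_L : L = a @` cc 0 c `|` b @` cc 0 d;
  hl_meet : forall s t, cc 0 c s -> cc 0 d t -> a s = b t -> (s = 0 /\ t = 0) \/ (s = c /\ t = d) }.

Lemma half_arcE (V : normedModType R) (a : R -> V) c : 0 < c -> half_arc a c = a @` cc 0 c.
Proof.
move=> c0; apply/seteqP; split=> [_ [t /I01P/andP[? ?] <-]|_ [t /andP[t0 t1] <-]].
  by exists (c * t) => //; apply/andP; split; nra.
exists (t / c); last by rewrite mulrCA divff ?mulr1// gt_eqF.
by apply/I01P; rewrite divr_ge0 ?(ltW c0)//= ler_pdivrMr// mul1r.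
Qed.

Lemma loop_setup g ginv p p' Js Ju : S2homeo g ginv -> direct_saddle g p -> p' <> p ->
  is_arc Js p p' -> Js `<=` Ws g p -> is_arc Ju p p' -> Ju `<=` Ws ginv p ->
  Js `&` Ju = [set p] `|` [set p'] ->
  exists W V h k mu lam eta a b c d, lsaddle g p W V h k mu lam eta /\
    hloop g k mu lam eta a b c d (Js `|` Ju).
Proof.
move=> hom ds pp'; have [W [V [h [k [mu [lam [eta0 ls0]]]]]]] := direct_saddle_lsaddle hom ds.
move=> [gs [/conP cgs igs gs0 gs1 JsE]] JsW [gu [/conP cgu igu gu0 gu1 JuE]] JuW meet.
have hom' := S2homeo_sym hom; have lsi := lsaddle_inv hom ls0.
have mu1 := ls_mu ls0; have lam0 := ls_lam0 ls0; have lam1 := ls_lam1 ls0; have e0 := ls_eta ls0.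
pose a := stable_param ginv k lam eta0.
pose b := stable_param g (fun y => k (swap y)) mu^-1 (lam * eta0).
have mu0 : mu != 0 by rewrite gt_eqF// (lt_trans ltr01).
have ra x : stable_set g p x -> range a x.
  by move=> /(stable_range hom ls0)[s <-]; exists s.
have rb x : stable_set ginv p x -> range b x.
  by move=> /(stable_range hom' lsi)[s <-]; exists s.
have a0 : a 0 = p := stable_param0 hom ls0.
have b0 : b 0 = p := stable_param0 hom' lsi.
have p'Js : Js p' by rewrite JsE; exists 1 => //; exact: I011.
have p'Ju : Ju p' by rewrite JuE; exists 1 => //; exact: I011.
have [c _ ac] : range a p' by apply: ra; have := JsW _ p'Js; exact: connected_component_sub.
have [d _ bd] : range b p' by apply: rb; have := JuW _ p'Ju; exact: connected_component_sub.
have c0 : c != 0 by apply/eqP => e; apply: pp'; rewrite -ac e a0.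
have d0 : d != 0 by apply/eqP => e; apply: pp'; rewrite -bd e b0.
have gb s : g (b s) = b (mu * s).
  by rewrite (stable_ginv hom' lsi) invrK.
have [LE IE] : gs @` I01 `|` gu @` I01 = half_arc a c `|` half_arc b d /\
  half_arc a c `&` half_arc b d = [set p] `|` [set p'].
  apply: (@loop_standard _ _ g a b lam mu c d p p' gs gu) => //.
  - exact: (stable_continuous hom ls0).
  - exact: (stable_inj hom ls0).
  - exact: (stable_ends hom ls0).
  - exact: (stable_continuous hom' lsi).
  - exact: (stable_inj hom' lsi).
  - exact: (stable_ends hom' lsi).
  - exact: (stable_g hom ls0).
  - move=> H x [->|[t /= t1 <-]]; first by rewrite a0 -b0; exists 0.
    by apply: rb; exact: (stable_end_unstable hom ls0 c0 H).
  - move=> H x [->|[t /= t1 <-]]; first by rewrite b0 -a0; exists 0.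
    by apply: ra; exact: (stable_end_unstable hom' lsi d0 H).
  - by move=> x gx; apply: ra; apply: (@connected_component_sub _ _ p); apply: JsW; rewrite JsE.
  - by move=> x gx; apply: rb; apply: (@connected_component_sub _ _ p); apply: JuW; rewrite JuE.
  - by rewrite -meet JsE JuE.
have [e1 [E1 e1d]] : exists e1, (e1 = 1 \/ e1 = -1) /\ 0 < e1 * d.
  have [dn|dp] := ltP d 0; first by exists (-1); split; [right|rewrite mulN1r oppr_gt0].
  by exists 1; split; [left|rewrite mul1r lt_neqAle eq_sym d0].
have [e2 [E2 e2c]] : exists e2, (e2 = 1 \/ e2 = -1) /\ 0 < e2 * c.
  have [dn|dp] := ltP c 0; first by exists (-1); split; [right|rewrite mulN1r oppr_gt0].
  by exists 1; split; [left|rewrite mul1r lt_neqAle eq_sym c0].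
have ee1 : e1 * e1 = 1 by case: E1 => ->; ring.
have ee2 : e2 * e2 = 1 by case: E2 => ->; ring.
have hE (f : R -> R3) e x : (e = 1 \/ e = -1) -> half_arc f x = half_arc (fun t => f (e * t)) (e * x).
  move=> He; have ee : e * e = 1 by case: He => ->; ring.
  rewrite /half_arc; apply: eq_imagel => t _; congr f; rewrite !mulrA ee; ring.
(* The smaller of the two boxes, valid for [g] and for its inverse. *)
pose eta := lam * eta0; have eta0' : 0 < eta by rewrite mulr_gt0.
have etale : eta <= eta0 by rewrite /eta ler_piMl// ltW.
exists W, (flip e1 e2 @^-1` V), (fun x => flip e1 e2 (h x)), (fun y => k (flip e1 e2 y)), mu, lam, eta.
exists (fun s => a (e2 * s)), (fun s => b (e1 * s)), (e2 * c), (e1 * d).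
split; first exact: lsaddle_flip (lsaddle_shrink eta0' etale ls0).
have n1 : `|e1| = 1 by case: E1 => ->; rewrite ?normrN normr1.
have n2 : `|e2| = 1 by case: E2 => ->; rewrite ?normrN normr1.
have cmul_e (e : R) : continuous (fun s : R => e * s).
  by move=> s; apply: continuousM; [exact: cst_continuous|].
have e1n : e1 != 0 by rewrite -normr_eq0 n1 oner_eq0.
have e2n : e2 != 0 by rewrite -normr_eq0 n2 oner_eq0.
split=> //.
- by move=> s; apply: continuous_comp; [exact: cmul_e|exact: (stable_continuous hom ls0)].
- by move=> s t /(stable_inj hom ls0)/(mulfI e2n).
- by move=> s; exact: (stable_S2 hom ls0).
- move=> s hs; rewrite /a (stable_local hom ls0); first by rewrite /flip /= mulr0.
  by rewrite normrM n2 mul1r (le_trans hs).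
- by move=> s; rewrite /a (stable_g hom ls0) mulrCA.
- by move=> s; apply: continuous_comp; [exact: cmul_e|exact: (stable_continuous hom' lsi)].
- by move=> s t /(stable_inj hom' lsi)/(mulfI e1n).
- by move=> s; exact: (stable_S2 hom' lsi).
- move=> s hs; rewrite /b (stable_local hom' lsi); first by rewrite /flip /swap /= mulr0.
  by rewrite normrM n1 mul1r.
- by move=> s; rewrite gb mulrCA.
- by rewrite !mulrA ee1 ee2 !mul1r ac bd.
- by rewrite JsE JuE LE (hE a e2 c E2) (hE b e1 d E1) !half_arcE.
- move=> s t hs ht e.
  have : (half_arc a c `&` half_arc b d) (a (e2 * s)).
    rewrite (hE a e2 c E2) (hE b e1 d E1) !half_arcE//; split; first by exists s.
    by rewrite e; exists t.
  rewrite IE => -[e'|e']; [left|right]; split.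
  + by apply: (mulfI e2n); rewrite mulr0; apply: (stable_inj hom ls0); rewrite -/a a0 -e'.
  + by apply: (mulfI e1n); rewrite mulr0; apply: (stable_inj hom' lsi); rewrite -/b b0 -e -e'.
  + apply: (mulfI e2n); rewrite mulrA ee2 mul1r.
    by apply: (stable_inj hom ls0); rewrite -/a ac -e'.
  + apply: (mulfI e1n); rewrite mulrA ee1 mul1r.
    by apply: (stable_inj hom' lsi); rewrite -/b bd -e -e'.
Qed.

End Setup.

(** * Charts of the sphere *)

Section Charts.
Variable R : realType.
Local Notation R3 := (R * R * R)%type.
Local Notation R2 := (R * R)%type.
Local Notation S2 := (@S2 R).

Lemma S2_compact : compact S2.
Proof.
have cB : compact ((`[-1, 1]%classic `*` `[-1, 1]%classic) `*` `[-1, 1]%classic : set R3).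
  by apply: compact_setX; [apply: compact_setX|]; exact: segment_compact.
have cn : con ((`[-1, 1]%classic `*` `[-1, 1]%classic) `*` `[-1, 1]%classic : set R3)
    (fun x : R3 => x.1.1 ^+ 2 + x.1.2 ^+ 2 + x.2 ^+ 2) by ctac.
have cl1 : closed [set (1 : R)].
  by apply: compact_closed; [exact: Rhausdorff|exact: compact_set1].
have := compact_preimage cn cB cl1.
rewrite (_ : _ `&` _ = S2)//; apply/seteqP; split=> [x [_]//|[[a b] c] /= e].
split=> //; rewrite /Defs.S2 /= in e; split; [split|]; rewrite /= in_itv /=; apply/andP;
  by have := sqr_ge0 a; have := sqr_ge0 b; have := sqr_ge0 c; split; nra.
Qed.

Lemma R3_hausdorff : hausdorff_space R3. Proof. exact: norm_hausdorff. Qed.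

Lemma n2_norm (z : R2) : `|z| ^+ 2 <= n2 z <= 2 * `|z| ^+ 2.
Proof.
case: z => a b; rewrite prod_normE /n2 /= -(real_normK (num_real a)) -(real_normK (num_real b)).
have := normr_ge0 a; have := normr_ge0 b; move: `|a| `|b| => x y ? ?.
rewrite maxEle; case: ifP => [h|/negbT]; last rewrite -ltNge => h; apply/andP; split; nra.
Qed.

Lemma cinv_norm (z : R2) e : 0 < e -> e^-1 < `|z| -> `|cinv z| < e.
Proof.
move=> e0 ez; have z0 : z != 0.
  by rewrite -normr_gt0 (lt_trans _ ez)// invr_gt0.
have /andP[h1 _] := n2_norm (cinv z); have /andP[h2 _] := n2_norm z.
have zp : 0 < `|z| by rewrite normr_gt0.
have n0 := n2_gt0 z0; have e1 : 0 < e^-1 by rewrite invr_gt0.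
have h3 : e ^- 2 < `|z| ^+ 2 by rewrite -exprVn; nra.
have h : `|cinv z| ^+ 2 < e ^+ 2.
  apply: (le_lt_trans h1); rewrite n2V invf_plt ?posrE ?exprn_gt0//.
  exact: lt_le_trans h2.
by have := normr_ge0 (cinv z); nra.
Qed.

Lemma cinv_large (z : R2) K : 0 < K -> z <> 0 -> `|z| < (2 * K)^-1 -> K < `|cinv z|.
Proof.
move=> K0 /eqP z0 zK; rewrite ltNge; apply/negP => cK.
have /andP[_ h1] := n2_norm (cinv z); have /andP[_ h2] := n2_norm z; rewrite n2V in h1.
have np := n2_gt0 z0; have zp : 0 < `|z| by rewrite normr_gt0.
have cp := normr_ge0 (cinv z).
have h3 : 2 * K * `|z| < 1 by move: zK; rewrite -[_^-1]div1r ltr_pdivlMr ?mulr_gt0// mulrC.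
have h4 : (n2 z)^-1 <= 2 * K ^+ 2 by apply: (le_trans h1); rewrite ler_pM2l// ler_pXn2r ?nnegrE// ltW.
have h5 : 1 <= 2 * K ^+ 2 * n2 z by rewrite -ler_pdivrMr// mul1r.
have h6 : 2 * K ^+ 2 * n2 z <= (2 * K * `|z|) ^+ 2.
  by rewrite (le_trans (ler_wpM2l _ h2)) ?mulr_ge0 ?sqr_ge0//; lra.
have : (2 * K * `|z|) ^+ 2 < 1 by rewrite expr_lt1// !mulr_ge0// ltW.
by lra.
Qed.

Section Chart.
Variables (q : R3) (phi : R3 -> R2) (psi : R2 -> R3).
Hypothesis ch : S2chart q phi psi.

Lemma chart_psiK x : S2 x -> x <> q -> psi (phi x) = x.
Proof. by case: ch => _ H _ _ _; exact: H. Qed.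
Lemma chart_S2 y : S2 (psi y). Proof. by case: ch => _ _ /(_ y)[]. Qed.
Lemma chart_neq y : psi y <> q. Proof. by case: ch => _ _ /(_ y)[]. Qed.
Lemma chart_phiK y : phi (psi y) = y. Proof. by case: ch => _ _ /(_ y)[]. Qed.
Lemma chart_con : con (S2 `\ q) phi. Proof. by case: ch => _ _ _ /conP. Qed.
Lemma chart_psi_cont : continuous psi. Proof. by case: ch. Qed.
Lemma chart_S2q : S2 q. Proof. by case: ch. Qed.
Lemma chart_inj x y : S2 x -> S2 y -> x <> q -> y <> q -> phi x = phi y -> x = y.
Proof. by move=> Sx Sy xq yq e; rewrite -(chart_psiK Sx xq) e chart_psiK. Qed.

(** The image of a bounded box is compact and misses the pole [q], so a whole neighbourhood of [q]
    misses it. *)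
Lemma chart_unbounded M : exists2 e, 0 < e & forall x, S2 x -> x <> q -> `|q - x| < e -> M < `|phi x|.
Proof.
have cK : compact (psi @` Bx M).
  apply: con_image_compact; last exact: rect_compact.
  by apply: con_continuous; exact: chart_psi_cont.
have cl : closed (psi @` Bx M) by apply: compact_closed => //; exact: R3_hausdorff.
have : nbhs q (~` (psi @` Bx M)).
  by apply: open_nbhs_nbhs; split; [exact: closed_openC|move=> [y _] /=; exact: chart_neq].
move=> /nbhs_ballP[e /= e0 He]; exists e => // x Sx xq qx; rewrite ltNge; apply/negP => xM.
apply: (He x); first by rewrite -ball_normE.
by exists (phi x); [exact/Bx_norm|rewrite chart_psiK].
Qed.

Lemma chart_tends e : 0 < e -> exists2 M, 0 < M & forall y, M <= `|y| -> `|q - psi y| < e.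
Proof.
move=> e0; pose K := S2 `&` [set x | e <= `|q - x|].
have cn : con setT (fun x : R3 => `|q - x|).
  apply: (con_comp1 (f := fun x : R3 => q - x) (g := fun z : R3 => `|z|)); first by ctac.
  exact: norm_continuous.
have cK : compact K.
  have [D cD DE] := con_preimage_closed cn (@closed_ge R e).
  apply: compact_closedI; first exact: S2_compact.
  by move: DE; rewrite !setTI => E; rewrite (_ : [set x | _] = D)// -E.
have cph : con K (fun x => `|phi x|).
  apply: (con_comp1 (f := phi)); last exact: norm_continuous.
  apply: con_subset chart_con => x [Sx /= ex]; split=> // xq.
  by rewrite xq subrr normr0 leNgt e0 in ex.
have [M M0 HM] := compact_upper_bound cK cph.
exists M => // y My; rewrite ltNge; apply/negP => ey.
by have := HM (psi y) (conj (chart_S2 y) ey); rewrite chart_phiK ltNge My.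
Qed.

Variable q0 : R3.
Hypotheses (Sq0 : S2 q0) (q0q : q0 <> q).

(** The inversion about [phi q0]: the pole of the chart moves from [q] to [q0], and [q] becomes the
    origin. *)
Definition inv_phi (x : R3) : R2 := if `[< x = q >] then 0 else cinv (phi x - phi q0).
Definition inv_psi (y : R2) : R3 := if `[< y = 0 >] then q else psi (cinv y + phi q0).

Lemma inv_phi_q : inv_phi q = 0. Proof. by rewrite /inv_phi; case: asboolP. Qed.
Lemma inv_phiE x : x <> q -> inv_phi x = cinv (phi x - phi q0).
Proof. by rewrite /inv_phi; case: asboolP. Qed.
Lemma inv_psi0 : inv_psi 0 = q. Proof. by rewrite /inv_psi; case: asboolP. Qed.
Lemma inv_psiE y : y <> 0 -> inv_psi y = psi (cinv y + phi q0).
Proof. by rewrite /inv_psi; case: asboolP. Qed.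

Lemma phi_neq x : S2 x -> x <> q -> x <> q0 -> phi x - phi q0 != 0.
Proof.
move=> Sx xq xq0; rewrite subr_eq0; apply/eqP => /(chart_inj Sx Sq0 xq q0q); exact: xq0.
Qed.

(** Only the continuity at [q], respectively at 0, is not formal: it expresses that approaching [q]
    on the sphere is the same as going to infinity in the plane. *)
Lemma inversion_chart : S2chart q0 inv_phi inv_psi.
Proof.
split=> //.
- move=> x Sx xq0; have [->|xq] := pselect (x = q); first by rewrite inv_phi_q inv_psi0.
  rewrite (inv_phiE xq) inv_psiE; last by apply/eqP; rewrite cinv_eq0; exact: phi_neq.
  by rewrite cinvK subrK chart_psiK.
- move=> y; have [->|y0] := pselect (y = 0).
    by rewrite inv_psi0 inv_phi_q; split=> //; [exact: chart_S2q|move/esym].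
  rewrite (inv_psiE y0); split; first exact: chart_S2.
    move=> e; have := chart_phiK (cinv y + phi q0); rewrite e => /eqP.
    by rewrite -subr_eq0 opprD addrCA subrr addr0 oppr_eq0 cinv_eq0 => /eqP.
  by rewrite inv_phiE ?chart_phiK ?addrK ?cinvK//; exact: chart_neq.
- apply/conP/con_eps => x [Sx /= xq0] e e0.
  have [->|xq] := pselect (x = q).
    have [d d0 Hd] := chart_unbounded (e^-1 + `|phi q0|).
    exists d => // y [Sy /= yq0] qy; rewrite inv_phi_q sub0r normrN.
    have [->|yq] := pselect (y = q); first by rewrite inv_phi_q normr0.
    rewrite (inv_phiE yq); apply: cinv_norm => //.
    have := Hd y Sy yq qy; have := ler_normB (phi y - phi q0) (- phi q0); rewrite opprK subrK normrN.
    lra.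
  have cA : con ((S2 `\ q) `\ q0) (fun x => cinv (phi x - phi q0)).
    apply: con_cinv; first by move=> w [[Sw /= wq] /= wq0]; exact: phi_neq.
    by apply: conB; [apply: con_subset chart_con => w []|exact: con_cst].
  have xA : ((S2 `\ q) `\ q0) x by [].
  have /con_eps/(_ x xA e e0)[d d0 Hd] := cA.
  have qx : 0 < `|x - q| by rewrite normr_gt0 subr_eq0; apply/eqP.
  exists (Num.min d `|x - q|); first by rewrite lt_min d0.
  move=> y [Sy /= yq0]; rewrite lt_min => /andP[xd xy].
  have yq : y <> q by move=> e'; rewrite e' ltxx in xy.
  by rewrite !inv_phiE//; apply: Hd.
- apply: con_setT; apply/con_eps => y _ e e0.
  have [->|y0] := pselect (y = 0).
    have [M M0 HM] := chart_tends e0; rewrite inv_psi0.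
    pose K := M + `|phi q0|; have K0 : 0 < K by rewrite ltr_pwDl.
    exists (2 * K)^-1; first by rewrite invr_gt0 mulr_gt0.
    move=> z _; rewrite sub0r normrN => zK.
    have [->|z0] := pselect (z = 0); first by rewrite inv_psi0 subrr normr0.
    rewrite (inv_psiE z0); apply: HM.
    have := cinv_large K0 z0 zK; have := ler_normB (cinv z + phi q0) (phi q0).
    by rewrite addrK /K; lra.
  have cA : con [set z : R2 | z != 0] (fun z => psi (cinv z + phi q0)).
    apply: (con_comp1 (f := fun z => cinv z + phi q0)); last exact: chart_psi_cont.
    by apply: conD; [apply: con_cinv => //; exact: con_id|exact: con_cst].
  have yn : y != 0 by apply/eqP.
  have /con_eps/(_ y yn e e0)[d d0 Hd] := cA.
  exists (Num.min d `|y|); first by rewrite lt_min d0 normr_gt0.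
  move=> z _; rewrite lt_min => /andP[yd yy].
  have z0 : z <> 0 by move=> e'; rewrite e' subr0 ltxx in yy.
  by rewrite !inv_psiE//; apply: Hd => //; apply/eqP.
Qed.

End Chart.
End Charts.

(** * The saddle coordinate seen from infinity *)

Section LocalDegree.
Variable R : realType.
Local Notation R3 := (R * R * R)%type.
Local Notation R2 := (R * R)%type.
Local Notation S2 := (@S2 R).

Definition pBx (r : R) : set R2 := Bx r `\` [set 0].

(* T is the local coordinate seen in a chart that sends p to infinity, so 1/T
   is a local homeomorphism at 0, of degree d. *)
Record local_degree (T : R2 -> R2) (r d : R) : Prop := LocalDegree {
  ld_r : 0 < r; ld_d : d = 1 \/ d = -1;
  ld_con : con (pBx r) T;
  ld_inj : forall x y, pBx r x -> pBx r y -> T x = T y -> x = y;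
  ld_pairs : forall c : seq (R -> R2 * R2), closed_chain c ->
    chain_in [set q | [/\ pBx r q.1, pBx r q.2 & q.1 <> q.2]] c ->
    wsum c (fun q => T q.1 - T q.2) =
    d * (wsum c (fun q => q.1 - q.2) - wsum c (fun q => q.1) - wsum c (fun q => q.2));
  ld_far : forall M, exists2 e, 0 < e <= r & forall z : R2, `|z| <= M ->
    (forall x, pBx e x -> T x <> z) /\
    forall c, closed_chain c -> chain_in (pBx e) c ->
      wsum c (fun x => T x - z) = - (d * wsum c id) }.

Variables (g : R3 -> R3) (p : R3) (W : set R3) (V : set R2) (h : R3 -> R2) (k : R2 -> R3).
Variables (mu lam eta : R) (phi : R3 -> R2) (psi : R2 -> R3).
Hypotheses (ls : lsaddle g p W V h k mu lam eta) (ch : S2chart p phi psi).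

(** [P], the saddle coordinate read in the inverted chart, is a genuine local homeomorphism at 0
    with a degree [d], and [T] is the reciprocal 1/P. A difference of two values of [T] is minus the
    difference of those of [P] divided by their product, which gives [ld_pairs]. Moreover [T - z] is
    [1 - z P] divided by [P], and [1 - z P] stays near 1, which gives [ld_far]. *)
Lemma local_degree_ex : exists r d, r <= eta /\ local_degree (fun y => phi (k y)) r d.
Proof.
have e0 := ls_eta ls; have box := ls_box ls.
pose q0 := psi 0; have Sq0 : S2 q0 := chart_S2 ch 0.
have q0p : q0 <> p := @chart_neq R p phi psi ch 0.
have phq0 : phi q0 = 0 := chart_phiK ch 0.
have ich := inversion_chart ch Sq0 q0p.
pose phi1 := inv_phi p phi q0; pose psi1 := inv_psi p phi psi q0.
have V0 : V 0 by apply: box; apply: Bx0; exact: ltW.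
have nV : nbhs (0 : R2) V by apply: open_nbhs_nbhs; split=> //; exact: ls_V ls.
have np0 : nbhs (k 0) (~` [set q0]).
  apply: open_nbhs_nbhs; split; last by rewrite (ls_p ls) => /esym.
  by apply: closed_openC; apply: compact_closed; [exact: R3_hausdorff|exact: compact_set1].
have /within_cvgP/(_ _ np0) nk := ls_k ls V0.
have [r1 r10 Hr1] := nbhs_Bx (filterI nV nk).
pose r := Num.min r1 eta; have r0 : 0 < r by rewrite lt_min r10.
have rr1 : Bx r `<=` Bx r1 by apply: Bx_sub; rewrite ge_min lexx.
have reta : r <= eta by rewrite ge_min lexx orbT.
have rV x : Bx r x -> V x by move=> /rr1/Hr1[].
have rq x : Bx r x -> k x <> q0 by move=> /rr1/Hr1[Vx H]; exact: (H Vx).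
pose P x := phi1 (k x).
have cP : con (Bx r) P.
  apply: (con_comp (f := k) (g := phi1) (B := S2 `\ q0)).
  - exact: con_subset rV (ls_k ls).
  - by move=> x Bx; split; [exact: (ls_kS2 ls (rV x Bx))|exact: rq].
  - by case: ich => _ _ _ /conP.
have iP x y : Bx r x -> Bx r y -> P x = P y -> x = y.
  move=> Bx By /(chart_inj ich (ls_kS2 ls (rV x Bx)) (ls_kS2 ls (rV y By)) (rq x Bx) (rq y By)).
  exact: (ls_kinj ls (rV x Bx) (rV y By)).
have P0 : P 0 = 0 by rewrite /P (ls_p ls); exact: inv_phi_q.
have PT x : pBx r x -> P x = cinv (phi (k x)).
  move=> [Bx /= x0]; rewrite /P /phi1 inv_phiE ?phq0 ?subr0// => e; apply: x0.
  apply: (ls_kinj ls (rV x Bx) V0); rewrite e (ls_p ls)//.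
have Pn0 x : pBx r x -> P x != 0.
  move=> [Bx /= x0]; apply/eqP => e; apply: x0; apply: iP => //; last by rewrite e P0.
  by apply: Bx0; exact: ltW.
have TE x : pBx r x -> phi (k x) = cinv (P x) by move=> Bx; rewrite PT// cinvK.
have [rho rho0 HS] : exists2 rho, 0 < rho & con (Bx rho) (fun y => h (psi1 y)) /\
    forall y, Bx rho y -> Bx r (h (psi1 y)) /\ P (h (psi1 y)) = y.
  have [d d0 Hd] := ls_near ls r0.
  have psi10 : psi1 0 = p by exact: inv_psi0.
  have cps : continuous psi1 by exact: (chart_psi_cont ich).
  have /nbhs_Bx[rho rho0 Hrho] : nbhs (0 : R2) [set y | `|p - psi1 y| < d].
    have nb : nbhs (psi1 0) [set x | `|p - x| < d].
      by rewrite psi10; apply/nbhs_ballP; exists d => // w; rewrite -ball_normE.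
    exact: cps nb.
  exists rho => //; have WE y : Bx rho y -> exists2 z, Bx r z & V z /\ k z = psi1 y.
    move=> /Hrho /(Hd _ (chart_S2 ich y))[z [Bz Vz kz]]; by exists z.
  have hz y z : V z -> k z = psi1 y -> h (psi1 y) = z by move=> Vz <-; have [] := ls_hk ls Vz.
  split.
    apply: (con_comp (f := psi1) (g := h) (B := W)); first by exact: con_continuous.
      by move=> y /WE[z _ [Vz <-]]; have [] := ls_hk ls Vz.
    exact: ls_h ls.
  move=> y /WE[z Bz [Vz kz]]; rewrite (hz y z)//; split=> //.
  by rewrite /P kz; exact: (chart_phiK ich).
have [d d1 Hd] := degree_unit r0 rho0 cP iP P0 HS.1 HS.2.
exists r, d; split=> //.
have cPp : con (pBx r) P by apply: con_subset cP => x [].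
split=> //.
- by apply: (con_eq (f := fun x => cinv (P x))); [move=> x /TE|exact: con_cinv].
- move=> x y Bx By e; have [Bx' _] := Bx; have [By' _] := By.
  by apply: iP => //; rewrite !PT// e.
- move=> c cc cX; set X := (X in chain_in X c) in cX.
  have c1 : con X (fun q => P q.1).
    by apply: (con_comp (f := fst)) cPp; [exact: con_fst_id|move=> q []].
  have c2 : con X (fun q => P q.2).
    by apply: (con_comp (f := snd)) cPp; [exact: con_snd_id|move=> q []].
  have n1 : nchain c (fun q => P q.1) by apply: chain_in_npath cX c1 _ => q [/Pn0].
  have n2 : nchain c (fun q => P q.2) by apply: chain_in_npath cX c2 _ => q [_ /Pn0].
  have n3 : nchain c (fun q => P q.1 - P q.2).
    apply: chain_in_npath cX (conB c1 c2) _ => q [[Bq1 _] [Bq2 _] qq].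
    by rewrite subr_eq0; apply/eqP => /(iP _ _ Bq1 Bq2).
  have E : wsum c (fun q => phi (k q.1) - phi (k q.2)) =
      wsum c (fun q => cmul (- (P q.1 - P q.2)) (cmul (cinv (P q.1)) (cinv (P q.2)))).
    apply: (wsum_eq_in cX) => q [B1 B2 _]; rewrite !TE// cinv_diff ?Pn0//.
    by rewrite opprB.
  rewrite E wsumM; [|exact: nchainN|by apply: nchainM; exact: nchainV].
  rewrite wsumN// wsumM ?wsumV//; [|exact: nchainV|exact: nchainV].
  have cX' : chain_in [set q | [/\ Bx r q.1, Bx r q.2 & q.1 <> q.2]] c.
    by apply: chain_sub cX => q [[? _] [? _] ?].
  rewrite (degree_pairs r0 cP iP P0 Hd cc cX').
  have F1 := Hd _ (closed_map fst cc); have F2 := Hd _ (closed_map snd cc).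
  rewrite !wsum_map in F1 F2; rewrite F1 ?F2; first by ring.
    by apply: (chain_map cX); [exact: con_snd_id|move=> q []].
  by apply: (chain_map cX); [exact: con_fst_id|move=> q []].
(* Where [P] is below [K^-1] in norm, the real part of [1 - z P] is positive for every [z] of norm
   at most [M]; the factor 2 in [K] pays for the two products in this real part. *)
- move=> M; pose K := 2 * (`|M| + 1); have K0 : 0 < K by rewrite mulr_gt0// ltr_wpDl.
  have B0 : Bx r 0 by apply: Bx0; exact: ltW.
  have nP : nbhs (P 0) [set y | `|y| < K^-1].
    rewrite P0; apply/nbhs_ballP; exists K^-1; first by rewrite /= invr_gt0.
    by move=> w; rewrite -ball_normE /ball_ /= sub0r normrN.
  have /within_cvgP/(_ _ nP) nn := cP 0 B0.
  have [e1 e10 He1] := nbhs_Bx nn.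
  pose e := Num.min e1 r; have e'0 : 0 < e by rewrite lt_min e10.
  have er : e <= r by rewrite ge_min lexx orbT.
  have ee1 : e <= e1 by rewrite ge_min lexx.
  exists e; first by rewrite e'0.
  have pr x : pBx e x -> pBx r x by move=> [/(Bx_sub er) ? ?].
  move=> z zM.
  have re x : pBx e x -> 0 < ((1, 0) - cmul z (P x)).1.
    move=> [Be x0]; have /= := He1 x (Bx_sub ee1 Be) (Bx_sub er Be).
    rewrite R2_norm_lt !ltr_norml => /andP[/andP[p1 p2] /andP[p3 p4]].
    have : `|z| <= `|M| by rewrite (le_trans zM)// ler_norm.
    rewrite R2_norm_le !ler_norml => /andP[/andP[z1 z2] /andP[z3 z4]].
    have Ki0 : 0 < K^-1 by rewrite invr_gt0.
    have KK : (`|M| + 1) * K^-1 = 1 / 2.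
      by rewrite /K invfM mulrCA divff ?mulr1 ?mul1r// gt_eqF// ltr_wpDl.
    have m0 := normr_ge0 M.
    have b1 : z.1 * (P x).1 <= `|M| * K^-1 by nra.
    have b2 : - (`|M| * K^-1) <= z.2 * (P x).2 by nra.
    rewrite /cmul /=; nra.
  have dotE x : pBx e x -> 0 < dot (1, 0) ((1, 0) - cmul z (P x)).
    by move=> /re; rewrite /dot /=; lra.
  have neq0 x : pBx e x -> ((1, 0) - cmul z (P x)) != 0.
    by move=> /re; apply: contraTneq => ->; rewrite ltxx.
  have FE x : pBx e x -> phi (k x) - z = cmul (cinv (P x)) ((1, 0) - cmul z (P x)).
    move=> Be; rewrite TE; last exact: pr.
    have := cmulV (Pn0 x (pr x Be)); rewrite /cmul; case: (P x) (cinv (P x)) z {zM re dotE neq0} => a b [c d'] [z1 z2] /= [i1 i2].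
    congr pair; rewrite /=; [rewrite (_ : c * (1 - (z1 * a - z2 * b)) - d' * (0 - (z1 * b + z2 * a)) =
      c - (z1 * (a * c - b * d') - z2 * (a * d' + b * c)))|rewrite (_ : c * (0 - (z1 * b + z2 * a)) + d' * (1 - (z1 * a - z2 * b)) =
      d' - (z1 * (a * d' + b * c) + z2 * (a * c - b * d')))]; by [rewrite i1 i2; ring|ring].
  split.
    move=> x Be e'; have := FE x Be; rewrite e' subrr => /esym/eqP.
    by rewrite cmul_eq0 (negbTE (neq0 x Be)) orbF cinv_eq0 (negbTE (Pn0 x (pr x Be))).
  move=> c cc cX; have cXr := chain_sub pr cX.
  have nP' : nchain c P by apply: chain_in_npath cXr cPp _ => x /Pn0.
  have c1 : con (pBx e) (fun x => (1, 0) - cmul z (P x)).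
    apply: conB; first exact: con_cst.
    by apply: con_cmul; [exact: con_cst|exact: con_subset pr cPp].
  have n1 := chain_in_npath cX c1 neq0.
  rewrite (wsum_eq_in cX FE) wsumM//; last exact: nchainV.
  rewrite wsumV// Hd// (@wsum_half R R2 (1, 0) c (fun x => (1, 0) - cmul z (P x)))// ?addr0//.
  by apply: alls_impl cX => u [cu uX]; split; [exact: con_comp cu uX c1|move=> t /uX/dotE].
Qed.

End LocalDegree.

(** * The turning of f x - x along the loop *)

Section PlaneLoop.
Variable R : realType.
Local Notation R2 := (R * R)%type.

Lemma chain_bounded (X : set R2) (c : seq (R -> R2)) : chain_in X c ->
  exists2 M, 0 < M & chain_in [set x | n2 x < M] c.
Proof.
elim: c => [_|u c IH] /=; first by exists 1.
move=> [[cu _] /IH[M M0 HM]].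
have [N N0 HN] := compact_upper_bound (@I01_compact R) (con_n2 cu).
exists (Num.max M N); first by rewrite lt_max M0.
split; first by split=> // t It; rewrite /= lt_max HN ?orbT.
by apply: chain_sub HM => x /= xM; rewrite lt_max xM.
Qed.

(* The winding number is constant along z, and zero about far away points. *)
Lemma wsum_escape (X : set R2) (c : seq (R -> R2)) (z : R -> R2) :
  closed_chain c -> chain_in X c -> con [set s : R | 0 < s <= 1] z ->
  (forall s, 0 < s <= 1 -> ~ X (z s)) ->
  (forall M, exists2 s, 0 < s <= 1 & M < `|z s|) ->
  wsum c (fun x => x - z 1) = 0.
Proof.
move=> cc cX cz zX zinf; have [M M0 HM] := chain_bounded cX.
have [s /andP[s0 s1] zs] := zinf (M + 1).
have zM : M < n2 (z s).
  have /andP[h _] := n2_norm (z s); apply: lt_le_trans h; nra.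
have := @wsum_move R c (fun t => z (1 + t * (s - 1))) cc.
rewrite mul0r addr0 (_ : 1 + 1 * (s - 1) = s); last by ring.
move=> ->.
- by apply: wsum_far => //; apply: chain_sub HM => x /= h; exact: lt_trans zM.
- apply: (con_comp (f := fun t : R => 1 + t * (s - 1)) (g := z)) cz; first by ctac.
  by move=> t /I01P/andP[? ?]; apply/andP; split; nra.
- apply: chain_sub cX => x Xx t /I01P/andP[? ?]; apply/eqP => e; apply: (zX (1 + t * (s - 1))).
    by apply/andP; split; nra.
  by rewrite -e.
Qed.

Definition lin (mu lam : R) (x : R2) : R2 := (mu * x.1, lam * x.2).

(* f is g in a chart sending p to infinity, A and B are the stable and unstable
   branches of the loop, both starting at infinity, and T is the saddle coordinate. *)
Record plane_loop (f T : R2 -> R2) (A B : R -> R2) (mu lam c d r del : R) : Prop := PlaneLoop {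
  pl_mu : 1 < mu; pl_lam0 : 0 < lam; pl_lam1 : lam < 1; pl_c : 0 < c; pl_d : 0 < d;
  pl_ld : local_degree T r del;
  pl_cA : con [set s : R | 0 < s] A; pl_cB : con [set s : R | 0 < s] B;
  pl_iA : forall s t, 0 < s -> 0 < t -> A s = A t -> s = t;
  pl_iB : forall s t, 0 < s -> 0 < t -> B s = B t -> s = t;
  pl_AB : forall s t, 0 < s <= c -> 0 < t <= d -> A s = B t -> s = c /\ t = d;
  pl_cd : A c = B d;
  pl_AT : forall s, 0 < s <= r -> A s = T (0, s);
  pl_BT : forall s, 0 < s <= r -> B s = T (s, 0);
  pl_fA : forall s, 0 < s -> f (A s) = A (lam * s);
  pl_fB : forall s, 0 < s -> f (B s) = B (mu * s);
  pl_fT : forall x, pBx r x -> f (T x) = T (lin mu lam x) }.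

Variables (f T : R2 -> R2) (A B : R -> R2) (mu lam c d r del : R).
Hypothesis pl : plane_loop f T A B mu lam c d r del.

Let mu1 : 1 < mu. Proof. exact: pl_mu pl. Qed.
Let lam0 : 0 < lam. Proof. exact: pl_lam0 pl. Qed.
Let lam1 : lam < 1. Proof. exact: pl_lam1 pl. Qed.
Let c0 : 0 < c. Proof. exact: pl_c pl. Qed.
Let d0 : 0 < d. Proof. exact: pl_d pl. Qed.
Let r0 : 0 < r. Proof. exact: ld_r (pl_ld pl). Qed.

(** The loop is run out along the unstable branch from the parameter [e] to [d], then back along the
    stable branch from [c] to [e]. *)
Definition sB (e t : R) := e + t * (d - e).
Definition sA (e t : R) := c + t * (e - c).

(** The bound on [mu * e] keeps the image under [lin] of the box of size [e] inside the domain of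
    [T]; the last two leave a nontrivial part of each branch. *)
Definition small (e : R) := [/\ 0 < e, mu * e <= r, e < c & e < d].

Lemma small_ex e0 : 0 < e0 -> exists2 e, e < e0 & small e.
Proof.
move=> h; have mu0 : 0 < mu by rewrite (lt_trans ltr01).
have q0 : 0 < r / mu by rewrite divr_gt0.
pose m := Num.min (Num.min e0 (r / mu)) (Num.min c d).
have m0 : 0 < m by rewrite !lt_min h q0 c0 d0.
have m1 : m <= e0 by rewrite !ge_min lexx.
have m2 : m <= r / mu by rewrite !ge_min lexx orbT.
have m3 : m <= c by rewrite !ge_min lexx !orbT.
have m4 : m <= d by rewrite !ge_min lexx !orbT.
have m5 : mu * m <= r by move: m2; rewrite ler_pdivlMr// mulrC.
clearbody m; exists (m / 2); first lra.
by split; [lra|nra|lra|lra].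
Qed.

Lemma small_le e : small e -> e <= r.
Proof. by move=> [e0 er _ _]; apply: le_trans er; rewrite ler_peMl// ltW. Qed.

Lemma sB_bounds e t : small e -> I01 t -> e <= sB e t <= d.
Proof. by move=> [? _ _ ?] /I01P/andP[? ?]; rewrite /sB; apply/andP; split; nra. Qed.
Lemma sA_bounds e t : small e -> I01 t -> e <= sA e t <= c.
Proof. by move=> [? _ ? _] /I01P/andP[? ?]; rewrite /sA; apply/andP; split; nra. Qed.
Lemma sB0 e : sB e 0 = e. Proof. by rewrite /sB mul0r addr0. Qed.
Lemma sB1 e : sB e 1 = d. Proof. by rewrite /sB mul1r addrC subrK. Qed.
Lemma sA0 e : sA e 0 = c. Proof. by rewrite /sA mul0r addr0. Qed.
Lemma sA1 e : sA e 1 = e. Proof. by rewrite /sA mul1r addrC subrK. Qed.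

Definition arcs e : seq (R -> R2) := [:: (fun t => B (sB e t)); (fun t => A (sA e t))].
Definition Lam (kap : seq (R -> R2)) e : seq (R -> R2) :=
  arcs e ++ [seq (fun t => T (u t)) | u <- kap].

(** The boundary condition is that of a path from [(0, e)] to [(e, 0)], which fills the gap left by
    the two arcs. *)
Definition closes e (kap : seq (R -> R2)) :=
  (forall F : R2 -> R, \sum_(u <- kap) (F (u 1) - F (u 0)) = F (e, 0) - F (0, e)) /\
  chain_in (pBx e) kap.

(* The loop is cut off near p and closed through the quadrant between its two
   branches, or through the other three quadrants. *)
Definition kap1 e : seq (R -> R2) := [:: seg (0, e) (e, 0)].
Definition kap2 e : seq (R -> R2) :=
  [:: seg (0, e) (- e, 0); seg (- e, 0) (0, - e); seg (0, - e) (e, 0)].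

Lemma seg_neq0 (u v : R2) t : cross u v != 0 -> seg u v t <> 0.
Proof.
move=> uv e; have [u0 v0] := cross_neq0 uv; move: uv; apply/negP/negPn/eqP.
have e1 : (1 - t) * u.1 + t * v.1 = 0 by have := congr1 fst e.
have e2 : (1 - t) * u.2 + t * v.2 = 0 by have := congr1 snd e.
have -> : cross u v = v.2 * ((1 - t) * u.1 + t * v.1) - v.1 * ((1 - t) * u.2 + t * v.2) +
    u.1 * ((1 - t) * u.2 + t * v.2) - u.2 * ((1 - t) * u.1 + t * v.1) by rewrite /cross; ring.
by rewrite e1 e2 !mulr0 !subr0 addr0.
Qed.

Lemma pBx_seg e (u v : R2) : Bx e u -> Bx e v -> cross u v != 0 ->
  con I01 (seg u v) /\ forall t, I01 t -> pBx e (seg u v t).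
Proof.
move=> [/andP[? ?] /andP[? ?]] [/andP[? ?] /andP[? ?]] uv; split; first exact: con_seg.
move=> t /I01P/andP[t0 t1]; split; last exact: seg_neq0.
by rewrite /seg; split; apply/andP; split=> /=; nra.
Qed.

Lemma axis_Bx e s : - e <= s <= e -> Bx e ((s, 0) : R2) /\ Bx e ((0, s) : R2).
Proof. by move=> /andP[? ?]; split; split; apply/andP; split=> /=; lra. Qed.

Lemma kap1_closes e : 0 < e -> closes e (kap1 e).
Proof.
move=> e0; split; first by move=> F; rewrite big_cons big_nil seg0 seg1 addr0.
have [h1 h2] : Bx e ((e, 0) : R2) /\ Bx e ((0, e) : R2) by apply: axis_Bx; lra.
by split=> //; apply: pBx_seg => //; rewrite /cross /= lt_eqF//; nra.
Qed.

Lemma kap2_closes e : 0 < e -> closes e (kap2 e).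
Proof.
move=> e0; split; first by move=> F; rewrite !big_cons big_nil !seg0 !seg1; ring.
have [h1 h2] : Bx e ((e, 0) : R2) /\ Bx e ((0, e) : R2) by apply: axis_Bx; lra.
have [h3 h4] : Bx e ((- e, 0) : R2) /\ Bx e ((0, - e) : R2) by apply: axis_Bx; lra.
by do 3?[split; first by apply: pBx_seg => //; rewrite /cross /= gt_eqF//; nra].
Qed.

Lemma Lam_closed e kap : small e -> closes e kap -> closed_chain (Lam kap e).
Proof.
move=> se [kc _] F; rewrite big_cat !big_cons big_nil big_map /=.
have er := small_le se; have [e0 _ _ _] := se.
rewrite (kc (fun x => F (T x))) sB0 sB1 sA0 sA1 (pl_cd pl) (pl_AT pl) ?e0// -(pl_BT pl) ?e0//.
ring.
Qed.

Lemma con_sB e : small e -> con I01 (fun t => B (sB e t)).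
Proof.
move=> se; have [e0 _ _ _] := se.
apply: (con_comp (f := sB e)) (pl_cB pl); first by rewrite /sB; ctac.
by move=> t It; have /andP[h _] := sB_bounds se It; exact: lt_le_trans h.
Qed.

Lemma con_sA e : small e -> con I01 (fun t => A (sA e t)).
Proof.
move=> se; have [e0 _ _ _] := se.
apply: (con_comp (f := sA e)) (pl_cA pl); first by rewrite /sA; ctac.
by move=> t It; have /andP[h _] := sA_bounds se It; exact: lt_le_trans h.
Qed.

Definition curve : set R2 := A @` [set s : R | 0 < s <= c] `|` B @` [set s : R | 0 < s <= d].

Lemma arcs_in e : small e -> chain_in curve (arcs e).
Proof.
move=> se; have [e0 _ _ _] := se; split; last split=> //.
  split; first exact: con_sB.
  move=> t It; right; exists (sB e t) => //; have /andP[h1 h2] := sB_bounds se It.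
  by rewrite /= h2 (lt_le_trans e0 h1).
split; first exact: con_sA.
move=> t It; left; exists (sA e t) => //; have /andP[h1 h2] := sA_bounds se It.
by rewrite /= h2 (lt_le_trans e0 h1).
Qed.

Lemma pBx_sub (e e' : R) (x : R2) : e <= e' -> pBx e x -> pBx e' x.
Proof. by move=> ee [/(Bx_sub ee) ? ?]. Qed.

Lemma Lam_in e kap (K : set R2) : small e -> chain_in K kap -> K `<=` pBx e ->
  chain_in (curve `|` T @` K) (Lam kap e).
Proof.
move=> se kX Kp; apply: alls_cat; first by apply: chain_sub (arcs_in se) => x; left.
have cT : con K T.
  by apply: con_subset (ld_con (pl_ld pl)) => x /Kp; apply: pBx_sub; exact: small_le.
by apply: (chain_map kX cT) => x Kx; right; exists x.
Qed.

Lemma lin_pBx e x : small e -> pBx e x -> [/\ pBx r x, pBx r (lin mu lam x) & lin mu lam x <> x].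
Proof.
move=> se [[/andP[h1 h2] /andP[h3 h4]] x0]; have er := small_le se.
have [e0 mer _ _] := se; have mu0 : 0 < mu := lt_trans ltr01 mu1.
have l0 := lam0; have l1 := lam1; split.
- by apply: pBx_sub er _; split=> //; split; apply/andP.
- have k1 : 0 <= mu * (e - x.1) by apply: mulr_ge0; lra.
  have k2 : 0 <= mu * (x.1 + e) by apply: mulr_ge0; lra.
  have k3 : 0 <= lam * (e - x.2) by apply: mulr_ge0; lra.
  have k4 : 0 <= lam * (x.2 + e) by apply: mulr_ge0; lra.
  have k5 : 0 <= (1 - lam) * e by apply: mulr_ge0; lra.
  split; first by rewrite /lin; split; apply/andP; split=> /=; nra.
  move=> [/eqP + /eqP]; rewrite !mulf_eq0 (gt_eqF mu0) (gt_eqF l0) /= => /eqP y1 /eqP y2.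
  by apply: x0; apply/eqP; rewrite pair_eq0 y1 y2 eqxx.
- case: x x0 {h1 h2 h3 h4} => [x1 x2] x0 [/= h1 h2]; apply: x0; congr pair.
    have /eqP : (mu - 1) * x1 = 0 by lra.
    by rewrite mulf_eq0 subr_eq0 gt_eqF//= => /eqP.
  have /eqP : (1 - lam) * x2 = 0 by lra.
  by rewrite mulf_eq0 subr_eq0 gt_eqF//= => /eqP.
Qed.

(** The vector joins a tail to a head that runs ahead of it on the loop. The head may first run
    through to its last position [A (lam * e)] while the tail waits at [B e], and the tail may
    follow afterwards; the two never meet because the head stays ahead. *)
Lemma mid_chain e : small e ->
  av (fun t => B (mu * sB e t) - B (sB e t)) + av (fun t => A (lam * sA e t) - A (sA e t)) =
  (av (fun t => B (mu * sB e t) - B e) + av (fun t => A (lam * sA e t) - B e)) +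
  (av (fun t => A (lam * e) - B (sB e t)) + av (fun t => A (lam * e) - A (sA e t))).
Proof.
move=> se; have [e0 _ _ _] := se.
have mu0 : 0 < mu := lt_trans ltr01 mu1.
have m1 := mu1; have l0 := lam0; have l1 := lam1; have c0' := c0; have d0' := d0.
have cB (g : R * R -> R) : con (I01 `*` I01) g -> (forall q, (I01 `*` I01) q -> 0 < g q) ->
    con (I01 `*` I01) (fun q => B (g q)) /\ con (I01 `*` I01) (fun q => A (g q)).
  by move=> cg g0; split; [apply: con_comp (pl_cB pl)|apply: con_comp (pl_cA pl)].
have bm (t u : R) : I01 t -> I01 u -> I01 (t * u).
  by move=> /I01P/andP[? ?] /I01P/andP[? ?]; apply/I01P; nra.
have sBp t : I01 t -> 0 < sB e t.
  by move=> /(sB_bounds se)/andP[h _]; exact: lt_le_trans h.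
have sAp t : I01 t -> 0 < sA e t.
  by move=> /(sA_bounds se)/andP[h _]; exact: lt_le_trans h.
have cs (g : R * R -> R) X : con X g -> con X (fun q => sB e (g q)) /\ con X (fun q => sA e (g q)).
  by move=> cg; rewrite /sB /sA; split; ctac.
have c1 : con (I01 `*` I01) (fun q : R * R => q.1) by ctac.
have c2 : con (I01 `*` I01) (fun q : R * R => q.2) by ctac.
have c12 : con (I01 `*` I01) (fun q : R * R => q.1 * q.2) by ctac.
have cA0 : A (lam * c) = B (mu * d) by rewrite -(pl_fA pl)// -(pl_fB pl)// (pl_cd pl).
(* the three squares on which the endpoints of the moving vectors stay distinct *)
have [] := @av_square R (fun q => B (mu * sB e q.2) - B (sB e (q.1 * q.2))).
- apply: conB.
    apply: (cB _ _ _).1; first by apply: conM; [exact: con_cst|exact: (cs _ _ c2).1].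
    by move=> q [_ /sBp ?]; rewrite mulr_gt0.
  by apply: (cB _ _ _).1; [exact: (cs _ _ c12).1|move=> q [? ?]; apply/sBp/bm].
- move=> [t u] [/= It Iu]; rewrite subr_eq0; apply/eqP.
  have It' := bm _ _ It Iu.
  move=> /(pl_iB pl); rewrite mulr_gt0 ?sBp// => /(_ isT isT).
  have := sBp u Iu; move: It Iu se => /I01P/andP[? ?] /I01P/andP[? ?] [_ _ _ ?].
  have h : sB e (t * u) <= sB e u.
    by rewrite /sB lerD2l ler_wpM2r ?ler_piMl//; lra.
  nra.
move=> E1 _.
have [] := @av_square R (fun q => A (lam * sA e q.2) - A (sA e (q.1 * q.2))).
- apply: conB.
    apply: (cB _ _ _).2; first by apply: conM; [exact: con_cst|exact: (cs _ _ c2).2].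
    by move=> q [_ /sAp ?]; rewrite mulr_gt0.
  by apply: (cB _ _ _).2; [exact: (cs _ _ c12).2|move=> q [? ?]; apply/sAp/bm].
- move=> [t u] [/= It Iu]; rewrite subr_eq0; apply/eqP.
  have It' := bm _ _ It Iu.
  move=> /(pl_iA pl); rewrite mulr_gt0 ?sAp// => /(_ isT isT).
  have := sAp u Iu; move: It Iu se => /I01P/andP[? ?] /I01P/andP[? ?] [_ _ ? _].
  have h : sA e u <= sA e (t * u).
    by rewrite /sA lerD2l ler_wnM2r ?ler_piMl//; lra.
  nra.
move=> E2 _.
have [] := @av_square R (fun q => A (lam * sA e q.1) - B (sB e q.2)).
- apply: conB.
    apply: (cB _ _ _).2; first by apply: conM; [exact: con_cst|exact: (cs _ _ c1).2].
    by move=> q [/sAp ? _]; rewrite mulr_gt0.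
  by apply: (cB _ _ _).1; [exact: (cs _ _ c2).1|move=> q [_ ?]; exact/sBp].
- move=> [t u] [/= It Iu]; rewrite subr_eq0; apply/eqP.
  have /andP[a1 a2] := sA_bounds se It; have /andP[b1 b2] := sB_bounds se Iu.
  move=> /(pl_AB pl)[]; [by apply/andP; split; nra|by apply/andP; split; lra|].
  by move=> h _; nra.
move=> E3 _; move: E1 E2 E3 => /=; rewrite sA0 sA1 sB0 sB1 cA0.
have z1 : av (fun t => B (mu * sB e 0) - B (sB e (t * 0))) = 0.
  rewrite (@av_eq R _ (fun=> B (mu * e) - B e)); last by move=> t _; rewrite mulr0 sB0.
  rewrite av_cst// subr_eq0; apply/eqP => /(pl_iB pl); rewrite e0 mulr_gt0// => /(_ isT isT).
  by nra.
have z2 : av (fun t => A (lam * sA e 0) - A (sA e (t * 0))) = 0.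
  rewrite (@av_eq R _ (fun=> A (lam * c) - A c)); last by move=> t _; rewrite mulr0 sA0.
  rewrite av_cst// subr_eq0; apply/eqP => /(pl_iA pl); rewrite c0 mulr_gt0// => /(_ isT isT).
  by nra.
move: z1 z2; rewrite sB0 sA0 cA0 => -> ->.
rewrite (@av_eq R (fun t => B (mu * sB e t) - B (sB e (0 * t))) (fun t => B (mu * sB e t) - B e));
  last by move=> t _; rewrite mul0r sB0.
rewrite (@av_eq R (fun t => B (mu * sB e t) - B (sB e (1 * t))) (fun t => B (mu * sB e t) - B (sB e t)));
  last by move=> t _; rewrite mul1r.
rewrite (@av_eq R (fun t => B (mu * d) - B (sB e (t * 1))) (fun t => B (mu * d) - B (sB e t)));
  last by move=> t _; rewrite mulr1.
rewrite (@av_eq R (fun t => A (lam * sA e t) - A (sA e (0 * t))) (fun t => A (lam * sA e t) - B d));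
  last by move=> t _; rewrite mul0r sA0 (pl_cd pl).
rewrite (@av_eq R (fun t => A (lam * sA e t) - A (sA e (1 * t))) (fun t => A (lam * sA e t) - A (sA e t)));
  last by move=> t _; rewrite mul1r.
rewrite (@av_eq R (fun t => A (lam * e) - A (sA e (t * 1))) (fun t => A (lam * e) - A (sA e t)));
  last by move=> t _; rewrite mulr1.
by move=> E1 E2 E3; lra.
Qed.

(** [T w] is led to infinity along the image of the segment from [w] to 0, so a chain that avoids
    this image does not wind around [T w]. *)
Lemma T_escape (ch : seq (R -> R2)) (w : R2) : pBx r w -> closed_chain ch ->
  chain_in [set x | forall s, 0 < s <= 1 -> x <> T (scal s w)] ch ->
  wsum ch (fun x => x - T w) = 0.
Proof.
move=> [rw w0] cc cX.
have sw e s : 0 < s -> s * r <= e -> pBx e (scal s w).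
  move=> s0 se; split; first exact: Bx_sub se _ (Bx_scal s0 rw).
  by move=> /eqP; rewrite scal_eq0 ?gt_eqF//= => /eqP.
rewrite -[w in LHS]scal1; apply: (wsum_escape (z := fun s => T (scal s w)) cc cX) => //.
- apply: con_comp (ld_con (pl_ld pl)).
    by rewrite /scal; ctac.
  by move=> s /andP[s0 s1]; apply: sw => //; rewrite ler_piMl// ltW.
- by move=> s s01 /(_ s s01).
move=> M; have [e /andP[e0 er] He] := ld_far (pl_ld pl) M.
have s0 : 0 < e / r by rewrite divr_gt0.
exists (e / r); first by rewrite s0 ler_pdivrMr// mul1r.
rewrite ltNge; apply/negP => /He[+ _] => /(_ (scal (e / r) w)); apply=> //.
by apply: sw => //; rewrite divfK ?gt_eqF.
Qed.

Lemma seg_pBx (v w : R) t : 0 < v <= r -> 0 < w <= r -> I01 t ->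
  pBx r (seg (v, 0) (0, w) t).
Proof.
move=> /andP[v0 vr] /andP[w0 wr].
apply: (pBx_seg _ _ _).2; [by case: (axis_Bx (e := r) (s := v)) => //; apply/andP; split; lra|
  by case: (axis_Bx (e := r) (s := w)) => //; apply/andP; split; lra|].
by rewrite /cross /= gt_eqF//; nra.
Qed.

Lemma con_Tseg (v w : R) : 0 < v <= r -> 0 < w <= r -> con I01 (fun t => T (seg (v, 0) (0, w) t)).
Proof.
move=> hv hw; apply: con_comp (ld_con (pl_ld pl)); first exact: con_seg.
by move=> t It; exact: seg_pBx.
Qed.

Lemma seg_Tneq (v w : R) t x : 0 < v <= r -> 0 < w <= r -> I01 t -> pBx r x ->
  seg (v, 0) (0, w) t <> x -> T (seg (v, 0) (0, w) t) <> T x.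
Proof.
move=> hv hw It rx ne /(ld_inj (pl_ld pl)) h; apply: ne; apply: h => //.
exact: seg_pBx.
Qed.

Lemma small_bounds e : small e -> [/\ 0 < e <= r, 0 < mu * e <= r & 0 < lam * e <= r].
Proof.
move=> se; have er := small_le se; have [e0 mer _ _] := se.
have h1 : 0 < lam * e by rewrite mulr_gt0.
have h2 : lam * e <= e by rewrite ler_piMl// ltW.
have h3 : 0 < mu * e by rewrite mulr_gt0// (lt_trans ltr01).
by rewrite e0 er mer h1 h3 (le_trans h2 er).
Qed.

Lemma axis_pBx v : 0 < v <= r -> pBx r ((v, 0) : R2) /\ pBx r ((0, v) : R2).
Proof.
move=> /andP[v0 vr]; have [h1 h2] := @axis_Bx r v ltac:(by apply/andP; split; lra).
by split; split=> // -[/eqP]; rewrite gt_eqF.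
Qed.

(** The head runs from [B (mu * e)] to [A (lam * e)], and so does the image of a straight segment in
    saddle coordinates. Together they form a closed chain that avoids the piece of the unstable
    branch between [B e] and [p], along which [B e] escapes. *)
Lemma close1 e : small e ->
  av (fun t => B (mu * sB e t) - B e) + av (fun t => A (lam * sA e t) - B e) =
  av (fun t => T (seg (mu * e, 0) (0, lam * e) t) - T (e, 0)).
Proof.
move=> se; have [er mer ler] := small_bounds se; have [e0 _ ec ed] := se.
have m1 := mu1; have l0 := lam0; have l1 := lam1; have cp := c0; have dp := d0.
have mu0 : 0 < mu := lt_trans ltr01 mu1.
have pe : pBx r ((e, 0) : R2) := (axis_pBx er).1.
have Tne t s : I01 t -> 0 < s <= 1 -> T (seg (mu * e, 0) (0, lam * e) t) <> T (scal s (e, 0)).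
  move=> /I01P/andP[t0 t1] /andP[s0 s1]; have se0 : 0 < s * e by rewrite mulr_gt0.
  have se1 : s * e <= e by rewrite ler_piMl// ltW.
  apply: seg_Tneq => //; first by apply/I01P; rewrite t0.
    rewrite /scal /= mulr0; apply: (axis_pBx _).1; have /andP[_ ?] := er.
    by rewrite se0 (le_trans se1).
  rewrite /seg /scal /= !mulr0 addr0 add0r => -[h1 /eqP].
  rewrite mulf_eq0 [lam * e == 0]gt_eqF ?mulr_gt0// orbF => /eqP t00.
  by move: h1; rewrite t00; nra.
have TB s : 0 < s <= 1 -> T (scal s (e, 0)) = B (s * e).
  move=> /andP[s0 s1]; rewrite (pl_BT pl) ?/scal /= ?mulr0// mulr_gt0//=.
  by have /andP[_] := er; apply: le_trans; rewrite ler_piMl// ltW.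
have pT : npath (fun t => T (seg (mu * e, 0) (0, lam * e) t) - T (e, 0)).
  split; first by apply: conB; [exact: con_Tseg|exact: con_cst].
  move=> t It; rewrite subr_eq0; apply/eqP; have := Tne t 1 It.
  by rewrite scal1; apply; rewrite ltr01 lexx.
pose ch : seq (R -> R2) := [:: (fun t => B (mu * sB e t)); (fun t => A (lam * sA e t));
  (fun t => T (seg (mu * e, 0) (0, lam * e) (1 - t)))].
have cch : closed_chain ch.
  move=> F; rewrite /ch !big_cons big_nil /= sB0 sB1 sA0 sA1 subrr subr0 seg0 seg1.
  rewrite -(pl_fA pl c0) -(pl_fB pl d0) (pl_cd pl) -(pl_AT pl)// -(pl_BT pl)//; ring.
suff : wsum ch (fun x => x - T (e, 0)) = 0.
  rewrite /ch /wsum !big_cons big_nil /= (av_rev pT) -(pl_BT pl)// addr0 => h; lra.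
apply: (T_escape pe cch); split; [|split; [|split=> //]]; split.
- apply: con_comp (pl_cB pl); first by rewrite /sB; ctac.
  by move=> t /(sB_bounds se)/andP[h _]; apply: mulr_gt0 => //; exact: lt_le_trans h.
- move=> t /(sB_bounds se)/andP[h _] s s01; rewrite TB//; have /andP[s0 s1] := s01.
  have p1 : 0 < mu * sB e t by rewrite mulr_gt0// (lt_le_trans e0 h).
  by move=> /(pl_iB pl p1 (mulr_gt0 s0 e0)); nra.
- apply: con_comp (pl_cA pl); first by rewrite /sA; ctac.
  by move=> t /(sA_bounds se)/andP[h _]; apply: mulr_gt0 => //; exact: lt_le_trans h.
- move=> t /(sA_bounds se)/andP[h h'] s s01; rewrite TB//; have /andP[s0 s1] := s01.
  by move=> /(pl_AB pl)[]; [apply/andP; split; nra|apply/andP; split; nra|nra].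
- by apply: (con_rev (c := fun t => T (seg (_, 0) (0, _) t))); exact: con_Tseg.
- by move=> t /I01C It s s01; exact: Tne.
Qed.

(** The same for the tail with the roles exchanged: the fixed head [A (lam * e)] escapes along the
    stable branch, and the tail is compared with the segment from [(e, 0)] to [(0, e)]. *)
Lemma close2 e : small e ->
  av (fun t => A (lam * e) - B (sB e t)) + av (fun t => A (lam * e) - A (sA e t)) =
  av (fun t => T (0, lam * e) - T (seg (e, 0) (0, e) t)).
Proof.
move=> se; have [er mer ler] := small_bounds se; have [e0 _ ec ed] := se.
have m1 := mu1; have l0 := lam0; have l1 := lam1; have cp := c0; have dp := d0.
have le0 : 0 < lam * e by rewrite mulr_gt0.
have pe : pBx r ((0, lam * e) : R2) := (axis_pBx ler).2.
have Tne t s : I01 t -> 0 < s <= 1 -> T (seg (e, 0) (0, e) t) <> T (scal s (0, lam * e)).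
  move=> /I01P/andP[t0 t1] /andP[s0 s1]; have se0 : 0 < s * (lam * e) by rewrite mulr_gt0.
  have se1 : s * (lam * e) <= lam * e by rewrite ler_piMl// ltW.
  apply: seg_Tneq => //; first by apply/I01P; rewrite t0.
    rewrite /scal /= mulr0; apply: (axis_pBx _).2; have /andP[_ ?] := ler.
    by rewrite se0 (le_trans se1).
  rewrite /seg /scal /= !mulr0 addr0 add0r => -[/eqP + h1].
  rewrite mulf_eq0 [e == 0]gt_eqF// orbF => /eqP t00.
  have t1' : t = 1 by lra.
  by move: h1; rewrite t1' mul1r; nra.
have TA s : 0 < s <= 1 -> T (scal s (0, lam * e)) = A (s * (lam * e)).
  move=> /andP[s0 s1]; rewrite (pl_AT pl) ?/scal /= ?mulr0// mulr_gt0//=.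
  by have /andP[_] := ler; apply: le_trans; rewrite ler_piMl// ltW.
have pT : npath (fun t => T (seg (e, 0) (0, e) t) - T (0, lam * e)).
  split; first by apply: conB; [exact: con_Tseg|exact: con_cst].
  move=> t It; rewrite subr_eq0; apply/eqP; have := Tne t 1 It.
  by rewrite scal1; apply; rewrite ltr01 lexx.
pose ch : seq (R -> R2) := [:: (fun t => B (sB e t)); (fun t => A (sA e t));
  (fun t => T (seg (e, 0) (0, e) (1 - t)))].
have cch : closed_chain ch.
  move=> F; rewrite /ch !big_cons big_nil /= sB0 sB1 sA0 sA1 subrr subr0 seg0 seg1.
  rewrite (pl_cd pl) -(pl_AT pl)// -(pl_BT pl)//; ring.
have cX : chain_in [set x | forall s, 0 < s <= 1 -> x <> T (scal s (0, lam * e))] ch.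
  split; [|split; [|split=> //]]; split.
  - exact: con_sB.
  - move=> t /(sB_bounds se)/andP[h h'] s s01; rewrite TA//; have /andP[s0 s1] := s01.
    move=> /esym/(pl_AB pl)[]; [apply/andP; split; [by rewrite mulr_gt0|]|by apply/andP; split; lra|].
      have : s * (lam * e) <= lam * e by rewrite ler_piMl// ltW.
      by nra.
    move=> hc _; have : s * (lam * e) <= lam * e by rewrite ler_piMl// ltW.
    by nra.
  - exact: con_sA.
  - move=> t /(sA_bounds se)/andP[h h'] s s01; rewrite TA//; have /andP[s0 s1] := s01.
    move=> /(pl_iA pl (lt_le_trans e0 h) (mulr_gt0 s0 le0)) hc.
    have : s * (lam * e) <= lam * e by rewrite ler_piMl// ltW.
    by nra.
  - by apply: (con_rev (c := fun t => T (seg (_, 0) (0, _) t))); exact: con_Tseg.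
  - by move=> t /I01C It s s01; exact: Tne.
have := T_escape pe cch cX.
have nch : nchain ch (fun x => x - T (0, lam * e)).
  apply: (chain_in_npath cX) => [|x Xx]; first by ctac.
  by rewrite subr_eq0; apply/eqP; rewrite -[X in T X]scal1; apply: Xx; rewrite ltr01 lexx.
have [n1 [n3 _]] := nch.
rewrite /ch /wsum !big_cons big_nil /= (av_rev pT) addr0.
rewrite -(avN n1) -(avN n3) -(avN pT) (pl_AT pl)// => h.
rewrite (@av_eq R _ (fun t => - (B (sB e t) - T (0, lam * e)))); last by move=> t _; rewrite opprB.
rewrite (@av_eq R (fun t => T _ - A _) (fun t => - (A (sA e t) - T (0, lam * e)))); last first.
  by move=> t _; rewrite opprB.
rewrite (@av_eq R (fun t => T _ - T _) (fun t => - (T (seg (e, 0) (0, e) t) - T (0, lam * e)))).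
  by lra.
by move=> t _; rewrite opprB.
Qed.

Definition diff (x : R2) : R2 := lin mu lam x - x.

(** [mid_chain], [close1] and [close2] reduce the turning to that of a closed chain of pairs of
    saddle coordinates, head and tail, to which [ld_pairs] applies. [G] is the turning of head minus
    tail over the two straight segments, and each [pi / 2] is the turning of the head or of the tail
    alone over one of them. *)
Lemma wsum_index e : small e -> exists2 G, 0 < G < 2 * pi &
  forall kap, closes e kap ->
    (exists n : int, G + wsum kap diff = 2 * pi * n%:~R) /\
    wsum (Lam kap e) (fun x => f x - x) =
      del * (G + wsum kap diff - (pi / 2 + wsum kap id) - (pi / 2 + wsum kap (lin mu lam))).
Proof.
move=> se; have [er mer ler] := small_bounds se; have [e0 _ ec ed] := se.
have m1 := mu1; have l0 := lam0; have l1 := lam1; have cp := c0; have dp := d0.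
have le0 : 0 < lam * e by rewrite mulr_gt0.
have me0 : 0 < mu * e by rewrite mulr_gt0// (lt_trans ltr01).
pose S1 := seg ((mu - 1) * e, 0) (- e, lam * e).
pose S2 := seg (- e, lam * e) (0, (lam - 1) * e).
have [P1 /andP[a1 a2] _] : [/\ npath S1, 0 < av S1 < pi & dot ((mu - 1) * e, 0) (- e, lam * e) = 0 -> av S1 = pi / 2].
  by apply: av_seg; rewrite /cross /= mul0r subr0; apply: mulr_gt0 => //; apply: mulr_gt0 => //; lra.
have [P2 /andP[a3 a4] _] : [/\ npath S2, 0 < av S2 < pi & dot (- e, lam * e) (0, (lam - 1) * e) = 0 -> av S2 = pi / 2].
  apply: av_seg; rewrite /cross /= mulr0 subr0 mulNr -mulrN -mulNr.
  by apply: mulr_gt0 => //; apply: mulr_gt0 => //; lra.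
exists (av S1 + av S2); first by apply/andP; split; lra.
move=> kap [kc kX]; have kr : chain_in (pBx r) kap by apply: chain_sub kX => x; apply: pBx_sub; exact: small_le.
pose ch : seq (R -> R2 * R2) :=
  [:: (fun t => (seg (mu * e, 0) (0, lam * e) t, (e, 0))),
      (fun t => ((0, lam * e), seg (e, 0) (0, e) t)) & [seq (fun t => (lin mu lam (u t), u t)) | u <- kap]].
have cch : closed_chain ch.
  move=> F; rewrite /ch !big_cons big_map /= (kc (fun x => F (lin mu lam x, x))) !seg0 !seg1.
  by rewrite /lin /= !mulr0; ring.
have clin X : con X (lin mu lam) by rewrite /lin; ctac.
have cX : chain_in [set q | [/\ pBx r q.1, pBx r q.2 & q.1 <> q.2]] ch.
  split; [|split]; [split|split|].
  - by apply: con_pair; [exact: con_seg|exact: con_cst].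
  - move=> t It; split; [exact: seg_pBx|exact: (axis_pBx er).1|].
    rewrite /seg /= => -[/eqP h1 /eqP]; rewrite mulr0 add0r mulf_eq0 (gt_eqF le0) orbF => /eqP t0.
    by move/eqP: h1; rewrite t0; nra.
  - by apply: con_pair; [exact: con_cst|exact: con_seg].
  - move=> t It; split; [exact: (axis_pBx ler).2|exact: seg_pBx|].
    rewrite /seg /= => -[/esym/eqP h1 h2]; move/eqP: h1; rewrite mulr0 addr0 => /eqP.
    rewrite mulf_eq0 (gt_eqF e0) orbF => /eqP t0.
    by move: h2; have -> : t = 1 by [lra|]; nra.
  - apply: (chain_map kX (f := fun x => (lin mu lam x, x))); first by apply: con_pair; [exact: clin|exact: con_id].
    by move=> x /(lin_pBx se)[h1 h2 h3].
have := ld_pairs (pl_ld pl) cch cX.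

have s1 t : seg (mu * e, 0) (0, lam * e) t - (e, 0) = S1 t.
  by rewrite /S1 /seg /=; congr pair; rewrite /=; ring.
have s2 t : (0, lam * e) - seg (e, 0) (0, e) t = S2 t.
  by rewrite /S2 /seg /=; congr pair; rewrite /=; ring.
rewrite /wsum /ch !big_cons !big_map /=.
have [_ _ q1] : [/\ npath (seg (mu * e, 0) (0, lam * e)), 0 < av (seg (mu * e, 0) (0, lam * e)) < pi &
  dot (mu * e, 0) (0, lam * e) = 0 -> av (seg (mu * e, 0) (0, lam * e)) = pi / 2].
  by apply: av_seg; rewrite /cross /= mul0r subr0 mulr_gt0.
have [_ _ q2] : [/\ npath (seg (e, 0) (0, e)), 0 < av (seg (e, 0) (0, e)) < pi &
  dot (e, 0) (0, e) = 0 -> av (seg (e, 0) (0, e)) = pi / 2].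
  by apply: av_seg; rewrite /cross /= mul0r subr0 mulr_gt0.
rewrite q1; last by rewrite /dot /= mulr0 mul0r addr0.
rewrite q2; last by rewrite /dot /= mulr0 mul0r addr0.
rewrite (av_cst (c := (e, 0))); last by rewrite pair_eq0 /= gt_eqF.
rewrite (av_cst (c := (0, lam * e))); last by rewrite pair_eq0 /= (gt_eqF le0) andbF.
rewrite (av_eq (fun t _ => s1 t)) (av_eq (fun t _ => s2 t)).
rewrite -(close1 se) -(close2 se) => E; split.
  have nch : nchain ch (fun q => q.1 - q.2).
    apply: (chain_in_npath cX) => [|q [_ _ h]]; last by rewrite subr_eq0; apply/eqP.
    by apply: conB; [exact: con_fst_id|exact: con_snd_id].
  have [n nE] := wsum_int cch nch.
  exists n; rewrite -nE /wsum /ch !big_cons big_map /= (av_eq (fun t _ => s1 t)) (av_eq (fun t _ => s2 t)).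
  by rewrite addrA.
have sBp t : I01 t -> 0 < sB e t.
  by move=> /(sB_bounds se)/andP[h _]; exact: lt_le_trans h.
have sAp t : I01 t -> 0 < sA e t.
  by move=> /(sA_bounds se)/andP[h _]; exact: lt_le_trans h.
rewrite (@av_eq R (fun t => f (B (sB e t)) - B (sB e t)) (fun t => B (mu * sB e t) - B (sB e t))); last first.
  by move=> t It; rewrite (pl_fB pl)//; exact: sBp.
rewrite (@av_eq R (fun t => f (A (sA e t)) - A (sA e t)) (fun t => A (lam * sA e t) - A (sA e t))); last first.
  by move=> t It; rewrite (pl_fA pl)//; exact: sAp.
rewrite addrA (mid_chain se).
have -> : \sum_(u <- kap) av (fun t => f (T (u t)) - T (u t)) =
    \sum_(u <- kap) av (fun t => T (lin mu lam (u t)) - T (u t)).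
  apply: sum_alls; apply: alls_impl kr => u [_ uX]; apply: av_eq => t It.
  by rewrite (pl_fT pl)//; exact: uX.
rewrite -addrA E /diff; ring.
Qed.

Lemma wsum_linseg (u v : R2) (a b : R) :
  av (fun t => lin a b (seg u v t)) = av (seg (lin a b u) (lin a b v)).
Proof. by apply: av_eq => t _; rewrite /lin /seg /=; congr pair; ring. Qed.

Lemma diffE x : diff x = lin (mu - 1) (lam - 1) x.
Proof. by rewrite /diff /lin; congr pair; rewrite /=; ring. Qed.

(** [G] is found by integrality: with the first closing, [G + pi / 2] is a multiple of [2 * pi]
    strictly between 0 and [4 * pi], hence [G = 3 * pi / 2]. All the other terms are sums of quarter
    turns. *)
Lemma index_kap e : small e ->
  wsum (Lam (kap1 e) e) (fun x => f x - x) = 2 * pi * del /\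
  wsum (Lam (kap2 e) e) (fun x => f x - x) = - (4 * pi * del).
Proof.
move=> se; have [e0 _ _ _] := se; have [G /andP[G0 G1] HG] := wsum_index se.
have m1 := mu1; have l0 := lam0; have l1 := lam1; have pi0 := pi_gt0 R.
have [[n nE] ->] := HG _ (kap1_closes e0); have [_ ->] := HG _ (kap2_closes e0).
have pos (u v : R2) : 0 < cross u v -> dot u v = 0 -> av (seg u v) = pi / 2.
  by move=> /av_seg[].
have neg (u v : R2) : cross u v < 0 -> dot u v = 0 -> av (seg u v) = - (pi / 2).
  by move=> /av_seg_neg[].
have dE (u v : R2) : av (fun t => diff (seg u v t)) = av (seg (lin (mu - 1) (lam - 1) u) (lin (mu - 1) (lam - 1) v)).
  by rewrite -wsum_linseg; apply: av_eq => t _; rewrite diffE.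
have h1 : 0 < (mu - 1) * e by apply: mulr_gt0; lra.
have h2 : 0 < (1 - lam) * e by apply: mulr_gt0; lra.
have h3 : 0 < mu * e by apply: mulr_gt0; lra.
have h4 : 0 < lam * e by apply: mulr_gt0; lra.
have h5 : 0 < e * e by apply: mulr_gt0.
have h6 := mulr_gt0 h1 h2; have h7 := mulr_gt0 h3 h4.
have K1 : wsum (kap1 e) diff = pi / 2.
  by rewrite /wsum !big_cons big_nil dE pos ?addr0 // /lin /cross /dot /=; lra.
have n1 : n = 1.
  move: nE; rewrite K1 => nE.
  have : 0 < 2 * pi * (n%:~R : R) < 2 * pi * 2 by apply/andP; split; lra.
  rewrite pmulr_rgt0 ?ltr_pM2l ?mulr_gt0// => /andP[].
  rewrite (_ : 2 = (2%:Z)%:~R)// ltr0z ltr_int; case: (n) => [[|[|m]]|m] //.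
have G2 : G = 3 * pi / 2 by move: nE; rewrite n1 K1 mulr1; lra.
have K2 : wsum (kap2 e) diff = - (3 * pi / 2).
  by rewrite /wsum !big_cons big_nil !dE !neg; rewrite /lin /cross /dot /=; lra.
have I1 : wsum (kap1 e) id = - (pi / 2).
  by rewrite /wsum !big_cons big_nil (neg (0, e) (e, 0)) /cross /dot /=; lra.
have I2 : wsum (kap2 e) id = 3 * pi / 2.
  rewrite /wsum !big_cons big_nil (pos (0, e) (- e, 0)) ?(pos (- e, 0) (0, - e)) ?(pos (0, - e) (e, 0));
    by rewrite /cross /dot /=; lra.
have J1 : wsum (kap1 e) (lin mu lam) = - (pi / 2).
  by rewrite /wsum !big_cons big_nil !wsum_linseg !neg; rewrite /lin /cross /dot /=; lra.
have J2 : wsum (kap2 e) (lin mu lam) = 3 * pi / 2.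
  by rewrite /wsum !big_cons big_nil !wsum_linseg !pos; rewrite /lin /cross /dot /=; lra.
by rewrite K1 I1 I2 J1 J2 K2 G2; split; lra.
Qed.

End PlaneLoop.

(** * Winding numbers of the rerouted loop *)

Section LoopWinding.
Variable R : realType.
Local Notation R2 := (R * R)%type.

Lemma compact_uniform (K : set R2) (Q : R -> R2 -> Prop) : compact K ->
  (forall z0, K z0 -> exists2 rho, 0 < rho & exists2 e0, 0 < e0 &
    forall z e, `|z - z0| < rho -> 0 < e < e0 -> Q e z) ->
  exists2 e0, 0 < e0 & forall z e, K z -> 0 < e < e0 -> Q e z.
Proof.
move=> /compact_near_coveringP cK H.
have := cK _ (0 : R)^'+ (fun e x => Q e x) _.
case=> [z0 /H[rho rho0 [e0 e00 HQ]]|e /= e0 He].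
  exists (ball z0 rho, [set e | 0 < e < e0]).
    split=> /=; first by exact: nbhsx_ballx.
    exists e0 => //= e; rewrite /ball /= sub0r normrN => h e1; rewrite e1 /=.
    by move: h; rewrite gtr0_norm.
  move=> [z e] [/= zb ee]; apply: HQ => //.
  by move: zb; rewrite -ball_normE /ball_ /= distrC.
exists e => // z e' Kz /andP[e'0 e'e]; apply: (He e') => //=.
by rewrite /ball /= sub0r normrN gtr0_norm.
Qed.

Variables (f T : R2 -> R2) (A B : R -> R2) (mu lam c d r del rho : R).
Hypothesis pl : plane_loop f T A B mu lam c d r del.
Hypothesis curve_closed : closed (curve A B c d).
Hypothesis rho_r : 0 < rho <= r.
Hypothesis sector : forall x, pBx rho x -> curve A B c d (T x) ->
  (x.1 = 0 /\ 0 <= x.2) \/ (x.2 = 0 /\ 0 <= x.1).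

Local Notation small := (small mu c d r).
Local Notation Lam := (Lam T A B c d).
Local Notation curve := (curve A B c d).
Definition wind kap e z := wsum (Lam kap e) (fun x => x - z).

(** For small [e] the closing near [p] is far away in the plane, so [z] only has to stay away from
    the curve; the bounds do not depend on the closing. *)
Lemma wind_local z0 : ~ curve z0 -> exists2 rho, 0 < rho & exists2 e0, 0 < e0 &
  forall z e kap, `|z - z0| < rho -> 0 < e < e0 -> small e -> closes e kap ->
    wind kap e z = wind kap e z0.
Proof.
move=> nz.
have /nbhs_ballP[s /= s0 Hs] : nbhs z0 (~` curve) by apply: open_nbhs_nbhs; split=> //; exact: closed_openC.
have [e0 /andP[e00 _] He0] := ld_far (pl_ld pl) (`|z0| + 1).
exists (Num.min s 1); first by rewrite lt_min s0 ltr01.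
exists e0 => // z e kap; rewrite lt_min => /andP[zs z1] /andP[ep ee] se ck.
pose w t : R2 := z0 + t *: (z - z0).
have wz t : I01 t -> `|w t - z0| <= `|z - z0|.
  by move=> /I01P/andP[t0 t1]; rewrite /w addrC addKr normrZ ger0_norm// ler_piMl.
have w0 : w 0 = z0 by rewrite /w scale0r addr0.
have w1 : w 1 = z by rewrite /w scale1r addrC subrK.
have := @wsum_move R (Lam kap e) w (Lam_closed pl se ck); rewrite w0 w1 /wind => <- //.
  by rewrite /w; ctac.
apply: (chain_sub _ (Lam_in pl se ck.2 (fun x h => h))) => x + t It; apply: contraPneq => -> [cw|[y py Ty]].
  by apply: (Hs _ _ cw); rewrite -ball_normE /ball_ /= distrC (le_lt_trans (wz t It)).
have /He0[+ _] : `|w t| <= `|z0| + 1.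
  rewrite -[w t](subrK z0) addrC (le_trans (ler_normD _ _))// lerD2l ltW//.
  exact: le_lt_trans (wz t It) z1.
by move=> /(_ y); apply=> //; apply: pBx_sub py; exact: ltW.
Qed.

(** The arcs cancel, and the two closings together leave a diamond around 0 run clockwise; [ld_far]
    gives the winding number of its image. *)
Lemma wind_diff M : exists2 e0, 0 < e0 & forall z e, `|z| <= M -> 0 < e < e0 -> small e ->
  wind (kap1 e) e z - wind (kap2 e) e z = 2 * pi * del.
Proof.
have [e0 /andP[e00 er] He0] := ld_far (pl_ld pl) M.
exists e0 => // z e zM /andP[ep ee] se; have [Tz Hz] := He0 z zM.
have sub x : pBx e x -> pBx e0 x by apply: pBx_sub; exact: ltW.
pose dia : seq (R -> R2) := [:: seg (0, e) (e, 0); seg (e, 0) (0, - e); seg (0, - e) (- e, 0);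
  seg (- e, 0) (0, e)].
have [h1 h2] : Bx e ((e, 0) : R2) /\ Bx e ((0, e) : R2) by apply: axis_Bx; lra.
have [h3 h4] : Bx e ((- e, 0) : R2) /\ Bx e ((0, - e) : R2) by apply: axis_Bx; lra.
have ee0 : 0 < e * e by rewrite mulr_gt0.
have cd : closed_chain dia by move=> F; rewrite !big_cons big_nil !seg0 !seg1; ring.
have dX : chain_in (pBx e) dia.
  by do 4?[split; first by apply: pBx_seg => //; rewrite /cross /= lt_eqF//; lra].
have E : wsum dia id = - (2 * pi).
  rewrite /wsum !big_cons big_nil; have neg (u v : R2) : cross u v < 0 -> dot u v = 0 -> av (seg u v) = - (pi / 2).
    by move=> /av_seg_neg[].
  by rewrite !neg; rewrite /cross /dot /=; lra.
have := Hz _ cd (chain_sub sub dX); rewrite E mulrN opprK /wind /wsum /Lam !big_cat /=.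
rewrite !big_cons !big_nil !addr0.
have rv (u v : R2) : Bx e u -> Bx e v -> cross u v != 0 ->
    av (fun t => T (seg u v t) - z) = - av (fun t => T (seg v u t) - z).
  move=> bu bv uv; rewrite -av_rev.
    by apply: av_eq => t _; rewrite seg_rev.
  have vu : cross v u != 0 by move: uv; rewrite /cross -oppr_eq0 opprB ![_.1 * _]mulrC ![_.2 * _]mulrC.
  have [c1 c2] := pBx_seg bv bu vu; split.
    apply: conB; last exact: con_cst.
    by apply: con_comp c1 _ (ld_con (pl_ld pl)) => t /c2 h; exact: pBx_sub (small_le pl se) h.
  by move=> t /c2/sub/Tz ?; rewrite subr_eq0; apply/eqP.
rewrite (rv (e, 0) (0, - e))// ?(rv (0, - e) (- e, 0))// ?(rv (- e, 0) (0, e))//; first lra.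
all: by rewrite /cross /=; apply/eqP; lra.
Qed.

Lemma pBx_rho x : pBx rho x -> pBx r x.
Proof. by apply: pBx_sub; case/andP: rho_r. Qed.

(** If neither the closing nor the loop meets the ray from 0 up to [w], then [T w] escapes to
    infinity along its image. *)
Lemma wind_ray (kap : R -> seq (R -> R2)) w : pBx rho w ->
  (forall e, 0 < e -> closes e (kap e)) ->
  (forall e s, 0 < e -> 0 < s <= 1 -> chain_in (pBx e `\` [set scal s w]) (kap e)) ->
  ~ (w.1 = 0 /\ 0 <= w.2) -> ~ (w.2 = 0 /\ 0 <= w.1) ->
  forall e, small e -> wind (kap e) e (T w) = 0.
Proof.
move=> pw ck kw n1 n2 e se; have [e0 _ _ _] := se.
apply: (T_escape pl (pBx_rho pw) (Lam_closed pl se (ck e e0))).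
have psw s : 0 < s <= 1 -> pBx rho (scal s w).
  move=> /andP[s0 s1]; split; first by apply: Bx_sub (Bx_scal s0 pw.1); rewrite ler_piMl// ltW//; case/andP: rho_r.
  by move=> /eqP; rewrite scal_eq0 ?gt_eqF// => /eqP; case: pw.
have nc s : 0 < s <= 1 -> ~ curve (T (scal s w)).
  move=> s01 /(sector (psw s s01)) /=; move: s01 => /andP[s0 s1].
  case=> -[/eqP]; rewrite mulf_eq0 (gt_eqF s0) /= pmulr_rge0// => /eqP h h'.
    by apply: n1.
  by apply: n2.
apply: alls_cat.
  by apply: chain_sub (arcs_in pl se) => x cx s s01 e'; apply: (nc s s01); rewrite -e'.
have H : alls (fun u => con I01 u /\ forall t, I01 t -> pBx e (u t)) (kap e) := (ck e e0).2.
have H' : alls (fun u => forall t, I01 t -> forall s, 0 < s <= 1 -> u t <> scal s w) (kap e).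
  elim: (kap e) (kw e) => [//|u l IH] Hu /=; split.
    by move=> t It s s01; have [[_ ul] _] := Hu s e0 s01; case: (ul t It).
  by apply: IH => s e0' s01; case: (Hu s e0' s01).
apply/alls_mapE; apply: alls_impl (alls_and H H') => u [[cu uX] us]; split.
  by apply: con_comp cu _ (ld_con (pl_ld pl)) => t /uX h; exact: pBx_sub (small_le pl se) h.
move=> t It s s01 /(ld_inj (pl_ld pl)) h; apply: (us t It s s01); apply: h.
  exact: pBx_sub (small_le pl se) (uX t It).
exact/pBx_rho/psw.
Qed.

Lemma wind1_ray s : 0 < s <= rho -> forall e, small e -> wind (kap1 e) e (T (- s, - s)) = 0.
Proof.
move=> /andP[s0 sr] e se; apply: (@wind_ray (@kap1 R) (- s, - s)) se => /= {e}.
- split; last by move=> [/eqP]; rewrite oppr_eq0 gt_eqF.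
  by split; apply/andP; split=> /=; lra.
- exact: kap1_closes.
- move=> e u e0 /andP[u0 u1]; have [_ [[cu uX] _]] := kap1_closes e0; split=> //; split=> // t It.
  split; first exact: uX.
  move=> [h1 h2]; have us : 0 < u * s by rewrite mulr_gt0.
  by move: It h1 h2 => /I01P/andP[? ?]; rewrite /seg /=; nra.
- by move=> [/eqP]; rewrite oppr_eq0 gt_eqF.
- by move=> [/eqP]; rewrite oppr_eq0 gt_eqF.
Qed.

Lemma wind2_ray s : 0 < s <= rho -> forall e, small e -> wind (kap2 e) e (T (s, s)) = 0.
Proof.
move=> /andP[s0 sr] e se; apply: (@wind_ray (@kap2 R) (s, s)) se => /= {e}.
- split; last by move=> [/eqP]; rewrite gt_eqF.
  by split; apply/andP; split=> /=; lra.
- exact: kap2_closes.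
- move=> e u e0 /andP[u0 u1]; have [_ [[cu uX] [[cu2 uX2] [[cu3 uX3] _]]]] := kap2_closes e0.
  have us : 0 < u * s by rewrite mulr_gt0.
  split; [|split; [|split=> //]]; split=> // t It; split=> //; do ?[by auto];
    by move=> [h1 h2]; move: It h1 h2 => /I01P/andP[? ?]; rewrite /seg /=; nra.
- by move=> [/eqP]; rewrite gt_eqF.
- by move=> [/eqP]; rewrite gt_eqF.
Qed.

End LoopWinding.

(** * The components of the complement of the loop *)

Section LoopComponents.
Variable R : realType.
Local Notation R3 := (R * R * R)%type.
Local Notation R2 := (R * R)%type.
Local Notation S2 := (@S2 R).
Variables (g ginv : R3 -> R3) (p : R3) (W : set R3) (V : set R2) (h : R3 -> R2) (k : R2 -> R3).
Variables (mu lam eta c d : R) (phi : R3 -> R2) (psi : R2 -> R3) (a b : R -> R3) (L : set R3).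
Hypotheses (hom : S2homeo g ginv) (ls : lsaddle g p W V h k mu lam eta) (ch : S2chart p phi psi).
Hypothesis hl : hloop g k mu lam eta a b c d L.

Definition plane_map z := phi (g (psi z)).
Local Notation f := plane_map.
Local Notation T := (fun x => phi (k x)).
Local Notation A := (fun s => phi (a s)).
Local Notation B := (fun s => phi (b s)).
Local Notation curve := (curve A B c d).

Let c0 : 0 < c. Proof. exact: hl_c hl. Qed.
Let d0 : 0 < d. Proof. exact: hl_d hl. Qed.
Let e0 : 0 < eta. Proof. exact: ls_eta ls. Qed.

Lemma loop_a0 : a 0 = p.
Proof. by rewrite (hl_a hl) ?normr0 ?ltW// (ls_p ls). Qed.
Lemma loop_b0 : b 0 = p.
Proof. by rewrite (hl_b hl) ?normr0 ?ltW// (ls_p ls). Qed.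

Lemma loop_a_neq s : 0 < s -> a s <> p.
Proof. by move=> s0; rewrite -loop_a0 => /(hl_ia hl) e; rewrite e ltxx in s0. Qed.
Lemma loop_b_neq s : 0 < s -> b s <> p.
Proof. by move=> s0; rewrite -loop_b0 => /(hl_ib hl) e; rewrite e ltxx in s0. Qed.

Lemma k_neq x : Bx eta x -> x <> 0 -> k x <> p.
Proof.
move=> Bx xn; rewrite -(ls_p ls) => /(ls_kinj ls (ls_box ls Bx)) H; apply: xn; apply: H.
by apply: (ls_box ls); apply: Bx0; exact: ltW.
Qed.

Lemma plane_loop_ex : exists r del, r <= eta /\ plane_loop f T A B mu lam c d r del.
Proof.
have [r [del [re ld]]] := local_degree_ex ls ch; exists r, del; split=> //.
have aS := hl_aS hl; have bS := hl_bS hl.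
have r0 := ld_r ld; have small s : 0 < s <= r -> `|s| <= eta.
  by move=> /andP[s0 sr]; rewrite gtr0_norm// (le_trans sr).
split=> //; try by case: ls.
- apply: (con_comp (f := a)) (chart_con ch); first exact/con_continuous/(hl_ca hl).
  by move=> s s0; split; [exact: aS|exact: loop_a_neq].
- apply: (con_comp (f := b)) (chart_con ch); first exact/con_continuous/(hl_cb hl).
  by move=> s s0; split; [exact: bS|exact: loop_b_neq].
- move=> s t s0 t0 /(chart_inj ch (aS s) (aS t) (loop_a_neq s0) (loop_a_neq t0)).
  exact: (hl_ia hl).
- move=> s t s0 t0 /(chart_inj ch (bS s) (bS t) (loop_b_neq s0) (loop_b_neq t0)).
  exact: (hl_ib hl).
- move=> s t /andP[s0 sc] /andP[t0 td].
  move=> /(chart_inj ch (aS s) (bS t) (loop_a_neq s0) (loop_b_neq t0)).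
  case/(hl_meet hl) => //; [by apply/andP; split; lra|by apply/andP; split; lra|].
  by move=> [e _]; rewrite e ltxx in s0.
- by rewrite (hl_cd hl).
- by move=> s /small/(hl_a hl) ->.
- by move=> s /small/(hl_b hl) ->.
- by move=> s s0; rewrite /f (chart_psiK ch) ?(hl_ga hl)//; exact: loop_a_neq.
- by move=> s s0; rewrite /f (chart_psiK ch) ?(hl_gb hl)//; exact: loop_b_neq.
- move=> x [Bx x0]; have Be := Bx_sub re Bx.
  by rewrite /f (chart_psiK ch (ls_kS2 ls (ls_box ls Be)) (k_neq Be x0)); have [_ ->] := ls_g ls Be.
Qed.

Lemma loop_p : L p.
Proof. by rewrite (hl_L hl); left; exists 0; [by apply/andP; split=> //; exact: ltW|exact: loop_a0]. Qed.

Lemma loop_compact : compact L.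
Proof.
rewrite (hl_L hl); apply: compactU; apply: con_image_compact; try exact: cc_compact.
  exact/con_continuous/(hl_ca hl).
exact/con_continuous/(hl_cb hl).
Qed.

Lemma loop_closed : closed L.
Proof. by apply: compact_closed; [exact: R3_hausdorff|exact: loop_compact]. Qed.

Lemma curveE z : curve z <-> L (psi z).
Proof.
rewrite (hl_L hl); split.
  move=> [[s /andP[s0 sc] <-]|[s /andP[s0 sc] <-]]; [left|right]; exists s;
    by rewrite ?/cc /= ?sc ?(ltW s0) ?(chart_psiK ch) //; first [exact: hl_aS hl _|exact: hl_bS hl _|
      exact: loop_a_neq|exact: loop_b_neq].
have zp := @chart_neq R p phi psi ch z.
move=> [[s /andP[s0 sc] e]|[s /andP[s0 sc] e]]; [left|right]; exists s; rewrite ?e ?(chart_phiK ch)//=;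
  rewrite sc andbT lt_neqAle s0 andbT; apply/eqP => s00; apply: zp; rewrite -e -s00;
  [exact: loop_a0|exact: loop_b0].
Qed.

Lemma curve_closed : closed curve.
Proof.
rewrite (_ : curve = psi @^-1` L); last by apply/seteqP; split=> z /curveE.
by apply: closed_comp loop_closed => z _; exact: (chart_psi_cont ch).
Qed.

(** The parts of the branches with parameter at least [m] form a compact set that misses [p]; close
    to [p] the loop therefore consists of the two local half axes. *)
Lemma sector_ex r0 : 0 < r0 -> exists2 rho, 0 < rho <= r0 & rho <= eta /\
  forall x, Bx rho x -> (L (k x) <-> (x.1 = 0 /\ 0 <= x.2) \/ (x.2 = 0 /\ 0 <= x.1)).
Proof.
move=> r00; pose m := Num.min (Num.min eta c) d.
have m0 : 0 < m by rewrite !lt_min e0 c0 d0.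
have me : m <= eta by rewrite !ge_min lexx.
have mc : m <= c by rewrite !ge_min lexx orbT.
have md : m <= d by rewrite ge_min lexx orbT.
clearbody m.
pose K := a @` cc m c `|` b @` cc m d.
have cK : closed K.
  apply: compact_closed; first exact: R3_hausdorff.
  by apply: compactU; apply: con_image_compact; try exact: cc_compact;
    [exact/con_continuous/(hl_ca hl)|exact/con_continuous/(hl_cb hl)].
have Kp : ~ K p.
  by move=> [[s /andP[s0 _]]|[s /andP[s0 _]]]; [apply: loop_a_neq|apply: loop_b_neq]; exact: lt_le_trans s0.
have nK : nbhs (k 0) (~` K).
  by rewrite (ls_p ls); apply: open_nbhs_nbhs; split=> //; exact: closed_openC.
have V0 : V 0 by apply: (ls_box ls); apply: Bx0; exact: ltW.
have /within_cvgP/(_ _ nK) nn := ls_k ls V0.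
have [r1 r10 H1] := nbhs_Bx nn.
pose rho := Num.min (Num.min r0 m) r1.
have rho0 : 0 < rho by rewrite !lt_min r00 m0 r10.
have h1 : rho <= r0 by rewrite !ge_min lexx.
have h2 : rho <= m by rewrite !ge_min lexx orbT.
have h3 : rho <= r1 by rewrite ge_min lexx orbT.
clearbody rho.
exists rho; first by rewrite rho0.
split; first exact: le_trans me.
move=> x bx; have Be : Bx eta x by apply: Bx_sub bx; exact: le_trans me.
have Vx := ls_box ls Be.
have nKx : ~ K (k x) by apply: H1 => //; exact: Bx_sub h3 _ bx.
have ax s : 0 <= s <= m -> Bx eta ((s, 0) : R2) /\ Bx eta ((0, s) : R2).
  by move=> /andP[s0 s1]; apply: axis_Bx; apply/andP; split; lra.
rewrite (hl_L hl); split.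
  move=> [[s /andP[s0 sc] e]|[s /andP[s0 sc] e]].
    have sm : s < m by rewrite ltNge; apply/negP => sm; apply: nKx; left; exists s => //; apply/andP.
    have [_ Bs] := ax s ltac:(by rewrite s0 ltW).
    rewrite (hl_a hl) ?ger0_norm ?(le_trans (ltW sm))// in e.
    by move/(ls_kinj ls (ls_box ls Bs) Vx) : e => <-; left.
  have sm : s < m by rewrite ltNge; apply/negP => sm; apply: nKx; right; exists s => //; apply/andP.
  have [Bs _] := ax s ltac:(by rewrite s0 ltW).
  rewrite (hl_b hl) ?ger0_norm ?(le_trans (ltW sm))// in e.
  by move/(ls_kinj ls (ls_box ls Bs) Vx) : e => <-; right.
case: x bx {Be Vx nKx} => [x1 x2] [/= /andP[? ?] /andP[? ?]] [[-> ?]|[-> ?]]; [left; exists x2|right; exists x1];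
  rewrite /cc /= ?(hl_a hl) ?(hl_b hl) ?ger0_norm//; try apply/andP; try split; lra.
Qed.

End LoopComponents.

Lemma connected_locally_constant (T : topologicalType) (C : set T) (P : T -> Prop) :
  connected C ->
  (forall x, C x -> exists2 U, nbhs x U & forall y, U y -> C y -> (P x <-> P y)) ->
  forall x y, C x -> C y -> P x -> P y.
Proof.
move=> cC H x y Cx Cy Px; pose B := C `&` [set z | P z].
suff BC : B = C by move: Cy; rewrite -BC => -[].
apply: cC; first by exists x.
- exists (interior [set z | C z -> P z]); first exact: open_interior.
  apply/seteqP; split=> z [Cz]; last by move=> /interior_subset Pz; split=> //; exact: Pz.
  move=> Pz; split=> //; have [U nU HU] := H z Cz.
  by apply: filterS nU => w Uw Cw; apply/(HU w Uw Cw).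
- exists (~` interior [set z | C z -> ~ P z]); first exact/open_closedC/open_interior.
  apply/seteqP; split=> z [Cz Pz]; split=> //; first by move=> /interior_subset/(_ Cz).
  apply: contrapT => nPz; apply: Pz; have [U nU HU] := H z Cz.
  by apply: filterS nU => w Uw Cw Pw; apply/nPz/(HU w Uw Cw).
Qed.

(** * Arcs do not bound a region of the plane *)

Section PlaneComponents.
Variable R : realType.
Local Notation R2 := (R * R)%type.

Lemma I01_connected : connected (@I01 R).
Proof. by apply/connected_intervalP; exact: interval_is_interval. Qed.

Lemma star_connected (D : set R2) o : D o ->
  (forall x t, D x -> I01 t -> D (seg o x t)) -> connected D.
Proof.
move=> Do Hs; have -> : D = \bigcup_(x in D) (seg o x @` I01).
  apply/seteqP; split=> x; first by move=> Dx; exists x => //; exists 1; [exact: I011|exact: seg1].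
  by move=> [y Dy [t It <-]]; exact: Hs.
apply: bigcup_connected; first by exists o => x Dx; exists 0; [exact: I010|exact: seg0].
by move=> x Dx; apply: con_image_connected; [exact: con_seg|exact: I01_connected].
Qed.

(** The angle is lifted on the parameter interval and carried back by the continuous inverse of
    [gam]. The interval is centred at 0 because [lift_angle] contracts to 0. *)
Lemma arc_angle (gam : R -> R2) (o : R2) : con (cc (-1) 1) gam ->
  (forall s t, cc (-1) 1 s -> cc (-1) 1 t -> gam s = gam t -> s = t) ->
  ~ (gam @` cc (-1) 1) o -> exists th, isang (gam @` cc (-1) 1) (fun x => x - o) th.
Proof.
move=> cg ig no; set K := cc _ _ in cg ig no *.
have cK : compact K by exact: cc_compact.
have [|||th [cth Hth]] := @lift_angle R _ K (fun t => gam t - o) cK.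
- move=> x s /andP[h1 h2] /I01P/andP[s0 s1]; apply/andP; rewrite /GRing.scale /=; split; nra.
- by ctac.
- by move=> t Kt; rewrite subr_eq0; apply/eqP => e; apply: no; exists t.
pose l x := xget 0 [set t | K t /\ gam t = x].
have lP x : (gam @` K) x -> K (l x) /\ gam (l x) = x.
  by move=> [t Kt <-]; apply: (@xgetPex _ 0 [set s | K s /\ gam s = gam t]); exists t.
exists (th \o l); split; last by move=> x /lP[Kl e]; have := Hth _ Kl; rewrite e.
apply: (con_comp (f := l) (B := K)) cth; last by move=> x /lP[].
by apply: (con_inverse (g := id) (@R2_hausdorff R) cK cg ig) lP; exact: con_id.
Qed.

(* The angle of x - o on J extends to G by Tietze: x - o could then be replaced
   inside G by a nonvanishing field, against its winding number on a large square. *)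
Lemma no_bounded_component (G J : set R2) (o : R2) th M : open G -> G o ->
  (forall z, G z -> `|z| < M) -> closure G `<=` G `|` J -> (forall z, J z -> ~ G z) ->
  compact J -> isang J (fun x => x - o) th -> False.
Proof.
move=> oG Go GM clG JG cJ [cth Hth].
have [TH cTH THE] := tietze_compact cJ cth.
pose w (x : R2) := scal (rad (x - o))^-1 (x - o).
have rn x : ~ G x -> x - o != 0 by move=> nG; rewrite subr_eq0; apply/eqP => e; apply: nG; rewrite e.
have cw : con (~` G) w.
  have c1 : con (~` G) (fun x : R2 => x - o) by ctac.
  have c2 : con (~` G) (fun x : R2 => (rad (x - o))^-1).
    by apply: conV; [move=> x /rn; rewrite rad_eq0|exact: con_rad].
  by rewrite /w /scal; ctac.
have ce : con (closure G) (fun x => expi (TH x)) by apply: con_expi; exact: con_continuous.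
(* The unit vector of the extended angle on the closure of [G], and that of [x - o] outside; the two
   agree on [J], where both are defined. *)
pose v x := if `[< closure G x >] then expi (TH x) else w x.
have cv : con (closure G `|` ~` G) v.
  apply: con_glue => //; [exact: closed_closure|exact: open_closedC|].
  move=> x /clG[//|Jx] nG; rewrite THE// /w {2}(Hth x Jx) /scal /=.
  have r0 : rad (x - o) != 0 by rewrite rad_eq0 rn.
  by rewrite /expi !mulrA mulVf// !mul1r.
have cov x : (closure G `|` ~` G) x.
  by have [/subset_closure|] := pselect (G x); [left|right].
have M0 : 0 < M by apply: le_lt_trans (GM o Go).
have w0 x : ~ G x -> w x != 0.
  by move=> /rn h; rewrite /w scal_eq0// invr_eq0 rad_eq0.
have v0 x : v x != 0.
  rewrite /v; case: asboolP => [_|nx]; first exact: expi_neq0.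
  by apply: w0 => /subset_closure.
have MM : - M <= M by lra.
have E1 : wsum (rect_chain (- M) M (- M) M) v = 0.
  apply: (wsum_rect0 (x0 := - M) (x1 := M) (y0 := - M) (y1 := M)).
  - exact: rect_chain_closed.
  - exact: rect_chain_in.
  - exact: con_subset cv.
  - by move=> x _; exact: v0.
have E2 : wsum (rect_chain (- M) M (- M) M) (fun x => x - o) = 2 * pi.
  have := GM o Go; rewrite R2_norm_lt !ltr_norml => /andP[? ?].
  by apply: wsum_rect_center.
have bdG x : rect_bd (- M) M (- M) M x -> ~ G x.
  by move=> /(wsum_rect_far M0) h /GM; rewrite ltNge h.
have ch := rect_chain_bd MM MM.
have E3 : wsum (rect_chain (- M) M (- M) M) v = wsum (rect_chain (- M) M (- M) M) w.
  apply: (wsum_eq_in ch) => x /bdG nG; rewrite /v; case: asboolP => // /clG[//|Jx].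
  rewrite THE// /w {2}(Hth x Jx) /scal /=.
  have r0 : rad (x - o) != 0 by rewrite rad_eq0 rn.
  by rewrite /expi !mulrA mulVf// !mul1r.
have E4 : wsum (rect_chain (- M) M (- M) M) w = wsum (rect_chain (- M) M (- M) M) (fun x => x - o).
  apply: sum_alls; apply: alls_impl ch => u [cu uX].
  apply: (av_scal (f := fun t => u t - o) (c := fun t => (rad (u t - o))^-1)).
    by split; [ctac|move=> t /uX/bdG/rn].
  by move=> t /uX/bdG/rn h; rewrite invr_gt0 rad_gt0.
by have := pi_gt0 R; move: E1 E2; rewrite E3 E4 => -> h; lra.
Qed.

End PlaneComponents.

Section TwoComponents.
Variable R : realType.
Local Notation R3 := (R * R * R)%type.
Local Notation R2 := (R * R)%type.
Local Notation S2 := (@S2 R).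
Variables (g ginv : R3 -> R3) (p : R3) (W : set R3) (V : set R2) (h : R3 -> R2) (k : R2 -> R3).
Variables (mu lam eta c d : R) (phi : R3 -> R2) (psi : R2 -> R3) (a b : R -> R3) (L : set R3).
Hypotheses (ls : lsaddle g p W V h k mu lam eta) (ch : S2chart p phi psi).
Hypothesis hl : hloop g k mu lam eta a b c d L.

Local Notation f := (plane_map g phi psi).
Local Notation T := (fun x => phi (k x)).
Local Notation A := (fun s => phi (a s)).
Local Notation B := (fun s => phi (b s)).
Local Notation curve := (curve A B c d).
Local Notation X := (S2 `\` L).

Variables (r del rho : R).
Hypotheses (reta : r <= eta) (pl : plane_loop f T A B mu lam c d r del).
Hypotheses (rho_r : 0 < rho <= r)
  (sector : forall x, Bx rho x -> (L (k x) <-> (x.1 = 0 /\ 0 <= x.2) \/ (x.2 = 0 /\ 0 <= x.1))).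

Let rho0 : 0 < rho. Proof. by case/andP: rho_r. Qed.

Lemma X_neq x : X x -> x <> p.
Proof. by move=> [_ nL] e; apply: nL; rewrite e; exact: loop_p ls hl. Qed.

Lemma curve_phi x : X x -> ~ curve (phi x).
Proof.
move=> Xx; have [Sx nL] := Xx; have xp := X_neq Xx.
by move=> /(curveE ls ch hl); rewrite (chart_psiK ch Sx xp).
Qed.

Lemma X_psi z : X (psi z) <-> ~ curve z.
Proof.
split; first by move=> [_ nL] /(curveE ls ch hl).
by move=> nc; split; [exact: chart_S2 ch z|move=> Lz; apply: nc; apply/(curveE ls ch hl)].
Qed.

Lemma phi_near x e : S2 x -> x <> p -> 0 < e ->
  exists2 U, nbhs x U & forall y, U y -> S2 y -> y <> p /\ `|phi y - phi x| < e.
Proof.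
move=> Sx xp e0; have /con_eps/(_ x (conj Sx xp) e e0)[s s0 Hs] := chart_con ch.
exists (ball x s `&` ~` [set p]).
  apply: filterI; first exact: nbhsx_ballx.
  apply: open_nbhs_nbhs; split=> //; apply: closed_openC.
  by apply: compact_closed; [exact: R3_hausdorff|exact: compact_set1].
move=> y [yb yp] Sy; split=> //; rewrite distrC; apply: Hs => //.
by move: yb; rewrite -ball_normE.
Qed.

Lemma component_nbhs x : X x -> exists2 U, nbhs x U &
  forall y, U y -> S2 y -> connected_component X x y.
Proof.
move=> Xx; have [Sx nL] := Xx; have xp := X_neq Xx.
have /nbhs_ballP[e /= e0 He] : nbhs (phi x) (~` curve).
  by apply: open_nbhs_nbhs; split; [apply: closed_openC; exact: curve_closed ls ch hl|exact: curve_phi].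
have [U nU HU] := phi_near Sx xp e0; exists U => // y Uy Sy.
have [yp yx] := HU y Uy Sy.
pose D := psi @` ball (phi x) e.
apply: (@connected_component_max _ X D x).
- by exists (phi x); [exact: ballxx|rewrite (chart_psiK ch Sx xp)].
- by move=> _ [z /He zc <-]; apply/X_psi.
- apply: con_image_connected; first by apply: con_continuous; exact: chart_psi_cont ch.
  apply: (@star_connected _ _ (phi x)); first exact: ballxx.
  move=> z t; rewrite -!ball_normE /ball_ /= => zb /I01P/andP[t0 t1].
  have -> : phi x - seg (phi x) z t = t *: (phi x - z).
    by rewrite scalE; case: (phi x) z {zb} => [u1 u2] [v1 v2]; rewrite /seg /scal; congr pair; rewrite /=; ring.
  by rewrite normrZ ger0_norm// (le_lt_trans _ zb)// ler_piMl.
- exists (phi y); last by rewrite (chart_psiK ch Sy yp).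
  by rewrite -ball_normE /ball_ /= distrC.
Qed.

Lemma component_open x : S2open (connected_component X x).
Proof.
pose C := connected_component X x.
exists (interior [set y | S2 y -> C y]); first exact: open_interior.
apply/seteqP; split=> y; last by move=> [Sy /interior_subset Cy]; exact: Cy.
move=> Cy; have Xy : X y := connected_component_sub Cy; split; first by case: Xy.
have [U nU HU] := component_nbhs Xy; apply: filterS nU => z Uz Sz.
exact: connected_component_trans Cy (HU z Uz Sz).
Qed.

(** The side that contains, near [p], the quadrant between the two branches; the other three
    quadrants belong to [C2]. *)
Definition C1 := connected_component X (k (rho, rho)).
Definition C2 := connected_component X (k (- rho, - rho)).

Let kS x : Bx rho x -> S2 (k x).
Proof.
move=> bx; apply: (ls_kS2 ls); apply: (ls_box ls); apply: Bx_sub bx.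
by case/andP: rho_r => _ /le_trans; apply.
Qed.

Lemma kX x : Bx rho x -> X (k x) <-> 0 < x.1 /\ 0 < x.2 \/ x.1 < 0 \/ x.2 < 0.
Proof.
move=> bx; split.
  move=> [_ nL]; have [x1|x1|x1] := ltgtP x.1 0; first by right; left.
    have [x2|x2|x2] := ltgtP x.2 0; [by right; right|by left|].
    by case: nL; apply/(sector bx); right; rewrite x2 ltW.
  have [x2|x2|x2] := ltgtP x.2 0; [by right; right| |]; case: nL; apply/(sector bx); left;
    by rewrite x1 ?x2 ?(ltW x2).
move=> H; split; first exact: kS.
by move=> /(sector bx); case: H => [[h1 h2]|[h1|h1]] [[e1 h3]|[e1 h3]]; lra.
Qed.

Let con_k : con (Bx rho) k.
Proof.
apply: con_subset (ls_k ls) => x bx; apply: (ls_box ls); apply: Bx_sub bx.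
by case/andP: rho_r => _ /le_trans; apply.
Qed.

Lemma quadrant1 x : Bx rho x -> 0 < x.1 -> 0 < x.2 -> C1 (k x).
Proof.
have r0 := rho0; move=> bx x1 x2; pose D := [set y : R2 | Bx rho y /\ (0 < y.1 /\ 0 < y.2)].
have Do : D (rho, rho) by split=> //; split; apply/andP; split=> /=; lra.
apply: (@connected_component_max _ X (k @` D)).
- by exists (rho, rho).
- by move=> _ [y [By yp] <-]; apply/(kX By); left.
- apply: con_image_connected; first by apply: con_subset con_k => y [].
  apply: (star_connected Do) => y t [[/andP[? ?] /andP[? ?]] [? ?]] /I01P/andP[? ?].
  by split; [split; apply/andP; split|split]; rewrite /seg /=; nra.
- by exists x.
Qed.

Lemma quadrant2 x : Bx rho x -> x.1 < 0 \/ x.2 < 0 -> C2 (k x).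
Proof.
have r0 := rho0; move=> bx x12; pose D := [set y : R2 | Bx rho y /\ (y.1 < 0 \/ y.2 < 0)].
have Do : D (- rho, - rho) by split; [split; apply/andP; split=> /=; lra|left=> /=; lra].
apply: (@connected_component_max _ X (k @` D)).
- by exists (- rho, - rho).
- by move=> _ [y [By yp] <-]; apply/(kX By); right.
- apply: con_image_connected; first by apply: con_subset con_k => y [].
  apply: (star_connected Do) => y t [[/andP[? ?] /andP[? ?]] yn] /I01P/andP[? ?].
  split; first by split; apply/andP; split; rewrite /seg /=; nra.
  by case: yn => yn; [left|right]; rewrite /seg /=; nra.
- by exists x.
Qed.

Lemma quadrant x : Bx rho x -> X (k x) -> C1 (k x) \/ C2 (k x).
Proof.
by move=> bx /(kX bx)[[x1 x2]|x12]; [left; exact: quadrant1|right; exact: quadrant2].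
Qed.

Local Notation small := (small mu c d r).
Local Notation wind := (wind T A B c d).

(** The chain depends on the cut [e], and its winding number around [phi x] settles only once the
    closing near [p] has passed beyond [phi x]; hence a threshold for each [x]. *)
Definition eventually_wind (kap : R -> seq (R -> R2)) (v : R) x := exists2 e1, 0 < e1 &
  forall e, 0 < e < e1 -> small e -> wind (kap e) e (phi x) = v.

Lemma eventually_wind_component kap v x y : (forall e, 0 < e -> closes e (kap e)) ->
  connected_component X x y -> eventually_wind kap v x -> eventually_wind kap v y.
Proof.
move=> ck xy; have Xx : X x.
  by apply: contrapT => nX; move: xy; rewrite connected_component_out.
apply: (connected_locally_constant (C := connected_component X x)) => //; last exact: connected_component_refl.
  exact: component_connected.
move=> {y xy} z Cz; have Xz : X z := connected_component_sub Cz; have [Sz _] := Xz.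
have [s s0 [e0 e00 H]] := wind_local pl (curve_closed ls ch hl) (curve_phi Xz).
have [U nU HU] := phi_near Sz (X_neq Xz) s0; exists U => // y Uy Cy.
have [Sy _] : X y := connected_component_sub Cy; have [_ yz] := HU y Uy Sy.
split=> -[e1 e10 E]; exists (Num.min e0 e1); rewrite ?lt_min ?e00// => e /andP[ep];
  rewrite lt_min => /andP[ee0 ee1] se;
  have e0e : 0 < e < e0 by [rewrite ep]; have Hyz := H (phi y) e (kap e) yz e0e se (ck e ep).
  by rewrite Hyz E ?ep.
by rewrite -Hyz E ?ep.
Qed.

Let sectorT x : pBx rho x -> curve (T x) -> (x.1 = 0 /\ 0 <= x.2) \/ (x.2 = 0 /\ 0 <= x.1).
Proof.
move=> [bx x0] /(curveE ls ch hl).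
have be : Bx eta x by apply: Bx_sub bx; case/andP: rho_r => _ /le_trans; apply.
by rewrite (chart_psiK ch (kS bx) (k_neq ls be x0)) => /(sector bx).
Qed.

(** The value 0 is read at the base point of [C1], from which a ray avoids the second closing, and
    is carried over the component; the other value follows from [wind_diff]. *)
Lemma wind_C1 x : C1 x -> eventually_wind (@kap2 R) 0 x /\ eventually_wind (@kap1 R) (2 * pi * del) x.
Proof.
move=> Cx; have w2 : eventually_wind (@kap2 R) 0 x.
  apply: (eventually_wind_component (@kap2_closes R) Cx).
  by exists 1 => // e _ se; apply: (wind2_ray pl rho_r sectorT); rewrite ?rho0 ?lexx.
split=> //; have [e1 e10 E1] := w2; have [e2 e20 E2] := wind_diff pl `|phi x|.
exists (Num.min e1 e2); first by rewrite lt_min e10.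
move=> e /andP[ep]; rewrite lt_min => /andP[ee1 ee2] se.
by have := E2 (phi x) e (lexx _); rewrite E1 ?ep ?ee1 ?ee2// => /(_ isT se); rewrite subr0.
Qed.

Lemma wind_C2 x : C2 x -> eventually_wind (@kap1 R) 0 x /\ eventually_wind (@kap2 R) (- (2 * pi * del)) x.
Proof.
move=> Cx; have w1 : eventually_wind (@kap1 R) 0 x.
  apply: (eventually_wind_component (@kap1_closes R) Cx).
  by exists 1 => // e _ se; apply: (wind1_ray pl rho_r sectorT); rewrite ?rho0 ?lexx.
split=> //; have [e1 e10 E1] := w1; have [e2 e20 E2] := wind_diff pl `|phi x|.
exists (Num.min e1 e2); first by rewrite lt_min e10.
move=> e /andP[ep]; rewrite lt_min => /andP[ee1 ee2] se.
have := E2 (phi x) e (lexx _); rewrite E1 ?ep ?ee1 ?ee2// => /(_ isT se); rewrite sub0r => <-.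
by rewrite opprK.
Qed.

Lemma C12_neq x : C1 x -> C2 x -> False.
Proof.
move=> /wind_C1[_ [e1 e10 E1]] /wind_C2[[e2 e20 E2] _].
have m0 : 0 < Num.min e1 e2 by rewrite lt_min e10.
have [e ee se] := small_ex pl m0; have [ep _ _ _] := se.
move: ee; rewrite lt_min => /andP[ee1 ee2].
have := E1 e; rewrite E2 ?ep ?ee1 ?ee2// => /(_ isT se)/esym.
by case: (ld_d (pl_ld pl)) => ->; have := pi_gt0 R; lra.
Qed.

Lemma near_p : exists2 s, 0 < s & forall x, X x -> `|p - x| < s -> C1 x \/ C2 x.
Proof.
have [e e0 He] := ls_near ls rho0; exists e => // x Xx /He H.
by have [y [By _ ky]] := H (proj1 Xx); move: Xx; rewrite -ky; exact: quadrant.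
Qed.

Lemma component_total x : X x -> C1 x \/ C2 x.
Proof.
move=> Xx; have [//|nC] := pselect (C1 x \/ C2 x); exfalso.
pose O := connected_component X x.
have OX y : O y -> X y by move=> /connected_component_sub.
have OC y : O y -> ~ (C1 y \/ C2 y).
  move=> Oy [Cy|Cy]; apply: nC; [left|right];
    exact: connected_component_trans Cy (connected_component_sym Oy).
have [s s0 Hs] := near_p.
(* Near [p] every point off the loop lies in [C1] or [C2], so a third component keeps away from [p],
   which makes it bounded in the plane. *)
have Ofar y : O y -> s <= `|p - y|.
  by move=> Oy; rewrite leNgt; apply/negP => /(Hs y (OX y Oy)); exact: OC.
have [M M0 HM] := chart_tends ch s0.
have small_arc (u : R -> R3) m : 0 < m -> continuous u -> u 0 = p ->
    exists2 s1, 0 < s1 < m & forall t, 0 <= t <= s1 -> `|p - u t| < s.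
  move=> m0 cu u0; have /cvgrPdist_lt/(_ s s0) := cu 0; rewrite u0 => /nbhs_ballP[e /= e0 He].
  pose w := Num.min e m; have w0 : 0 < w by rewrite lt_min e0.
  have we : w <= e by rewrite ge_min lexx.
  have wm : w <= m by rewrite ge_min lexx orbT.
  clearbody w; exists (w / 2); first by apply/andP; split; lra.
  move=> t /andP[t0 t1]; apply: He; rewrite -ball_normE /ball_ /= sub0r normrN ger0_norm//; lra.
have [s1 /andP[s10 s1c] Ha] := small_arc a c (hl_c hl) (hl_ca hl) (loop_a0 ls hl).
have [s2 /andP[s20 s2d] Hb] := small_arc b d (hl_d hl) (hl_cb hl) (loop_b0 ls hl).
(* The part of the loop away from [p] as a single arc over [-1, 1], with the corner [A c = B d] at
   the parameter 0. *)
pose gam t := if `[< cc 0 1 t >] then A (c - t * (c - s1)) else B (d + t * (d - s2)).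
have gA t : 0 <= t <= 1 -> gam t = A (c - t * (c - s1)) /\ s1 <= c - t * (c - s1) <= c.
  by move=> /andP[t0 t1]; rewrite /gam; case: asboolP => [_|[]]; [split=> //; apply/andP; split; nra|apply/andP].
have gB t : -1 <= t <= 0 -> gam t = B (d + t * (d - s2)) /\ s2 <= d + t * (d - s2) <= d.
  move=> /andP[t0 t1]; split; last by apply/andP; split; nra.
  rewrite /gam; case: asboolP => [/andP[t2 t3]|//].
  by have -> : t = 0 by [lra|]; rewrite !mul0r subr0 addr0 (pl_cd pl).
have cca : cc (-1) 1 = cc 0 1 `|` cc (-1) 0 :> set R.
  apply/seteqP; split=> t; rewrite /cc /=; last by move=> [|] /andP[? ?]; apply/andP; split; lra.
  by move=> /andP[? ?]; have [t0|t0] := leP 0 t; [left|right]; apply/andP; split; lra.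
have cg : con (cc (-1) 1) gam.
  rewrite cca; apply: con_glue; try by rewrite ccE; exact: itv_closed.
  - apply: (con_comp (f := fun t : R => c - t * (c - s1))) (pl_cA pl); first by ctac.
    by move=> t /andP[t0 t1]; rewrite /=; nra.
  - apply: (con_comp (f := fun t : R => d + t * (d - s2))) (pl_cB pl); first by ctac.
    by move=> t /andP[t0 t1]; rewrite /=; nra.
  - move=> t /andP[t0 _] /andP[_ t1]; have -> : t = 0 by lra.
    by rewrite !mul0r subr0 addr0 (pl_cd pl).
have ig t u : cc (-1) 1 t -> cc (-1) 1 u -> gam t = gam u -> t = u.
  have main t' u' : 0 <= t' <= 1 -> -1 <= u' <= 0 -> gam t' = gam u' -> t' = u'.
    move=> /[dup] ht' /gA[-> /andP[h1 h2]] /[dup] hu' /gB[-> /andP[h3 h4]] /(pl_AB pl)[].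
    + by rewrite h2 (lt_le_trans s10 h1).
    + by rewrite h4 (lt_le_trans s20 h3).
    + by move: ht' hu' => /andP[? ?] /andP[? ?] e1 e2; have t0 : t' = 0 by [nra|]; have u0 : u' = 0 by [nra|]; lra.
  rewrite cca => -[ht|ht] [hu|hu].
  - have [-> /andP[h1 h2]] := gA t ht; have [-> /andP[h3 h4]] := gA u hu.
    by move=> /(pl_iA pl (lt_le_trans s10 h1) (lt_le_trans s10 h3)) e; nra.
  - exact: main.
  - by move/esym/(main _ _ hu ht)/esym.
  - have [-> /andP[h1 h2]] := gB t ht; have [-> /andP[h3 h4]] := gB u hu.
    by move=> /(pl_iB pl (lt_le_trans s20 h1) (lt_le_trans s20 h3)) e; nra.
have gcurve t : cc (-1) 1 t -> curve (gam t).
  rewrite cca => -[/gA[-> /andP[h1 h2]]|/gB[-> /andP[h1 h2]]]; [left|right];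
    [exists (c - t * (c - s1))|exists (d + t * (d - s2))] => //=; rewrite h2 andbT; exact: lt_le_trans h1.
pose G := psi @^-1` O; have GX z : G z -> ~ curve z by move=> /OX/X_psi.
have no : ~ (gam @` cc (-1) 1) (phi x).
  by move=> [t /gcurve + e]; rewrite e; exact: curve_phi.
have [th Hth] := arc_angle cg ig no.
have Sx := proj1 Xx.
apply: (@no_bounded_component _ G (gam @` cc (-1) 1) (phi x) th M) Hth.
- have [D oD OD] := component_open x.
  rewrite (_ : G = psi @^-1` D); first by apply: open_comp oD => z _; exact: (chart_psi_cont ch).
  apply/seteqP; split=> z; rewrite /G /= /O OD; first by case.
  by split=> //; exact: chart_S2 ch z.
- by rewrite /G /= (chart_psiK ch Sx (X_neq Xx)); exact: connected_component_refl.
- by move=> z Gz; rewrite ltNge; apply/negP => /HM; apply/negP; rewrite -leNgt; exact: Ofar.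
- move=> z cz; have [cu|ncu] := pselect (curve z); [right|left].
    have far : s <= `|p - psi z|.
      rewrite leNgt; apply/negP => zs.
      have nz : nbhs z (psi @^-1` [set y | `|p - y| < s]).
        apply: (chart_psi_cont ch); apply/nbhs_ballP; exists (s - `|p - psi z|); first by rewrite /= subr_gt0.
        move=> y; rewrite -ball_normE /ball_ /= => yz.
        rewrite -[p - y](subrKA (psi z)) (le_lt_trans (ler_normD _ _))//; lra.
      by have [y [Oy /=]] := cz _ nz; apply/negP; rewrite -leNgt; exact: Ofar.
    case: cu => -[t /andP[t0 tm] tz].
      have t1 : s1 < t.
        rewrite ltNge; apply/negP => t1; have := Ha t; rewrite (ltW t0) t1 => /(_ isT).
        by apply/negP; rewrite -leNgt; move: far; rewrite -tz (chart_psiK ch (hl_aS hl t) (loop_a_neq ls hl t0)).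
      exists ((c - t) / (c - s1)); last rewrite -tz.
        by rewrite cca; left; apply/andP; rewrite divr_ge0 ?ler_pdivrMr; lra.
      have [|-> _] := gA ((c - t) / (c - s1)); first by apply/andP; rewrite divr_ge0 ?ler_pdivrMr; lra.
      by rewrite divfK ?subKr//; apply/eqP; lra.
    have t1 : s2 < t.
      rewrite ltNge; apply/negP => t1; have := Hb t; rewrite (ltW t0) t1 => /(_ isT).
      by apply/negP; rewrite -leNgt; move: far; rewrite -tz (chart_psiK ch (hl_bS hl t) (loop_b_neq ls hl t0)).
    have q1 : -1 <= - ((d - t) / (d - s2)) <= 0.
      by rewrite oppr_le0 lerN2; apply/andP; rewrite divr_ge0 ?ler_pdivrMr; lra.
    exists (- ((d - t) / (d - s2))); first by rewrite cca; right.
    have [-> _] := gB _ q1; rewrite -tz mulNr divfK; first by congr (phi (b _)); lra.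
    by apply/eqP; lra.
  have Xz : X (psi z) by apply/X_psi.
  have [U nU HU] := component_nbhs Xz.
  have nz : nbhs z (psi @^-1` U) by exact: (chart_psi_cont ch).
  have [y [Oy Uy]] := cz _ nz.
  by apply: connected_component_trans Oy (connected_component_sym _); apply: HU => //; exact: chart_S2 ch y.
- by move=> z [t /gcurve cz <-] Gz; exact: GX Gz cz.
- by apply: con_image_compact => //; exact: cc_compact.
Qed.

End TwoComponents.

(** * The index of a component *)

Section IndexChain.
Variable R : realType.
Local Notation R3 := (R * R * R)%type.
Local Notation R2 := (R * R)%type.
Local Notation S2 := (@S2 R).

(* K is the fixed point set of f and c is the loop rerouted through C near p; the sign
   of v depends on the chart, the ratio n does not. *)
Definition loop_chain (f : R2 -> R2) (psi : R2 -> R3) (C : set R3) (K : set R2) (v : R) (n : int) :=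
  exists c : seq (R -> R2), [/\ closed_chain c, chain_in (~` K) c,
    forall z, K z -> wsum c (fun x => x - z) = (if `[< C (psi z) >] then v else 0)
    & wsum c (fun x => f x - x) = n%:~R * v].

Lemma chain_norm (X : set R2) (c : seq (R -> R2)) : chain_in X c ->
  exists2 M, 0 < M & chain_in ([set x | `|x| < M] `&` X) c.
Proof.
move=> cX; have [M M0 HM] := chain_bounded cX; exists (M + 1); first lra.
apply: alls_impl (alls_and cX HM) => u [[cu uX] [_ uM]]; split=> // t It.
split; last exact: uX.
have /andP[h _] := n2_norm (u t); have /= h2 := uM t It.
have : `|u t| ^+ 2 < M by exact: le_lt_trans h2.
by have := normr_ge0 (u t); rewrite /=; nra.
Qed.

(** By [winding_detection], the turnings along [c] and along [N] are the same integer combination of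
    their winding numbers around points of [F]. Only points in [C] count, with weight [v] for [c]
    and [2 * pi] for [N], so the turning along [c] determines the one along [N]. *)
Lemma index_from_chain (f : R2 -> R2) (psi : R2 -> R3) (C : set R3) (v : R) (n : int) (N : seq (R -> R2)) :
  continuous f -> compact [set z | f z = z] -> v != 0 ->
  loop_chain f psi C [set z | f z = z] v n ->
  closed_chain N -> chain_in (~` [set z | f z = z]) N ->
  (forall z, f z = z -> wsum N (fun x => x - z) = (if `[< C (psi z) >] then 2 * pi else 0)) ->
  wsum N (fun x => x - f x) = 2 * pi * n%:~R.
Proof.
move=> cf cF v0; set F := [set z | f z = z] in cF *; move=> [c [cc cX cw ci]] cN NX Nw.
have clF : closed F by apply: compact_closed; [exact: R2_hausdorff|].
have [M1 M10 H1] := chain_norm cX; have [M2 M20 H2] := chain_norm NX.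
pose M := (Num.truncn (M1 + M2)).+1.
have MM : M1 + M2 < M%:R by rewrite /M truncnS_gt.
have [e1 e10 E1] := chain_dist clF (H1 : chain_in ([set x | `|x| < M1] `\` F) c).
have [e2 e20 E2] := chain_dist clF (H2 : chain_in ([set x | `|x| < M2] `\` F) N).
pose e := Num.min e1 e2; have e0 : 0 < e by rewrite lt_min e10.
have cv : con (@dom R M) (fun x => x - f x) by apply: conB; [exact: con_id|exact: con_continuous].
have v0' x : dom M x -> ~ F x -> x - f x != 0.
  by move=> _ nF; rewrite subr_eq0; apply/eqP => h; apply: nF; rewrite /F /= -h.
have [L [LF HL]] := winding_detection (isT : (0 < M)%N) e0 cv v0'.
have domM x (M' : R) : `|x| < M' -> M' <= M%:R -> dom M x.
  by move=> h1 h2; apply/Bx_norm/ltW; exact: lt_le_trans h2.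
have Hc := HL c cc; have HN := HL N cN.
have nc : nchain c (fun x => f x - x).
  apply: (chain_in_npath cX); first by apply: conB; [exact: con_continuous|exact: con_id].
  by move=> x nF; rewrite subr_eq0; apply/eqP.
have Hc' : n%:~R * v = \sum_(q <- L) q.2%:~R * wsum c (fun x => x - q.1).
  rewrite -Hc; first by rewrite -ci -(wsumN nc); apply: (wsum_eq_in cX) => x _; rewrite opprB.
  apply: chain_sub E1 => x [h1 h2]; split; first by apply: domM h1 _; lra.
  by move=> z /h2; apply: le_trans; rewrite /e ge_min lexx.
pose m (q : R2 * int) : R := if `[< C (psi q.1) >] then q.2%:~R else 0.
have S1 : \sum_(q <- L) q.2%:~R * wsum c (fun x => x - q.1) = \sum_(q <- L) m q * v.
  apply: sum_alls; apply: alls_impl LF => q Fq; rewrite cw// /m.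
  by case: asboolP; rewrite ?mul0r ?mulr0.
have S2' : \sum_(q <- L) q.2%:~R * wsum N (fun x => x - q.1) = \sum_(q <- L) m q * (2 * pi).
  apply: sum_alls; apply: alls_impl LF => q Fq; rewrite Nw// /m.
  by case: asboolP; rewrite ?mul0r ?mulr0.
rewrite HN; last first.
  apply: chain_sub E2 => x [h1 h2]; split; first by apply: domM h1 _; lra.
  by move=> z /h2; apply: le_trans; rewrite /e ge_min lexx orbT.
rewrite S2' -mulr_suml mulrC; congr (_ * _).
by apply: (mulIf v0); rewrite Hc' S1 -mulr_suml.
Qed.

(* If q <> p, the inversion x = 1 / (y - phi' p) leads to a chart at p; the correction
   terms y - phi' p and phi' (g (psi' y)) - phi' p do not vanish on the grid region. *)
Lemma index_boundary (g ginv : R3 -> R3) (p : R3) (C : set R3) (n : int) q phi' psi' kk s :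
  S2homeo g ginv -> S2chart q phi' psi' -> g p = p -> C `<=` S2 -> ~ C p -> S2 p ->
  ~ C q -> admissible g C q phi' psi' kk s ->
  (forall phi psi, S2chart p phi psi ->
     [/\ continuous (plane_map g phi psi), compact [set z | plane_map g phi psi z = z] &
         exists2 v, v != 0 & loop_chain (plane_map g phi psi) psi C [set z | plane_map g phi psi z = z] v n]) ->
  wsum (bchain R kk s) (fun y => y - phi' (g (psi' y))) = 2 * pi * n%:~R /\
    nchain (bchain R kk s) (fun y => y - phi' (g (psi' y))).
Proof.
move=> hom ch gp CS nCp Sp nCq [us [Hs Hfix]] H.
have gS x : S2 x -> S2 (g x) by case: hom => h _ _ _ _; exact: h.
have gK x : S2 x -> ginv (g x) = x by case: hom => _ _ h _ _ /h[].
have gneq x : S2 x -> g x = p -> x = p by move=> Sx e; rewrite -(gK x Sx) e -gp gK.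
have pS y : S2 (psi' y) := chart_S2 ch y.
have cG (D : set R2) : con D psi' by apply: con_continuous; exact: chart_psi_cont ch.
have cg : con S2 g by case: hom => _ _ _ /conP.
have cpg : con (grid_union kk s) (fun y => phi' (g (psi' y))).
  apply: (con_comp (f := fun y => g (psi' y)) (B := S2 `\ q)) (chart_con ch).
    by apply: (con_comp (f := psi')) cg; [exact: cG|move=> y _; exact: pS].
  by move=> y /Hs[_ h]; split=> //; exact/gS/pS.
have nfix y : gbd kk s y -> phi' (g (psi' y)) <> y.
  move=> [gy ni] e; have [Cy gq] := Hs y gy; apply: ni; apply: Hfix.
  exists (psi' y); last exact: chart_phiK ch y.
  split=> //; split; first exact: pS.
  by rewrite -[in RHS]e (chart_psiK ch)//; exact/gS/pS.
have bin := bchain_in R kk s.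
have gin (y : R2) : gbd kk s y -> grid_union kk s y by case.
have ncb : nchain (bchain R kk s) (fun y => y - phi' (g (psi' y))).
  apply: (chain_in_npath bin); first by apply: conB; [exact: con_id|exact: con_subset gin cpg].
  by move=> y /nfix h; rewrite subr_eq0; apply/eqP => e; apply: h; rewrite -e.
split=> //.
have cb := bchain_closed (R := R) kk us.
have wz (z : R2) : (forall y, grid_union kk s y -> y <> z) -> wsum (bchain R kk s) (fun y => y - z) = 0.
  by move=> h; apply: (wsum_bchain0 us); [ctac|move=> y /h; rewrite subr_eq0 => /eqP].
have w1 (z : R2) : g (psi' z) = psi' z ->
    wsum (bchain R kk s) (fun x => x - z) = (if `[< C (psi' z) >] then 2 * pi else 0).
  move=> e; case: asboolP => [Cz|nC].
    apply: (wsum_bchain1 us); apply: Hfix; exists (psi' z); last exact: chart_phiK ch z.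
    by split=> //; split.
  by apply: wz => y /Hs[Cy _] yz; apply: nC; rewrite -yz.
have [qp|qp] := pselect (q = p).
  rewrite qp in ch; have [c1 c2 [v v0 c3]] := H _ _ ch.
  apply: (index_from_chain c1 c2 v0 c3 cb).
    by apply: chain_sub bin => y /nfix.
  move=> z fz; apply: w1; rewrite -[in RHS]fz /plane_map (chart_psiK ch)//; first exact/gS/pS.
  by move=> /(gneq _ (pS z)); exact: chart_neq ch z.
have pq : p <> q by move=> e; apply: qp.
have ich := inversion_chart ch Sp pq.
set phi := inv_phi q phi' p in ich; set psi := inv_psi q phi' psi' p in ich.
have [c1 c2 [v v0 c3]] := H _ _ ich; set f := plane_map g phi psi in c1 c2 c3.
pose c' := phi' p; have psc : psi' c' = p := chart_psiK ch Sp pq.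
have gc y : grid_union kk s y -> y - c' != 0.
  by move=> /Hs[Cy _]; rewrite subr_eq0; apply/eqP => e; apply: nCp; rewrite -psc -e.
have gc2 y : grid_union kk s y -> phi' (g (psi' y)) - c' != 0.
  move=> /Hs[Cy gq]; rewrite subr_eq0; apply/eqP => e; apply: nCp.
  rewrite -(gneq _ (pS y))// -psc -e (chart_psiK ch)//; exact/gS/pS.
pose x (y : R2) := cinv (y - c').
have psix y : grid_union kk s y -> psi (x y) = psi' y.
  move=> gy; rewrite /psi inv_psiE; first by rewrite /x cinvK subrK.
  by apply/eqP; rewrite cinv_eq0; exact: gc.
have fx y : grid_union kk s y -> f (x y) = cinv (phi' (g (psi' y)) - c').
  by move=> gy; rewrite /f /plane_map psix// /phi inv_phiE//; case: (Hs y gy).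
have cx : con (grid_union kk s) x by apply: con_cinv; [exact: gc|ctac].
pose N := [seq (fun t => x (u t)) | u <- bchain R kk s].
have n1 : nchain (bchain R kk s) (fun y => cinv (y - c')).
  by apply: (chain_in_npath bin); [exact: con_subset gin cx|move=> y /gin/gc; rewrite cinv_eq0].
have cy2 : con (grid_union kk s) (fun y => phi' (g (psi' y)) - c') by ctac.
have n2 : nchain (bchain R kk s) (fun y => phi' (g (psi' y)) - c').
  by apply: (chain_in_npath bin); [exact: con_subset gin cy2|move=> y /gin/gc2].
have n2' := nchainV n2.
have n0 : nchain (bchain R kk s) (fun y => y - c').
  by apply: (chain_in_npath bin); [ctac|move=> y /gin/gc].
have w0 : wsum (bchain R kk s) (fun y => y - c') = 0.
  by apply: (wsum_bchain0 us); [ctac|exact: gc].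
have w2 : wsum (bchain R kk s) (fun y => phi' (g (psi' y)) - c') = 0.
  exact: (wsum_bchain0 us).
(* A difference of two inverses is the negated difference divided by the product; the two factors of
   this product do not turn along the boundary, by [w0] and [w2]. *)
have E : wsum N (fun y => y - f y) = wsum (bchain R kk s) (fun y => y - phi' (g (psi' y))).
  rewrite wsum_map; transitivity (wsum (bchain R kk s) (fun y => cmul (- (y - phi' (g (psi' y))))
    (cmul (cinv (y - c')) (cinv (phi' (g (psi' y)) - c'))))).
    apply: (wsum_eq_in bin) => y /gin gy; rewrite fx// /x (cinv_diff (gc _ gy) (gc2 _ gy)).
    by congr cmul; rewrite !opprB addrA subrK.
  have -> := wsumM (nchainN ncb) (nchainM n1 n2').
  by rewrite wsumN// wsumM// !wsumV// w0 w2 oppr0 !addr0.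
rewrite -E; apply: (index_from_chain c1 c2 v0 c3).
- exact: closed_map.
- apply: (chain_map bin); first exact: con_subset gin cx.
  move=> y /[dup] /gin gy /nfix nf /=; rewrite fx// => /(congr1 (@cinv R)); rewrite /x !cinvK => e.
  by apply: nf; apply: (addIr (- c')).
- move=> z fz; rewrite wsum_map.
  (* The origin stands for [q], which lies outside [C]; the winding number of the inverted chain
     around it is minus that of the boundary around [c'], which is 0. *)
  have [z0|z0] := pselect (z = 0).
    have psz : psi z = q by rewrite z0; exact: inv_psi0.
    rewrite psz; case: asboolP => // _; rewrite -[RHS]oppr0 -w0 -wsumV//.
    by apply: (wsum_eq_in bin) => y _; rewrite z0 subr0.
  have zn : z != 0 by apply/eqP.
  have psz : psi z = psi' (cinv z + c') by rewrite /psi inv_psiE.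
  have gz : g (psi' (cinv z + c')) = psi' (cinv z + c').
    rewrite -psz -[in RHS]fz /f /plane_map (chart_psiK ich) //; first exact/gS/(chart_S2 ich).
    by move=> /(gneq _ (chart_S2 ich z)); exact: chart_neq ich z.
  rewrite psz -w1//; transitivity (wsum (bchain R kk s) (fun y => cmul (- (y - (cinv z + c')))
      (cmul (cinv (y - c')) z))).
    apply: (wsum_eq_in bin) => y /gin gy; rewrite /x -{1}[z]cinvK cinv_diff ?gc ?cinv_eq0//.
    by rewrite cinvK; congr cmul; rewrite !opprB addrA.
  have nz : nchain (bchain R kk s) (fun y => y - (cinv z + c')).
    apply: (chain_in_npath bin); first by ctac.
    move=> y [gy ni]; rewrite subr_eq0; apply/eqP => e; apply: ni; apply: Hfix.
    exists (psi' y); last exact: chart_phiK ch y.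
    by rewrite e; split; [split|rewrite -e; case: (Hs y gy)].
  have nzc : nchain (bchain R kk s) (fun=> z) by apply: alls_all => u; exact: npath_cst.
  have -> := wsumM (nchainN nz) (nchainM n1 nzc).
  by rewrite wsumN// wsumM// wsumV// w0 wsum_cst// oppr0 !addr0.
Qed.

End IndexChain.

Lemma alls_in (S : eqType) (T : Type) (P : T -> Prop) (f : S -> T) (r : seq S) i :
  alls P [seq f j | j <- r] -> i \in r -> P (f i).
Proof.
by elim: r => //= j r IH [Pj /IH h]; rewrite in_cons => /orP[/eqP ->|].
Qed.

(** * Existence of admissible grid regions *)

Section Admissible.
Variable R : realType.
Local Notation R3 := (R * R * R)%type.
Local Notation R2 := (R * R)%type.
Local Notation S2 := (@S2 R).

(** A square is taken when it meets the neighbourhood of [K] of radius [dl], not only [K], so that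
    the union contains a neighbourhood of [K]. Mesh and radius are each at most half of a lower
    bound for the distance to the complement of [G]. *)
Lemma grid_cover (K G : set R2) : compact K -> open G -> K `<=` G ->
  exists k s, [/\ uniq s, grid_union k s `<=` G & K `<=` interior (grid_union k s : set R2)].
Proof.
move=> cK oG KG.
have [|e e0 He] := compact_dist cK (open_closedC oG); first by move=> x /KG Gx /(_ Gx).
have cn : con K (fun x : R2 => `|x|).
  by apply: con_continuous; exact: norm_continuous.
have [M1 M10 HM] := compact_upper_bound cK cn.
pose dl := Num.min (e / 2) 1; have dl0 : 0 < dl by rewrite lt_min divr_gt0 ?ltr01.
have dle : dl <= e / 2 by rewrite ge_min lexx.
have dl1 : dl <= 1 by rewrite ge_min lexx orbT.
clearbody dl.
have [k ke] : exists k : nat, (2 ^+ k)^-1 < e / 2 by apply: mesh_ex; rewrite divr_gt0.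
pose M := (Num.truncn (M1 + 1)).+1; have MM : M1 + 1 < M%:R by rewrite /M truncnS_gt.
pose near x := exists2 z, K z & `|z - x| < dl.
pose s := [seq ij <- box k M | `[< exists2 x : R2, near x & square k ij x >]].
exists k, s; split; first by rewrite filter_uniq// box_uniq.
- move=> y [ij]; rewrite mem_filter => /andP[/asboolP[x [z Kz zx] Sx] _] Sy.
  apply: contrapT => nG; have := He z y Kz nG; apply/negP; rewrite -ltNge.
  rewrite -(subrKA x) (le_lt_trans (ler_normD _ _))//.
  have := square_diam Sx Sy; lra.
- move=> z Kz; apply/nbhs_ballP; exists dl => //= x; rewrite -ball_normE /ball_ /= => zx.
  have : dom M x.
    apply/Bx_norm; move: (HM z Kz) => h.
    by have := ler_normB z (z - x); rewrite subKr; lra.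
  rewrite -(grid_union_box R k (isT : (0 < M)%N)) => -[ij ijb Sx].
  by exists ij => //; rewrite mem_filter ijb andbT; apply/asboolP; exists x => //; exists z.
Qed.

Lemma admissible_ex (g ginv : R3 -> R3) (p : R3) (C : set R3) phi psi :
  S2homeo g ginv -> g p = p -> S2chart p phi psi -> S2open C -> ~ C p ->
  compact (Fix g `&` C) -> exists k s, admissible g C p phi psi k s.
Proof.
move=> hom gp ch oC nCp cF; have Sp := chart_S2q ch.
have gK x : S2 x -> ginv (g x) = x by case: hom => _ _ h _ _ /h[].
have cK : compact (phi @` (Fix g `&` C)).
  apply: con_image_compact cF; apply: con_subset (chart_con ch) => x [[Sx _] Cx].
  by split=> // xp; apply: nCp; rewrite -xp.
have oG : open (psi @^-1` C).
  have [D oD ->] := oC; rewrite (_ : _ @^-1` _ = psi @^-1` D).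
    by apply: open_comp oD => z _; exact: (chart_psi_cont ch).
  by apply/seteqP; split=> z; [case|split=> //; exact: chart_S2 ch z].
have KG : phi @` (Fix g `&` C) `<=` psi @^-1` C.
  move=> _ [x [[Sx _] Cx] <-] /=; rewrite (chart_psiK ch Sx)// => xp.
  by apply: nCp; rewrite -xp.
have [k [s [us sG Ks]]] := grid_cover cK oG KG; exists k, s; split=> //; split=> //.
move=> y /sG Cy; split=> // e; apply: (@chart_neq R p phi psi ch y).
by rewrite -(gK _ (chart_S2 ch y)) e -gp gK.
Qed.

Lemma boundary_angle_wsum (g : R3 -> R3) phi psi k s (a : R) :
  wsum (bchain R k s) (fun y => y - phi (g (psi y))) = a ->
  nchain (bchain R k s) (fun y => y - phi (g (psi y))) -> boundary_angle g phi psi k s a.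
Proof.
move=> <- nc; exists (fun ij d => av (fun t => edge_path k ij d t - phi (g (psi (edge_path k ij d t))))).
split.
  move=> ij d ijs bd; apply: avP.
  apply: (alls_in (i := (ij, d)) (f := fun x => @edge_path R k x.1 x.2) nc).
  by rewrite mem_filter /= bd /=; apply/allpairsP; exists (ij, d); split=> //; rewrite mem_enum.
exact: (sum_bchain k s (fun u => av (fun t => u t - phi (g (psi (u t)))))).
Qed.

End Admissible.

(** * Fixed points off the loop *)

Section FixedPoints.
Variable R : realType.
Local Notation R3 := (R * R * R)%type.
Local Notation R2 := (R * R)%type.
Local Notation S2 := (@S2 R).
Variables (g ginv : R3 -> R3) (p : R3) (W : set R3) (V : set R2) (h : R3 -> R2) (k : R2 -> R3).
Variables (mu lam eta c d : R) (a b : R -> R3) (L : set R3).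
Hypotheses (hom : S2homeo g ginv) (ls : lsaddle g p W V h k mu lam eta).
Hypothesis hl : hloop g k mu lam eta a b c d L.
Local Notation X := (S2 `\` L).

Lemma fixed_p : g p = p.
Proof.
have B0 : Bx eta (0 : R2) by apply: Bx0; exact: ltW (ls_eta ls).
by have [_] := ls_g ls B0; rewrite /= !mulr0 (ls_p ls).
Qed.

Lemma fix_loop x : g x = x -> L x -> x = p.
Proof.
have lam1 := ls_lam1 ls; have mu1 := ls_mu ls.
move=> gx; rewrite (hl_L hl) => -[[s _ e]|[s _ e]]; rewrite -e in gx *.
  move: gx; rewrite (hl_ga hl) => /(hl_ia hl) es; have s0 : s = 0.
    by apply/eqP; have /eqP : (1 - lam) * s = 0 by [lra|]; rewrite mulf_eq0 subr_eq0 gt_eqF.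
  by rewrite s0 (loop_a0 ls hl).
move: gx; rewrite (hl_gb hl) => /(hl_ib hl) es; have s0 : s = 0.
  by apply/eqP; have /eqP : (mu - 1) * s = 0 by [lra|]; rewrite mulf_eq0 subr_eq0 gt_eqF.
by rewrite s0 (loop_b0 ls hl).
Qed.

Lemma fix_isolated : exists2 s, 0 < s & forall x, Fix g x -> `|p - x| < s -> x = p.
Proof.
have [s s0 Hs] := ls_near ls (ls_eta ls); exists s => // x [Sx gx] /(Hs x Sx)[y [By Vy ky]].
have lam1 := ls_lam1 ls; have mu1 := ls_mu ls.
move: gx; rewrite -ky; have [Vl ->] := ls_g ls By; move=> /(ls_kinj ls Vl Vy).
case: y {By Vy ky Vl} => [y1 y2] [/= e1 e2].
have /eqP : (mu - 1) * y1 = 0 by lra.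
rewrite mulf_eq0 subr_eq0 gt_eqF//= => /eqP ->.
have /eqP : (1 - lam) * y2 = 0 by lra.
by rewrite mulf_eq0 subr_eq0 gt_eqF//= => /eqP ->; exact: ls_p ls.
Qed.

Lemma fix_compact : compact (Fix g).
Proof.
have cg : con S2 (fun x => g x - x).
  by apply: conB; [case: hom => _ _ _ /conP|exact: con_id].
have c1 : closed ([set 0] : set R3) by apply: compact_closed; [exact: R3_hausdorff|exact: compact_set1].
rewrite (_ : Fix g = S2 `&` (fun x => g x - x) @^-1` [set 0]).
  exact: compact_preimage cg (@S2_compact R) c1.
apply/seteqP; split=> x [Sx] /= e; split=> //=; first by rewrite e subrr.
by apply/eqP; rewrite -subr_eq0 e.
Qed.

Lemma far_closed s : closed [set x : R3 | s <= `|p - x|].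
Proof.
have cn : con setT (fun x : R3 => `|p - x|).
  apply: (con_comp1 (f := fun x : R3 => p - x) (g := fun z : R3 => `|z|)); first by ctac.
  exact: norm_continuous.
have [V' cV' VE] := con_preimage_closed cn (@closed_ge R s).
by move: VE; rewrite !setTI => E; move: cV'; rewrite -E.
Qed.

(** The only fixed point on the loop is [p], and it is isolated. So the fixed points in [C] are what
    remains of [Fix g] when a ball around [p] and the other component, which is open, are
    removed. *)
Lemma fix_component (C C' : set R3) : S2open C' -> C `<=` X -> (forall x, X x -> C x \/ C' x) ->
  (forall x, C x -> C' x -> False) -> compact (Fix g `&` C).
Proof.
move=> [D oD CD] CX tot dis; have [s s0 Hs] := fix_isolated.
rewrite (_ : _ `&` _ = Fix g `&` ([set x | s <= `|p - x|] `&` ~` D)).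
  apply: compact_closedI fix_compact _.
  by apply: closedI; [exact: far_closed|exact: open_closedC].
apply/seteqP; split=> x [Fx].
  move=> Cx; have [Sx nL] := CX x Cx; split=> //; split.
    rewrite /= leNgt; apply/negP => /(Hs x Fx) xp; apply: nL; rewrite xp; exact: loop_p ls hl.
  by move=> Dx; apply: (dis x Cx); rewrite CD.
move=> [/= ps nD]; split=> //; have [Sx gx] := Fx.
have nL : ~ L x.
  by move=> /(fix_loop gx) xp; move: ps; rewrite xp subrr normr0 leNgt s0.
have [//|] := tot x (conj Sx nL).
by rewrite CD => -[_ /nD].
Qed.

Variables (phi : R3 -> R2) (psi : R2 -> R3).
Hypothesis ch : S2chart p phi psi.
Local Notation f := (plane_map g phi psi).

Lemma g_neq x : S2 x -> x <> p -> g x <> p.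
Proof.
move=> Sx xp e; apply: xp; case: hom => _ _ H _ _.
by have [<- _] := H x Sx; rewrite e -[in LHS]fixed_p; have [] := H p (ls_S2p ls).
Qed.

Lemma plane_map_continuous : continuous f.
Proof.
apply: con_setT; apply: (con_comp (f := fun z => g (psi z))) (chart_con ch).
  apply: (con_comp (f := psi) (B := S2)); first exact/con_continuous/(chart_psi_cont ch).
    by move=> z _; exact: chart_S2 ch z.
  by case: hom => _ _ _ /conP.
move=> z _; split; first by case: hom => H _ _ _ _; apply: H; exact: chart_S2 ch z.
by apply: g_neq; [exact: chart_S2 ch z|exact: (@chart_neq R p phi psi ch z)].
Qed.

Lemma plane_fix z : f z = z <-> Fix g (psi z).
Proof.
have Sz := chart_S2 ch z; have zp := @chart_neq R p phi psi ch z; split.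
  move=> fz; split=> //; rewrite -[in RHS]fz /plane_map (chart_psiK ch)//; last exact: g_neq.
  by case: hom => H _ _ _ _; exact: H.
by move=> [_ e]; rewrite /plane_map e (chart_phiK ch).
Qed.

(** In the plane [p] lies at infinity, so its isolation keeps the other fixed points bounded. *)
Lemma plane_fix_compact : compact [set z | f z = z].
Proof.
have [s s0 Hs] := fix_isolated.
have c1 : compact (Fix g `&` [set x : R3 | s <= `|p - x|]).
  by apply: compact_closedI; [exact: fix_compact|exact: far_closed].
rewrite (_ : [set z | _] = phi @` (Fix g `&` [set x : R3 | s <= `|p - x|])).
  apply: con_image_compact c1; apply: con_subset (chart_con ch) => x [[Sx _] /= px]; split=> //.
  by move=> e; move: px; rewrite e subrr normr0 leNgt s0.
apply/seteqP; split=> z.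
  move=> /plane_fix Fz; exists (psi z); last exact: chart_phiK ch z.
  split=> //=; rewrite leNgt; apply/negP => /(Hs _ Fz); exact: chart_neq ch z.
move=> [x [[Sx gx] /= px] <-]; apply/plane_fix.
by rewrite (chart_psiK ch Sx)// => e; move: px; rewrite e subrr normr0 leNgt s0.
Qed.

End FixedPoints.

(** * The index of each side *)

Section LoopChains.
Variable R : realType.
Local Notation R3 := (R * R * R)%type.
Local Notation R2 := (R * R)%type.
Local Notation S2 := (@S2 R).
Variables (g ginv : R3 -> R3) (p : R3) (W : set R3) (V : set R2) (h : R3 -> R2) (k : R2 -> R3).
Variables (mu lam eta c d : R) (a b : R -> R3) (L : set R3).
Hypotheses (hom : S2homeo g ginv) (ls : lsaddle g p W V h k mu lam eta).
Hypothesis hl : hloop g k mu lam eta a b c d L.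
Local Notation X := (S2 `\` L).

Section Chart.
Variables (phi : R3 -> R2) (psi : R2 -> R3).
Hypothesis ch : S2chart p phi psi.
Local Notation f := (plane_map g phi psi).
Local Notation T := (fun x => phi (k x)).
Local Notation A := (fun s => phi (a s)).
Local Notation B := (fun s => phi (b s)).

(** The thresholds of [eventually_wind] depend on the point; local constancy and compactness of the
    fixed point set yield one [e] for all fixed points, chosen so small that the closing lies beyond
    them. *)
Lemma loop_chain_ex (C : set R3) (kap : R -> seq (R -> R2)) (v : R) (n : int) r del :
  plane_loop f T A B mu lam c d r del ->
  (forall e, 0 < e -> closes e (kap e)) ->
  (forall x y, connected_component X x y -> (C x <-> C y)) ->
  (forall x, X x -> eventually_wind k mu c d phi a b r kap (if `[< C x >] then v else 0) x) ->
  (forall e, small mu c d r e -> wsum (Lam T A B c d (kap e) e) (fun x => f x - x) = n%:~R * v) ->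
  loop_chain f psi C [set z | f z = z] v n.
Proof.
move=> pl ck Cc ev wi; pose F := [set z | f z = z].
have cF : compact F := plane_fix_compact hom ls ch.
have FX z : F z -> X (psi z).
  move=> /(plane_fix hom ls ch)[Sz gz]; split=> // /(fix_loop ls hl gz).
  exact: (@chart_neq R p phi psi ch z).
have Fc z : F z -> ~ curve A B c d z by move=> /FX/(X_psi ls ch hl).
pose Q e z := small mu c d r e ->
  wind T A B c d (kap e) e z = if `[< C (psi z) >] then v else 0.
have [|e1 e10 H1] := @compact_uniform R F Q cF.
  move=> z0 Fz0; have Xz := FX z0 Fz0.
  have [s s0 [e0 e00 Hw]] := wind_local pl (curve_closed ls ch hl) (Fc z0 Fz0).
  have [e1 e10 He1] := ev _ Xz; rewrite (chart_phiK ch) in He1.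
  have [U nU HU] := component_nbhs ls ch hl Xz.
  have /nbhs_ballP[s' /= s'0 Hs'] : nbhs z0 (psi @^-1` U) by exact: (chart_psi_cont ch).
  exists (Num.min s s'); first by rewrite lt_min s0.
  exists (Num.min e0 e1); first by rewrite lt_min e00.
  move=> z e; rewrite lt_min => /andP[zs zs'] /andP[ep]; rewrite lt_min => /andP[ee0 ee1] se.
  have e0e : 0 < e < e0 by rewrite ep.
  rewrite (Hw z e (kap e) zs e0e se (ck e ep)) He1 ?ep//.
  have Cz : C (psi z0) <-> C (psi z).
    apply: Cc; apply: HU; last exact: chart_S2 ch z.
    by apply: Hs'; rewrite -ball_normE /ball_ /= distrC.
  by congr (if _ then _ else _); apply/asboolP/asboolP => /Cz.
have cn : con F (fun x : R2 => `|x|) by apply: con_continuous; exact: norm_continuous.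
have [M M0 HM] := compact_upper_bound cF cn.
have [e2 /andP[e20 _] He2] := ld_far (pl_ld pl) M.
have m0 : 0 < Num.min e1 e2 by rewrite lt_min e10.
have [e ee se] := small_ex pl m0; have [ep _ _ _] := se.
move: ee; rewrite lt_min => /andP[ee1 ee2].
exists (Lam T A B c d (kap e) e); split.
- exact: (Lam_closed pl se (ck e ep)).
- apply: chain_sub (Lam_in pl se (ck e ep).2 (fun x h => h)) => x [cx Fx|[y py Ty] Fx].
    exact: Fc Fx cx.
  have [/(_ y) + _] := He2 x (ltW (HM x Fx)); apply=> //.
  exact: pBx_sub (ltW ee2) py.
- by move=> z Fz; apply: (H1 z e) => //; rewrite ep.
- exact: wi.
Qed.

Variables (rho0 : R).
Hypotheses (rho0_eta : 0 < rho0 <= eta)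
  (sector0 : forall x, Bx rho0 x -> (L (k x) <-> (x.1 = 0 /\ 0 <= x.2) \/ (x.2 = 0 /\ 0 <= x.1))).

(** The radius on which the saddle coordinate is controlled varies with the chart, but the two sides
    must not. They are therefore defined by [rho0], and a smaller [rho] adapted to the chart gives
    base points in the same components. *)
Lemma components :
  [/\ forall x, X x -> C1 k L rho0 x \/ C2 k L rho0 x,
      forall x, C1 k L rho0 x -> C2 k L rho0 x -> False,
      exists2 v, v != 0 & loop_chain f psi (C1 k L rho0) [set z | f z = z] v 1 &
      exists2 v, v != 0 & loop_chain f psi (C2 k L rho0) [set z | f z = z] v 2].
Proof.
have [r [del [reta pl]]] := plane_loop_ex ls ch hl.
have r0 := ld_r (pl_ld pl); have /andP[rho00 rho0e] := rho0_eta.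
have m0 : 0 < Num.min r rho0 by rewrite lt_min r0.
have [rho /andP[rp rm] [re sec]] := sector_ex ls hl m0.
have rr : 0 < rho <= r by rewrite rp (le_trans rm)// ge_min lexx.
have rr0 : rho <= rho0 by rewrite (le_trans rm)// ge_min lexx orbT.
have b1 : Bx rho0 ((rho, rho) : R2) by split; apply/andP; split=> /=; lra.
have b2 : Bx rho0 ((- rho, - rho) : R2) by split; apply/andP; split=> /=; lra.
have E1 : C1 k L rho0 = C1 k L rho.
  by apply: same_connected_component; exact: (quadrant1 ls (lexx _) rho0_eta sector0 b1).
have E2 : C2 k L rho0 = C2 k L rho.
  apply: same_connected_component; apply: (quadrant2 ls (lexx _) rho0_eta sector0 b2).
  by left; rewrite /= oppr_lt0.
rewrite E1 E2; have tot := component_total ls ch hl reta pl rr sec.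
have dis := C12_neq ls ch hl reta pl rr sec.
have comp (x0 : R3) x y : connected_component X x y -> (connected_component X x0 x <-> connected_component X x0 y).
  move=> xy; split=> x0x; first exact: connected_component_trans x0x xy.
  exact: connected_component_trans x0x (connected_component_sym xy).
have d0 : del != 0.
  by case: (ld_d (pl_ld pl)) => ->; rewrite ?oppr_eq0 oner_eq0.
have v0 : 2 * pi * del != 0 by rewrite !mulf_neq0// gt_eqF// pi_gt0.
split=> //.
- exists (2 * pi * del) => //; apply: (loop_chain_ex (kap := @kap1 R) pl).
  + exact: kap1_closes.
  + exact: comp.
  + move=> x Xx; case: asboolP => [/(wind_C1 ls ch hl reta pl rr sec)[]//|nC].
    by case: (tot x Xx) => // /(wind_C2 ls ch hl reta pl rr sec)[].
  + by move=> e /(index_kap pl)[-> _]; rewrite mul1r.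
- exists (- (2 * pi * del)); first by rewrite oppr_eq0.
  apply: (loop_chain_ex (kap := @kap2 R) pl).
  + exact: kap2_closes.
  + exact: comp.
  + move=> x Xx; case: asboolP => [/(wind_C2 ls ch hl reta pl rr sec)[]//|nC].
    by case: (tot x Xx) => // /(wind_C1 ls ch hl reta pl rr sec)[].
  + by move=> e /(index_kap pl)[_ ->]; ring.
Qed.

End Chart.

Lemma component_index (phi : R3 -> R2) (psi : R2 -> R3) (C C' : set R3) (n : int) : S2chart p phi psi ->
  S2open C -> S2open C' -> C `<=` X -> (forall x, X x -> C x \/ C' x) -> (forall x, C x -> C' x -> False) ->
  (forall phi psi, S2chart p phi psi -> exists2 v, v != 0 &
    loop_chain (plane_map g phi psi) psi C [set z | plane_map g phi psi z = z] v n) ->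
  fp_index g C n.
Proof.
move=> ch oC oC' CX tot dis H; have cF := fix_component hom ls hl oC' CX tot dis.
have nCp : ~ C p by move=> /CX[_]; apply; exact: loop_p ls hl.
have gp := fixed_p ls; have CS : C `<=` S2 by move=> x /CX[].
split=> //.
- have [kk [s ad]] := admissible_ex hom gp ch oC nCp cF.
  by exists p, phi, psi, kk, s.
- move=> q phi' psi' kk s nCq ch' ad.
  have [w nc] := index_boundary hom ch' gp CS nCp (ls_S2p ls) nCq ad (fun phi psi ch =>
    And3 (plane_map_continuous hom ls ch) (plane_fix_compact hom ls ch) (H phi psi ch)).
  exact: boundary_angle_wsum w nc.
Qed.

End LoopChains.

Theorem theorem2p3 (R : realType) (g ginv : R * R * R -> R * R * R)
  (p p' : R * R * R) (Js Ju : set (R * R * R)) :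
  S2homeo g ginv ->
  orientation_preserving g ->
  direct_saddle g p ->
  p' <> p -> Ws g p p' -> Ws ginv p p' ->
  is_arc Js p p' -> Js `<=` Ws g p ->
  is_arc Ju p p' -> Ju `<=` Ws ginv p ->
  Js `&` Ju = [set p] `|` [set p'] ->
  exists C1 C2 : set (R * R * R),
    [/\ (exists2 x, (@S2 R `\` (Js `|` Ju)) x & C1 = connected_component (@S2 R `\` (Js `|` Ju)) x),
        (exists2 x, (@S2 R `\` (Js `|` Ju)) x & C2 = connected_component (@S2 R `\` (Js `|` Ju)) x),
        C1 <> C2,
        (forall x, (@S2 R `\` (Js `|` Ju)) x -> C1 x \/ C2 x) &
        fp_index g C1 1 /\ fp_index g C2 2].
Proof.
move=> hom [q [phi0 [psi0 [ch0 _]]]] ds pp' _ _ js jsW ju juW meet.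
have [W [V [h [k [mu [lam [eta [a [b [c [d [ls hl]]]]]]]]]]]] := loop_setup hom ds pp' js jsW ju juW meet.
set L := Js `|` Ju in hl *.
(* If the given chart has its pole elsewhere, an inversion moves the pole to [p]. *)
have [phi [psi ch]] : exists phi psi, S2chart p phi psi.
  have [qp|qp] := pselect (q = p); first by exists phi0, psi0; rewrite -qp.
  by exists (inv_phi q phi0 p), (inv_psi q phi0 psi0 p); apply: (inversion_chart ch0 (ls_S2p ls)) => /esym.
have [rho /andP[rho0 rhoe] [_ sec]] := sector_ex ls hl (ls_eta ls).
have re : 0 < rho <= eta by rewrite rho0.
have [tot dis _ _] := components hom ls hl ch re sec.
have b1 : Bx rho ((rho, rho) : R * R) by split; apply/andP; split=> /=; lra.
have b2 : Bx rho ((- rho, - rho) : R * R) by split; apply/andP; split=> /=; lra.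
have X1 : (@S2 R `\` L) (k (rho, rho)) by apply/(kX ls (lexx _) re sec b1); left.
have X2 : (@S2 R `\` L) (k (- rho, - rho)).
  by apply/(kX ls (lexx _) re sec b2); right; left; rewrite /= oppr_lt0.
have O1 := component_open ls ch hl (k (rho, rho)).
have O2 := component_open ls ch hl (k (- rho, - rho)).
exists (C1 k L rho), (C2 k L rho); split=> //.
- by exists (k (rho, rho)).
- by exists (k (- rho, - rho)).
- move=> e; have c1 : C1 k L rho (k (rho, rho)) by exact: connected_component_refl.
  by apply: (dis _ c1); rewrite -e.
- split; apply: (component_index hom ls hl ch).
  + exact: O1.
  + exact: O2.
  + exact: connected_component_sub.
  + exact: tot.
  + exact: dis.
  + by move=> phi' psi' ch'; have [_ _ v1 _] := components hom ls hl ch' re sec.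
  + exact: O2.
  + exact: O1.
  + exact: connected_component_sub.
  + by move=> x /tot[]; [right|left].
  + by move=> x h1 h2; exact: dis h2 h1.
  + by move=> phi' psi' ch'; have [_ _ _ v2] := components hom ls hl ch' re sec.
Qed.
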